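(* Assume that $\pi$ is a finite measure and that the supOU process has no Gaussian component ($b=0$), with $a=\int_{|z|\le1}z\,\lambda(dz)$ if $\int_{|z|\le1}|z|\lambda(dz)<\infty$ and $a=0$ if $\int_{|z|\le1}|z|\lambda(dz)=\infty$. Let $X^*$ be the integrated supOU process, let $\alpha,\beta,\eta$ be the index parameters defined in the context, and put $$R(t)=\frac{\log\big|X^*(t)-\mathbf 1(\mathbf E|X^*(t)|<\infty)\,\mathbf E X^*(t)\big|}{\log t}.$$ Then almost surely $$\limsup_{t\to\infty}R(t)\le\begin{cases}\frac12,&\text{if }\alpha\ge1\text{ and }\eta\ge2,\\[2pt]\frac1\eta,&\text{if }(\alpha\ge1,\ \eta<2)\text{ or }(\alpha<1,\ \eta\le1+\alpha,\ \beta\le1+\alpha),\\[2pt]\frac1{1+\alpha},&\text{if }\alpha<1,\ \eta>1+\alpha\text{ and }\beta\le1+\alpha,\\[2pt]1-\frac\alpha\beta,&\text{if }\alpha<1,\ \eta>1+\alpha\text{ and }\beta>1+\alpha.\end{cases}$$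
   Context: Let $\pi$ be a measure on $(0,\infty)$ with $m_{-1}(\pi)=\int_{(0,\infty)}x^{-1}\pi(dx)<\infty$, and let $(a,b,\lambda)$ be a Lévy–Khintchine triplet ($a\in\mathbb R$, $b\ge 0$, $\lambda$ a Lévy measure on $\mathbb R$) with $\int_{|z|>1}\log|z|\,\lambda(dz)<\infty$. Let $\Lambda$ be the homogeneous infinitely divisible independently scattered random measure on $(0,\infty)\times\mathbb R$ with generating quadruple $(a,b,\lambda,\pi)$: for disjoint bounded Borel sets $A_1,A_2,\dots$ the variables $\Lambda(A_1),\Lambda(A_2),\dots$ are independent, and for bounded Borel $A$ $$\log\mathbf E e^{i\theta\Lambda(A)}=(\pi\times\mathrm{Leb})(A)\Big(i\theta a-\tfrac{\theta^2}{2}b+\int_{\mathbb R}(e^{i\theta z}-1-i\theta z\mathbf 1(|z|\le 1))\lambda(dz)\Big).$$ The supOU process is $X(t)=\int\!\!\int_{(0,\infty)\times(-\infty,t]}e^{-x(t-s)}\Lambda(dx,ds)$, $t\in\mathbb R$, taken in a measurable modification. The integrated supOU process is $X^*(t)=\int_0^tX(u)\,du$, $t\ge 0$; a.s. $X^*(t)=\int\!\!\int_{(0,\infty)\times\mathbb R}f_t(x,s)\Lambda(dx,ds)$, where $f_t(x,s)=x^{-1}(1-e^{-xt})e^{xs}$ for $s\le 0$ and $f_t(x,s)=x^{-1}(1-e^{-x(t-s)})\mathbf 1(s\le t)$ for $s>0$. Convention: $\log 0=-\infty$, $1/0=\infty$. Indices: $\beta_0=\inf\{\beta\ge0:\int_{|z|\le1}|z|^\beta\lambda(dz)<\infty\}$,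 $\eta_\infty=\sup\{\eta\ge0:\int_{|z|>1}|z|^\eta\lambda(dz)<\infty\}$, $\alpha_0=\sup\{\alpha\ge0:\int_{(0,1]}x^{-\alpha-1}\pi(dx)<\infty\}$. Put $\beta=\beta_0$ if $\int_{|z|\le1}|z|^{\beta_0}\lambda(dz)<\infty$; otherwise $\beta>\beta_0$ is a fixed number arbitrarily close to $\beta_0$ (in particular $\beta\le2$, and $\beta\le1$ if $\beta_0<1$). Put $\eta=\eta_\infty$ if $\eta_\infty<\infty$ and the integral defining it is finite at $\eta_\infty$; otherwise $\eta<\eta_\infty$ is a fixed nonnegative number arbitrarily close to $\eta_\infty$ (arbitrarily large if $\eta_\infty=\infty$). Likewise $\alpha=\alpha_0$ if $\alpha_0<\infty$ and $\int_{(0,1]}x^{-\alpha_0-1}\pi(dx)<\infty$; otherwise $\alpha<\alpha_0$ is a fixed nonnegative number arbitrarily close to $\alpha_0$ (arbitrarily large if $\alpha_0=\infty$). *)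

(* Defs.v *)
From mathcomp Require Import all_boot all_order all_algebra.
From mathcomp Require Import finmap complex.
From mathcomp Require Import all_classical all_reals all_analysis.

Set Implicit Arguments.
Unset Strict Implicit.
Unset Printing Implicit Defensive.

Import Order.TTheory GRing.Theory Num.Theory.
Import numFieldNormedType.Exports.

Local Open Scope classical_set_scope.
Local Open Scope ring_scope.
Local Open Scope complex_scope.

Notation plane R := (measurableTypeR R * measurableTypeR R)%type.

Definition half_plane (R : realType) : set (plane R) := [set p | 0 < p.1].

Definition bounded_borel (R : realType) (A : set (plane R)) : Prop :=
  [/\ measurable A, A `<=` @half_plane R & bounded_set (A : set (R * R))].

Definition cexp (R : realType) (z : R[i]) : R[i] :=
  (expR (complex.Re z))%:C * Complex (cos (complex.Im z)) (sin (complex.Im z)).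

Definition cintegral d (T : measurableType d) (R : realType)
    (m : {measure set T -> \bar R}) (g : T -> R[i]) : R[i] :=
  Complex (\int[m]_x complex.Re (g x)) (\int[m]_x complex.Im (g x)).

Definition charfun d (T : measurableType d) (R : realType)
    (P : probability T R) (Y : T -> R) (theta : R) : R[i] :=
  cintegral P (fun w => cexp (Complex 0 (theta * Y w))).

Definition mutually_independent d (T : measurableType d) (R : realType)
    (P : probability T R) (Y : nat -> T -> R) : Prop :=
  forall (J : {fset nat}) (B : nat -> set R),
    (forall i, measurable (B i)) ->
    P (\bigcap_(i in [set` J]) (Y i @^-1` B i)) =
    (\prod_(i <- J) P (Y i @^-1` B i))%E.

Definition cvg_in_probability d (T : measurableType d) (R : realType)
    (P : probability T R) (Y : nat -> T -> R) (Z : T -> R) : Prop :=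
  forall eps : R, 0 < eps ->
    P [set w | eps <= `|Y n w - Z w|] @[n --> \oo] --> 0%E.

Definition is_levy_measure (R : realType)
    (lam : {measure set (measurableTypeR R) -> \bar R}) : Prop :=
  lam [set 0] = 0%E /\ (\int[lam]_z (Num.min 1 (z ^+ 2))%:E < +oo)%E.

Definition levy_exponent (R : realType) (a b : R)
    (lam : {measure set (measurableTypeR R) -> \bar R}) (theta : R) : R[i] :=
  Complex 0 (theta * a) - (theta ^+ 2 / 2 * b)%:C
  + cintegral lam (fun z : R =>
      cexp (Complex 0 (theta * z)) - 1
      - Complex 0 (theta * z * (`|z| <= 1)%R%:R)).

(* The logarithm in the Levy-Khintchine formula is the distinguished one, so
   the formula is stated after exponentiation.  The control measure of a
   bounded A is finite as soon as the integral of x^-1 against mu is. *)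
Record is_levy_basis d (T : measurableType d) (R : realType)
    (P : probability T R) (a b : R)
    (lam mu : {measure set (measurableTypeR R) -> \bar R})
    (Lam : set (plane R) -> T -> R) : Prop := {
  levy_basis_measurable : forall A, bounded_borel A ->
    measurable_fun setT (Lam A) ;
  levy_basis_independent : forall A : nat -> set (plane R),
    (forall i, bounded_borel (A i)) -> trivIset setT A ->
    mutually_independent P (fun i => Lam (A i)) ;
  levy_basis_additive : forall A : nat -> set (plane R),
    (forall i, bounded_borel (A i)) -> trivIset setT A ->
    bounded_borel (\bigcup_i A i) ->
    {ae P, forall w,
      (\sum_(i < n) Lam (A i) w) @[n --> \oo] --> Lam (\bigcup_i A i) w} ;
  levy_basis_charfun : forall A theta, bounded_borel A ->
    charfun P (Lam A) theta =
    cexp ((fine ((mu \x @lebesgue_measure R)%E A))%:C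
          * levy_exponent a b lam theta) }.

Record simple_integrand (R : realType) := SimpleIntegrand {
  si_size : nat ;
  si_coef : 'I_si_size -> R ;
  si_set : 'I_si_size -> set (plane R) ;
  si_borel : forall i, bounded_borel (si_set i) ;
  si_disjoint : trivIset setT si_set }.

Definition si_eval (R : realType) (f : simple_integrand R) (p : plane R) : R :=
  \sum_(i < si_size f) si_coef i * \1_(si_set i) p.

Definition si_integral d (T : measurableType d) (R : realType)
    (Lam : set (plane R) -> T -> R) (A : set (plane R))
    (f : simple_integrand R) (w : T) : R :=
  \sum_(i < si_size f) si_coef i * Lam (si_set i `&` A) w.

(* Integral with respect to an independently scattered random measure, in the
   sense of Urbanik-Woyczynski and Rajput-Rosinski: f is integrable when it is
   an almost everywhere limit of simple functions whose integrals over every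
   Borel set converge in probability.  Y is a version of the integral of f. *)
Definition is_stochastic_integral d (T : measurableType d) (R : realType)
    (P : probability T R) (mu : {measure set (measurableTypeR R) -> \bar R})
    (Lam : set (plane R) -> T -> R) (f : plane R -> R) (Y : T -> R) : Prop :=
  exists fn : nat -> simple_integrand R,
    [/\ {ae (mu \x @lebesgue_measure R)%E, forall p, half_plane p ->
           si_eval (fn n) p @[n --> \oo] --> f p},
        forall A, measurable A -> A `<=` @half_plane R ->
          exists2 Z : T -> R, measurable_fun setT Z &
            cvg_in_probability P (fun n => si_integral Lam A (fn n)) Z
      & cvg_in_probability P
          (fun n => si_integral Lam (@half_plane R) (fn n)) Y].

Definition supOU_kernel (R : realType) (t : R) (p : plane R) : R :=
  expR (- p.1 * (t - p.2)) * (p.2 <= t)%R%:R.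

Definition is_supOU d (T : measurableType d) (R : realType)
    (P : probability T R) (mu : {measure set (measurableTypeR R) -> \bar R})
    (Lam : set (plane R) -> T -> R) (X : R -> T -> R) : Prop :=
  measurable_fun setT (fun q : measurableTypeR R * T => X q.1 q.2) /\
  forall t, is_stochastic_integral P mu Lam (supOU_kernel t) (X t).

Definition integrated d (T : measurableType d) (R : realType)
    (X : R -> T -> R) (t : R) (w : T) : R :=
  \int[@lebesgue_measure R]_(u in `[0, t]) X u w.

Definition small_moment (R : realType)
    (lam : {measure set (measurableTypeR R) -> \bar R}) (beta : R) : \bar R :=
  (\int[lam]_(z in [set z | (`|z| <= 1)%R]) (`|z| `^ beta)%:E)%E.

Definition large_moment (R : realType)
    (lam : {measure set (measurableTypeR R) -> \bar R}) (eta : R) : \bar R :=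
  (\int[lam]_(z in [set z | (1 < `|z|)%R]) (`|z| `^ eta)%:E)%E.

Definition origin_moment (R : realType)
    (mu : {measure set (measurableTypeR R) -> \bar R}) (alpha : R) : \bar R :=
  (\int[mu]_(x in `]0%R, 1%R]) (x `^ (- alpha - 1))%:E)%E.

Definition beta0 (R : realType)
    (lam : {measure set (measurableTypeR R) -> \bar R}) : R :=
  inf [set beta | 0 <= beta /\ (small_moment lam beta < +oo)%E].

Definition eta_infty (R : realType)
    (lam : {measure set (measurableTypeR R) -> \bar R}) : \bar R :=
  ereal_sup [set eta%:E | eta in
    [set eta | 0 <= eta /\ (large_moment lam eta < +oo)%E]].

Definition alpha0 (R : realType)
    (mu : {measure set (measurableTypeR R) -> \bar R}) : \bar R :=
  ereal_sup [set alpha%:E | alpha in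
    [set alpha | 0 <= alpha /\ (origin_moment mu alpha < +oo)%E]].

(* When the critical exponent is not attained, every admissible exponent
   strictly on the right side of it is allowed, not only those close to it. *)
Definition beta_param (R : realType)
    (lam : {measure set (measurableTypeR R) -> \bar R}) (beta : R) : Prop :=
  if (small_moment lam (beta0 lam) < +oo)%E then beta = beta0 lam
  else [/\ beta0 lam < beta, beta <= 2 & (beta0 lam < 1 -> beta <= 1)].

Definition eta_param (R : realType)
    (lam : {measure set (measurableTypeR R) -> \bar R}) (eta : R) : Prop :=
  if ((eta_infty lam < +oo)
      && (large_moment lam (fine (eta_infty lam)) < +oo))%E
  then eta%:E = eta_infty lam
  else 0 <= eta /\ (eta%:E < eta_infty lam)%E.

Definition alpha_param (R : realType)
    (mu : {measure set (measurableTypeR R) -> \bar R}) (alpha : R) : Prop :=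
  if ((alpha0 mu < +oo) && (origin_moment mu (fine (alpha0 mu)) < +oo))%E
  then alpha%:E = alpha0 mu
  else 0 <= alpha /\ (alpha%:E < alpha0 mu)%E.

Definition centering d (T : measurableType d) (R : realType)
    (P : probability T R) (Y : T -> R) : R :=
  if ('E_P[fun w => `|Y w|%R] < +oo)%E then fine ('E_P[Y])%E else 0.

(* lne 0 = -oo, and ln t > 0 for the relevant t *)
Definition growth_ratio d (T : measurableType d) (R : realType)
    (P : probability T R) (Y : R -> T -> R) (t : R) (w : T) : \bar R :=
  (lne (`|Y t w - centering P (Y t)|%R)%:E / (ln t)%:E)%E.

(* Main.v *)
(** Passing to X - X' with X' an independent copy removes the drift and makes the
characteristic functional of the process equal to exp(-2 Phi), where Phi is the
integral of 1 - cos against the jump measure nu = pi x Leb x lambda. The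
inequality E(1 - cos) <= 2 nu(1 - cos) is stable under multiplication by averages
of cosines, hence controls the mean absolute value of the sum of t consecutive
values of X - X', shifted by v in [0,1], by the nu-integral of powers p1 (jumps of
size at most 1) and p2 (larger jumps) of the kernel: with constants independent of
the starting point, P(.. > r) <= C (t^H / r)^min(p1, p2) as soon as p_i H >= 1 and
p_i - alpha <= p_i H. If H < 1, removing the symmetrization and chaining over dyadic
blocks gives the growth rate H of the centered integral. If H >= 1, the masses of |X| over
unit intervals have tails of order r^(-min(p1, p2)), which bounds the growth of
their sum without centering; the centering is linear in t if large jumps have a
finite mean, and is 0 otherwise because E|X*(t)| is then infinite. The four cases
correspond to four choices of p1 and p2. *)

From HB Require Import structures.
Require Import Defs.
From mathcomp Require Import all_boot all_order all_algebra.
From mathcomp Require Import finmap complex.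
From mathcomp Require Import all_classical all_reals all_analysis.
From mathcomp Require Import measurable_realfun.
From mathcomp Require Import ring lra.

Set Implicit Arguments.
Unset Strict Implicit.
Unset Printing Implicit Defensive.

Import Order.TTheory GRing.Theory Num.Theory.
Import numFieldNormedType.Exports.

Local Open Scope classical_set_scope.
Local Open Scope ring_scope.

(** * Positive definite domination *)

(** Only characteristic functions of finite linear combinations of values of the process are at
    hand; there is no decomposition into jumps to estimate directly. Hence tails come from
    functionals built of cosines, whose products expand into cosines of further combinations. Even
    these characteristic functions need work: the simple functions defining a stochastic integral
    are not dominated by anything, and a gliding hump replaces dominated convergence. The exponents
    come from one computation. For small x, a jump with decay rate x contributes an amount of order
    min(t, 1/x) to a block of length t, for jump times spanning t + 1/x. The integral of the p-th
    power is then of order t^max(1, p - alpha), and the rate H is reached when p H >= max(1, p -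
    alpha). The two terms balance at p = 1 + alpha, H = 1/(1 + alpha). Moments of the Levy measure
    restrict p: eta bounds p2 from above, hence H >= 1/eta; beta bounds p1 from below, hence H >= 1
    - alpha/beta when beta > 1 + alpha; and p <= 2 gives 1/2. *)

Section cosine_kernel.
Context {R : realType}.
Implicit Types (x y : R) (i I : nat).

Lemma onem_cos_ge0 x : 0 <= 1 - cos x.
Proof. by rewrite subr_ge0 cos_le1. Qed.

Lemma onem_cos_le2 x : 1 - cos x <= 2.
Proof. by have := cos_geN1 x; lra. Qed.

Lemma cos_normr x : cos `|x| = cos x.
Proof.
have [x0|x0] := leP 0 x; first by rewrite ger0_norm.
by rewrite ltr0_norm// cosN.
Qed.

Lemma normr_sin_le x : `|sin x| <= `|x|.
Proof.
wlog x0 : x / 0 <= x.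
  move=> h; have [/h//|x0] := leP 0 x.
  by rewrite -(normrN x) -(normrN (sin x)) -sinN; apply: h; lra.
rewrite (ger0_norm x0).
have [x1|x1] := leP 1 x.
  by rewrite (le_trans _ x1)// ler_norml sin_geN1 sin_le1.
have [->|xn0] := eqVneq x 0; first by rewrite sin0 normr0.
have xgt0 : 0 < x by rewrite lt_neqAle eq_sym xn0.
have pos : 0 <= sin x.
  by apply: sin_ge0_pi; rewrite x0/= (le_trans (ltW x1))// (le_trans _ (pi_ge2 _))//; lra.
rewrite ger0_norm//.
have [z zin zE] : exists2 z, z \in `]0, x[%R & sin x - sin 0 = cos z * (x - 0).
  by apply: (MVT _ (fun y _ => is_derive_sin y)) => //; apply: continuous_subspaceT => y; apply: continuous_sin.
move: zE; rewrite sin0 !subr0 => ->.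
by rewrite -[leRHS]mul1r ler_pM2r// cos_le1.
Qed.

Lemma onem_cosE x : 1 - cos x = 2 * sin (x / 2) ^+ 2.
Proof.
have {1}-> : x = x / 2 *+ 2 by rewrite -mulr_natr divfK.
by rewrite cos_mulr2n cos2sin2 mulr2n; lra.
Qed.

Lemma onem_cos_le_sqr x : 1 - cos x <= x ^+ 2 / 2.
Proof.
rewrite onem_cosE.
have : sin (x / 2) ^+ 2 <= (x / 2) ^+ 2.
  by rewrite -[leLHS]real_normK ?num_real// -[leRHS]real_normK ?num_real//
     lerXn2r ?nnegrE// normr_sin_le.
rewrite expr_div_n; lra.
Qed.

Lemma measurable_cos (D : set R) : measurable_fun D (@cos R).
Proof. by apply: measurable_funTS; apply: continuous_measurable_fun; exact: continuous_cos. Qed.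

Lemma measurable_sin (D : set R) : measurable_fun D (@sin R).
Proof. by apply: measurable_funTS; apply: continuous_measurable_fun; exact: continuous_sin. Qed.

End cosine_kernel.
#[global] Hint Extern 0 (measurable_fun _ cos) =>
  solve [exact: measurable_cos] : core.
#[global] Hint Extern 0 (measurable_fun _ sin) =>
  solve [exact: measurable_sin] : core.

(** * Dyadic sums of 1 - cos as a substitute for the absolute value *)

Section dyadic_weight.
Context {R : realType}.
Implicit Types (x y : R) (I : nat).

(** Cosine decreases on [1, 2] because 2 <= pi, so only x = 1 matters. There 1 - cos 1 = 2
    sin(1/2)^2, and sin(1/2) >= 7/16 gives 49/128, just above 3/8. *)
Lemma onem_cos_ge x : 1 <= x <= 2 -> 3 / 8 <= 1 - cos x.
Proof.
move=> /andP[x1 x2].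
have : cos x <= cos 1.
  have p2 := @pi_ge2 R.
  rewrite leNgt ltr_cos ?in_itv/= -?leNgt//; apply/andP; split; lra.
suff : 3 / 8 <= 1 - cos (1 : R) by lra.
rewrite onem_cosE.
have [z zin zE] : exists2 z, z \in `]0, (1 / 2 : R)[%R & sin (1 / 2) - sin 0 = cos z * (1 / 2 - 0).
  by apply: (MVT _ (fun y _ => is_derive_sin y)) => //; apply: continuous_subspaceT => y; apply: continuous_sin.
move: zE; rewrite sin0 !subr0 => ->.
move: zin; rewrite in_itv/= => /andP[z0 z1].
have zz : z ^+ 2 <= 1 / 4 by rewrite expr2; nra.
have cz : 7 / 8 <= cos z by have := onem_cos_le_sqr z; lra.
have : (7 / 8) ^+ 2 <= cos z ^+ 2 by rewrite lerXn2r ?nnegrE//; lra.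
rewrite exprMn !expr2; lra.
Qed.

(* Comparable with |y| for 1 <= |y| <= 2^(I+1), while its mean only involves
   characteristic functions. *)
Definition dyadic_weight I y : R :=
  \sum_(i < I.+1) 2 ^+ i * (1 - cos (2 ^- i * y)).

Lemma dyadic_weight_ge0 I y : 0 <= dyadic_weight I y.
Proof. by apply: sumr_ge0 => i _; rewrite mulr_ge0 ?exprn_ge0 ?onem_cos_ge0. Qed.

Lemma dyadic_weightS I y : dyadic_weight I y <= dyadic_weight I.+1 y.
Proof.
by rewrite /dyadic_weight [leRHS]big_ord_recr/= lerDl mulr_ge0 ?exprn_ge0 ?onem_cos_ge0.
Qed.

Lemma dyadic_weight_le_sqr I y : dyadic_weight I y <= y ^+ 2.
Proof.
(* Since 1 - cos u <= u^2 / 2, the i-th term is at most y^2 / 2^(i+1); the induction carries the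
   partial sum of this geometric series. *)
suff : dyadic_weight I y <= y ^+ 2 * (1 - 2 ^- I.+1).
  move=> /le_trans; apply.
  have : 0 <= 2 ^- I.+1 :> R by rewrite invr_ge0 exprn_ge0.
  by have := sqr_ge0 y; nra.
have h2 i : 2 ^+ i != 0 :> R by rewrite expf_neq0.
have termle i : 2 ^+ i * (1 - cos (2 ^- i * y)) <= y ^+ 2 * 2 ^- i.+1.
  rewrite (le_trans (ler_wpM2l _ (onem_cos_le_sqr _))) ?exprn_ge0//.
  rewrite exprMn (exprS _ i) invfM le_eqVlt; apply/orP; left; apply/eqP; field.
  by rewrite h2.
elim: I => [|I ih]; rewrite /dyadic_weight.
  by rewrite big_ord1 (le_trans (termle _))// expr1; lra.
rewrite big_ord_recr/= (le_trans (lerD ih (termle _)))// -mulrDr ler_wpM2l ?sqr_ge0//.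
rewrite (exprS _ I.+1) invfM; lra.
Qed.

(** One term suffices: if 2^i <= |y| <= 2^(i+1), the argument of the i-th cosine has modulus in
    [1, 2], so that term is at least 3/8 * 2^i >= 3/16 * |y|. The induction on [I] locates i. *)
Lemma dyadic_weight_geS I y : 1 <= `|y| <= 2 ^+ I.+1 -> `|y| / 8 <= dyadic_weight I y.
Proof.
move=> /andP[y1]; elim: I => [|I ih] yI.
  rewrite /dyadic_weight big_ord1 expr0 mul1r invr1 mul1r.
  have : 3 / 8 <= 1 - cos y.
    by rewrite -cos_normr; apply: onem_cos_ge; rewrite y1.
  by move: yI; rewrite expr1; lra.
have [/ih/le_trans->//|yI'] := leP `|y| (2 ^+ I.+1); first exact: dyadic_weightS.
rewrite /dyadic_weight big_ord_recr/=.
have p2 : 0 < 2 ^+ I.+1 :> R by rewrite exprn_gt0.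
have := dyadic_weight_ge0 I y; rewrite /dyadic_weight => s0.
apply: (@le_trans _ _ (2 ^+ I.+1 * (1 - cos (2 ^- I.+1 * y)))); last by rewrite lerDr.
have : 3 / 8 <= 1 - cos (2 ^- I.+1 * y).
  rewrite -cos_normr normrM ger0_norm ?invr_ge0 ?exprn_ge0//.
  apply: onem_cos_ge; rewrite ler_pdivlMl// mulr1 (ltW yI')/=.
  by rewrite ler_pdivrMl// -exprSr.
move=> /(ler_wpM2l (ltW p2)); apply: le_trans.
by move: yI; rewrite exprS; lra.
Qed.

Lemma dyadic_weight_le_norm I y : dyadic_weight I y <= 4 * `|y|.
Proof.
(* The extra -2 closes the induction: the weight of level I+1 is 1 - cos y plus twice the weight of
   level I at y / 2, and 2 + 2 * (4 * |y| / 2 - 2) = 4 * |y| - 2. For |y| <= 2 the quadratic bound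
   is enough. *)
suff h : 1 <= `|y| -> dyadic_weight I y <= 4 * `|y| - 2.
  have [/h|y1] := leP 1 `|y|; first lra.
  rewrite (le_trans (dyadic_weight_le_sqr _ _))// -real_normK ?num_real// expr2.
  by have := normr_ge0 y; nra.
have small J x : 1 <= `|x| -> `|x| <= 2 -> dyadic_weight J x <= 4 * `|x| - 2.
  move=> x1 x2; rewrite (le_trans (dyadic_weight_le_sqr _ _))//.
  by rewrite -real_normK ?num_real// expr2; nra.
elim: I y => [|I ih] y y1.
  have [|y2] := leP `|y| 2; first exact: small.
  rewrite /dyadic_weight big_ord1 expr0 mul1r (le_trans (onem_cos_le2 _))//; lra.
have [|y2] := leP `|y| 2; first exact: small.
have -> : dyadic_weight I.+1 y = (1 - cos y) + 2 * dyadic_weight I (y / 2).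
  rewrite /dyadic_weight big_ord_recl/= expr0 invr1 !mul1r mulr_sumr; congr (_ + _).
  apply: eq_bigr => i _; rewrite /bump/= add1n exprS -mulrA invfM.
  by congr (_ * (_ * (1 - cos _))); rewrite mulrC; ring.
have y2E : `|y / 2| = `|y| / 2 by rewrite normrM normfV [ `|2|]ger0_norm.
have y21 : 1 <= `|y / 2| by rewrite y2E; lra.
have := ih _ y21; rewrite y2E.
have := onem_cos_le2 y; lra.
Qed.

End dyadic_weight.

(* A list of pairs (c, u) encodes the functional y |-> sum of the c * y u. *)
Definition lincomb {R : realType} (l : seq (R * R)) (y : R -> R) : R :=
  \sum_(q <- l) q.1 * y q.2.

Section lincomb_theory.
Context {R : realType}.
Implicit Types (l : seq (R * R)) (y : R -> R).

Lemma lincomb_cat l1 l2 y : lincomb (l1 ++ l2) y = lincomb l1 y + lincomb l2 y.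
Proof. by rewrite /lincomb big_cat. Qed.

Definition scale_comb (a : R) l := [seq (a * q.1, q.2) | q <- l].

Lemma lincomb_scale a l y : lincomb (scale_comb a l) y = a * lincomb l y.
Proof.
rewrite /lincomb big_map mulr_sumr; apply: eq_bigr => q _ /=; by rewrite mulrA.
Qed.

Lemma measurable_lincomb d (T : measurableType d) (Y : R -> T -> R) l :
  (forall u, measurable_fun setT (Y u)) ->
  measurable_fun setT (fun w => lincomb l (Y^~ w)).
Proof.
move=> mY; apply: measurable_sum => q.
by apply: measurable_funM.
Qed.

End lincomb_theory.

(** * Stability of the domination under cosine averages *)

Section positive_definite_functionals.
Context {R : realType} dO dE (Om : measurableType dO) (E : measurableType dE).
Variables (P : probability Om R) (nu : {sigma_finite_measure set E -> \bar R}).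
Variables (W : R -> Om -> R) (ka : R -> E -> R).
Local Notation Wp w := (fun u => W u w).
Local Notation kp e := (fun u => ka u e).

(* For F = 1 this is 1 - exp (- 2 x) <= 2 x; the class is then enlarged to
   functionals of whole paths by dominated_functionalM. *)
Definition dominated_functional (F : (R -> R) -> R) := forall l,
  (\int[P]_w (1 - cos (lincomb l (Wp w)) * F (Wp w))%:E <=
   2%:E * \int[nu]_e (1 - cos (lincomb l (kp e)) * F (kp e))%:E)%E.

(** Bounds and measurability are asked only along the two families of paths, so that no
    sigma-algebra on the space of all functions is involved. *)
Record tame_functional (F : (R -> R) -> R) : Prop := {
  tame_itvW : forall w, 0 <= F (Wp w) <= 1;
  tame_itvk : forall e, 0 <= F (kp e) <= 1;
  tame_W : measurable_fun setT (fun w => F (Wp w));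
  tame_k : measurable_fun setT (fun e => F (kp e)) }.

Hypotheses (mW : forall u, measurable_fun setT (W u))
  (mka : forall u, measurable_fun setT (ka u)).

Context dV (V : measurableType dV) (Q : probability V R) (f : V -> seq (R * R)).
Hypotheses
  (mfW : measurable_fun setT (fun q : V * Om => lincomb (f q.1) (Wp q.2)))
  (mfk : measurable_fun setT (fun q : V * E => lincomb (f q.1) (kp q.2))).

(** The [Q]-mean of (1 + cos) / 2, written through 1 - cos so that the integrand is nonnegative. The
    shift by 1 keeps the value in [0, 1], as products and powers of such averages require. *)
Definition cos_average (y : R -> R) : R :=
  1 - fine (\int[Q]_v (1 - cos (lincomb (f v) y))%:E)%E / 2.

Let split_itv (b c : R) : 0 <= b <= 1 -> -1 <= c <= 1 -> 0 <= 1 - c * b.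
Proof. move=> /andP[? ?] /andP[? ?]; nra. Qed.

(** Product-to-sum formula: with A and B the values of [l] and [f v], cos A * (1 + cos B) / 2 is the
    mean of cos A with weight 1/2 and of cos (A + B), cos (A - B) with weights 1/4, all of them
    cosines of linear combinations ([mixE]). *)
Let mix (F : (R -> R) -> R) (l : seq (R * R)) (v : V) (y : R -> R) : R :=
  (1 - cos (lincomb l y) * F y) / 2 +
  ((1 - cos (lincomb (l ++ f v) y) * F y) +
   (1 - cos (lincomb (l ++ scale_comb (-1) (f v)) y) * F y)) / 4.

Let term_ge0 (F : (R -> R) -> R) l y : 0 <= F y <= 1 -> 0 <= 1 - cos (lincomb l y) * F y.
Proof. by move=> h; apply: split_itv => //; rewrite cos_geN1 cos_le1. Qed.

Let mix_ge0 (F : (R -> R) -> R) l v y : 0 <= F y <= 1 -> 0 <= mix F l v y.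
Proof.
move=> h; have := @term_ge0 F l y h; have := @term_ge0 F (l ++ f v) y h.
have := @term_ge0 F (l ++ scale_comb (-1) (f v)) y h; rewrite /mix; lra.
Qed.

Let mixE (F : (R -> R) -> R) l v y :
  mix F l v y = 1 - cos (lincomb l y) * F y * (1 + cos (lincomb (f v) y)) / 2.
Proof.
rewrite /mix !lincomb_cat lincomb_scale mulN1r cosD cosB; lra.
Qed.

Let integral_mix (F : (R -> R) -> R) l y : measurable_fun setT (fun v => lincomb (f v) y) ->
  0 <= F y <= 1 ->
  (\int[Q]_v (mix F l v y)%:E)%E = (1 - cos (lincomb l y) * (F y * cos_average y))%:E.
Proof.
move=> mf F01.
have mc : measurable_fun setT (fun v => 1 - cos (lincomb (f v) y)).
  by apply: measurable_funB => //; apply: measurableT_comp.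
have ic : Q.-integrable setT (EFin \o (fun v => 1 - cos (lincomb (f v) y))).
  apply: measurable_bounded_integrable => //.
    by have := probability_setT Q => /= ->; rewrite ltry.
  exists 2; split; rewrite ?num_real// => M M2 v _ /=.
  by rewrite ger0_norm ?onem_cos_ge0// (le_trans (onem_cos_le2 _))// ltW.
under eq_integral do rewrite mixE.
set A := cos (lincomb l y) * F y.
have -> : (\int[Q]_v (1 - A * (1 + cos (lincomb (f v) y)) / 2)%:E =
   \int[Q]_v ((1 - A)%:E + (A / 2)%:E * (1 - cos (lincomb (f v) y))%:E))%E.
  by apply: eq_integral => v _; rewrite -EFinM -EFinD; congr EFin; lra.
rewrite integralD//; last 2 first.
  - exact: finite_measure_integrable_cst.
  - exact: integrableZl.
rewrite integralZl// integral_cst// [X in (_ * X)%E]probability_setT mule1.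
rewrite -[X in (_ + _ * X)%E]fineK; last exact: integrable_fin_num.
rewrite -EFinM -EFinD; congr EFin; rewrite /cos_average mulrA -/A; lra.
Qed.

Let meas_mix d (X : measurableType d) (Y : R -> X -> R) (F : (R -> R) -> R) l :
  (forall u, measurable_fun setT (Y u)) ->
  measurable_fun setT (fun q : V * X => lincomb (f q.1) (Y^~ q.2)) ->
  measurable_fun setT (fun x => F (Y^~ x)) ->
  measurable_fun setT (fun q : X * V => (mix F l q.2 (Y^~ q.1))%:E).
Proof.
move=> mY mf mF; apply/measurable_EFinP.
have -> : (fun q : X * V => mix F l q.2 (Y^~ q.1)) = (fun q =>
    1 - cos (lincomb l (Y^~ q.1)) * F (Y^~ q.1) *
      (1 + cos (lincomb (f q.2) (Y^~ q.1))) / 2).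
  by apply/funext => q; rewrite mixE.
apply: measurable_funB => //; apply: measurable_funM => //; apply: measurable_funM.
  apply: measurable_funM.
    apply: measurableT_comp; first exact: measurable_cos.
    exact: (measurableT_comp (measurable_lincomb l mY) measurable_fst).
  exact: (measurableT_comp mF measurable_fst).
apply: measurable_funD => //; apply: measurableT_comp => //.
exact: (measurableT_comp mf (measurable_fun_pair measurable_snd measurable_fst)).
Qed.

Let meas_term d (X : measurableType d) (Y : R -> X -> R) (F : (R -> R) -> R) l :
  (forall u, measurable_fun setT (Y u)) ->
  measurable_fun setT (fun x => F (Y^~ x)) ->
  measurable_fun setT (fun x => (1 - cos (lincomb l (Y^~ x)) * F (Y^~ x))%:E).
Proof.
move=> mY mF; apply/measurable_EFinP; apply: measurable_funB => //.
apply: measurable_funM => //.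
apply: measurableT_comp; [exact: measurable_cos|exact: measurable_lincomb].
Qed.

Let section_meas d (X : measurableType d) (Y : R -> X -> R) x :
  measurable_fun setT (fun q : V * X => lincomb (f q.1) (Y^~ q.2)) ->
  measurable_fun setT (fun v => lincomb (f v) (Y^~ x)).
Proof.
move=> mf; exact: (measurableT_comp mf (measurable_pair2 x)).
Qed.

Lemma cos_average_itv y : measurable_fun setT (fun v => lincomb (f v) y) ->
  0 <= cos_average y <= 1.
Proof.
move=> mf.
have mc : measurable_fun setT (fun v => (1 - cos (lincomb (f v) y))%:E).
  by apply/measurable_EFinP/measurable_funB => //; apply: measurableT_comp.
have i0 : (0 <= \int[Q]_v (1 - cos (lincomb (f v) y))%:E)%E.
  by apply: integral_ge0 => v _; rewrite lee_fin onem_cos_ge0.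
have i2 : (\int[Q]_v (1 - cos (lincomb (f v) y))%:E <= 2%:E)%E.
  rewrite -[leRHS]mule1 -(probability_setT Q) -integral_cst//.
  by apply: ge0_le_integral => //= v _; rewrite lee_fin ?onem_cos_ge0 ?onem_cos_le2.
have := fine_ge0 i0.
have : fine (\int[Q]_v (1 - cos (lincomb (f v) y))%:E)%E <= 2.
  by rewrite -lee_fin fineK// ge0_fin_numE// (le_lt_trans i2)// ltry.
rewrite /cos_average; lra.
Qed.

(** Tonelli turns both sides into [Q]-averages of [mix], and for each v the domination of [F]
    applies to the three combinations l, l + f v and l - f v. The weights being nonnegative, the
    inequality survives. *)
Lemma dominated_functionalM F : tame_functional F -> dominated_functional F ->
  dominated_functional (fun y => F y * cos_average y).
Proof.
move=> [FW01 Fk01 mFW mFk] domF l.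
under eq_integral => w _.
  rewrite -integral_mix//; last exact: section_meas.
  over.
under [X in (_ <= _ * X)%E]eq_integral => e _.
  rewrite -integral_mix//; last exact: section_meas.
  over.
rewrite (fubini_tonelli (fun q => (mix F l q.2 (Wp q.1))%:E)) /=; last 2 first.
  - exact: meas_mix.
  - by move=> q; rewrite lee_fin mix_ge0.
rewrite (fubini_tonelli (fun q => (mix F l q.2 (kp q.1))%:E)) /=; last 2 first.
  - exact: meas_mix.
  - by move=> q; rewrite lee_fin mix_ge0.
rewrite -ge0_integralZl//=; last 2 first.
  - apply: (measurable_fun_fubini_tonelli_G (fun q => (mix F l q.2 (kp q.1))%:E)) => //=.
      exact: meas_mix.
    by move=> q; rewrite lee_fin mix_ge0.
  - by move=> v _; apply: integral_ge0 => e _; rewrite lee_fin mix_ge0.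
apply: ge0_le_integral => //=.
- by move=> v _; apply: integral_ge0 => w _; rewrite lee_fin mix_ge0.
- apply: (measurable_fun_fubini_tonelli_G (fun q => (mix F l q.2 (Wp q.1))%:E)) => //=.
    exact: meas_mix.
  by move=> q; rewrite lee_fin mix_ge0.
- apply: measurable_funeM.
  apply: (measurable_fun_fubini_tonelli_G (fun q => (mix F l q.2 (kp q.1))%:E)) => //=.
    exact: meas_mix.
  by move=> q; rewrite lee_fin mix_ge0.
move=> v _.
have int_mix d (X : measurableType d) (m : {measure set X -> \bar R}) (Y : R -> X -> R) :
    (forall u, measurable_fun setT (Y u)) ->
    measurable_fun setT (fun x => F (Y^~ x)) -> (forall x, 0 <= F (Y^~ x) <= 1) ->
  (\int[m]_x (mix F l v (Y^~ x))%:E =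
   (2^-1)%:E * \int[m]_x (1 - cos (lincomb l (Y^~ x)) * F (Y^~ x))%:E +
   ((4^-1)%:E * \int[m]_x (1 - cos (lincomb (l ++ f v) (Y^~ x)) * F (Y^~ x))%:E +
   (4^-1)%:E * \int[m]_x (1 - cos (lincomb (l ++ scale_comb (-1) (f v)) (Y^~ x)) * F (Y^~ x))%:E))%E.
  move=> mY mF F01.
  rewrite -!ge0_integralZl//=; try (by move=> x _; rewrite lee_fin term_ge0);
    try (exact: meas_term).
  rewrite -!ge0_integralD//=;
    try (by move=> x _; rewrite -?EFinM -?EFinD lee_fin ?addr_ge0 ?mulr_ge0 ?term_ge0);
    try (by apply: measurable_funeM; exact: meas_term);
    try (by apply: emeasurable_funD; apply: measurable_funeM; exact: meas_term).
  by apply: eq_integral => x _; rewrite -!EFinM -!EFinD /mix; congr EFin; lra.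
rewrite !int_mix//.
have pos d (X : measurableType d) (m : {measure set X -> \bar R}) (Y : R -> X -> R) l' : (forall x, 0 <= F (Y^~ x) <= 1) ->
  (0 <= \int[m]_x (1 - cos (lincomb l' (Y^~ x)) * F (Y^~ x))%:E)%E.
  by move=> F01; apply: integral_ge0 => x _; rewrite lee_fin term_ge0.
have key (a1 b1 c1 a2 b2 c2 : \bar R) :
    (0 <= a2 -> 0 <= b2 -> 0 <= c2 ->
     a1 <= 2%:E * a2 -> b1 <= 2%:E * b2 -> c1 <= 2%:E * c2 ->
     (2^-1)%:E * a1 + ((4^-1)%:E * b1 + (4^-1)%:E * c1) <=
     2%:E * ((2^-1)%:E * a2 + ((4^-1)%:E * b2 + (4^-1)%:E * c2)))%E.
  move=> a0 b0 c0 ha hb hc.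
  rewrite !ge0_muleDr ?adde_ge0 ?mule_ge0 ?lee_fin//.
  rewrite ![(2%:E * (_ * _))%E]muleCA.
  by apply: leeD; last apply: leeD; rewrite lee_pmul2l//.
by apply: key; do ?exact: pos; exact: domF.
Qed.

End positive_definite_functionals.

Section dyadic_bounds.
Context {R : realType}.

Lemma measure_bigcup_le d (T : measurableType d) (m : {measure set T -> \bar R})
    (F : (set T)^nat) (c : \bar R) :
  (forall n, measurable (F n)) -> nondecreasing_seq F ->
  (forall n, m (F n) <= c)%E -> (m (\bigcup_n F n) <= c)%E.
Proof.
move=> mF ndF Fc; have h : m (F n) @[n --> \oo] --> m (\bigcup_n F n).
  exact: (nondecreasing_cvg_mu mF (bigcup_measurable (fun n _ => mF n)) ndF).
rewrite -(cvg_lim _ h)//; apply: lime_le; first by apply/cvg_ex; eexists; exact: h.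
by apply: nearW => n; exact: Fc.
Qed.

Lemma measurable_dyadic_weight (I : nat) (D : set R) : measurable_fun D (dyadic_weight I).
Proof.
apply: measurable_funTS; apply: measurable_sum => i.
apply: measurable_funM => //; apply: measurable_funB => //.
by apply: measurableT_comp; [exact: measurable_cos|apply: measurable_funM].
Qed.

(** Pointwise |g| <= 1 + 8 h, where h is the increasing limit of the weights: the 1 covers |g| <= 1,
    and elsewhere the weight of a high level is at least |g| / 8. Monotone convergence transfers the
    uniform bound on the means. *)
Lemma integral_norm_le_dyadic dV (V : measurableType dV) (Q : probability V R)
    (g : V -> R) (c : \bar R) : (0 <= c)%E -> measurable_fun setT g ->
  (forall I, \int[Q]_v (dyadic_weight I (g v))%:E <= c)%E ->
  (\int[Q]_v `|g v|%:E <= 1%:E + 8%:E * c)%E.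
Proof.
move=> c0 mg hc.
have mI I : measurable_fun setT (fun v => (dyadic_weight I (g v))%:E).
  by apply/measurable_EFinP; apply: measurableT_comp => //; exact: measurable_dyadic_weight.
pose h v := limn (fun I => (dyadic_weight I (g v))%:E).
have nd v : nondecreasing_seq (fun I => (dyadic_weight I (g v))%:E).
  by apply/nondecreasing_seqP => I; rewrite lee_fin dyadic_weightS.
have h0 v : (0 <= h v)%E.
  apply: lime_ge; first exact: ereal_nondecreasing_is_cvgn.
  by apply: nearW => I; rewrite lee_fin dyadic_weight_ge0.
have mh : measurable_fun setT h.
  apply: (emeasurable_fun_cvg (fun I v => (dyadic_weight I (g v))%:E)) => // v _.
  exact: ereal_nondecreasing_is_cvgn.
have gh v : (`|g v|%:E <= 1%:E + 8%:E * h v)%E.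
  have [g1|g1] := leP `|g v| 1.
    by rewrite (@le_trans _ _ 1%:E) ?lee_fin// leeDl// mule_ge0.
  have [I gI] : exists I, `|g v| <= 2 ^+ I.+1.
    exists (Num.truncn `|g v|).
    rewrite -natrX; apply/ltW/(lt_le_trans (truncnS_gt _)).
    by rewrite ler_nat ltnW// ltn_expl.
  have hI : ((dyadic_weight I (g v))%:E <= h v)%E.
    apply: lime_ge; first exact: ereal_nondecreasing_is_cvgn.
    by exists I => // J /= IJ; exact: nd.
  apply: (@le_trans _ _ (8%:E * (dyadic_weight I (g v))%:E)%E).
    rewrite -EFinM lee_fin; have := @dyadic_weight_geS _ I (g v).
    by rewrite (ltW g1) gI => /(_ isT); lra.
  rewrite (@le_trans _ _ (8%:E * h v)%E) ?lee_pmul2l//.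
  by rewrite leeDr// lee_fin.
apply: (@le_trans _ _ (\int[Q]_v (1%:E + 8%:E * h v))%E).
  apply: ge0_le_integral => //=.
  - by apply/measurable_EFinP; apply: measurableT_comp.
  - by apply: emeasurable_funD => //; apply: measurable_funeM.
rewrite ge0_integralD//; last 2 first.
  - by move=> v _; rewrite mule_ge0.
  - exact: measurable_funeM.
rewrite integral_cst//= probability_setT mule1 leeD2l//.
rewrite ge0_integralZl// lee_pmul2l//.
rewrite monotone_convergence//;
  last by move=> I v _; rewrite lee_fin dyadic_weight_ge0.
apply: lime_le; last by apply: nearW => I; exact: hc.
apply: ereal_nondecreasing_is_cvgn => I J IJ; apply: ge0_le_integral => //.
- by move=> v _; rewrite lee_fin dyadic_weight_ge0.
- by move=> v _; exact: nd.
Qed.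

End dyadic_bounds.

(** * From the domination to tails and means *)

Section dyadic_product.
Context {R : realType} dO dE (Om : measurableType dO) (E : measurableType dE).
Variables (P : probability Om R) (nu : {sigma_finite_measure set E -> \bar R}).
Variables (W : R -> Om -> R) (ka : R -> E -> R).
Local Notation Wp w := (fun u => W u w).
Local Notation kp e := (fun u => ka u e).
Hypotheses (mW : forall u, measurable_fun setT (W u))
  (mka : forall u, measurable_fun setT (ka u)).
Hypothesis LK : dominated_functional P nu W ka (fun=> 1).
Context dV (V : measurableType dV) (Q : probability V R) (f : V -> seq (R * R)).
Hypotheses
  (mfW : measurable_fun setT (fun q : V * Om => lincomb (f q.1) (Wp q.2)))
  (mfk : measurable_fun setT (fun q : V * E => lincomb (f q.1) (kp q.2))).

(** The powers 2^i in [F] below copy the coefficients of [dyadic_weight]. The mean weight of level I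
    is twice the sum of 2^i (1 - A i), so [F I.+1] is at most exp (- mean / 2) while 1 - F is at
    most mean / 2: one functional serves both sides of the domination. *)
Let A i (y : R -> R) := cos_average Q (fun v => scale_comb (2 ^- i) (f v)) y.
Let F I (y : R -> R) := \prod_(i < I) A i y ^+ (2 ^ i).

Let tame Y := measurable_fun setT (fun v : V => lincomb (f v) Y).

Let tame_scale i y : tame y ->
  measurable_fun setT (fun v => lincomb (scale_comb (2 ^- i) (f v)) y).
Proof.
by move=> my; under eq_fun do rewrite lincomb_scale; apply: measurable_funM.
Qed.

Let A01 i y : tame y -> 0 <= A i y <= 1.
Proof. by move=> my; apply: cos_average_itv; exact: tame_scale. Qed.

Let tameW w : tame (Wp w).
Proof. exact: (measurableT_comp mfW (measurable_pair2 w)). Qed.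

Let tamek e : tame (kp e).
Proof. exact: (measurableT_comp mfk (measurable_pair2 e)). Qed.

Let F01 I y : tame y -> 0 <= F I y <= 1.
Proof.
move=> my; elim: I => [|I /andP[ih0 ih1]]; first by rewrite /F big_ord0 ler01 lexx.
have /andP[a0 a1] := A01 I my.
rewrite /F big_ord_recr/= mulr_ge0 ?exprn_ge0//= mulr_ile1 ?exprn_ge0//.
by rewrite exprn_ile1.
Qed.

Let meas_A d (X : measurableType d) (Y : R -> X -> R) i :
  measurable_fun setT (fun q : V * X => lincomb (f q.1) (Y^~ q.2)) ->
  measurable_fun setT (fun x => A i (Y^~ x)).
Proof.
move=> mf; apply: measurable_funB => //; apply: measurable_funM => //.
apply: (measurableT_comp (fine_measurable measurableT)).
apply: (measurable_fun_fubini_tonelli_G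
  (fun q : V * X => (1 - cos (lincomb (scale_comb (2 ^- i) (f q.1)) (Y^~ q.2)))%:E)) => /=.
  apply/measurable_EFinP; apply: measurable_funB => //.
  apply: measurableT_comp; first exact: measurable_cos.
  by under eq_fun do rewrite lincomb_scale; apply: measurable_funM.
by move=> q; rewrite lee_fin onem_cos_ge0.
Qed.

Let F_tame_dom I : tame_functional W ka (F I) /\ dominated_functional P nu W ka (F I).
Proof.
elim: I => [|I [ih1 ih2]].
  have -> : F 0 = fun=> 1 by apply/funext => y; rewrite /F big_ord0.
  by split => //; split => // x; rewrite ler01 lexx.
have -> : F I.+1 = fun y => F I y * A I y ^+ (2 ^ I).
  by apply/funext => y; rewrite /F big_ord_recr.
(* The power is reached one factor at a time, because [dominated_functionalM] multiplies by a single
   cosine average. *)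
elim: (2 ^ I)%N => [|n [jh1 jh2]].
  have -> // : (fun y => F I y * A I y ^+ 0) = F I.
  by apply/funext => y; rewrite expr0 mulr1.
have -> : (fun y => F I y * A I y ^+ n.+1) = (fun y => F I y * A I y ^+ n * A I y).
  by apply/funext => y; rewrite exprSr mulrA.
split; last first.
  apply: dominated_functionalM => //.
  - by under eq_fun do rewrite lincomb_scale; apply: measurable_funM.
  - by under eq_fun do rewrite lincomb_scale; apply: measurable_funM.
case: jh1 => h1 h2 h3 h4; split.
- move=> w; have /andP[? ?] := h1 w; have /andP[? ?] := A01 I (tameW w).
  by rewrite mulr_ge0//= mulr_ile1.
- move=> e; have /andP[? ?] := h2 e; have /andP[? ?] := A01 I (tamek e).
  by rewrite mulr_ge0//= mulr_ile1.
- by apply: measurable_funM => //; exact: meas_A.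
- by apply: measurable_funM => //; exact: meas_A.
Qed.

Let mean_weight I y := (\int[Q]_v (dyadic_weight I (lincomb (f v) y))%:E)%E.

Let mean_weightE I y : tame y ->
  mean_weight I y = (\sum_(i < I.+1) 2 ^+ i * (2 * (1 - A i y)))%:E.
Proof.
move=> my; rewrite /mean_weight.
have mi i : measurable_fun setT (fun v => (1 - cos (2 ^- i * lincomb (f v) y))%:E).
  apply/measurable_EFinP; apply: measurable_funB => //.
  by apply: measurableT_comp; [exact: measurable_cos|apply: measurable_funM].
under eq_integral do rewrite /dyadic_weight -sumEFin.
rewrite ge0_integral_sum//;
    last by move=> i; under eq_fun do rewrite EFinM; apply: measurable_funeM.
rewrite -sumEFin; apply: eq_bigr => i _.
under eq_integral do rewrite EFinM.
rewrite ge0_integralZl//.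
rewrite EFinM; congr (_ * _)%E.
rewrite /A /cos_average opprB addrC subrK mulrCA divff// mulr1 fineK.
  by apply: eq_integral => v _; rewrite lincomb_scale.
rewrite ge0_fin_numE; last by apply: integral_ge0 => v _; rewrite lee_fin onem_cos_ge0.
apply: (@le_lt_trans _ _ (\int[Q]_v (cst 2%:E v))%E).
  apply: ge0_le_integral => //=.
  - by under eq_fun do rewrite lincomb_scale; exact: mi.
  - by move=> v _; rewrite lee_fin onem_cos_le2.
by rewrite integral_cst//= probability_setT mule1 ltry.
Qed.

Let onem_exprn_le (x : R) n : 0 <= x <= 1 -> 1 - x ^+ n <= n%:R * (1 - x).
Proof.
move=> /andP[x0 x1]; elim: n => [|n ih]; first by rewrite expr0 subrr mul0r.
have xn0 : 0 <= x ^+ n by rewrite exprn_ge0.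
have xn1 : x ^+ n <= 1 by rewrite exprn_ile1.
rewrite exprS -natr1; nra.
Qed.

Let onem_F_le I y : tame y -> 1 - F I y <= \sum_(i < I) 2 ^+ i * (1 - A i y).
Proof.
move=> my; elim: I => [|I ih]; first by rewrite /F !big_ord0 subrr.
have /andP[f0 f1] := F01 I my; have /andP[a0 a1] := A01 I my.
have := onem_exprn_le (2 ^ I) (A01 I my).
have p0 : 0 <= A I y ^+ (2 ^ I) by rewrite exprn_ge0.
have p1 : A I y ^+ (2 ^ I) <= 1 by rewrite exprn_ile1.
have -> : F I.+1 y = F I y * A I y ^+ (2 ^ I) by rewrite /F big_ord_recr.
rewrite big_ord_recr/= natrX; nra.
Qed.

Let F_le I y : tame y -> F I y <= expR (- \sum_(i < I) 2 ^+ i * (1 - A i y)).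
Proof.
move=> my; elim: I => [|I ih]; first by rewrite /F !big_ord0 oppr0 expR0.
have -> : F I.+1 y = F I y * A I y ^+ (2 ^ I) by rewrite /F big_ord_recr.
have /andP[f0 f1] := F01 I my; have /andP[a0 a1] := A01 I my.
rewrite big_ord_recr/= opprD expRD ler_pM ?exprn_ge0//.
rewrite -mulrN -natrX expRM_natl ler_pXn2r ?nnegrE ?expR_ge0 ?expn_gt0//.
by have := expR_ge1Dx (- (1 - A I y)); lra.
Qed.

(* The domination is applied with F a product of powers of cosine averages at
   the scales 2^-i, which is at most 2/3 where the mean of dyadic_weight is
   larger than 1. *)
Lemma prob_mean_norm_gt (b : E -> R) : measurable_fun setT b ->
  (forall v e, Num.min 1 (lincomb (f v) (kp e) ^+ 2) <= b e) ->
  (P [set w | 9%:E < \int[Q]_v `|lincomb (f v) (Wp w)|%:E] <=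
   6%:E * \int[nu]_e (b e)%:E)%E.
Proof.
move=> mb hb.
have b0 e : 0 <= b e.
  have [v _] : exists v : V, True by exists point.
  by apply: le_trans (hb v e); rewrite le_min ler01 sqr_ge0.
have mwW I : measurable_fun setT (fun w => mean_weight I (Wp w)).
  apply: (measurable_fun_fubini_tonelli_G
    (fun q : V * Om => (dyadic_weight I (lincomb (f q.1) (Wp q.2)))%:E)) => /=.
    apply/measurable_EFinP; apply: measurableT_comp => //.
    exact: measurable_dyadic_weight.
  by move=> q; rewrite lee_fin dyadic_weight_ge0.
(* Since 9 = 1 + 8 * 1, [integral_norm_le_dyadic] forces the mean weight above 1 at some level. The
   events [G I] increase with I, so a bound uniform in I is enough. *)
pose G I := [set w | (1 < mean_weight I (Wp w))%E].
have mG I : measurable (G I).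
  rewrite -[G I]setTI; exact: emeasurable_fun_o_infty.
have ndG : nondecreasing_seq G.
  apply/nondecreasing_seqP => I; apply/subsetPset => w /lt_le_trans; apply.
  apply: ge0_le_integral => //.
  - by move=> v _; rewrite lee_fin dyadic_weight_ge0.
  - apply/measurable_EFinP; apply: measurableT_comp; first exact: measurable_dyadic_weight.
    exact: tameW.
  - apply/measurable_EFinP; apply: measurableT_comp; first exact: measurable_dyadic_weight.
    exact: tameW.
  - by move=> v _; rewrite lee_fin dyadic_weightS.
apply: (@le_trans _ _ (P (\bigcup_I G I))).
  apply: le_measure; rewrite ?inE.
  - rewrite -[X in measurable X]setTI; apply: emeasurable_fun_o_infty => //.
    apply: (measurable_fun_fubini_tonelli_G
      (fun q : V * Om => `|lincomb (f q.1) (Wp q.2)|%:E)) => //=.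
    by apply/measurable_EFinP; apply: measurableT_comp.
  - exact: bigcup_measurable.
  - move=> w /= hw; apply: contrapT => nG.
    have : (\int[Q]_v `|lincomb (f v) (Wp w)|%:E <= 1%:E + 8%:E * 1%:E)%E.
      apply: integral_norm_le_dyadic => // [|I]; first exact: tameW.
      by rewrite leNgt; apply/negP => h; apply: nG; exists I.
    by rewrite leNgt -EFinM -EFinD (_ : 1 + 8 * 1 = 9 :> R) ?hw//; lra.
apply: measure_bigcup_le => // I.
have [tF dF] := F_tame_dom I.+1.
(* The empty combination has cosine 1, so the domination compares the integrals of 1 - F. *)
have := dF [::].
under eq_integral do rewrite /lincomb big_nil cos0 mul1r.
under [X in (_ <= _ * X)%E -> _]eq_integral do rewrite /lincomb big_nil cos0 mul1r.
move=> dF1.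
have GF w : G I w -> F I.+1 (Wp w) <= 2 / 3.
  move=> Gw; apply: (le_trans (F_le _ (tameW w))).
  move: Gw; rewrite /G/= mean_weightE//= lte_fin => h.
  have {}h : 1 / 2 < \sum_(i < I.+1) 2 ^+ i * (1 - A i (Wp w)).
    suff : \sum_(i < I.+1) 2 ^+ i * (2 * (1 - A i (Wp w))) =
      2 * \sum_(i < I.+1) 2 ^+ i * (1 - A i (Wp w)) by move=> e; move: h; rewrite e; lra.
    by rewrite mulr_sumr; apply: eq_bigr => i _; rewrite mulrCA.
  (* exp (-1/2) <= 2/3 because exp (1/2) >= 3/2. Hence 1 - F >= 1/3 on [G I]; with the factor 2 of
     the domination this makes the constant 6. *)
  apply: (@le_trans _ _ (expR (- (1 / 2)))); first by rewrite ler_expR lerN2 ltW.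
  rewrite expRN -[leRHS]invrK lef_pV2 ?posrE ?expR_gt0 ?invr_gt0//.
  by have := expR_ge1Dx (1 / 2 : R); lra.
have [_ _ mFW mFk] := tF.
have : ((3^-1)%:E * P (G I) <= \int[P]_w (1 - F I.+1 (Wp w))%:E)%E.
  rewrite -integral_cst//.
  rewrite -[leLHS]/(\int[P]_(x in G I) (cst (3^-1)%:E x))%E.
  apply: (@le_trans _ _ (\int[P]_(w in G I) (1 - F I.+1 (Wp w))%:E)%E).
    apply: ge0_le_integral => //=.
    - by apply/measurable_EFinP; apply: measurable_funTS; apply: measurable_funB.
    - by move=> w /GF; rewrite lee_fin; lra.
  apply: ge0_subset_integral => //=.
  - by apply/measurable_EFinP; apply: measurable_funB.
  - by move=> w _; rewrite lee_fin subr_ge0; have /andP[] := F01 I.+1 (tameW w).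
have : (2%:E * \int[nu]_e (1 - F I.+1 (kp e))%:E <= 2%:E * \int[nu]_e (b e)%:E)%E.
  rewrite lee_pmul2l//; apply: ge0_le_integral => //=.
  - by move=> e _; rewrite lee_fin subr_ge0; have /andP[] := F01 I.+1 (tamek e).
  - by apply/measurable_EFinP; apply: measurable_funB.
  - exact/measurable_EFinP.
  move=> e _; rewrite lee_fin.
  have /andP[F0 F1] := F01 I.+1 (tamek e).
  (* Where b < 1 the hypothesis bounds the square itself, so the mean weight is at most b, and 1 - F
     at most b / 2. *)
  have [b1|b1] := leP 1 (b e); first by apply: le_trans b1; lra.
  apply: (le_trans (onem_F_le I.+1 (tamek e))).
  have : (mean_weight I (kp e) <= (b e)%:E)%E.
    rewrite -[leRHS]mule1 -(probability_setT Q) -integral_cst//.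
    apply: ge0_le_integral => //=.
    - by move=> v _; rewrite lee_fin dyadic_weight_ge0.
    - apply/measurable_EFinP; apply: measurableT_comp; first exact: measurable_dyadic_weight.
      exact: tamek.
    - move=> v _; rewrite lee_fin (le_trans (dyadic_weight_le_sqr _ _))//.
      by have := hb v e; rewrite ge_min => /orP[|//]; rewrite leNgt b1.
  rewrite mean_weightE// lee_fin => h.
  have : \sum_(i < I.+1) 2 ^+ i * (2 * (1 - A i (kp e))) =
      2 * \sum_(i < I.+1) 2 ^+ i * (1 - A i (kp e)).
    by rewrite mulr_sumr; apply: eq_bigr => i _; rewrite mulrCA.
  have : 0 <= \sum_(i < I.+1) 2 ^+ i * (1 - A i (kp e)).
    apply: sumr_ge0 => i _; rewrite mulr_ge0 ?exprn_ge0// subr_ge0.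
    by have /andP[] := A01 i (tamek e).
  by move=> ? h2; move: h; rewrite h2; lra.
move=> h1 h2.
have := le_trans h2 (le_trans dF1 h1).
have e0 : (0 <= 3%:E :> \bar R)%E by rewrite lee_fin.
move=> /(lee_wpmul2l e0).
by rewrite !muleA -!EFinM mulfV// mul1e (_ : 3 * 2 = 6 :> R)//; lra.
Qed.

(** For a single combination no product of averages is needed: the weight is a sum of terms 1 - cos,
    so the domination for F = 1 is summed over the scales 2^-i. The linear bound on the weight keeps
    the right side finite for jumps with a first but no second moment. The constant 16 is 8 from
    [integral_norm_le_dyadic] times 2. *)
Lemma mean_norm_le (l : seq (R * R)) (b : E -> R) : measurable_fun setT b ->
  (forall e, Num.min (lincomb l (kp e) ^+ 2) (4 * `|lincomb l (kp e)|) <= b e) ->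
  (\int[P]_w `|lincomb l (Wp w)|%:E <= 1%:E + 16%:E * \int[nu]_e (b e)%:E)%E.
Proof.
move=> mb hb.
have b0 e : 0 <= b e.
  by apply: le_trans (hb e); rewrite le_min sqr_ge0 mulr_ge0.
rewrite (_ : 16%:E * _ = 8%:E * (2%:E * \int[nu]_e (b e)%:E))%E; last first.
  by rewrite muleA -EFinM; congr (_%:E * _)%E; lra.
have mlW : measurable_fun setT (fun w => lincomb l (Wp w)) by exact: measurable_lincomb.
have mlk : measurable_fun setT (fun e => lincomb l (kp e)) by exact: measurable_lincomb.
apply: integral_norm_le_dyadic => //.
  by rewrite mule_ge0//; apply: integral_ge0 => e _; rewrite lee_fin.
move=> I.
apply: (@le_trans _ _ (2%:E * \int[nu]_e (dyadic_weight I (lincomb l (kp e)))%:E))%E; last first.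
  rewrite lee_pmul2l//; apply: ge0_le_integral => //=.
  - by move=> e _; rewrite lee_fin dyadic_weight_ge0.
  - by apply/measurable_EFinP; apply: measurableT_comp => //; exact: measurable_dyadic_weight.
  - exact/measurable_EFinP.
  move=> e _; rewrite lee_fin; apply: le_trans (hb e).
  by rewrite le_min dyadic_weight_le_sqr dyadic_weight_le_norm.
have sumE d (X : measurableType d) (m : {measure set X -> \bar R}) (g : X -> R) :
    measurable_fun setT g ->
    (\int[m]_x (dyadic_weight I (g x))%:E =
     \sum_(i < I.+1) (2 ^+ i)%:E * \int[m]_x (1 - cos (2 ^- i * g x))%:E)%E.
  move=> mg; under eq_integral do rewrite /dyadic_weight -sumEFin.
  have mi (i : 'I_I.+1) : measurable_fun setT (fun v => (1 - cos (2 ^- i * g v))%:E).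
    apply/measurable_EFinP; apply: measurable_funB => //.
    by apply: measurableT_comp; [exact: measurable_cos|apply: measurable_funM].
  rewrite ge0_integral_sum//;
    last by move=> i; under eq_fun do rewrite EFinM; apply: measurable_funeM.
  apply: eq_bigr => i _; under eq_integral do rewrite EFinM.
  by rewrite ge0_integralZl.
rewrite !sumE// ge0_sume_distrr; last first.
  by move=> i _; rewrite mule_ge0// integral_ge0// => e _; rewrite lee_fin onem_cos_ge0.
apply: lee_sum => i _; rewrite muleCA lee_pmul2l ?exprn_gt0//.
have := LK (scale_comb (2 ^- i) l).
under [X in (X <= _)%E -> _]eq_integral do rewrite mulr1 lincomb_scale.
by under [X in (_ <= _ * X)%E -> _]eq_integral do rewrite mulr1 lincomb_scale.
Qed.

End dyadic_product.

(** * Characteristic functions of stochastic integrals *)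

Lemma bounded_integrable d (T : measurableType d) (R : realType)
    (m : {finite_measure set T -> \bar R}) (f : T -> R) (M : R) :
  measurable_fun setT f -> (forall x, `|f x| <= M) ->
  m.-integrable setT (EFin \o f).
Proof.
move=> mf fM; apply: measurable_bounded_integrable => //.
  by rewrite ltey_eq fin_num_measure.
exists M; split; rewrite ?num_real// => N MN x _ /=.
exact: le_trans (fM x) (ltW MN).
Qed.

(** * Independence and sums of independent variables *)

Section independence.
Context d (T : measurableType d) (R : realType) (P : probability T R).
Implicit Types U V : T -> R.

Lemma cos_sin_bound (x : R) : (`|cos x| <= 1) * (`|sin x| <= 1).
Proof. by rewrite !ler_norml cos_geN1 cos_le1 sin_geN1 sin_le1. Qed.

(** The joint law is the product of the marginal laws, as both agree on rectangles; Fubini then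
    factors the integral. *)
Lemma independent_integralM U V (f g : R -> R) :
  measurable_fun setT U -> measurable_fun setT V ->
  (forall A B, measurable A -> measurable B ->
    P (U @^-1` A `&` V @^-1` B) = (P (U @^-1` A) * P (V @^-1` B))%E) ->
  measurable_fun setT f -> measurable_fun setT g ->
  (forall x, `|f x| <= 1) -> (forall x, `|g x| <= 1) ->
  \int[P]_w (f (U w) * g (V w)) = (\int[P]_w f (U w)) * (\int[P]_w g (V w)).
Proof.
move=> mU mV ind mf mg f1 g1.
pose Um : {mfun T >-> R} := HB.pack U (isMeasurableFun.Build _ _ _ _ U mU).
pose Vm : {mfun T >-> R} := HB.pack V (isMeasurableFun.Build _ _ _ _ V mV).
pose UV w := (U w, V w).
have mUV : measurable_fun setT UV by exact: measurable_fun_pair.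
pose UVm : {mfun T >-> (R * R)%type} :=
  HB.pack UV (isMeasurableFun.Build _ _ _ _ UV mUV).
pose lU := distribution P Um; pose lV := distribution P Vm.
pose lUV := distribution P UVm.
have eqm X : measurable X -> (lU \x lV)%E X = lUV X.
  apply: product_measure_unique => A B mA mB.
  by rewrite /lUV /lU /lV /distribution/= /pushforward -ind//.
have fg1 (q : R * R) : `|f q.1 * g q.2| <= 1 by rewrite normrM mulr_ile1.
have mfg : measurable_fun setT (fun q : R * R => f q.1 * g q.2).
  apply: measurable_funM.
    exact: (measurableT_comp mf measurable_fst).
  exact: (measurableT_comp mg measurable_snd).
have ifg : (lU \x lV)%E.-integrable setT (EFin \o (fun q : R * R => f q.1 * g q.2)).
  have /integrableP[mh h] := bounded_integrable lUV mfg fg1.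
  apply/integrableP; split => //; rewrite (eq_measure_integral lUV)//.
  by move=> A mA _; exact: eqm.
have iU := bounded_integrable lU mf f1.
have iV := bounded_integrable lV mg g1.
rewrite /Rintegral.
have -> : (\int[P]_w (f (U w) * g (V w))%:E = \int[lUV]_q (f q.1 * g q.2)%:E)%E.
  rewrite integral_distribution//.
  - exact/measurable_EFinP.
  - apply: (@bounded_integrable _ _ _ P (fun w => f (U w) * g (V w)) 1).
      exact: (measurableT_comp mfg mUV).
    by move=> w; exact: (fg1 (U w, V w)).
have -> : (\int[P]_w (f (U w))%:E = \int[lU]_x (f x)%:E)%E.
  rewrite integral_distribution//.
  - exact/measurable_EFinP.
  - apply: (@bounded_integrable _ _ _ P (fun w => f (U w)) 1) => //.
    exact: (measurableT_comp mf mU).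
have -> : (\int[P]_w (g (V w))%:E = \int[lV]_x (g x)%:E)%E.
  rewrite integral_distribution//.
  - exact/measurable_EFinP.
  - apply: (@bounded_integrable _ _ _ P (fun w => g (V w)) 1) => //.
    exact: (measurableT_comp mg mV).
rewrite (eq_measure_integral (lU \x lV)%E); last by move=> A mA _; apply/esym; exact: eqm.
rewrite -(integral12_prod_meas1 ifg)/=.
under eq_integral do rewrite /fubini_F/=.
rewrite -fineM; [|exact: integrable_fin_num..].
congr fine.
transitivity (\int[lU]_x ((f x)%:E * \int[lV]_y (g y)%:E))%E.
  apply: eq_integral => x _; rewrite -integralZl//.
rewrite -[X in (_ = _ * X)%E]fineK; last exact: integrable_fin_num.
by rewrite -integralZr// fineK//; exact: integrable_fin_num.
Qed.

(* [Y] has characteristic function exp (al + i be) at 1. *)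
Definition has_char Y (al be : R) : Prop :=
  \int[P]_w cos (Y w) = expR al * cos be /\ \int[P]_w sin (Y w) = expR al * sin be.

Lemma has_charD U V au bu av bv :
  measurable_fun setT U -> measurable_fun setT V ->
  (forall A B, measurable A -> measurable B ->
    P (U @^-1` A `&` V @^-1` B) = (P (U @^-1` A) * P (V @^-1` B))%E) ->
  has_char U au bu -> has_char V av bv ->
  has_char (fun w => U w + V w) (au + av) (bu + bv).
Proof.
move=> mU mV ind [cU sU] [cV sV].
have mc (Y : T -> R) : measurable_fun setT Y -> measurable_fun setT (fun w => cos (Y w)).
  by move=> mY; apply: (measurableT_comp _ mY); exact: measurable_cos.
have ms (Y : T -> R) : measurable_fun setT Y -> measurable_fun setT (fun w => sin (Y w)).
  by move=> mY; apply: (measurableT_comp _ mY); exact: measurable_sin.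
have ii (f g : T -> R) : measurable_fun setT f -> measurable_fun setT g ->
    (forall x, `|f x| <= 1) -> (forall x, `|g x| <= 1) ->
    P.-integrable setT (EFin \o (fun w => f w * g w)).
  move=> mf mg f1 g1; apply: (@bounded_integrable _ _ _ _ _ 1).
    exact: measurable_funM.
  by move=> w; rewrite normrM mulr_ile1.
have b1 (Y : T -> R) w : `|cos (Y w : R)| <= 1 by rewrite cos_sin_bound.
have b2 (Y : T -> R) w : `|sin (Y w : R)| <= 1 by rewrite cos_sin_bound.
have bc (x : R) : `|cos x| <= 1 by rewrite cos_sin_bound.
have bs (x : R) : `|sin x| <= 1 by rewrite cos_sin_bound.
have mcos := @measurable_cos R setT; have msin := @measurable_sin R setT.
split.
  under eq_Rintegral do rewrite cosD.
  rewrite RintegralB//; do ?[by apply: ii; [exact: mc|exact: mc|exact: b1|exact: b1] |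
     by apply: ii; [exact: ms|exact: ms|exact: b2|exact: b2]].
  by rewrite !independent_integralM// cU cV sU sV expRD cosD; ring.
under eq_Rintegral do rewrite sinD.
rewrite RintegralD//; do ?[by apply: ii; [exact: mc|exact: ms|exact: b1|exact: b2] |
     by apply: ii; [exact: ms|exact: mc|exact: b2|exact: b1]].
by rewrite !independent_integralM// cU cV sU sV expRD sinD; ring.
Qed.

(** For fixed [E] both sides are finite measures in [C]. On rectangles both equal the product of a
    multiple of the law of [U] with the law of [V], and uniqueness of product measures extends the
    equality. *)
Lemma independent_event_prod U V (E : set T) : measurable E ->
  measurable_fun setT U -> measurable_fun setT V ->
  (forall A B, measurable A -> measurable B ->
    P (U @^-1` A `&` V @^-1` B) = (P (U @^-1` A) * P (V @^-1` B))%E) ->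
  (forall A B, measurable A -> measurable B ->
    P ((U @^-1` A `&` V @^-1` B) `&` E) = (P (U @^-1` A) * P (V @^-1` B) * P E)%E) ->
  forall C, measurable C ->
  P ((fun w => (U w, V w)) @^-1` C `&` E) = (P ((fun w => (U w, V w)) @^-1` C) * P E)%E.
Proof.
move=> mE mU mV ind indE C mC.
pose Um : {mfun T >-> R} := HB.pack U (isMeasurableFun.Build _ _ _ _ U mU).
pose Vm : {mfun T >-> R} := HB.pack V (isMeasurableFun.Build _ _ _ _ V mV).
pose UV w := (U w, V w).
have mUV : measurable_fun setT UV by exact: measurable_fun_pair.
pose UVm : {mfun T >-> (R * R)%type} :=
  HB.pack UV (isMeasurableFun.Build _ _ _ _ UV mUV).
pose lU := distribution P Um; pose lV := distribution P Vm.
pose lUV := distribution P UVm.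
have pE0 : 0 <= fine (P E) by exact: fine_ge0.
pose k : {nonneg R} := NngNum pE0.
have kE : k%:num%:E = P E by rewrite /= fineK// fin_num_measure.
pose lE := pushforward (mrestr P mE) UVm.
have h1 : (mscale k lU \x lV)%E C = mscale k lUV C.
  apply: product_measure_unique => // A B mA mB.
  by rewrite /mscale/= /lUV /lU /lV /distribution/= /pushforward -muleA -ind.
have h2 : (mscale k lU \x lV)%E C = lE C.
  apply: product_measure_unique => // A B mA mB.
  transitivity (P ((U @^-1` A `&` V @^-1` B) `&` E)); first by [].
  transitivity (k%:num%:E * P (U @^-1` A) * P (V @^-1` B))%E; last by [].
  by rewrite indE// kE muleC muleA.
have := h2; rewrite h1 /lE /pushforward /mrestr => <-.
by rewrite /mscale kE muleC.
Qed.

(** Keeping a joint event of the variables of index at least k makes the induction work: [Y k] moves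
    from that event into the sum, since the pair formed by the previous sum and [Y k] is independent
    of the remaining event by [independent_event_prod]. *)
Lemma mutually_independent_sum (Y : nat -> T -> R) (c : nat -> R) :
  mutually_independent P Y -> (forall i, measurable_fun setT (Y i)) ->
  forall k (J : {fset nat}) (A : set R) (B : nat -> set R),
  (forall i, i \in J -> (k <= i)%N) -> measurable A -> (forall i, measurable (B i)) ->
  P ((fun w => \sum_(i < k) c i * Y i w) @^-1` A `&` \bigcap_(i in [set` J]) (Y i @^-1` B i)) =
  (P ((fun w => (\sum_(i < k) c i * Y i w)%R) @^-1` A) *
   P (\bigcap_(i in [set` J]) (Y i @^-1` B i)))%E.
Proof.
move=> ind mY.
have mcap (J : {fset nat}) (B : nat -> set R) : (forall i, measurable (B i)) ->
    measurable (\bigcap_(i in [set` J]) (Y i @^-1` B i)).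
  move=> mB; apply: bigcap_measurableType => i _.
  by rewrite -[X in measurable X]setTI; apply: mY.
elim=> [|k ih] J A B kJ mA mB.
  have [A0|A0] := pselect (A 0).
    rewrite (_ : _ @^-1` A = setT) ?setTI ?probability_setT ?mul1e//.
    by apply/seteqP; split => // w _ /=; rewrite big_ord0.
  rewrite (_ : _ @^-1` A = set0) ?set0I ?measure0 ?mul0e//.
  by apply/seteqP; split => // w /=; rewrite big_ord0.
pose S w := \sum_(i < k) c i * Y i w.
have mS : measurable_fun setT S.
  by apply: measurable_sum => i; apply: measurable_funM.
pose E := \bigcap_(i in [set` J]) (Y i @^-1` B i).
have kNJ : k \notin J by apply/negP => /kJ; rewrite ltnn.
have one (B1 : set R) : measurable B1 -> Y k @^-1` B1 =
   \bigcap_(i in [set` [fset k]%fset]) (Y i @^-1` B1).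
  move=> _; apply/seteqP; split => [w Yw i /=|w /(_ k) h]; last by apply: h; rewrite /= inE.
  by rewrite inE => /eqP ->.
have indSY A1 B1 : measurable A1 -> measurable B1 ->
    P (S @^-1` A1 `&` Y k @^-1` B1) = (P (S @^-1` A1) * P (Y k @^-1` B1))%E.
  move=> mA1 mB1; rewrite one//; apply: ih => // i.
  by rewrite inE => /eqP ->.
pose B' B1 i := if i == k then B1 else B i.
have BkE B1 : Y k @^-1` B1 `&` E = \bigcap_(i in [set` (k |` J)%fset]) (Y i @^-1` B' B1 i).
  apply/seteqP; split => [w [Yw Ew] i /=|w h].
    rewrite !inE /B' => /orP[/eqP->|iJ]; first by rewrite eqxx.
    by case: eqP => [->//|_]; exact: Ew.
  split; first by have := h k; rewrite /= !inE eqxx/= /B' eqxx; exact.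
  move=> i /= iJ; have := h i; rewrite /= !inE iJ orbT /B' => /(_ isT).
  by case: eqP iJ => // ->; rewrite (negPf kNJ).
have mB' B1 i : measurable B1 -> measurable (B' B1 i) by rewrite /B'; case: ifP.
have indYE B1 : measurable B1 -> P (Y k @^-1` B1 `&` E) = (P (Y k @^-1` B1) * P E)%E.
  move=> mB1; rewrite BkE ind; last by move=> i; exact: mB'.
  rewrite big_fsetU1//= /B' eqxx ind//; congr (_ * _)%E.
  rewrite big_seq [RHS]big_seq; apply: eq_bigr => i iJ.
  by case: eqP iJ => // ->; rewrite (negPf kNJ).
have indSYE A1 B1 : measurable A1 -> measurable B1 ->
    P ((S @^-1` A1 `&` Y k @^-1` B1) `&` E) = (P (S @^-1` A1) * P (Y k @^-1` B1) * P E)%E.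
  move=> mA1 mB1; rewrite -setIA BkE ih//; last 2 first.
  - by move=> i; rewrite !inE => /orP[/eqP->//|/kJ/ltnW].
  - by move=> i; exact: mB'.
  by rewrite -BkE indYE// muleA.
pose C := [set q : R * R | A (q.1 + c k * q.2)].
have mC : measurable C.
  have mf : measurable_fun setT (fun q : R * R =>
      (q.1 + c k * q.2 : R)).
    apply: measurable_funD; first exact: measurable_fst.
    by apply: measurable_funM => //; exact: measurable_snd.
  by rewrite -[C]setTI; exact: mf.
have := independent_event_prod (mcap J B mB) mS (mY k) indSY indSYE mC.
rewrite (_ : _ @^-1` C = (fun w => \sum_(i < k.+1) c i * Y i w) @^-1` A)//.
by apply/seteqP; split => w; rewrite /= big_ord_recr.
Qed.

Lemma has_char_sum (Y : nat -> T -> R) (c : nat -> R) (al be : nat -> R) :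
  mutually_independent P Y -> (forall i, measurable_fun setT (Y i)) ->
  (forall i, has_char (fun w => c i * Y i w) (al i) (be i)) ->
  forall k, has_char (fun w => \sum_(i < k) c i * Y i w)
    (\sum_(i < k) al i) (\sum_(i < k) be i).
Proof.
move=> ind mY hY; elim=> [|k ih].
  rewrite /has_char; under eq_Rintegral do rewrite big_ord0 cos0.
  under [in X in _ /\ X]eq_Rintegral do rewrite big_ord0 sin0.
  have P1 : fine (P setT) = 1 by rewrite probability_setT.
  by rewrite !big_ord0 expR0 cos0 sin0 !Rintegral_cst// P1; split; rewrite ?mulr1 ?mulr0.
rewrite !big_ord_recr/=.
have -> : (fun w => \sum_(i < k.+1) c i * Y i w) =
    (fun w => \sum_(i < k) c i * Y i w + c k * Y k w).
  by apply/funext => w; rewrite big_ord_recr.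
apply: has_charD => //.
- by apply: measurable_sum => i; apply: measurable_funM.
- by apply: measurable_funM.
move=> A B mA mB.
have mB' : measurable ((fun x => c k * x) @^-1` B).
  by rewrite -[X in measurable X]setTI; exact: mulrl_measurable.
have E1 : (fun w => c k * Y k w) @^-1` B =
   \bigcap_(i in [set` [fset k]%fset]) (Y i @^-1` ((fun x => c k * x) @^-1` B)).
  apply/seteqP; split => [w Yw i /=|w /(_ k) h]; last by apply: h; rewrite /= inE.
  by rewrite inE => /eqP ->.
rewrite E1.
apply: (@mutually_independent_sum Y c ind mY k [fset k]%fset A
  (fun=> (fun x => c k * x) @^-1` B)) => // i.
by rewrite inE => /eqP ->.
Qed.

End independence.

(** A quadratic bound is enough, because compensated small jumps are measured by min (1, z^2). Below
    2 it follows from sin x = x cos z and 1 - cos z <= z^2 / 2. *)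
Lemma normr_sin_sub_le (R : realType) (x : R) : `|sin x - x| <= x ^+ 2.
Proof.
wlog x0 : x / 0 <= x.
  move=> h; have [/h//|x0] := leP 0 x.
  rewrite -(sqrrN x) -normrN opprB -[x in x - _]opprK addrC -sinN.
  by apply: h; lra.
rewrite ler_norml; have := normr_sin_le x; rewrite (ger0_norm x0) => h.
have [x1|x1] := leP 2 x.
  have := sin_geN1 x; have := ler_norm (sin x); rewrite expr2; nra.
have [->|xn0] := eqVneq x 0; first by rewrite sin0; lra.
have xgt0 : 0 < x by rewrite lt_neqAle eq_sym xn0.
have [z zin zE] : exists2 z, z \in `]0, x[%R & sin x - sin 0 = cos z * (x - 0).
  by apply: (MVT _ (fun y _ => is_derive_sin y)) => //; apply: continuous_subspaceT => y; apply: continuous_sin.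
move: zE; rewrite sin0 !subr0 => ->.
have := onem_cos_le_sqr z; have := cos_le1 z; move: zin; rewrite in_itv/= => /andP[z0 zx].
have : z ^+ 2 <= x ^+ 2 by rewrite !expr2; nra.
rewrite !expr2; nra.
Qed.

Lemma measurable_unit_ball (R : realType) :
  measurable ([set z | `|z| <= 1] : set (measurableTypeR R)).
Proof.
rewrite (_ : [set z | _] = `[-1, 1]%classic); first exact: measurable_itv.
by apply/seteqP; split => z; rewrite /= ler_norml in_itv/=.
Qed.

(** * The Levy exponent in real coordinates *)

Section levy_rate.
Context {R : realType}.
Variables (a : R) (lam : {measure set (measurableTypeR R) -> \bar R}).

(** Real and imaginary parts of the Levy exponent without Gaussian part ([levy_exponentE]), kept
    apart because all limits below are taken on real integrals. *)
Definition rate_re (th : R) : R := - \int[lam]_z (1 - cos (th * z)).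
Definition rate_im (th : R) : R :=
  th * a + \int[lam]_z (sin (th * z) - th * z * (`|z| <= 1)%R%:R).

Lemma rate0 : (rate_re 0 = 0) * (rate_im 0 = 0).
Proof.
rewrite /rate_re /rate_im mul0r add0r; split.
  under eq_Rintegral do rewrite mul0r cos0 subrr.
  by rewrite Rintegral_cst// mul0r oppr0.
under eq_Rintegral do rewrite !mul0r sin0 subrr.
by rewrite Rintegral_cst// mul0r.
Qed.

Hypothesis lam_levy : is_levy_measure lam.

Let minz (z : measurableTypeR R) : R := Num.min 1 (z ^+ 2).

Lemma integrable_levy_min : lam.-integrable setT (EFin \o minz).
Proof.
apply/integrableP; split.
  by apply/measurable_EFinP; apply: measurable_minr => //; exact: measurable_funX.
have [_] := lam_levy; apply: le_lt_trans; rewrite le_eqVlt; apply/orP; left; apply/eqP.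
apply: eq_integral => z _; rewrite /= ger0_norm// le_min ler01/= sqr_ge0//.
Qed.

Lemma min_sqr_scale (c : R) (z : R) : 0 <= c ->
  Num.min 1 (c * z ^+ 2) <= (1 + c) * Num.min 1 (z ^+ 2).
Proof.
move=> c0; have z0 := sqr_ge0 z.
have [h1|h1] := leP 1 (z ^+ 2); first by rewrite mulr1 ge_min lerDl c0.
by rewrite ge_min; apply/orP; right; nra.
Qed.

Lemma onem_cos_min (x : R) : 1 - cos x <= 2 * Num.min 1 (x ^+ 2).
Proof.
have := onem_cos_le2 x; have := onem_cos_le_sqr x; have := sqr_ge0 x.
by case: (leP 1 (x ^+ 2)) => ? ? ? ?; lra.
Qed.

Lemma sin_sub_min (th z : R) :
  `|sin (th * z) - th * z * (`|z| <= 1)%R%:R| <= (1 + th ^+ 2) * Num.min 1 (z ^+ 2).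
Proof.
have th2 := sqr_ge0 th; have [z1|z1] := leP `|z| 1.
  rewrite mulr1 (le_trans (normr_sin_sub_le _))// exprMn.
  have : z ^+ 2 <= 1 by rewrite -real_normK ?num_real// exprn_ile1.
  by move=> /min_idPr ->; have := sqr_ge0 z; nra.
rewrite mulr0 subr0 (le_trans (_ : _ <= 1)) ?cos_sin_bound//.
have : 1 <= z ^+ 2 by rewrite -real_normK ?num_real// exprn_ege1// ltW.
by move=> /min_idPl ->; lra.
Qed.

Lemma measurable_rate_re_integrand th :
  measurable_fun setT (fun z : measurableTypeR R => 1 - cos (th * z)).
Proof.
apply: measurable_funB => //; apply: measurableT_comp; first exact: measurable_cos.
by apply: measurable_funM.
Qed.

Lemma measurable_rate_im_integrand th :
  measurable_fun setT (fun z : measurableTypeR R => sin (th * z) - th * z * (`|z| <= 1)%R%:R).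
Proof.
apply: measurable_funB.
  apply: measurableT_comp; first exact: measurable_sin.
  by apply: measurable_funM.
apply: measurable_funM; first exact: measurable_funM.
have -> : (fun z : measurableTypeR R => (`|z| <= 1)%R%:R : R) = \1_[set z | `|z| <= 1].
  by apply/funext => z; rewrite indicE; congr (_%:R); apply/esym; rewrite mem_setE.
by apply: measurable_indic; exact: measurable_unit_ball.
Qed.

Lemma integrable_rate_re th :
  lam.-integrable setT (EFin \o (fun z => 1 - cos (th * z))).
Proof.
apply: (@le_integrable _ _ _ lam setT measurableT _
   (EFin \o (fun z => 2 * (1 + th ^+ 2) * minz z))).
- by apply/measurable_EFinP; exact: measurable_rate_re_integrand.
- move=> z _; rewrite lee_fin ger0_norm ?onem_cos_ge0//.
  rewrite ger0_norm; last by rewrite !mulr_ge0 ?addr_ge0 ?sqr_ge0 ?le_min ?ler01 ?sqr_ge0.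
  rewrite (le_trans (onem_cos_min _))// -mulrA ler_pM2l// exprMn.
  exact: min_sqr_scale (sqr_ge0 _).
- exact: integrableZl integrable_levy_min.
Qed.

Lemma integrable_rate_im th :
  lam.-integrable setT (EFin \o (fun z => sin (th * z) - th * z * (`|z| <= 1)%R%:R)).
Proof.
apply: (@le_integrable _ _ _ lam setT measurableT _
   (EFin \o (fun z => (1 + th ^+ 2) * minz z))).
- by apply/measurable_EFinP; exact: measurable_rate_im_integrand.
- move=> z _; rewrite lee_fin (le_trans (sin_sub_min _ _))//.
  exact: ler_norm.
- exact: integrableZl integrable_levy_min.
Qed.

Lemma levy_exponentE th :
  levy_exponent a 0 lam th = Complex (rate_re th) (rate_im th).
Proof.
rewrite /levy_exponent /cintegral mulr0.
have -> : \int[lam]_x complex.Re (cexp (Complex 0 (th * x)) - 1 - Complex 0 (th * x * (`|x| <= 1)%R%:R))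
   = rate_re th.
  rewrite /rate_re -[RHS]mulN1r -RintegralZl//; last exact: integrable_rate_re.
  apply: eq_Rintegral => z _; rewrite /cexp/= expR0; simpc => /=; lra.
have -> : \int[lam]_x complex.Im (cexp (Complex 0 (th * x)) - 1 - Complex 0 (th * x * (`|x| <= 1)%R%:R))
   = rate_im th - th * a.
  rewrite /rate_im addrC addKr.
  apply: eq_Rintegral => z _; rewrite /cexp/= expR0; simpc => /=; lra.
by simpc; congr Complex; lra.
Qed.

End levy_rate.

Lemma integrable_indic_lty d (T : measurableType d) (R : realType)
    (m : {measure set T -> \bar R}) (A : set T) :
  measurable A -> (m A < +oo)%E -> m.-integrable setT (EFin \o \1_A).
Proof.
move=> mA fA; apply/integrableP; split.
  by apply/measurable_EFinP; exact: measurable_indic.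
under eq_integral do rewrite /= ger0_norm//.
by rewrite integral_indic// setIT.
Qed.

(** * Characteristic functions of integrals of step functions *)

Section levy_basis.
Context (R : realType) (d : measure_display) (T : measurableType d).
Variables (P : probability T R) (a : R).
Variables (lam mu : {measure set (measurableTypeR R) -> \bar R}).
Variable Lam : set (plane R) -> T -> R.
Hypotheses (lam_levy : is_levy_measure lam)
  (Lam_basis : is_levy_basis P a 0 lam mu Lam) (mu_fin : (mu setT < +oo)%E).
Local Notation m := (mu \x @lebesgue_measure R)%E.

Lemma bounded_borel0 : bounded_borel (set0 : set (plane R)).
Proof. by split => //; exists 0; split => // M _ x []. Qed.

Lemma bounded_borelS (A B : set (plane R)) : measurable A -> A `<=` B ->
  bounded_borel B -> bounded_borel A.
Proof.
move=> mA AB [mB Bh bB]; split => //; first exact: subset_trans Bh.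
case: bB => M [rM hM]; exists M; split => // N MN x /AB; exact: hM.
Qed.

Lemma bounded_borel_fin A : bounded_borel A -> (m A < +oo)%E.
Proof.
move=> [mA _ [M [_ hM]]].
have {}hM := hM (`|M| + 1) _.
apply: (@le_lt_trans _ _ (m (setT `*` `[-(`|M| + 1), `|M| + 1]))).
  apply: le_measure; rewrite ?inE//; first exact: measurableX.
  move=> p Ap; split => //=.
  have : `|(p : R * R)| <= `|M| + 1 by apply: hM => //; rewrite ltr_pwDr// ler_norm.
  rewrite prod_normE/= ge_max => /andP[_]; rewrite ler_norml in_itv/=; exact.
rewrite product_measure1E// lte_mul_pinfty//.
  by rewrite ge0_fin_numE.
have h := lebesgue_measure_itv `[-(`|M| + 1), `|M| + 1].
apply: (@le_lt_trans _ _ _ _ _ (_ : _ <= _)%E (_ : _ < _)%E).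
  by rewrite le_eqVlt; apply/orP; left; apply/eqP; exact: h.
by rewrite /=; case: ifPn => _; rewrite ?ltry// -EFinB ltry.
Qed.

Lemma Lam_char A th : bounded_borel A ->
  has_char P (fun w => th * Lam A w)
    (fine (m A) * rate_re lam th) (fine (m A) * rate_im a lam th).
Proof.
move=> bA; have := levy_basis_charfun Lam_basis th bA.
rewrite levy_exponentE// /charfun /cintegral.
set M := fine (m A); rewrite /cexp; simpc => /=.
under [X in Complex X _]eq_Rintegral do rewrite expR0; simpc.
move=> [hc hs]; split.
  by rewrite -[RHS]hc; apply: eq_Rintegral => w _; rewrite ?expR0; ring.
by rewrite -[RHS]hs; apply: eq_Rintegral => w _; rewrite ?expR0; ring.
Qed.

(** Additivity for the constant sequence of empty sets says that the multiples n * Lam set0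
    converge, which forces the common increment to vanish. *)
Lemma Lam_set0 : {ae P, forall w, Lam set0 w = 0}.
Proof.
have h := @levy_basis_additive _ _ _ _ _ _ _ _ _ Lam_basis (fun=> set0) (fun=> bounded_borel0).
have {h} : {ae P, forall w, (\sum_(i < n) Lam set0 w) @[n --> \oo] --> Lam (\bigcup_(i : nat) set0) w}.
  apply: h.
    by apply/trivIsetP => i j _ _ _; rewrite set0I.
  by rewrite bigcup0//; exact: bounded_borel0.
rewrite bigcup0//; apply: filterS => w h.
have h1 : (\sum_(i < n.+1) Lam set0 w) @[n --> \oo] --> Lam set0 w.
  by rewrite (cvg_shiftS (fun n => \sum_(i < n) Lam set0 w)).
have := cvgB h1 h; rewrite subrr.
have e n : \sum_(i < n.+1) Lam set0 w - \sum_(i < n) Lam set0 w = Lam set0 w.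
  by rewrite big_ord_recr/= addrAC subrr add0r.
rewrite (_ : _ - _ = cst (Lam set0 w)); last by apply/funext => n; exact: e.
move=> hc; have {}hc : cst (Lam set0 w) x @[x --> \oo] --> 0 by apply: hc.
by rewrite -(cvg_lim _ hc)// lim_cst.
Qed.

Lemma has_char_ae (U V : T -> R) al be :
  measurable_fun setT U -> measurable_fun setT V ->
  {ae P, forall w, U w = V w} -> has_char P U al be -> has_char P V al be.
Proof.
move=> mU mV UV [hc hs].
rewrite /has_char -hc -hs; split; congr fine; apply: ae_eq_integral => //=.
- by apply/measurable_EFinP; apply: measurableT_comp => //; exact: measurable_cos.
- by apply/measurable_EFinP; apply: measurableT_comp => //; exact: measurable_cos.
- by apply: filterS UV => w -> _.
- by apply/measurable_EFinP; apply: measurableT_comp => //; exact: measurable_sin.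
- by apply/measurable_EFinP; apply: measurableT_comp => //; exact: measurable_sin.
- by apply: filterS UV => w -> _.
Qed.

Section finite_family.
Variables (I : finType) (c : I -> R) (B : I -> set (plane R)).
Hypothesis bB : forall i, bounded_borel (B i).

Let F := {ffun I -> bool}.
(** Atoms of the family [B], indexed by membership patterns. The points outside every [B i] are
    excluded, as they do not form a bounded set. [A] lists the atoms as a sequence padded with empty
    sets, the form in which the axioms of the basis are stated. *)
Let C (J : F) : set (plane R) :=
  [set p | (exists i, B i p) /\ forall i, (p \in B i) = J i].
Let A (k : nat) : set (plane R) :=
  if insub k is Some k' then C (enum_val (k' : 'I_#|F|)) else set0.
Let mem (k : nat) (i : I) : bool :=
  if insub k is Some k' then enum_val (k' : 'I_#|F|) i else false.

Let C_sub (J : F) (i : I) : J i -> C J `<=` B i.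
Proof. by move=> Ji p [_ /(_ i)]; rewrite Ji => h; exact: set_mem h. Qed.

Let bC J : bounded_borel (C J).
Proof.
have mC : measurable (C J).
  rewrite (_ : C J = (\bigcup_i B i) `&` \bigcap_i (if J i then B i else ~` B i)).
    apply: measurableI.
      apply: fin_bigcup_measurable => // i _; by case: (bB i).
    apply: fin_bigcap_measurable; first exact: finite_finset.
    by move=> i _; case: ifP => _; last apply: measurableC; case: (bB i).
  apply/seteqP; split => [p [[i Bi] h]|p [[i _ Bi] h]].
    split; first by exists i.
    move=> j _; rewrite -h; case: ifPn => [|/negP]; first exact: set_mem.
    by move=> nB Bj; apply: nB; exact: mem_set.
  split; first by exists i.
  move=> j; have := h j Logic.I; case: ifP => Jj; first by move=> /mem_set.
  by move=> nB; apply/negbTE/negP => /set_mem.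
have [[i Ji]|nJ] := pselect (exists i, J i).
  exact: bounded_borelS mC (C_sub Ji) (bB i).
rewrite (_ : C J = set0); first exact: bounded_borel0.
apply/seteqP; split => // p [[i Bi] h]; apply: nJ; exists i.
by rewrite -h mem_set.
Qed.

Let bA k : bounded_borel (A k).
Proof. by rewrite /A; case: insubP => [k' _ _|_]; [exact: bC|exact: bounded_borel0]. Qed.

Let tA : trivIset setT A.
Proof.
move=> k1 k2 _ _; rewrite /A; case: insubP => [k1' _ <-|_]; last by case=> p [].
case: insubP => [k2' _ <-|_]; last by case=> p [].
move=> [p [[_ h1] [_ h2]]]; congr (val _); apply: enum_val_inj.
by apply/ffunP => i; rewrite -h1 h2.
Qed.

Let B_part i : B i = \bigcup_k (if mem k i then A k else set0).
Proof.
apply/seteqP; split => [p Bp|p [k _]].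
  pose J : F := [ffun i => p \in B i].
  exists (enum_rank J) => //; rewrite /mem /A valK enum_rankK ffunE mem_set//.
  by split; [exists i|move=> j; rewrite ffunE].
rewrite /mem /A; case: insubP => [k' _ _|_]; last by [].
by case: ifP => // /C_sub; exact.
Qed.

Lemma Lam_partition : {ae P, forall w, forall i,
  Lam (B i) w = \sum_(k < #|F|) (mem k i)%:R * Lam (A k) w}.
Proof.
suff h i : {ae P, forall w, Lam (B i) w = \sum_(k < #|F|) (mem k i)%:R * Lam (A k) w}.
  (* Almost sure statements are intersected over natural numbers, so the finite index i is replaced
     by its rank. *)
  have : forall n, {ae P, forall w, forall i : I, enum_rank i = n :> nat ->
      Lam (B i) w = \sum_(k < #|F|) (mem k i)%:R * Lam (A k) w}.
    move=> n; have [nM|nM] := ltnP n #|I|.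
      apply: filterS (h (enum_val (Ordinal nM))) => w hw i iE.
      have -> // : i = enum_val (Ordinal nM).
      by rewrite -[i in LHS]enum_rankK; congr enum_val; exact: val_inj.
    by apply: aeW => w i iE; move: nM; rewrite -iE leqNgt ltn_ord.
  by move=> /ae_foralln; apply: filterS => w hw i; exact: (hw (enum_rank i)).
pose A' k := if mem k i then A k else set0.
have bA' k : bounded_borel (A' k).
  by rewrite /A'; case: ifP => _; [exact: bA|exact: bounded_borel0].
have tA' : trivIset setT A'.
  move=> k1 k2 _ _; rewrite /A'; case: ifP => _; last by case=> p [].
  by case: ifP => _; [exact: tA|case=> p []].
have := @levy_basis_additive _ _ _ _ _ _ _ _ _ Lam_basis A' bA' tA'.
rewrite -B_part => /(_ (bB i)) hA'.
apply: filterS2 hA' Lam_set0 => w h h0.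
(* Beyond [#|F|] all sets are empty, so the partial sums are constant and equal to the announced
   limit. *)
have E n : \sum_(k < n + #|F|) Lam (A' k) w = \sum_(k < #|F|) (mem k i)%:R * Lam (A k) w.
  rewrite addnC big_split_ord/= [X in _ + X]big1 ?addr0.
    by apply: eq_bigr => k _; rewrite /A'; case: ifP; rewrite ?mul1r ?mul0r.
  move=> k _; rewrite /A' /A; case: ifP => // _.
  by case: insubP => [k' /=|//]; rewrite ltnNge leq_addr.
move: h; rewrite -(cvg_shiftn #|F|).
rewrite [X in X @ _ --> _](_ : _ = cst (\sum_(k < #|F|) (mem k i)%:R * Lam (A k) w)); last first.
  by apply/funext => n; rewrite /= E.
by move=> /cvg_lim <-//; rewrite lim_cst.
Qed.

(** On atoms the combination has constant coefficients [c'], so it becomes a sum of independent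
    variables. As the rates vanish at 0, the plane integral of the rate of a step function is the
    sum of its values on the atoms times their measures. *)
Lemma Lam_char_family : has_char P (fun w => \sum_i c i * Lam (B i) w)
  (\int[m]_p rate_re lam (\sum_i c i * \1_(B i) p))
  (\int[m]_p rate_im a lam (\sum_i c i * \1_(B i) p)).
Proof.
pose c' k := \sum_i c i * (mem k i)%:R.
have mL k : measurable_fun setT (Lam (A k)) by exact: (levy_basis_measurable Lam_basis).
have step (r : R -> R) : r 0 = 0 ->
    \int[m]_p r (\sum_i c i * \1_(B i) p) = \sum_(k < #|F|) fine (m (A k)) * r (c' k).
  move=> r0.
  have -> : (fun p => r (\sum_i c i * \1_(B i) p)) = (fun p => \sum_(k < #|F|) r (c' k) * \1_(A k) p).
    apply/funext => p.
    have [[i Bi]|nB] := pselect (exists i, B i p).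
      pose J : F := [ffun i => p \in B i].
      have AJ : A (enum_rank J) p.
        rewrite /A valK enum_rankK; split; first by exists i.
        by move=> j; rewrite ffunE.
      rewrite [RHS](bigD1 (enum_rank J))//= indicE mem_set// mulr1 [X in _ + X]big1 ?addr0.
        congr (r _); apply: eq_bigr => j _; congr (_ * _%:R).
        by rewrite /mem valK enum_rankK ffunE.
      move=> k kJ; rewrite indicE memNset ?mulr0// => Ak.
      move/eqP: kJ; apply; apply: val_inj; apply: tA => //.
      by exists p.
    rewrite big1 ?r0 => [|i _]; last by rewrite indicE memNset ?mulr0// => Bi; apply: nB; exists i.
    rewrite big1// => k _; rewrite indicE memNset ?mulr0//.
    rewrite /A; case: insubP => [k' _ _ [[i Bi] _]|_ []]; by apply: nB; exists i.
  rewrite /Rintegral; under eq_integral do rewrite -sumEFin.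
  have iA (k : 'I_#|F|) : m.-integrable setT (fun p => (r (c' k) * \1_(A k) p)%:E).
    under eq_fun do rewrite EFinM; apply: integrableZl => //.
    have [mA _ _] := bA k; apply: integrable_indic_lty => //; exact: bounded_borel_fin.
  transitivity (fine (\sum_(k < #|F|) (fine (m (A k)) * r (c' k))%:E)%E); last by rewrite sumEFin.
  congr fine; rewrite integral_sum//.
  apply: eq_bigr => k _; under eq_integral do rewrite EFinM.
  have [mA _ _] := bA k.
  have fA : (m (A k) < +oo)%E by exact: bounded_borel_fin.
  rewrite integralZl//; last by apply: integrable_indic_lty.
  by rewrite integral_indic// setIT EFinM fineK ?ge0_fin_numE// muleC.
rewrite !step ?rate0//.
have h := has_char_sum (levy_basis_independent Lam_basis bA tA) mL
  (fun k => Lam_char (c' k) (bA k)) #|F|.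
apply: has_char_ae h.
- by apply: measurable_sum => k; apply: measurable_funM.
- apply: measurable_sum => i; apply: measurable_funM => //.
  exact: (levy_basis_measurable Lam_basis).
apply: filterS Lam_partition => w hw.
under [RHS]eq_bigr do rewrite hw mulr_sumr.
rewrite exchange_big/=; apply: eq_bigr => k _.
by rewrite mulr_suml; apply: eq_bigr => i _; rewrite mulrA.
Qed.

End finite_family.

End levy_basis.

Lemma cvg_subseq_ge (T : topologicalType) (u : nat -> T) (f : nat -> nat) (l : T) :
  (forall k, (k <= f k)%N) -> u @ \oo --> l -> (u \o f) @ \oo --> l.
Proof.
move=> hf hu; suff hoo : f @ \oo --> \oo by exact: (cvg_comp _ _ hoo hu).
by move=> A [N _ hN]; exists N => // k Nk; apply: hN => /=; exact: leq_trans (hf k).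
Qed.

(** * Gliding hump *)

Section gliding_hump.
Context d (X : measurableType d) (R : realType).
Variables (al be V : nat -> set X -> R) (D : set X) (E : nat -> set X).
Hypotheses (mD : measurable D) (mE : forall j, measurable (E j))
  (ED : forall j, E j `<=` D) (ndE : nondecreasing_seq E).
Hypotheses
  (alU : forall n A, measurable A -> A `<=` D -> al n D = al n A + al n (D `\` A))
  (beU : forall n A, measurable A -> A `<=` D -> be n D = be n A + be n (D `\` A))
  (alV : forall n A, measurable A -> A `<=` D -> `|al n A| <= V n A)
  (beV : forall n A, measurable A -> A `<=` D -> `|be n A| <= V n A)
  (VU : forall n A B C, measurable A -> measurable B -> measurable C ->
     A `<=` D -> B `<=` D -> C `<=` A `|` B -> V n C <= V n A + V n B)
  (Vn : forall j, V n (E j) @[n --> \oo] --> 0)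
  (Vj : forall n, V n (D `\` E j) @[j --> \oo] --> 0)
  (cvc : forall A, measurable A -> A `<=` D ->
     cvgn (fun n => expR (al n A) * cos (be n A)))
  (cvs : forall A, measurable A -> A `<=` D ->
     cvgn (fun n => expR (al n A) * sin (be n A))).

Let V0 n A : measurable A -> A `<=` D -> 0 <= V n A.
Proof. by move=> mA AD; apply: le_trans (alV n mA AD). Qed.

Let small (u : nat -> R) (k N : nat) : (forall n, 0 <= u n) -> u @ \oo --> 0 ->
  exists n, (N <= n)%N /\ u n <= k.+1%:R^-1.
Proof.
move=> u0 /cvgr0_norm_lt /(_ k.+1%:R^-1) /(_ _)[]; first by rewrite invr_gt0.
move=> M _ hM; exists (maxn N M); rewrite leq_maxl; split => //.
have /= := hM (maxn N M) (leq_maxr _ _); rewrite ger0_norm//; exact: ltW.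
Qed.

(* Blocks E (j k.+1) \ E (j k) off which the n k-th set function is small; the
   union A of the even blocks has al (n k) A close to al (n k) D for k even and
   close to 0 for k odd. *)
Lemma gliding_hump : (expR (al n D) * cos (be n D)) @[n --> \oo] --> (1 : R) /\
  (expR (al n D) * sin (be n D)) @[n --> \oo] --> (0 : R).
Proof.
(* Two choices behind the hump: for given j and k, a rank n >= k at which [V n] is small on [E j];
   and for given n and k, an index j off which [V n] has little mass left. *)
have /choice[N hN] : forall q : nat * nat, exists n,
    (q.2 <= n)%N /\ V n (E q.1) <= q.2.+1%:R^-1.
  by move=> [j k] /=; apply: small => // n; exact: V0.
have mDE j : measurable (D `\` E j) by exact: measurableD.
have /choice[J hJ] : forall q : nat * nat * nat, exists j,
    (q.2 <= j)%N /\ V q.1.1 (D `\` E j) <= q.1.2.+1%:R^-1.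
  move=> [[n k] j0] /=; apply: (small (u := fun j => V n (D `\` E j))) => // j.
  by apply: V0 => // x [].
pose j := fix j k := if k is k'.+1 then J (N (j k', k'), k', j k') else 0%N.
pose n k := N (j k, k).
have jS k : j k.+1 = J (n k, k, j k) by [].
have kn k : (k <= n k)%N by have [] := hN (j k, k).
have V1 k : V (n k) (E (j k)) <= k.+1%:R^-1 by have [] := hN (j k, k).
have V2 k : V (n k) (D `\` E (j k.+1)) <= k.+1%:R^-1.
  by rewrite jS; have [] := hJ (n k, k, j k).
have jle k : (j k <= j k.+1)%N by rewrite jS; have [] := hJ (n k, k, j k).
have jmono k l : (k <= l)%N -> E (j k) `<=` E (j l).
  move=> kl; apply/subsetPset/ndE; elim: l kl => [|l ih]; first by rewrite leqn0 => /eqP->.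
  by rewrite leq_eqVlt => /predU1P[->//|/ih/leq_trans]; apply.
pose A := \bigcup_(k in [set k | ~~ odd k]) (E (j k.+1) `\` E (j k)).
have mA : measurable A.
  by apply: bigcup_measurable => k _; exact: measurableD.
have AD : A `<=` D by move=> x [k _ [/ED]].
have mDA : measurable (D `\` A) by exact: measurableD.
have DAD : D `\` A `<=` D by move=> x [].
have Veven k : ~~ odd k -> V (n k) (D `\` A) <= 2 * k.+1%:R^-1.
  move=> ek; rewrite mulr_natl mulr2n; apply: le_trans (lerD (V1 k) (V2 k)).
  apply: VU => //.
  move=> x [Dx nA]; have [Ejx|nEx] := pselect (E (j k.+1) x); last by right.
  left; apply: contrapT => nE; apply: nA; exists k => //.
have Vodd k : odd k -> V (n k) A <= 2 * k.+1%:R^-1.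
  move=> ok; rewrite mulr_natl mulr2n; apply: le_trans (lerD (V1 k) (V2 k)).
  apply: VU => //.
  move=> x [l /= el [x1 x2]]; have Dx : D x by exact: ED x1.
  have [Ejx|nEx] := pselect (E (j k.+1) x); last by right.
  left; have [kl|lk|kl] := ltngtP k l.
  - by exfalso; apply: x2; exact: jmono Ejx.
  - exact: (jmono l.+1 k lk).
  - by move: el; rewrite -kl ok.
have inv0 (f : nat -> nat) : (forall k, (k <= f k)%N) ->
    (2 * (f k).+1%:R^-1 : R) @[k --> \oo] --> 0.
  move=> hf; rewrite -[0](mulr0 2); apply: cvgMr.
  have h := @cvg_harmonic R; exact: (cvg_subseq_ge hf h).
have tozero (a v : nat -> R) : (forall k, `|a k| <= v k) -> v @ \oo --> 0 -> a @ \oo --> 0.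
  move=> av v0; apply/norm_cvg0P.
  apply: (squeeze_cvgr _ (cvg_cst 0) v0); apply: nearW => k.
  by rewrite normr_ge0 av.
pose o k := k.*2.+1; pose e k := k.*2.
have ko k : (k <= o k)%N by rewrite /o -addnn ltnW// ltnS leq_addr.
have ke k : (k <= e k)%N by rewrite /e -addnn leq_addr.
have oo k : odd (o k) by rewrite /o /= odd_double.
have ee k : ~~ odd (e k) by rewrite /e odd_double.
have kno k : (k <= n (o k))%N by exact: leq_trans (ko k) (kn _).
have kne k : (k <= n (e k))%N by exact: leq_trans (ke k) (kn _).
have ao : al (n (o k)) A @[k --> \oo] --> 0.
  apply: (tozero _ _ _ (inv0 _ ko)) => k.
  exact: le_trans (alV _ mA AD) (Vodd _ (oo k)).
have bo : be (n (o k)) A @[k --> \oo] --> 0.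
  apply: (tozero _ _ _ (inv0 _ ko)) => k.
  exact: le_trans (beV _ mA AD) (Vodd _ (oo k)).
have ae : al (n (e k)) (D `\` A) @[k --> \oo] --> 0.
  apply: (tozero _ _ _ (inv0 _ ke)) => k.
  exact: le_trans (alV _ mDA DAD) (Veven _ (ee k)).
have bee : be (n (e k)) (D `\` A) @[k --> \oo] --> 0.
  apply: (tozero _ _ _ (inv0 _ ke)) => k.
  exact: le_trans (beV _ mDA DAD) (Veven _ (ee k)).
have cexp (a : nat -> R) : a @ \oo --> 0 -> expR (a k) @[k --> \oo] --> (1 : R).
  by move=> a0; rewrite -expR0; apply: continuous_cvg => //; exact: continuous_expR.
have ccos (a : nat -> R) : a @ \oo --> 0 -> cos (a k) @[k --> \oo] --> (1 : R).
  by move=> a0; rewrite -cos0; apply: continuous_cvg => //; exact: continuous_cos.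
have csin (a : nat -> R) : a @ \oo --> 0 -> sin (a k) @[k --> \oo] --> (0 : R).
  by move=> a0; rewrite -sin0; apply: continuous_cvg => //; exact: continuous_sin.
(* The limits for [A] exist along the full sequence. The odd ranks identify them as 1 and 0, and the
   even ranks transfer them to [D], whose limits exist as well. *)
have /cvg_ex[x hx] := cvc mA AD; have /cvg_ex[y hy] := cvs mA AD.
have uniq (u : nat -> R) (p q : R) : u @ \oo --> p -> u @ \oo --> q -> p = q.
  by move=> h1 h2; rewrite -(cvg_lim _ h1)// -(cvg_lim _ h2).
have x1 : x = 1.
  have h2 : (expR (al (n (o k)) A) * cos (be (n (o k)) A)) @[k --> \oo] --> (1 * 1 : R).
    exact: cvgM (cexp _ ao) (ccos _ bo).
  by rewrite -[RHS]mulr1; apply: uniq (cvg_subseq_ge kno hx) h2.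
have y0 : y = 0.
  have h2 : (expR (al (n (o k)) A) * sin (be (n (o k)) A)) @[k --> \oo] --> (1 * 0 : R).
    exact: cvgM (cexp _ ao) (csin _ bo).
  by rewrite -[RHS](mulr0 1); apply: uniq (cvg_subseq_ge kno hy) h2.
have hxe := cvg_subseq_ge kne hx; have hye := cvg_subseq_ge kne hy.
rewrite x1 in hxe; rewrite y0 in hye.
have /cvg_ex[x' hx'] := cvc mD (@subset_refl _ _).
have /cvg_ex[y' hy'] := cvs mD (@subset_refl _ _).
have hxe' := cvg_subseq_ge kne hx'; have hye' := cvg_subseq_ge kne hy'.
have h2 : (expR (al (n (e k)) D) * cos (be (n (e k)) D)) @[k --> \oo] --> (1 : R).
  rewrite (_ : (fun k => _) = (fun k => expR (al (n (e k)) (D `\` A)) *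
     ((expR (al (n (e k)) A) * cos (be (n (e k)) A)) * cos (be (n (e k)) (D `\` A)) -
      (expR (al (n (e k)) A) * sin (be (n (e k)) A)) * sin (be (n (e k)) (D `\` A))))).
    rewrite [X in _ --> X](_ : _ = 1 * (1 * 1 - 0 * 0)); last by ring.
    exact: cvgM (cexp _ ae) (cvgB (cvgM hxe (ccos _ bee)) (cvgM hye (csin _ bee))).
  by apply/funext => k; rewrite (alU _ mA AD) (beU _ mA AD) expRD cosD; ring.
have h3 : (expR (al (n (e k)) D) * sin (be (n (e k)) D)) @[k --> \oo] --> (0 : R).
  rewrite (_ : (fun k => _) = (fun k => expR (al (n (e k)) (D `\` A)) *
     ((expR (al (n (e k)) A) * sin (be (n (e k)) A)) * cos (be (n (e k)) (D `\` A)) +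
      (expR (al (n (e k)) A) * cos (be (n (e k)) A)) * sin (be (n (e k)) (D `\` A))))).
    rewrite [X in _ --> X](_ : _ = 1 * (0 * 1 + 1 * 0)); last by ring.
    exact: cvgM (cexp _ ae) (cvgD (cvgM hye (ccos _ bee)) (cvgM hxe (csin _ bee))).
  by apply/funext => k; rewrite (alU _ mA AD) (beU _ mA AD) expRD sinD; ring.
split.
  by have <- : x' = 1 by exact: uniq hxe' h2.
by have <- : y' = 0 by exact: uniq hye' h3.
Qed.

End gliding_hump.

Section Rintegral_limits.
Context d (X : measurableType d) (R : realType) (m : {measure set X -> \bar R}).
Variables (D : set X) (mD : measurable D).

Lemma Rintegral_dominated_cvg (f_ : nat -> X -> R) (f g : X -> R) :
  (forall n, measurable_fun D (f_ n)) -> measurable_fun D f ->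
  {ae m, forall x, D x -> f_ n x @[n --> \oo] --> f x} ->
  m.-integrable D (EFin \o g) -> (forall n x, D x -> `|f_ n x| <= g x) ->
  (\int[m]_(x in D) f_ n x) @[n --> \oo] --> \int[m]_(x in D) f x.
Proof.
move=> mf_ mf ff ig fg.
have [| | | |i1 _ i2] := @dominated_convergence _ _ _ m D mD (fun n => EFin \o f_ n)
   (EFin \o f) (EFin \o g) _ _ _ ig.
- by move=> n; apply/measurable_EFinP.
- exact/measurable_EFinP.
- apply: filterS ff => x h Dx; apply: (cvg_comp _ _ (h Dx)) => //.
- by apply: aeW => x n Dx; rewrite /= lee_fin fg.
apply: fine_cvg; rewrite fineK; last exact: integrable_fin_num.
exact: i2.
Qed.

End Rintegral_limits.

(** * Convergence in probability *)

Section convergence_in_probability.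
Context d (T : measurableType d) (R : realType) (P : probability T R).
Implicit Types (Y : nat -> T -> R) (Z : T -> R).

Lemma cvg_in_probabilityD Y Y' Z Z' :
  (forall n, measurable_fun setT (Y n)) -> (forall n, measurable_fun setT (Y' n)) ->
  measurable_fun setT Z -> measurable_fun setT Z' ->
  cvg_in_probability P Y Z -> cvg_in_probability P Y' Z' ->
  cvg_in_probability P (fun n w => Y n w + Y' n w) (fun w => Z w + Z' w).
Proof.
move=> mY mY' mZ mZ' h h' e e0.
have e20 : 0 < e / 2 by rewrite divr_gt0.
have mset (U V : T -> R) (r : R) : measurable_fun setT U -> measurable_fun setT V ->
    measurable [set w | r <= `|U w - V w|].
  move=> mU mV; rewrite -[X in measurable X]setTI.
  have mUV : measurable_fun setT (fun w => `|U w - V w|).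
    by apply: measurableT_comp => //; apply: measurable_funB.
  by apply: measurable_fun_le.
have := cvgeD _ (h _ e20) (h' _ e20); rewrite adde0 => /(_ _)hs.
apply: (squeeze_cvge _ (cvg_cst 0%E) (hs _)) => //.
apply: nearW => n; rewrite measure_ge0/=.
apply: le_trans (measureU2 _ _ _); [|exact: mset|exact: mset].
apply: le_measure; rewrite ?inE; [|apply: measurableU; exact: mset|].
  by apply: mset; apply: measurable_funD.
move=> w /= ew; have [h1|h1] := leP (e / 2) `|Y n w - Z w|; [by left|right].
rewrite leNgt; apply/negP => h2; have : `|Y n w + Y' n w - (Z w + Z' w)| < e.
  rewrite opprD addrACA (le_lt_trans (ler_normD _ _))// [ltRHS](splitr e).
  exact: ltrD.
by rewrite ltNge ew.
Qed.

Lemma cvg_in_probabilityZ (c : R) Y Z :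
  (forall n, measurable_fun setT (Y n)) -> measurable_fun setT Z ->
  cvg_in_probability P Y Z ->
  cvg_in_probability P (fun n w => c * Y n w) (fun w => c * Z w).
Proof.
move=> mY mZ h e e0.
have [->|c0] := eqVneq c 0.
  rewrite (_ : (fun n => _) = cst 0%E); first exact: cvg_cst.
  apply/funext => n; rewrite (_ : [set w | _] = set0) ?measure0//.
  by apply/seteqP; split => // w /=; rewrite !mul0r subrr normr0 leNgt e0.
have := h (e / `|c|); rewrite divr_gt0 ?normr_gt0// => /(_ isT).
rewrite (_ : (fun n => P [set w | e / `|c| <= _]) =
  (fun n => P [set w | e <= `|c * Y n w - c * Z w|]))//.
apply/funext => n; congr (P _); apply/seteqP; split => w /=.
  by rewrite -mulrBr normrM ler_pdivrMr ?normr_gt0// mulrC.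
by rewrite -mulrBr normrM ler_pdivrMr ?normr_gt0// mulrC.
Qed.

Lemma cvg_in_probability_sum (I : finType) (c : I -> R) (Y : I -> nat -> T -> R)
    (Z : I -> T -> R) :
  (forall i n, measurable_fun setT (Y i n)) -> (forall i, measurable_fun setT (Z i)) ->
  (forall i, cvg_in_probability P (Y i) (Z i)) ->
  cvg_in_probability P (fun n w => \sum_i c i * Y i n w) (fun w => \sum_i c i * Z i w).
Proof.
move=> mY mZ h; elim: (index_enum I) => [|i s ih].
  move=> e e0; rewrite (_ : (fun n => _) = cst 0%E); first exact: cvg_cst.
  apply/funext => n; rewrite (_ : [set w | _] = set0) ?measure0//.
  by apply/seteqP; split => // w /=; rewrite !big_nil subrr normr0 leNgt e0.
have -> : (fun (n : nat) w => \sum_(j <- i :: s) c j * Y j n w) =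
    (fun n w => c i * Y i n w + \sum_(j <- s) c j * Y j n w).
  by apply/funext => n; apply/funext => w; rewrite big_cons.
have -> : (fun w => \sum_(j <- i :: s) c j * Z j w) =
    (fun w => c i * Z i w + \sum_(j <- s) c j * Z j w).
  by apply/funext => w; rewrite big_cons.
apply: cvg_in_probabilityD => //.
- by move=> n; apply: measurable_funM.
- by move=> n; apply: measurable_sum => j; apply: measurable_funM.
- by apply: measurable_funM.
- by apply: measurable_sum => j; apply: measurable_funM.
- exact: cvg_in_probabilityZ.
Qed.

(** Off the event |Y - Z| >= e / 2 the Lipschitz bound gives e / 2. On it the difference is at most
    2, and its probability is eventually at most e / 4. *)
Lemma cvg_in_probability_expectation (phi : R -> R) Y Z :
  measurable_fun setT phi -> (forall x, `|phi x| <= 1) ->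
  (forall x y, `|phi x - phi y| <= `|x - y|) ->
  (forall n, measurable_fun setT (Y n)) -> measurable_fun setT Z ->
  cvg_in_probability P Y Z ->
  (\int[P]_w phi (Y n w)) @[n --> \oo] --> \int[P]_w phi (Z w).
Proof.
move=> mphi phi1 philip mY mZ h.
have ic U : measurable_fun setT U -> P.-integrable setT (EFin \o (fun w => phi (U w))).
  move=> mU; apply: (@bounded_integrable _ _ _ P _ 1) => //.
  exact: measurableT_comp.
apply/cvgrPdist_le => e e0.
have e20 : 0 < e / 2 by rewrite divr_gt0.
have e40 : (0 < (e / 4)%:E)%E by rewrite lte_fin divr_gt0.
have /fine_cvgP[hfin hc] := h _ e20.
have /cvgrPdist_le/(_ (e / 4)) := hc; rewrite divr_gt0// => /(_ isT) hc4.
near=> n.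
have Pn : `|0 - fine (P [set w | e / 2 <= `|Y n w - Z w|])| <= e / 4 by near: n; exact: hc4.
have mS : measurable [set w | e / 2 <= `|Y n w - Z w|].
  rewrite -[X in measurable X]setTI.
  have mUV : measurable_fun setT (fun w => `|Y n w - Z w|).
    by apply: measurableT_comp => //; apply: measurable_funB.
  by apply: measurable_fun_le.
set S := [set w | _] in mS Pn.
rewrite -RintegralB//; [|exact: ic..].
apply: (@le_trans _ _ (\int[P]_w (e / 2 + 2 * \1_S w))).
  have iB : P.-integrable setT (EFin \o (fun w => phi (Z w) - phi (Y n w))).
    apply: (@bounded_integrable _ _ _ P _ 2).
      by apply: measurable_funB; exact: measurableT_comp.
    move=> w; rewrite (le_trans (ler_normB _ _))// [leRHS](_ : _ = 1 + 1)//.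
    exact: lerD.
  apply: (le_trans (le_normr_Rintegral _ iB)) => //.
  apply: le_Rintegral => //.
  - exact: integrable_norm.
  - apply: (@bounded_integrable _ _ _ P _ (e / 2 + 2)).
      by apply: measurable_funD => //; apply: measurable_funM => //; exact: measurable_indic.
    move=> w; rewrite indicE.
    by case: (w \in S); rewrite /= ?mulr1 ?mulr0 ger0_norm; lra.
  move=> w _; rewrite indicE; have [wS|wS] := boolP (w \in S).
    rewrite mulr1 (@le_trans _ _ 2) ?lerDr ?(ltW e20)//.
    rewrite (le_trans (ler_normB _ _))// [leRHS](_ : _ = 1 + 1)//; exact: lerD.
  rewrite mulr0 addr0 (le_trans (philip _ _))// distrC ltW// ltNge.
  by apply: contra wS => ?; rewrite mem_setE.
have i1 : P.-integrable setT (EFin \o (fun w => 2 * \1_S w)).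
  apply: (@bounded_integrable _ _ _ P _ 2).
    by apply: measurable_funM => //; exact: measurable_indic.
  move=> w; rewrite indicE; case: (_ \in _); rewrite ?mulr1 ?mulr0 ?normr0// ger0_norm//.
rewrite RintegralD//; last exact: finite_measure_integrable_cst.
rewrite Rintegral_cst// RintegralZl//; last first.
  by apply: integrable_indic_lty => //; rewrite (le_lt_trans (probability_le1 _ _))// ltry.
have P1 : fine (P setT) = 1 by rewrite probability_setT.
rewrite P1 mulr1 /Rintegral integral_indic// setIT.
move: Pn; rewrite -/S sub0r normrN ger0_norm ?fine_ge0//; lra.
Unshelve. all: by end_near.
Qed.

Lemma cos_lipschitz (x y : R) : `|cos x - cos y| <= `|x - y|.
Proof.
wlog xy : x y / x < y.
  move=> h; have [/h//|/h h'|->] := ltgtP x y; last by rewrite !subrr.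
  by rewrite distrC [leRHS]distrC.
have [z _ zE] : exists2 z, z \in `]x, y[%R & cos y - cos x = - sin z * (y - x).
  apply: (MVT xy (fun z _ => is_derive_cos z)).
  by apply: continuous_subspaceT => z; apply: continuous_cos.
rewrite distrC zE normrM normrN [leRHS]distrC ler_piMl//.
by rewrite ler_norml sin_geN1 sin_le1.
Qed.

Lemma sin_lipschitz (x y : R) : `|sin x - sin y| <= `|x - y|.
Proof.
have := cos_lipschitz (x - pi / 2) (y - pi / 2).
by rewrite !cosBpihalf opprB addrA subrK.
Qed.

End convergence_in_probability.

Section rate_continuity.
Context {R : realType} (a : R) (lam : {measure set (measurableTypeR R) -> \bar R}).
Hypothesis lam_levy : is_levy_measure lam.

Let bounded_of_cvg (y_ : nat -> R) (y : R) : y_ @ \oo --> y ->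
  exists2 C, 0 <= C & forall n, `|y_ n| <= C.
Proof.
move=> h; have /cvg_seq_bounded : cvgn y_ by apply/cvg_ex; exists y.
move=> [M [_ hM]]; exists (`|M| + 1); first by rewrite addr_ge0.
by move=> n; apply: hM => //; rewrite ltr_pwDr// ler_norm.
Qed.

(** Dominated convergence along sequences: a convergent sequence of arguments is bounded by some C,
    and then the integrands by a multiple of min (1, z^2). *)
Lemma continuous_rate_re : continuous (rate_re lam).
Proof.
move=> y; apply/(@cvg_nbhsP _ R^o) => y_ hy.
apply: cvgN; have [C C0 hC] := bounded_of_cvg hy.
apply: (@Rintegral_dominated_cvg _ _ _ lam setT measurableT _ _
  (fun z => 2 * (1 + C ^+ 2) * Num.min 1 (z ^+ 2))).
- by move=> n; exact: measurable_rate_re_integrand.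
- exact: measurable_rate_re_integrand.
- apply: aeW => z _; apply: cvgB; first exact: cvg_cst.
  apply: continuous_cvg; first exact: continuous_cos.
  by apply: cvgMl.
- exact: integrableZl (integrable_levy_min lam_levy).
move=> n z _; rewrite ger0_norm ?onem_cos_ge0// (le_trans (onem_cos_min _))//.
rewrite -mulrA ler_pM2l// exprMn (le_trans _ (min_sqr_scale _ (sqr_ge0 C)))//.
rewrite le_min ge_min lexx/= ge_min; apply/orP; right.
by rewrite ler_wpM2r ?sqr_ge0// -real_normK ?num_real// lerXn2r ?nnegrE.
Qed.

Lemma continuous_rate_im : continuous (rate_im a lam).
Proof.
move=> y; apply/(@cvg_nbhsP _ R^o) => y_ hy.
have [C C0 hC] := bounded_of_cvg hy.
apply: cvgD; first by apply: cvgMl.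
apply: (@Rintegral_dominated_cvg _ _ _ lam setT measurableT _ _
  (fun z => (1 + C ^+ 2) * Num.min 1 (z ^+ 2))).
- by move=> n; exact: measurable_rate_im_integrand.
- exact: measurable_rate_im_integrand.
- apply: aeW => z _; apply: cvgB; last by apply: cvgMl; apply: cvgMl.
  apply: continuous_cvg; first exact: continuous_sin.
  by apply: cvgMl.
- exact: integrableZl (integrable_levy_min lam_levy).
move=> n z _; rewrite (le_trans (sin_sub_min _ _))// ler_wpM2r ?le_min ?ler01 ?sqr_ge0//.
by rewrite lerD2l -real_normK ?num_real// lerXn2r ?nnegrE//; exact: hC.
Qed.

Lemma rate_bounded (r : R -> R) (C : R) : continuous r ->
  exists K, forall y, `|y| <= C -> `|r y| <= K.
Proof.
move=> cr.
have : compact [set` `[- C, C]] by exact: segment_compact.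
move=> /(@continuous_compact _ _ r _ (continuous_subspaceT cr))/compact_bounded [K [_ hK]].
exists (K + 1) => y yC; apply: hK; first by rewrite ltrDl.
by exists y => //=; rewrite in_itv/= -ler_norml.
Qed.

End rate_continuity.

(** * From simple functions to stochastic integrals *)

Section stochastic_integral_char.
Context (R : realType) (d : measure_display) (T : measurableType d).
Variables (P : probability T R) (a : R).
Variables (lam : {measure set (measurableTypeR R) -> \bar R}).
Variables (m : {measure set (plane R) -> \bar R}).
Variable Lam : set (plane R) -> T -> R.
Hypotheses (lam_levy : is_levy_measure lam)
  (mLam : forall A, bounded_borel A -> measurable_fun setT (Lam A))
  (m_fin : forall A : set (plane R), bounded_borel A -> (m A < +oo)%E)
  (Lam_char : forall (I : finType) (c : I -> R) (B : I -> set (plane R)),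
    (forall i, bounded_borel (B i)) ->
    has_char P (fun w => \sum_i c i * Lam (B i) w)
      (\int[m]_p rate_re lam (\sum_i c i * \1_(B i) p))
      (\int[m]_p rate_im a lam (\sum_i c i * \1_(B i) p))).
Local Notation D := (@half_plane R).

Lemma measurable_half_plane : measurable D.
Proof.
rewrite (_ : D = [set` `]0, +oo[%R] `*` setT); first exact: measurableX.
by apply/seteqP; split => p /=; rewrite in_itv/= andbT// => -[].
Qed.

Lemma measurable_si_eval (f : simple_integrand R) : measurable_fun setT (si_eval f).
Proof.
apply: measurable_sum => i; apply: measurable_funM => //.
by apply: measurable_indic; case: (si_borel i).
Qed.

Lemma measurable_si_integral A f : measurable A -> A `<=` D ->
  measurable_fun setT (si_integral Lam A f).
Proof.
move=> mA AD; apply: measurable_sum => i; apply: measurable_funM => //.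
apply: mLam.
have bf := si_borel i; have mB : measurable (si_set i) by case: bf.
by apply: bounded_borelS bf => //; exact: measurableI.
Qed.

Variables (I : finType) (c : I -> R) (f : I -> plane R -> R) (Y : I -> T -> R).
Hypotheses (mf : forall i, measurable_fun setT (f i))
  (mY : forall i, measurable_fun setT (Y i)).
Let g p := \sum_i c i * f i p.
Hypotheses (ire : m.-integrable D (fun p => (rate_re lam (g p))%:E))
  (iim : m.-integrable D (fun p => (rate_im a lam (g p))%:E)).

Variable fn : I -> nat -> simple_integrand R.
Hypothesis fn_cvg : forall i, {ae m, forall p, half_plane p ->
  si_eval (fn i n) p @[n --> \oo] --> f i p}.
Hypothesis fn_int : forall i A, measurable A -> A `<=` D ->
  exists2 Z : T -> R, measurable_fun setT Z &
    cvg_in_probability P (fun n => si_integral Lam A (fn i n)) Z.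
Hypothesis fn_Y : forall i, cvg_in_probability P (fun n => si_integral Lam D (fn i n)) (Y i).

Let gn n p := \sum_i c i * si_eval (fn i n) p.
Let Zn n A w := \sum_i c i * si_integral Lam A (fn i n) w.

Let mgn n : measurable_fun setT (gn n).
Proof.
by apply: measurable_sum => i; apply: measurable_funM => //; exact: measurable_si_eval.
Qed.

Let mg : measurable_fun setT g.
Proof. by apply: measurable_sum => i; apply: measurable_funM. Qed.

Let mre (h : plane R -> R) : measurable_fun setT h -> measurable_fun setT (fun p => rate_re lam (h p)).
Proof.
move=> mh; apply: (measurableT_comp _ mh).
by apply: continuous_measurable_fun; exact: continuous_rate_re.
Qed.

Let mim (h : plane R -> R) : measurable_fun setT h -> measurable_fun setT (fun p => rate_im a lam (h p)).
Proof.
move=> mh; apply: (measurableT_comp _ mh).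
by apply: continuous_measurable_fun; exact: continuous_rate_im.
Qed.

(** All pieces of the simple functions approximating the [f i] at stage n. Pieces belonging to
    different i may overlap, which is why [Lam_char] is assumed for arbitrary finite families. *)
Let K n := {i : I & 'I_(si_size (fn i n))}.
Let cK n (k : K n) : R := c (tag k) * si_coef (tagged k).
Let BK n (k : K n) : set (plane R) := si_set (tagged k).

Let bBK n (k : K n) A : measurable A -> bounded_borel (BK k `&` A).
Proof.
move=> mA; have bf := si_borel (tagged k).
have mB : measurable (BK k) by case: bf.
by apply: bounded_borelS bf => //; exact: measurableI.
Qed.

Let gnE n A p : \sum_(k : K n) cK k * \1_(BK k `&` A) p = gn n p * \1_A p.
Proof.
rewrite /gn mulr_suml.
transitivity (\sum_(i : I) \sum_(j < si_size (fn i n)) c i * si_coef j * \1_(si_set j `&` A) p).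
  rewrite (sig_big_dep (fun=> true) (fun i j => true)
    (fun i (j : 'I_(si_size (fn i n))) => c i * si_coef j * \1_(si_set j `&` A) p))/=.
  by apply: eq_bigr.
apply: eq_bigr => i _; rewrite /si_eval mulr_sumr mulr_suml.
by apply: eq_bigr => j _; rewrite indicI/= !mulrA.
Qed.

Let ZnE n A w : \sum_(k : K n) cK k * Lam (BK k `&` A) w = Zn n A w.
Proof.
transitivity (\sum_(i : I) \sum_(j < si_size (fn i n)) c i * si_coef j * Lam (si_set j `&` A) w).
  rewrite (sig_big_dep (fun=> true) (fun i j => true)
    (fun i (j : 'I_(si_size (fn i n))) => c i * si_coef j * Lam (si_set j `&` A) w))/=.
  by apply: eq_bigr.
apply: eq_bigr => i _; rewrite /si_integral mulr_sumr.
by apply: eq_bigr => j _; rewrite mulrA.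
Qed.

Let aln n A := \int[m]_(p in A) rate_re lam (gn n p).
Let ben n A := \int[m]_(p in A) rate_im a lam (gn n p).

Let rate_restrict (r : R -> R) n A : r 0 = 0 ->
  \int[m]_p r (gn n p * \1_A p) = \int[m]_(p in A) r (gn n p).
Proof.
move=> r0; rewrite [RHS]Rintegral_mkcond; apply: eq_Rintegral => p _.
by rewrite patchE indicE; case: (p \in A); rewrite ?mulr1// mulr0 r0.
Qed.

Let Zn_char n A : measurable A -> A `<=` D -> has_char P (Zn n A) (aln n A) (ben n A).
Proof.
move=> mA AD.
have := @Lam_char (K n) (@cK n) _ (fun k => @bBK n k A mA).
rewrite /has_char.
under [X in X = _ /\ _ -> _]eq_Rintegral do rewrite ZnE.
under [X in _ /\ X = _ -> _]eq_Rintegral do rewrite ZnE.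
under [X in _ = expR X * _ /\ _ -> _]eq_Rintegral do rewrite gnE.
under [X in _ = _ * cos X /\ _ -> _]eq_Rintegral do rewrite gnE.
under [X in _ /\ _ = expR X * _ -> _]eq_Rintegral do rewrite gnE.
under [X in _ /\ _ = _ * sin X -> _]eq_Rintegral do rewrite gnE.
by rewrite !rate_restrict ?rate0.
Qed.

(** The rate of a simple function is bounded and vanishes off finitely many bounded sets, because r
    0 = 0. *)
Let int_rate (r : R -> R) n : continuous r -> r 0 = 0 -> m.-integrable D (fun p => (r (gn n p))%:E).
Proof.
move=> cr r0.
have mr : measurable_fun setT (fun p => r (gn n p)).
  by apply: (measurableT_comp _ (mgn n)); exact: continuous_measurable_fun cr.
have [C hC] : exists C, forall p, `|gn n p| <= C.
  exists (\sum_(k : K n) `|cK k|) => p.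
  have := gnE n setT p; rewrite indicT mulr1 => <-.
  rewrite (le_trans (ler_norm_sum _ _ _))//; apply: ler_sum => k _.
  rewrite normrM ler_piMr// indicE; by case: (_ \in _); rewrite ?normr1 ?normr0.
have [K1 hK] := rate_bounded C cr.
have K10 : 0 <= K1 by apply: le_trans (hK 0 _); rewrite ?normr0// (le_trans _ (hC point)).
apply: (@le_integrable _ _ _ m D measurable_half_plane _
  (fun p => \sum_(k : K n) (K1 * \1_(BK k) p)%:E)%E).
- by apply/measurable_EFinP; exact: measurable_funTS.
- move=> p _; rewrite sumEFin lee_fin [leRHS]ger0_norm; last first.
    by apply: sumr_ge0 => k _; rewrite mulr_ge0.
  have [[k Bk]|nB] := pselect (exists k : K n, BK k p).
    rewrite (bigD1 k)//= indicE mem_set// mulr1 (le_trans (hK _ (hC p)))// lerDl.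
    by apply: sumr_ge0 => l _; rewrite mulr_ge0.
  suff -> : gn n p = 0 by rewrite r0 normr0; apply: sumr_ge0 => l _; rewrite mulr_ge0.
  have := gnE n setT p; rewrite indicT mulr1 => <-.
  by rewrite big1// => k _; rewrite setIT indicE memNset ?mulr0// => Bp; apply: nB; exists k.
apply: (integrable_sum measurable_half_plane) => k _; apply: (integrableS measurableT) => //.
  exact: measurable_half_plane.
under eq_fun do rewrite EFinM; apply: integrableZl => //.
have bk := si_borel (tagged k).
apply: integrable_indic_lty; first by case: bk.
exact: m_fin.
Qed.

Let dre n p := rate_re lam (gn n p) - rate_re lam (g p).
Let dim n p := rate_im a lam (gn n p) - rate_im a lam (g p).
Let h n p := `|dre n p| + `|dim n p|.
(** Bounded regions where all approximations obey one common bound: there dominated convergence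
    applies ([V_E]). They exhaust [D] up to a null set because a convergent sequence is bounded
    ([V_DE]). *)
Let E (j : nat) := [set p | D p /\ (`|p.1| <= j%:R /\ `|p.2| <= j%:R) /\ forall n, `|gn n p| <= j%:R].

Let ire_n n : m.-integrable D (EFin \o (fun p => rate_re lam (gn n p))).
Proof. apply: int_rate; [exact: continuous_rate_re|by rewrite (rate0 a)]. Qed.

Let iim_n n : m.-integrable D (EFin \o (fun p => rate_im a lam (gn n p))).
Proof. apply: int_rate; [exact: continuous_rate_im|by rewrite rate0]. Qed.

Let idre n : m.-integrable D (EFin \o dre n).
Proof. have hh := integrableB measurable_half_plane (ire_n n) ire.
exact: hh. Qed.

Let idim n : m.-integrable D (EFin \o dim n).
Proof. have hh := integrableB measurable_half_plane (iim_n n) iim.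
exact: hh. Qed.

Let ih n : m.-integrable D (EFin \o h n).
Proof.
have mD := measurable_half_plane.
have hh := integrableD mD (integrable_norm (idre n)) (integrable_norm (idim n)).
exact: hh.
Qed.

Let h0 n p : 0 <= h n p. Proof. exact: addr_ge0. Qed.

Let mh n : measurable_fun setT (h n).
Proof.
by apply: measurable_funD; apply: measurableT_comp => //; apply: measurable_funB;
  do ?[exact: mre|exact: mim].
Qed.

Let ED j : E j `<=` D. Proof. by move=> p []. Qed.

Let mE j : measurable (E j).
Proof.
rewrite (_ : E j = D `&` ([set p | `|p.1| <= j%:R] `&` [set p | `|p.2| <= j%:R]) `&`
   \bigcap_n [set p | `|gn n p| <= j%:R]); last first.
  apply/seteqP; split => [p [Dp [[? ?] hp]]|p [[Dp [? ?]] hp]]; split => //.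
    by move=> n _; exact: hp.
  by split => // n; exact: hp.
have mle (u : plane R -> R) : measurable_fun setT u -> measurable [set p | `|u p| <= j%:R].
  move=> mu'; rewrite -[X in measurable X]setTI; apply: measurable_fun_le => //.
  exact: measurableT_comp.
apply: measurableI; last by apply: bigcap_measurableType => n _; exact: mle.
apply: measurableI; first exact: measurable_half_plane.
by apply: measurableI; apply: mle; [exact: measurable_fst|exact: measurable_snd].
Qed.

Let bE j : bounded_borel (E j).
Proof.
split; [exact: mE|exact: ED|exists (j%:R : R); split]; rewrite ?num_real// => M jM p [_ [[h1 h2] _]] /=.
have -> : `|p| = Num.max `|p.1| `|p.2| by exact: prod_normE.
by rewrite ge_max !(le_trans _ (ltW jM)).
Qed.

Let gn_cvg : {ae m, forall p, D p -> gn n p @[n --> \oo] --> g p}.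
Proof.
have : {ae m, forall p, forall i, D p -> si_eval (fn i n) p @[n --> \oo] --> f i p}.
  exact: filter_forall fn_cvg.
apply: filterS => p hp Dp; rewrite /gn /g.
elim: (index_enum I) => [|i s ihs].
  by under eq_cvg do rewrite big_nil; rewrite big_nil; exact: cvg_cst.
under eq_cvg do rewrite big_cons.
by rewrite big_cons; apply: cvgD => //; apply: cvgMl_tmp; exact: hp.
Qed.

Let h_cvg p : gn n p @[n --> \oo] --> g p -> h n p @[n --> \oo] --> 0.
Proof.
move=> hp; rewrite -[0](addr0 0); apply: cvgD.
  rewrite -(normr0 R) -(subrr (rate_re lam (g p))); apply: cvg_norm; apply: cvgB.
    by apply: continuous_cvg => //; exact: continuous_rate_re.
  exact: cvg_cst.
rewrite -(normr0 R) -(subrr (rate_im a lam (g p))); apply: cvg_norm; apply: cvgB.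
  by apply: continuous_cvg => //; exact: continuous_rate_im.
exact: cvg_cst.
Qed.

Let V n A := \int[m]_(p in A) h n p.

Let V_E j : V n (E j) @[n --> \oo] --> 0.
Proof.
have e0 : 0 = \int[m]_(p in E j) (0 : R) by rewrite Rintegral_cst// mul0r.
rewrite [X in _ --> X]e0.
have [K1 hK1] := rate_bounded j%:R (continuous_rate_re lam_levy).
have [K2 hK2] := rate_bounded j%:R (continuous_rate_im (a := a) lam_levy).
have iD (u : plane R -> \bar R) : m.-integrable D u -> m.-integrable (E j) u.
  by apply: integrableS => //; exact: measurable_half_plane.
apply: (@Rintegral_dominated_cvg _ _ _ m (E j) (mE j) _ _
  (fun p => (K1 + K2) + (`|rate_re lam (g p)| + `|rate_im a lam (g p)|))).
- by move=> n; exact: measurable_funTS.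
- exact: measurable_cst.
- by apply: filterS gn_cvg => p hp /ED Dp; apply: h_cvg; exact: hp.
- have ic : m.-integrable (E j) (cst (K1 + K2)%:E).
    apply/integrableP; split; first exact: measurable_cst.
    by rewrite integral_cst// lte_mul_pinfty//; exact: m_fin.
  have hh := integrableD (mE j) ic (integrableD (mE j)
    (integrable_norm (iD (EFin \o (fun p => rate_re lam (g p))) ire))
    (integrable_norm (iD (EFin \o (fun p => rate_im a lam (g p))) iim))).
  exact: hh.
move=> n p [_ [_ hp]]; rewrite ger0_norm// addrACA; apply: lerD.
  by rewrite (le_trans (ler_normB _ _))// lerD2r hK1.
by rewrite (le_trans (ler_normB _ _))// lerD2r hK2.
Qed.

Let V_DE n : V n (D `\` E j) @[j --> \oo] --> 0.
Proof.
have mD := measurable_half_plane.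
have e0 : 0 = \int[m]_(p in D) (0 : R) by rewrite Rintegral_cst// mul0r.
rewrite [X in _ --> X]e0.
rewrite (_ : (fun j => _) = (fun j => \int[m]_(p in D) (h n p * \1_(~` E j) p))); last first.
  apply/funext => j; rewrite /V setDE Rintegral_mkcondr; apply: eq_Rintegral => p _.
  by rewrite patchE indicE; case: (p \in _); rewrite ?mulr1 ?mulr0.
apply: (@Rintegral_dominated_cvg _ _ _ m D mD _ _ (h n)) => //.
- move=> j; apply: measurable_funTS; apply: measurable_funM; first exact: mh.
  by apply: measurable_indic; apply: measurableC; exact: mE.
- apply: filterS gn_cvg => p hp Dp.
  have /cvg_seq_bounded : cvgn (gn ^~ p) by apply/cvg_ex; exists (g p); exact: hp.
  move=> [M [_ hM]].
  pose B := `|M| + 1 + `|p.1| + `|p.2|.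
  apply: cvg_near_cst; exists (Num.truncn B).+1 => // j /= Bj.
  have {}Bj : B <= j%:R.
    by rewrite (le_trans (ltW (truncnS_gt _)))// ler_nat.
  have Ejp : E j p.
    split => //; split; first by split; apply: le_trans Bj; rewrite /B;
      have := normr_ge0 M; have := normr_ge0 p.1; have := normr_ge0 p.2; lra.
    move=> k; apply: le_trans Bj; apply: (@le_trans _ _ (`|M| + 1)).
      by apply: hM => //; rewrite ltr_pwDr// ler_norm.
    by rewrite /B; have := normr_ge0 p.1; have := normr_ge0 p.2; lra.
  by rewrite indicE memNset ?mulr0// => nE; exact: nE.
- move=> j p _; rewrite normrM ger0_norm// ler_piMr// indicE.
  by case: (_ \in _); rewrite ?normr1 ?normr0.
Qed.

Let ndE : nondecreasing_seq E.
Proof.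
apply/nondecreasing_seqP => j; apply/subsetPset => p [Dp [[h1 h2] h3]].
have jj : j%:R <= j.+1%:R :> R by rewrite ler_nat.
by split => //; split; [split; exact: le_trans jj|move=> n; exact: le_trans jj].
Qed.

Let sub_int (u : plane R -> R) A : measurable A -> A `<=` D ->
  m.-integrable D (EFin \o u) -> m.-integrable A (EFin \o u).
Proof. by move=> mA AD; apply: integrableS => //; exact: measurable_half_plane. Qed.

Let split_int (u : plane R -> R) A : measurable A -> A `<=` D ->
  m.-integrable D (EFin \o u) ->
  \int[m]_(p in D) u p = \int[m]_(p in A) u p + \int[m]_(p in D `\` A) u p.
Proof.
move=> mA AD iu; have mD := measurable_half_plane.
rewrite -Rintegral_setU//; first by rewrite setDUK.
- exact: measurableD.
- by rewrite setDUK.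
- by apply/disj_set2P; rewrite setDE setICA setICr setI0.
Qed.

Let al n A := \int[m]_(p in A) dre n p.
Let be n A := \int[m]_(p in A) dim n p.
Let al0 A := \int[m]_(p in A) rate_re lam (g p).
Let be0 A := \int[m]_(p in A) rate_im a lam (g p).

Let alE n A : measurable A -> A `<=` D -> aln n A = al0 A + al n A.
Proof.
move=> mA AD; rewrite /al /dre RintegralB//; [by rewrite addrC subrK| |].
- by apply: sub_int => //; exact: ire_n.
- by apply: sub_int => //; exact: ire.
Qed.

Let beE n A : measurable A -> A `<=` D -> ben n A = be0 A + be n A.
Proof.
move=> mA AD; rewrite /be /dim RintegralB//; [by rewrite addrC subrK| |].
- by apply: sub_int => //; exact: iim_n.
- by apply: sub_int => //; exact: iim.
Qed.

Let VU n A B C : measurable A -> measurable B -> measurable C ->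
  A `<=` D -> B `<=` D -> C `<=` A `|` B -> V n C <= V n A + V n B.
Proof.
move=> mA mB mC AD BD CAB.
have mBA : measurable (B `\` A) by exact: measurableD.
have UE : A `|` B = A `|` (B `\` A) by rewrite setDE setUIr setUv setIT.
have UD : A `|` B `<=` D by move=> p [/AD|/BD].
have mono U U' : measurable U -> measurable U' -> U `<=` U' -> U' `<=` D -> V n U <= V n U'.
  move=> mU mU' UU' U'D; apply: fine_le.
  - by apply: integrable_fin_num => //; apply: sub_int => //; exact: subset_trans U'D.
  - by apply: integrable_fin_num => //; exact: sub_int.
  - apply: ge0_subset_integral => //; first by apply/measurable_EFinP; exact: measurable_funTS.
    by move=> p _; rewrite lee_fin.
apply: (@le_trans _ _ (V n (A `|` B))); first by apply: mono => //; exact: measurableU.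
rewrite UE /V Rintegral_setU//; last 2 first.
- by rewrite -UE; apply: sub_int => //; exact: measurableU.
- by apply/disj_set2P; rewrite setDE setICA setICr setI0.
rewrite lerD2l; apply: mono => //; by move=> p [].
Qed.

Let abs_le (u : nat -> plane R -> R) n A : (forall p, `|u n p| <= h n p) ->
  measurable A -> A `<=` D -> m.-integrable D (EFin \o u n) ->
  `|\int[m]_(p in A) u n p| <= V n A.
Proof.
move=> uh mA AD iu; have iuA := sub_int mA AD iu.
apply: (le_trans (le_normr_Rintegral mA iuA)).
apply: le_Rintegral => //; [exact: integrable_norm|exact: sub_int].
Qed.

Let Zmeas n A : measurable A -> A `<=` D -> measurable_fun setT (Zn n A).
Proof.
move=> mA AD; apply: measurable_sum => i; apply: measurable_funM => //.
exact: measurable_si_integral.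
Qed.

Let Zcvg A : measurable A -> A `<=` D -> exists2 Z : T -> R, measurable_fun setT Z &
  cvg_in_probability P (fun n => Zn n A) Z.
Proof.
move=> mA AD.
have /choice[Z hZ] : forall i, exists Z : T -> R, measurable_fun setT Z /\
    cvg_in_probability P (fun n => si_integral Lam A (fn i n)) Z.
  by move=> i; have [Z ? ?] := fn_int i mA AD; exists Z.
exists (fun w => \sum_i c i * Z i w).
  by apply: measurable_sum => i; apply: measurable_funM => //; case: (hZ i).
apply: cvg_in_probability_sum => [i n|i|i]; [|by case: (hZ i)..].
exact: measurable_si_integral.
Qed.

Let cosn A Z : measurable A -> A `<=` D -> measurable_fun setT Z ->
  cvg_in_probability P (fun n => Zn n A) Z ->
  (expR (aln n A) * cos (ben n A)) @[n --> \oo] --> \int[P]_w cos (Z w) /\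
  (expR (aln n A) * sin (ben n A)) @[n --> \oo] --> \int[P]_w sin (Z w).
Proof.
move=> mA AD mZ hZ; split.
  rewrite (_ : (fun n => _) = (fun n => \int[P]_w cos (Zn n A w))); last first.
    by apply/funext => n; have [-> _] := Zn_char n mA AD.
  apply: cvg_in_probability_expectation => //.
  - by move=> x; rewrite cos_sin_bound.
  - exact: cos_lipschitz.
  - by move=> n; exact: Zmeas.
rewrite (_ : (fun n => _) = (fun n => \int[P]_w sin (Zn n A w))); last first.
  by apply/funext => n; have [_ ->] := Zn_char n mA AD.
apply: cvg_in_probability_expectation => //.
- by move=> x; rewrite cos_sin_bound.
- exact: sin_lipschitz.
- by move=> n; exact: Zmeas.
Qed.

(** The characteristic functions over [A] converge since the integrals over [A] converge in
    probability. Dividing out the constant factor exp (al0 + i be0) leaves the error terms [al] and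
    [be]. *)
Let cs_conv A : measurable A -> A `<=` D ->
  cvgn (fun n => expR (al n A) * cos (be n A)) /\
  cvgn (fun n => expR (al n A) * sin (be n A)).
Proof.
move=> mA AD; have [Z mZ hZ] := Zcvg mA AD.
have [hc hs] := cosn mA AD mZ hZ.
split; apply/cvg_ex.
  exists (expR (- al0 A) * (\int[P]_w cos (Z w) * cos (be0 A) + \int[P]_w sin (Z w) * sin (be0 A))).
  rewrite (_ : (fun n => _) = (fun n => expR (- al0 A) *
    (expR (aln n A) * cos (ben n A) * cos (be0 A) + expR (aln n A) * sin (ben n A) * sin (be0 A)))).
    by apply: cvgMl_tmp; apply: cvgD; apply: cvgMr_tmp.
  apply/funext => n; rewrite -!mulrA -mulrDr -cosB mulrA -expRD alE// beE//.
  by rewrite addKr [be0 A + _]addrC addrK.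
exists (expR (- al0 A) * (\int[P]_w sin (Z w) * cos (be0 A) - \int[P]_w cos (Z w) * sin (be0 A))).
rewrite (_ : (fun n => _) = (fun n => expR (- al0 A) *
  (expR (aln n A) * sin (ben n A) * cos (be0 A) - expR (aln n A) * cos (ben n A) * sin (be0 A)))).
  by apply: cvgMl_tmp; apply: cvgB; apply: cvgMr_tmp.
apply/funext => n; rewrite -!mulrA -mulrBr -sinB mulrA -expRD alE// beE//.
by rewrite addKr [be0 A + _]addrC addrK.
Qed.

(** [al] and [be] are the errors of the rates integrated over a set. Nothing dominates them over all
    of [D], but the exponentials of the errors converge over every Borel subset, and the gliding
    hump shows that over [D] their limit is 1. *)
Lemma stochastic_integral_has_char : has_char P (fun w => \sum_i c i * Y i w)
  (\int[m]_(p in D) rate_re lam (g p)) (\int[m]_(p in D) rate_im a lam (g p)).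
Proof.
have mD := measurable_half_plane.
have [|||||||||gc gs] := @gliding_hump _ (plane R) R al be V D E mD mE ED ndE.
- by move=> n A mA AD; exact: split_int.
- by move=> n A mA AD; exact: split_int.
- by move=> n A mA AD; apply: (@abs_le dre) => // p; rewrite /h lerDl.
- by move=> n A mA AD; apply: (@abs_le dim) => // p; rewrite /h lerDr.
- exact: VU.
- exact: V_E.
- exact: V_DE.
- by move=> A mA AD; case: (cs_conv mA AD).
- by move=> A mA AD; case: (cs_conv mA AD).
have mSY : measurable_fun setT (fun w => \sum_i c i * Y i w).
  by apply: measurable_sum => i; apply: measurable_funM.
have hSY : cvg_in_probability P (fun n => Zn n D) (fun w => \sum_i c i * Y i w).
  by apply: cvg_in_probability_sum => // i n; exact: measurable_si_integral.
have [hc hs] := cosn mD (@subset_refl _ D) mSY hSY.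
have uniq (u : nat -> R) (p q : R) : u @ \oo --> p -> u @ \oo --> q -> p = q.
  by move=> h1 h2; rewrite -(cvg_lim _ h1)// -(cvg_lim _ h2).
have keyc (x y z t : R) :
    expR (x + y) * cos (z + t) = expR x * (expR y * cos t * cos z - expR y * sin t * sin z).
  by rewrite expRD cosD; ring.
have keys (x y z t : R) :
    expR (x + y) * sin (z + t) = expR x * (expR y * sin t * cos z + expR y * cos t * sin z).
  by rewrite expRD sinD; ring.
split; [apply: uniq hc _|apply: uniq hs _].
  rewrite (_ : (fun n => _) = (fun n => expR (al0 D) *
    (expR (al n D) * cos (be n D) * cos (be0 D) - expR (al n D) * sin (be n D) * sin (be0 D)))).
    rewrite [X in _ --> X](_ : _ = expR (al0 D) * (1 * cos (be0 D) - 0 * sin (be0 D))); last by rewrite mul1r mul0r subr0.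
    by apply: cvgMl_tmp; apply: cvgB; apply: cvgMr_tmp.
  by apply/funext => n; rewrite alE// beE//; exact: keyc.
rewrite (_ : (fun n => _) = (fun n => expR (al0 D) *
  (expR (al n D) * sin (be n D) * cos (be0 D) + expR (al n D) * cos (be n D) * sin (be0 D)))).
  rewrite [X in _ --> X](_ : _ = expR (al0 D) * (0 * cos (be0 D) + 1 * sin (be0 D))); last by rewrite mul1r mul0r add0r.
  by apply: cvgMl_tmp; apply: cvgD; apply: cvgMr_tmp.
by apply/funext => n; rewrite alE// beE//; exact: keys.
Qed.

End stochastic_integral_char.

(** * Moment bounds for sums of kernels *)

Lemma sigma_finite_product d1 d2 (T1 : measurableType d1) (T2 : measurableType d2)
    (R : realType) (m1 : {sigma_finite_measure set T1 -> \bar R})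
    (m2 : {sigma_finite_measure set T2 -> \bar R}) :
  sigma_finite setT (m1 \x m2)%E.
Proof.
have /sigma_finiteP[F1 [F1T ndF1 fF1]] := sigma_finiteT m1.
have /sigma_finiteP[F2 [F2T ndF2 fF2]] := sigma_finiteT m2.
exists (fun n => F1 n `*` F2 n).
  apply/seteqP; split => // -[x y] _.
  have [n1 _ xF] : (\bigcup_n F1 n) x by rewrite -F1T.
  have [n2 _ yF] : (\bigcup_n F2 n) y by rewrite -F2T.
  exists (maxn n1 n2) => //; split => /=.
    by move: x xF; apply/subsetPset/ndF1; exact: leq_maxl.
  by move: y yF; apply/subsetPset/ndF2; exact: leq_maxr.
move=> n; have [mF1 lF1] := fF1 n; have [mF2 lF2] := fF2 n.
split; first exact: measurableX.
by rewrite product_measure1E// lte_mul_pinfty// ge0_fin_numE.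
Qed.

(** Bundled as sigma-finite, so that Tonelli's theorem applies again when a third factor is
    added. *)
Definition product_sigma_finite d1 d2 (T1 : measurableType d1) (T2 : measurableType d2)
    (R : realType) (m1 : {sigma_finite_measure set T1 -> \bar R})
    (m2 : {sigma_finite_measure set T2 -> \bar R}) :
    {sigma_finite_measure set (T1 * T2)%type -> \bar R} :=
  HB.pack (m1 \x m2)%E
    (Measure_isSigmaFinite.Build _ _ _ (m1 \x m2)%E (sigma_finite_product m1 m2)).

(** * An envelope for sums of kernels *)

Section envelope.
Context {R : realType}.
Implicit Types (x s t v p : R).

Lemma integral_exp_left (c s0 : R) : 0 < c ->
  (\int[@lebesgue_measure R]_(s in `]-oo, s0]) (expR (- c * (s0 - s)))%:E = (c^-1)%:E)%E.
Proof.
move=> c0.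
have cG : continuous (fun s : R => expR (- c * (s0 - s))).
  move=> z; apply: continuous_comp; last exact: continuous_expR.
  apply: continuousM; first exact: cst_continuous.
  by apply: continuousB; [exact: cst_continuous|move=> ?; exact: cvg_id].
have := @ge0_integration_by_substitutionNy R (fun s => expR (- c * (s0 - s))) (- s0).
rewrite opprK => ->; last 2 first.
- exact: continuous_subspaceT.
- by move=> x _; exact: expR_ge0.
have Fd (z : R) : is_derive z 1 (fun z : R => - c^-1 * expR (- c * (s0 - - z))) (expR (- c * (s0 - - z))).
  have h1 : is_derive z 1 (fun z : R => - c * (s0 - - z)) (- c).
    have -> : (fun z : R => - c * (s0 - - z)) = (fun z => - (c * z) - c * s0).
      by apply/funext => y; ring.
    apply: is_derive_eq; rewrite /GRing.scale/= ?mulr1 ?subr0//.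
  have h2 := @is_derive1_comp R expR (fun z : R => - c * (s0 - - z)) z _ _ (is_derive_expR (- c * (s0 - - z))) h1.
  have h3 := is_deriveZ (- c^-1) h2.
  by apply: (is_derive_eq h3); rewrite /GRing.scale/=; field; rewrite gt_eqF.
have cF : continuous (fun z : R => - c^-1 * expR (- c * (s0 - - z))).
  by move=> z; apply/differentiable_continuous/derivable1_diffP; have [] := Fd z.
rewrite (@ge0_continuous_FTC2y _ _ (fun z => - c^-1 * expR (- c * (s0 - - z))) _ 0).
- rewrite opprK subrr mulr0 expR0 mulr1 EFinN oppeK add0e//.
- by move=> x _ /=; exact: expR_ge0.
- apply: continuous_subspaceT => z.
  by apply: (@continuous_comp _ _ _ (-%R)); [exact: opp_continuous|exact: cG].
- rewrite -(mulr0 (- c^-1)); apply: cvgMl_tmp.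
  rewrite (_ : (fun x => expR (- c * (s0 - - x))) =
     (fun z => expR (- z)) \o (fun z => c * z + c * s0)); last first.
    by apply/funext => z /=; congr expR; ring.
  apply: (@cvg_comp _ _ _ _ _ _ (pinfty_nbhs R)); last exact: cvgr_expR.
  apply/cvgryPge => A; exists ((A - c * s0) / c); split; first exact: num_real.
  by move=> z /ltW; rewrite ler_pdivrMr// (mulrC z) lerBlDr.
- by move=> x _; have [] := Fd x.
- exact/cvg_at_right_filter/cF.
- by move=> x _; rewrite derive1E; have [_ ->] := Fd x.
Qed.

Lemma measurable_ramp (c s0 t : R) : measurable_fun setT
  (fun s : measurableTypeR R => expR (- c * Num.max (s0 - s) 0) * (s <= s0 + t)%R%:R).
Proof.
apply: measurable_funM.
  apply: measurableT_comp => //; apply: measurable_funM => //.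
  by apply: measurable_maxr => //; apply: measurable_funB.
have -> : (fun s : measurableTypeR R => (s <= s0 + t)%R%:R : R) = \1_(`]-oo, s0 + t]).
  by apply/funext => s; rewrite indicE; congr (_%:R); apply/esym; rewrite mem_setE in_itv.
by apply: measurable_indic; exact: measurable_itv.
Qed.

(** The exponential tail to the left of [s0] contributes 1 / c, the plateau from [s0] to [s0 + t] at
    most t. *)
Lemma integral_ramp_le (c s0 t : R) : 0 < c -> 0 <= t ->
  (\int[@lebesgue_measure R]_s
     (expR (- c * Num.max (s0 - s) 0) * (s <= s0 + t)%R%:R)%:E <= (c^-1 + t)%:E)%E.
Proof.
move=> c0 t0.
have ge0 s : 0 <= expR (- c * Num.max (s0 - s) 0) * (s <= s0 + t)%R%:R.
  by rewrite mulr_ge0 ?expR_ge0.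
have mf : measurable_fun setT (fun s : measurableTypeR R =>
    (expR (- c * Num.max (s0 - s) 0) * (s <= s0 + t)%R%:R)%:E).
  by apply/measurable_EFinP; exact: measurable_ramp.
rewrite -(setUv `]-oo, s0]%classic) ge0_integral_setU//=; last 3 first.
- exact: measurableC.
- by rewrite setUv.
- exact/disj_setPCl.
rewrite EFinD; apply: leeD.
  rewrite -(integral_exp_left s0 c0) le_eqVlt; apply/orP; left; apply/eqP.
  apply: eq_integral => s; rewrite inE/= in_itv/= => ss0.
  by rewrite max_l ?subr_ge0// (le_trans ss0) ?lerDl// mulr1.
apply: (@le_trans _ _ (\int[@lebesgue_measure R]_(s in ~` `]-oo, s0]) (\1_(`]s0, s0 + t]) s)%:E)%E).
  apply: ge0_le_integral => //.
  - exact: measurableC.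
  - by apply: measurable_funTS.
  - by apply/measurable_EFinP/measurable_funTS; apply: measurable_indic; exact: measurable_itv.
  - move=> s /=; rewrite in_itv/= => /negP; rewrite -ltNge => s0s.
    rewrite lee_fin indicE mem_setE in_itv/= s0s/=.
    rewrite ler_piMl// expR_le1 mulNr oppr_le0 mulr_ge0 ?(ltW c0)//.
    by rewrite le_max lexx orbT.
rewrite integral_indic//; last exact: measurableC.
rewrite (le_trans (le_measure _ _ _ (@subIsetl _ _ _)))//.
- by rewrite inE; apply: measurableI => //; exact: measurableC.
- by rewrite inE.
have := @lebesgue_measure_itv R `]s0, (s0 + t)%R]; rewrite /= => ->.
rewrite lte_fin; case: ifPn => _; last by rewrite lee_fin.
by rewrite lee_fin addrC addKr.
Qed.

(* Bound of the sum of exp (- x k) over k < t. *)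
Definition depth (t : nat) (x : R) : R := Num.min t%:R (1 + x^-1).

(** Dominates the sum of the kernels at the times s0 + k + v, k < t, uniformly in v in [0, 1]
    ([sum_kernel_le]): full [depth] for jumps after [s0], exponential damping for earlier ones, and
    nothing after s0 + t, the last possible time. *)
Definition envelope (t : nat) (s0 : R) (p : plane R) : R :=
  depth t p.1 * (expR (- p.1 * Num.max (s0 - p.2) 0) * (p.2 <= s0 + t%:R)%R%:R)
  * (0 < p.1)%R%:R.

Lemma supOU_kernel_ge0 u (p : plane R) : 0 <= supOU_kernel u p.
Proof. by rewrite mulr_ge0 ?expR_ge0. Qed.

(** Induction on t, shifting y by 1. For y >= 0 the step reduces to 1 + x <= e^x; for y < 0 the
    first term is absent. *)
Lemma sum_kernel_base_le (t : nat) x (y : R) : 0 < x ->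
  \sum_(k < t) expR (- x * (y + k%:R)) * (0 <= y + k%:R)%R%:R <=
  (1 + x^-1) * expR (- x * Num.max y 0).
Proof.
move=> x0; elim: t y => [|t IH] y.
  by rewrite big_ord0 mulr_ge0 ?expR_ge0// addr_ge0 ?invr_ge0 ?ltW.
rewrite big_ord_recl/= addr0.
under eq_bigr => k _ do rewrite /bump/= natrD addrA.
have := IH (y + 1); set S := \sum_(_ < _) _ => {}IH.
have ex : expR x >= 1 + x by exact: expR_ge1Dx.
have xi : x * x^-1 = 1 by rewrite divff// gt_eqF.
have xi0 : 0 < x^-1 by rewrite invr_gt0.
have [y0|y0] := leP 0 y.
  rewrite (max_l (addr_ge0 y0 ler01)) in IH.
  rewrite mulr1.
  have eE : expR (- x * y) = expR (- x * (y + 1)) * expR x.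
    by rewrite -expRD; congr expR; ring.
  have e0 : 0 < expR (- x * (y + 1)) by exact: expR_gt0.
  rewrite eE; move: e0 IH; set e := expR (- x * (y + 1)); set E := expR x in ex *.
  move=> e0 IH; have : (1 + x^-1) * e * (1 + x) <= (1 + x^-1) * e * E.
    by rewrite ler_pM2l// mulr_gt0// addr_gt0.
  have : e * E + (1 + x^-1) * e <= (1 + x^-1) * e * E.
    have -> : (1 + x^-1) * e * E = e * E + x^-1 * e * E by ring.
    rewrite lerD2l; have -> : (1 + x^-1) * e = x^-1 * e * (1 + x).
      by rewrite mulrDl mul1r mulrDr mulr1 (mulrC (_ * e) x) mulrA xi mul1r addrC.
    by rewrite ler_pM2l// mulr_gt0.
  rewrite mulrA; nra.
rewrite mulr0 add0r mulr0 expR0 mulr1.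
apply: le_trans IH _; rewrite ger_pMr ?addr_gt0// expR_le1 mulNr oppr_le0 mulr_ge0 ?(ltW x0)//.
by rewrite le_max lexx orbT.
Qed.

Lemma sum_kernel_le (t : nat) (s0 v : R) (p : plane R) : 0 <= v <= 1 -> 0 < p.1 ->
  \sum_(k < t) supOU_kernel (s0 + k%:R + v) p <= envelope t s0 p.
Proof.
move=> /andP[v0 v1] x0; rewrite /envelope x0 mulr1 /supOU_kernel.
set x := p.1 in x0 *; set s := p.2.
have [ss|ss] := leP s (s0 + t%:R); last first.
  rewrite big1 ?mulr0// => k _; rewrite leNgt (le_lt_trans _ ss) ?mulr0//.
  rewrite -addrA lerD2l (le_trans (_ : _ <= k%:R + 1)) ?lerD2l//.
  by rewrite natr1 ler_nat ltn_ord.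
rewrite mulr1.
have mx : Num.max (s0 - s) 0 <= Num.max (s0 + v - s) 0.
  by rewrite ge_max !le_max lexx orbT andbT; apply/orP; left; lra.
have eb : expR (- x * Num.max (s0 + v - s) 0) <= expR (- x * Num.max (s0 - s) 0).
  by rewrite ler_expR !mulNr lerN2 ler_pM2l.
(* Either each of the t terms is bounded by the exponential at [s0], or the geometric bound is used;
   the shift by v only decreases the exponential. *)
rewrite /depth -/x; have [_|_] := leP t%:R (1 + x^-1).
  apply: (@le_trans _ _ (\sum_(k < t) expR (- x * Num.max (s0 - s) 0))).
    apply: ler_sum => k _; have [h|h] := leP s (s0 + k%:R + v); last by rewrite mulr0 expR_ge0.
    rewrite mulr1 ler_expR !mulNr lerN2 ler_pM2l// ge_max subr_ge0 h andbT.
    have := ler0n R k; lra.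
  by rewrite sumr_const card_ord mulr_natl.
apply: (@le_trans _ _ ((1 + x^-1) * expR (- x * Num.max (s0 + v - s) 0))); last first.
  by rewrite ler_pM2l// addr_gt0 ?invr_gt0.
apply: le_trans (sum_kernel_base_le t (s0 + v - s) x0).
apply: ler_sum => k _.
have -> : s0 + v - s + k%:R = s0 + k%:R + v - s by ring.
by rewrite subr_ge0.
Qed.

Lemma envelope_ge0 (t : nat) (s0 : R) (p : plane R) : 0 <= envelope t s0 p.
Proof.
rewrite /envelope; have [p0|p0] := ltP 0 p.1; last by rewrite mulr0.
rewrite mulr1 mulr_ge0 ?mulr_ge0 ?expR_ge0// /depth le_min ler0n/= addr_ge0// invr_ge0 ltW//.
Qed.

Lemma measurable_envelope (t : nat) (s0 : R) : measurable_fun setT (envelope t s0).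
Proof.
have m1 : measurable_fun setT (fun p : plane R => p.1 : R) by exact: measurable_fst.
have m2 : measurable_fun setT (fun p : plane R => p.2 : R) by exact: measurable_snd.
have -> : envelope t s0 = (fun p : plane R => Num.min t%:R (1 + p.1 `^ (-1))
    * (expR (- p.1 * Num.max (s0 - p.2) 0) * (p.2 <= s0 + t%:R)%R%:R) * (0 < p.1)%R%:R).
  apply/funext => p; rewrite /envelope /depth; have [p0|p0] := ltP 0 p.1; last by rewrite !mulr0.
  by rewrite powR_inv1// ltW.
apply: measurable_funM.
  apply: measurable_funM.
    apply: measurable_minr => //; apply: measurable_funD => //.
    by apply: (measurableT_comp (measurable_powR (-1)) m1).
  apply: measurable_funM.
    apply: measurableT_comp => //; apply: measurable_funM; first exact: measurableT_comp m1.
    by apply: measurable_maxr => //; apply: measurable_funB.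
  have -> : (fun p : plane R => (p.2 <= s0 + t%:R)%R%:R : R) =
      (\1_(`]-oo, s0 + t%:R]) : R -> R) \o snd.
    by apply/funext => s; rewrite /= indicE; congr (_%:R); apply/esym; rewrite mem_setE in_itv.
  by apply: measurableT_comp m2; apply: measurable_indic; exact: measurable_itv.
have -> : (fun p : plane R => (0 < p.1)%R%:R : R) = (\1_(`]0, +oo[) : R -> R) \o fst.
  by apply/funext => s; rewrite /= indicE; congr (_%:R); apply/esym; rewrite mem_setE in_itv/= andbT.
by apply: measurableT_comp m1; apply: measurable_indic; exact: measurable_itv.
Qed.

End envelope.

Section envelope_moments.
Context {R : realType}.

(** A power of a number below both t and y is shared between y, up to the order c that can be
    integrated, and t, which takes the excess. *)
Lemma powR_min_split (q c m t y : R) : 0 <= c -> 1 <= m -> m <= t -> m <= y ->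
  m `^ q <= y `^ c * t `^ Num.max (q - c) 0.
Proof.
move=> c0 m1 mt my; have m0 : 0 <= m by rewrite (le_trans _ m1).
have t1 := le_trans m1 mt.
have [qc|cq] := leP (q - c) 0.
  rewrite powRr0 mulr1; apply: (@le_trans _ _ (m `^ c)).
    by rewrite ler_powR//; lra.
  by rewrite ge0_ler_powR ?nnegrE// (le_trans m0).
have -> : q = c + (q - c) by ring.
rewrite powRD; last by apply/implyP => _; rewrite gt_eqF// (lt_le_trans _ m1).
rewrite [c + _]addrC addrK; apply: ler_pM; rewrite ?powR_ge0//.
  by rewrite ge0_ler_powR ?nnegrE// (le_trans m0).
by rewrite ge0_ler_powR ?nnegrE ?(ltW cq)// (le_trans m0).
Qed.

(** The factor 1 / (p x) + t bounds the time integral of the damping. For x <= 1 both products are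
    brought to x^(-al - 1): order [al] is spent next to 1 / x, which already carries one power, and
    order [al + 1] next to t. The power of t left is at most max (1, p - al). For x > 1 the depth is
    at most 2. *)
Lemma depth_powR_le (t : nat) (x al p g : R) : (0 < t)%N -> 0 < x -> 0 <= al ->
  0 < p -> 1 <= g -> p - al <= g ->
  depth t x `^ p * ((p * x)^-1 + t%:R) <=
  2 `^ p * (p^-1 + 1) * t%:R `^ g * (1 + (x <= 1)%R%:R * x `^ (- al - 1)).
Proof.
move=> t0 x0 al0 p0 g1 pg.
have t1 : 1 <= t%:R :> R by rewrite ler1n.
have tg : t%:R <= t%:R `^ g :> R.
  by rewrite -{1}(powRr1 (le_trans ler01 t1)) ler_powR.
have tg1 := le_trans t1 tg.
have xi0 : 0 < x^-1 by rewrite invr_gt0.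
have pi0 : 0 < p^-1 by rewrite invr_gt0.
have d0 : 0 <= depth t x by rewrite /depth le_min ler0n/= addr_ge0// ltW.
have p2 : 0 < 2 `^ p :> R by rewrite powR_gt0.
have [x1|x1] := leP x 1; last first.
  rewrite mul0r addr0 mulr1.
  have xi1 : x^-1 <= 1 by rewrite invf_le1 ?ltW.
  rewrite -mulrA; apply: ler_pM; rewrite ?powR_ge0 ?addr_ge0 ?invr_ge0 ?mulr_ge0 ?(ltW p0) ?(ltW x0)//.
    rewrite ge0_ler_powR ?nnegrE ?(ltW p0)// /depth ge_min; apply/orP; right; lra.
  rewrite invfM mulrDl mul1r lerD//.
  by rewrite ler_pM2l// (le_trans xi1).
rewrite mul1r.
pose m := Num.min t%:R x^-1.
have m1 : 1 <= m by rewrite le_min t1 invf_ge1.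
have mt : m <= t%:R by rewrite ge_min lexx.
have mx : m <= x^-1 by rewrite ge_min lexx orbT.
have dm : depth t x <= 2 * m.
  rewrite /depth /m; have xi1 : 1 <= x^-1 by rewrite invf_ge1.
  have [h|h] := leP t%:R x^-1; first by rewrite ge_min; apply/orP; left; lra.
  by rewrite ge_min; apply/orP; right; lra.
have dmp : depth t x `^ p <= 2 `^ p * m `^ p.
  rewrite -powRM ?(le_trans _ m1)//.
  by rewrite ge0_ler_powR ?nnegrE ?(ltW p0)// mulr_ge0// (le_trans _ m1).
have i1 := powR_min_split p al0 m1 mt mx.
have i2 := powR_min_split p (addr_ge0 al0 ler01) m1 mt mx.
have e1 : x^-1 `^ (al + 1) = x `^ (- al - 1).
  by rewrite -(powR_inv1 (ltW x0)) -powRrM mulN1r opprD.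
have e2 : x^-1 `^ al * x^-1 = x `^ (- al - 1).
  rewrite -e1 powRD ?powRr1 ?(ltW xi0)//; apply/implyP => _; exact: lt0r_neq0.
have j1 : m `^ p * x^-1 <= t%:R `^ g * x `^ (- al - 1).
  rewrite -e2 mulrA ler_pM2r//; apply: le_trans i1 _.
  by rewrite mulrC ler_wpM2r ?powR_ge0// ler_powR// ge_max pg (le_trans ler01).
have j2 : m `^ p * t%:R <= t%:R `^ g * x `^ (- al - 1).
  rewrite -e1; apply: le_trans (ler_wpM2r (ler0n _ _) i2) _.
  rewrite -mulrA [X in _ <= X]mulrC ler_wpM2l ?powR_ge0//.
  rewrite -[X in _ * X]powRr1 ?ler0n// -powRD; last first.
    by apply/implyP => _; rewrite gt_eqF// (lt_le_trans _ t1).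
  rewrite ler_powR// -lerBrDr ge_max; apply/andP; split; lra.
set A := x `^ _ in j1 j2 *; have A0 : 0 <= A by exact: powR_ge0.
apply: (@le_trans _ _ (2 `^ p * m `^ p * ((p * x)^-1 + t%:R))).
  by rewrite ler_wpM2r// addr_ge0 ?invr_ge0 ?mulr_ge0 ?(ltW p0) ?(ltW x0).
rewrite -!mulrA ler_pM2l//.
apply: (@le_trans _ _ ((p^-1 + 1) * (t%:R `^ g * A))).
  rewrite invfM mulrDr mulrCA mulrDl mul1r lerD// ler_pM2l//.
by rewrite ler_pM2l ?addr_gt0// ler_wpM2l ?powR_ge0// lerDr.
Qed.

Variable (mu : {finite_measure set (measurableTypeR R) -> \bar R}).

(** Integrating in s first leaves the quantity of [depth_powR_le]. Its bound is integrable in x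
    because [mu] is finite and has a finite origin moment of order [al]. Translation invariance in
    time makes the constant independent of [s0]. *)
Lemma integral_envelope_le (al p g : R) : 0 <= al -> 0 < p -> 1 <= g -> p - al <= g ->
  (origin_moment mu al < +oo)%E ->
  exists2 C, 0 <= C & forall t s0, (0 < t)%N ->
   (\int[mu \x @lebesgue_measure R]_q (envelope t s0 q `^ p)%:E <= (C * t%:R `^ g)%:E)%E.
Proof.
move=> al0 p0 g1 pg om.
have om0 : (0 <= origin_moment mu al)%E.
  by apply: integral_ge0 => x _; rewrite lee_fin powR_ge0.
have omE : origin_moment mu al = (fine (origin_moment mu al))%:E.
  by rewrite fineK// ge0_fin_numE.
have muE : mu setT = (fine (mu setT))%:E.
  by rewrite fineK// fin_num_measure.
exists (2 `^ p * (p^-1 + 1) * (fine (mu setT) + fine (origin_moment mu al))).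
  by rewrite !mulr_ge0 ?powR_ge0 ?addr_ge0 ?fine_ge0 ?invr_ge0 ?(ltW p0).
move=> t s0 t0.
have menv : measurable_fun setT (fun q : plane R => (envelope t s0 q `^ p)%:E).
  apply/measurable_EFinP; apply: (measurableT_comp (measurable_powR p)).
  exact: measurable_envelope.
rewrite (@fubini_tonelli1 _ _ _ _ _ mu (@lebesgue_measure R)) //; last first.
  by move=> q; rewrite lee_fin powR_ge0.
set K := 2 `^ p * (p^-1 + 1) * t%:R `^ g.
have K0 : 0 <= K by rewrite !mulr_ge0 ?powR_ge0 ?addr_ge0 ?invr_ge0 ?(ltW p0).
pose h (x : measurableTypeR R) : R := \1_(`]0, 1]) x * x `^ (- al - 1).
have mh : measurable_fun setT h.
  apply: measurable_funM; first by apply: measurable_indic; exact: measurable_itv.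
  exact: measurable_powR.
have h0 x : 0 <= h x by rewrite mulr_ge0 ?powR_ge0.
have hE : (\int[mu]_x (h x)%:E = origin_moment mu al)%E.
  rewrite /origin_moment [RHS]integral_mkcond; apply: eq_integral => x _.
  rewrite /h restrict_EFin/= patchE indicE; case: ifPn => xI; rewrite ?mul1r ?mul0r//.
apply: (@le_trans _ _ (\int[mu]_x (K * (1 + h x))%:E)%E).
  apply: ge0_le_integral => //.
  - by move=> x _; apply: integral_ge0 => y _; rewrite lee_fin powR_ge0.
  - by apply: measurable_fun_fubini_tonelli_F => // q; rewrite lee_fin powR_ge0.
  - apply/measurable_EFinP; apply: measurable_funM => //; exact: measurable_funD.
  - move=> x _; rewrite /fubini_F/=; have [x0|x0] := ltP 0 x; last first.
      rewrite [X in (X <= _)%E]integral0_eq; first by rewrite lee_fin mulr_ge0// addr_ge0.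
      by move=> y _; rewrite /envelope/= ltNge x0 mulr0 powR0// gt_eqF.
    rewrite (_ : \int[_]_y _ = \int[@lebesgue_measure R]_y ((depth t x `^ p)%:E *
       (expR (- (p * x) * Num.max (s0 - y) 0) * (y <= s0 + t%:R)%R%:R)%:E))%E; last first.
      apply: eq_integral => y _; rewrite -EFinM; congr EFin.
      rewrite /envelope/= x0 mulr1 powRM ?mulr_ge0 ?expR_ge0//; last first.
        by rewrite /depth le_min ler0n addr_ge0// invr_ge0 ltW.
      congr (_ * _); case: (y <= _); last by rewrite !mulr0 powR0// gt_eqF.
      by rewrite !mulr1 /powR (gt_eqF (expR_gt0 _)) expRK; congr expR; ring.
    rewrite ge0_integralZl; last 4 first.
    - exact: measurableT.
    - by apply/measurable_EFinP; exact: measurable_ramp.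
    - by move=> y _; rewrite lee_fin mulr_ge0 ?expR_ge0.
    - by rewrite lee_fin powR_ge0.
    apply: (@le_trans _ _ ((depth t x `^ p)%:E * ((p * x)^-1 + t%:R)%:E)%E).
      by apply: lee_wpmul2l; rewrite ?lee_fin ?powR_ge0//; apply: integral_ramp_le; rewrite ?mulr_gt0.
    rewrite -EFinM lee_fin; apply: le_trans (depth_powR_le t0 x0 al0 p0 g1 pg) _.
    by rewrite /h indicE mem_setE in_itv/= x0.
under eq_integral do rewrite EFinM EFinD.
rewrite ge0_integralZl; last 4 first.
- exact: measurableT.
- by apply: emeasurable_funD => //; exact/measurable_EFinP.
- by move=> x _; rewrite adde_ge0// lee_fin.
- by rewrite lee_fin.
rewrite ge0_integralD//; last 2 first.
- by move=> x _; rewrite lee_fin.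
- exact/measurable_EFinP.
have -> : (\int[mu]_(x in setT) 1%:E = mu setT)%E.
  by have := integral_cst mu measurableT 1%E; rewrite mul1e.
rewrite hE muE omE -EFinD -EFinM lee_fin /K.
by rewrite le_eqVlt; apply/orP; left; apply/eqP; ring.
Qed.

End envelope_moments.

(** * Two-exponent weights of jumps *)

Section two_power.
Context {R : realType}.
Implicit Types (p q w y z : R).

(** A single power whose exponent depends on the jump size ([two_powerE]); the form with indicators
    is the one suited to measurability and integration. *)
Definition two_power (p1 p2 y z : R) : R :=
  (`|z| * y) `^ p1 * \1_[set z | `|z| <= 1] z
  + (`|z| * y) `^ p2 * \1_[set z | 1 < `|z|] z.

Lemma two_powerE p1 p2 y z :
  two_power p1 p2 y z = (`|z| * y) `^ (if `|z| <= 1 then p1 else p2).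
Proof.
rewrite /two_power !indicE.
have -> : (z \in [set z | `|z| <= 1]) = (`|z| <= 1).
  by apply/idP/idP => [/set_mem|h]//; apply/mem_set.
have -> : (z \in [set z | 1 < `|z|]) = (1 < `|z|).
  by apply/idP/idP => [/set_mem|h]//; apply/mem_set.
have [z1|z1] := leP `|z| 1.
  by rewrite mulr1 mulr0 addr0.
by rewrite mulr0 mulr1 add0r.
Qed.

Lemma two_power_ge0 p1 p2 y z : 0 <= two_power p1 p2 y z.
Proof. by rewrite two_powerE powR_ge0. Qed.

(** A power of order between 0 and 2 lies above w^2 for w <= 1 and above 1 for w >= 1; this is where
    the restriction to exponents at most 2 comes from. *)
Lemma min_sqr_powR p w : 0 <= p <= 2 -> 0 <= w -> Num.min 1 (w ^+ 2) <= w `^ p.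
Proof.
move=> /andP[p0 p2] w0; have [w1|w1] := leP 1 w.
  rewrite ge_min; apply/orP; left; rewrite -{1}(powRr0 w) ler_powR//.
rewrite ge_min; apply/orP; right; rewrite -powR_mulrn//.
have [->|wn0] := eqVneq w 0.
  by rewrite powR0 ?powR_ge0.
have wgt : 0 < w by rewrite lt_neqAle eq_sym wn0.
by rewrite ger_powR// wgt ltW.
Qed.

Lemma two_power_min_sqr p1 p2 y z : 0 <= p1 <= 2 -> 0 <= p2 <= 2 -> 0 <= y ->
  Num.min 1 ((z * y) ^+ 2) <= two_power p1 p2 y z.
Proof.
move=> h1 h2 y0; rewrite two_powerE -real_normK ?num_real// normrM (ger0_norm y0).
by apply: min_sqr_powR; [case: ifP|rewrite mulr_ge0].
Qed.

Lemma two_power_min_norm p1 p2 y z : 1 <= p1 <= 2 -> 1 <= p2 <= 2 -> 0 <= y ->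
  Num.min ((z * y) ^+ 2) (4 * `|z * y|) <= 4 * two_power p1 p2 y z.
Proof.
move=> h1 h2 y0; rewrite two_powerE -real_normK ?num_real// normrM (ger0_norm y0).
set p := if _ then _ else _; have /andP[p1' p2'] : 1 <= p <= 2 by rewrite /p; case: ifP.
have w0 : 0 <= `|z| * y by rewrite mulr_ge0.
set w := _ * y in w0 *; rewrite ge_min; have [w1|w1] := leP 1 w.
  by apply/orP; right; rewrite ler_pM2l// -{1}(powRr1 w0) ler_powR.
apply/orP; left.
have := min_sqr_powR (p := p) (w := w); rewrite w0 p2' (le_trans ler01 p1') => /(_ isT isT).
have w2 : w ^+ 2 <= 1 by rewrite exprn_ile1// ltW.
rewrite (min_idPr w2); have := powR_ge0 w p; lra.
Qed.

Lemma measurable_two_power d (T : measurableType d) p1 p2 (f : T -> R) (g : T -> R) :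
  measurable_fun setT f -> measurable_fun setT g ->
  measurable_fun setT (fun x => two_power p1 p2 (f x) (g x)).
Proof.
move=> mf mg; rewrite /two_power.
have mng : measurable_fun setT (fun x => `|g x| * f x).
  by apply: measurable_funM => //; exact: measurableT_comp.
apply: measurable_funD; apply: measurable_funM.
- exact: (measurableT_comp (measurable_powR p1) mng).
- apply: (@measurableT_comp _ _ _ _ _ _ (\1_[set z : measurableTypeR R | `|z| <= 1] : _ -> R)) => //.
  by apply: measurable_indic; exact: measurable_unit_ball.
- exact: (measurableT_comp (measurable_powR p2) mng).
- apply: (@measurableT_comp _ _ _ _ _ _ (\1_[set z : measurableTypeR R | 1 < `|z|] : _ -> R)) => //.
  apply: measurable_indic; rewrite (_ : [set z | _] = ~` [set z : measurableTypeR R | `|z| <= 1]).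
    by apply: measurableC; exact: measurable_unit_ball.
  by apply/seteqP; split => z /=; rewrite ltNge => /negP.
Qed.

Variable lam : {measure set (measurableTypeR R) -> \bar R}.

Lemma measurable_large : measurable [set z : measurableTypeR R | 1 < `|z|].
Proof.
rewrite (_ : [set z | _] = ~` [set z : measurableTypeR R | `|z| <= 1]).
  by apply: measurableC; exact: measurable_unit_ball.
by apply/seteqP; split => z /=; rewrite ltNge => /negP.
Qed.

Lemma small_moment_mono p q : 0 <= p -> p <= q ->
  (small_moment lam p < +oo -> small_moment lam q < +oo)%E.
Proof.
move=> p0 pq; apply: le_lt_trans; apply: ge0_le_integral => //.
- exact: measurable_unit_ball.
- apply/measurable_EFinP/measurable_funTS/(measurableT_comp (measurable_powR q)).
  exact: normr_measurable.
- apply/measurable_EFinP/measurable_funTS/(measurableT_comp (measurable_powR p)).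
  exact: normr_measurable.
- move=> z /= z1; rewrite lee_fin; have [->|zn0] := eqVneq z 0.
    rewrite normr0; have [->|pn0] := eqVneq p q; first by [].
    by rewrite (@powR0 _ q) ?powR_ge0// gt_eqF// (le_lt_trans p0)// lt_neqAle pn0.
  by rewrite ger_powR// normr_gt0 zn0.
Qed.

Lemma large_moment_mono p q : q <= p ->
  (large_moment lam p < +oo -> large_moment lam q < +oo)%E.
Proof.
move=> pq; apply: le_lt_trans; apply: ge0_le_integral => //.
- exact: measurable_large.
- apply/measurable_EFinP/measurable_funTS/(measurableT_comp (measurable_powR q)).
  exact: normr_measurable.
- apply/measurable_EFinP/measurable_funTS/(measurableT_comp (measurable_powR p)).
  exact: normr_measurable.
- by move=> z /= z1; rewrite lee_fin ler_powR// ltW.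
Qed.

Lemma integral_two_power p1 p2 y : 0 <= y ->
  (\int[lam]_z (two_power p1 p2 y z)%:E =
   (y `^ p1)%:E * small_moment lam p1 + (y `^ p2)%:E * large_moment lam p2)%E.
Proof.
move=> y0.
have key p (A : set (measurableTypeR R)) : measurable A ->
   (\int[lam]_z ((`|z| * y) `^ p * \1_A z)%:E = (y `^ p)%:E * \int[lam]_(z in A) (`|z| `^ p)%:E)%E.
  move=> mA; rewrite -ge0_integralZl//; last 2 first.
  - apply/measurable_EFinP/measurable_funTS/(measurableT_comp (measurable_powR p)).
    exact: normr_measurable.
  - by rewrite lee_fin powR_ge0.
  rewrite [RHS]integral_mkcond; apply: eq_integral => z _; rewrite patchE indicE.
  case: ifPn => _; last by rewrite mulr0.
  by rewrite mulr1 powRM// EFinM muleC.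
under eq_integral do rewrite /two_power EFinD.
rewrite ge0_integralD//.
- by rewrite !key//; [exact: measurable_large|exact: measurable_unit_ball].
- by move=> z _; rewrite lee_fin mulr_ge0 ?powR_ge0.
- apply/measurable_EFinP; apply: measurable_funM.
    by apply: (measurableT_comp (measurable_powR p1)); apply: measurable_funM.
  by apply: measurable_indic; exact: measurable_unit_ball.
- by move=> z _; rewrite lee_fin mulr_ge0 ?powR_ge0.
- apply/measurable_EFinP; apply: measurable_funM.
    by apply: (measurableT_comp (measurable_powR p2)); apply: measurable_funM.
  by apply: measurable_indic; exact: measurable_large.
Qed.

Lemma small_moment_ge0 p : (0 <= small_moment lam p)%E.
Proof. by apply: integral_ge0 => z _; rewrite lee_fin powR_ge0. Qed.

Lemma large_moment_ge0 p : (0 <= large_moment lam p)%E.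
Proof. by apply: integral_ge0 => z _; rewrite lee_fin powR_ge0. Qed.

Lemma levy_small_moment2 : is_levy_measure lam -> (small_moment lam 2 < +oo)%E.
Proof.
move=> [_]; apply: le_lt_trans; rewrite /small_moment integral_mkcond.
apply: ge0_le_integral => //.
- by move=> z _; rewrite patchE; case: ifP => // _; rewrite lee_fin powR_ge0.
- apply/measurable_restrict; rewrite ?setTI//; first exact: measurable_unit_ball.
  apply/measurable_EFinP/measurable_funTS/(measurableT_comp (measurable_powR 2)).
  exact: normr_measurable.
- by apply/measurable_EFinP; apply: measurable_minr => //; exact: measurable_funX.
- move=> z _; rewrite patchE; case: ifPn => [|_]; last first.
    by rewrite lee_fin le_min ler01 sqr_ge0.
  rewrite mem_setE => z1; rewrite lee_fin powR_mulrn// real_normK ?num_real//.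
  by rewrite le_min lexx andbT -real_normK ?num_real// exprn_ile1.
Qed.

Variable a : R.
Hypothesis lam_levy : is_levy_measure lam.

(** Large jumps need p <= 1: then |sin w| <= |w|^p for every w. Compensated small jumps give y^2,
    and the linear term comes from the drift alone. *)
Lemma rate_le p : 0 <= p <= 1 -> (large_moment lam p < +oo)%E ->
  exists2 C, 0 <= C & forall y, `|rate_re lam y| <= C * (`|y| + y ^+ 2 + `|y| `^ p) /\
     `|rate_im a lam y| <= C * (`|y| + y ^+ 2 + `|y| `^ p).
Proof.
move=> /andP[p0 p1] lp; have s2 := levy_small_moment2 lam_levy.
have sE : small_moment lam 2 = (fine (small_moment lam 2))%:E.
  by rewrite fineK// ge0_fin_numE// small_moment_ge0.
have lE : large_moment lam p = (fine (large_moment lam p))%:E.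
  by rewrite fineK// ge0_fin_numE// large_moment_ge0.
set s := fine _ in sE; set l := fine _ in lE.
have sge : 0 <= s by rewrite fine_ge0// small_moment_ge0.
have lge : 0 <= l by rewrite fine_ge0// large_moment_ge0.
have I y : (\int[lam]_z (two_power 2 p `|y| z)%:E = (y ^+ 2 * s + `|y| `^ p * l)%:E)%E.
  by rewrite integral_two_power// sE lE -!EFinM -EFinD powR_mulrn// real_normK ?num_real.
have iI y : lam.-integrable setT (fun z => (two_power 2 p `|y| z)%:E).
  apply/integrableP; split.
    by apply/measurable_EFinP; apply: measurable_two_power.
  under eq_integral do rewrite /= ger0_norm ?two_power_ge0//.
  by rewrite I ltry.
have RI y : \int[lam]_z (two_power 2 p `|y| z) = y ^+ 2 * s + `|y| `^ p * l.
  by rewrite /Rintegral I.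
have p02 : 0 <= p <= 2 by rewrite p0 (le_trans p1)// ler1n.
have h22 : 0 <= (2:R) <= 2 by rewrite lexx ler0n.
exists (2 * s + 2 * l + `|a|); first by have := normr_ge0 a; lra.
move=> y; have y2 := sqr_ge0 y; have yp := powR_ge0 `|y| p; have ya := normr_ge0 y; have aa := normr_ge0 a.
have b1 z : 1 - cos (y * z) <= 2 * two_power 2 p `|y| z.
  rewrite (le_trans (onem_cos_min _))// ler_pM2l// mulrC.
  have := two_power_min_sqr z h22 p02 ya.
  by rewrite -real_normK ?num_real// normrM normr_id -normrM real_normK// num_real.
have b2 z : `|sin (y * z) - y * z * (`|z| <= 1)%R%:R| <= two_power 2 p `|y| z.
  rewrite two_powerE; have [z1|z1] := leP `|z| 1.
    rewrite mulr1 (le_trans (normr_sin_sub_le _))// powR_mulrn ?mulr_ge0//.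
    by rewrite -normrM real_normK ?num_real// mulrC.
  rewrite mulr0 subr0 -normrM mulrC; set w := z * y.
  have [w1|w1] := leP 1 `|w|.
    apply: (@le_trans _ _ 1); first by rewrite cos_sin_bound.
    by rewrite -{1}(powRr0 `|w|) ler_powR.
  apply: le_trans (normr_sin_le w) _.
  have [->|wn0] := eqVneq w 0; first by rewrite normr0 powR_ge0.
  by rewrite -{1}(powRr1 (normr_ge0 w)) ger_powR// normr_gt0 wn0 ltW.
split.
  rewrite /rate_re normrN ger0_norm; last first.
    by apply: Rintegral_ge0 => z _; rewrite onem_cos_ge0.
  apply: (@le_trans _ _ (\int[lam]_z (2 * two_power 2 p `|y| z))).
    apply: le_Rintegral => //; first exact: integrable_rate_re.
    have := integrableZl measurableT 2 (iI y) => hh; exact: hh.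
  rewrite (RintegralZl _ measurableT (iI y)) RI; nra.
rewrite /rate_im (le_trans (ler_normD _ _))// normrM.
have : `|\int[lam]_z (sin (y * z) - y * z * (`|z| <= 1)%R%:R)| <= y ^+ 2 * s + `|y| `^ p * l.
  rewrite -RI (le_trans (le_normr_Rintegral _ _))//; first exact: integrable_rate_im.
  apply: le_Rintegral => //.
  - have := integrable_rate_im lam_levy y => /integrable_norm hh; exact: hh.
  - exact: iI.
nra.
Qed.

End two_power.

Section levy_control.
Context {R : realType}.
Variables (mu : {finite_measure set (measurableTypeR R) -> \bar R})
  (lam : {sigma_finite_measure set (measurableTypeR R) -> \bar R}).

Definition plane_control : {sigma_finite_measure set (plane R) -> \bar R} :=
  product_sigma_finite mu (@lebesgue_measure R).

Definition jump_control :
    {sigma_finite_measure set (plane R * measurableTypeR R)%type -> \bar R} :=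
  product_sigma_finite plane_control lam.

(* The indicator of x > 0 is needed because the control measure is carried by
   the whole plane, and the kernel is unbounded for x < 0. *)
Definition jump_kernel (u : R) (e : plane R * measurableTypeR R) : R :=
  e.2 * (supOU_kernel u e.1 * (0 < e.1.1)%R%:R).

Lemma measurable_pos : measurable_fun setT (fun q : plane R => (0 < q.1)%R%:R : R).
Proof.
have -> : (fun p : plane R => (0 < p.1)%R%:R : R) = (\1_(`]0, +oo[) : R -> R) \o fst.
  by apply/funext => s; rewrite /= indicE; congr (_%:R); apply/esym; rewrite mem_setE in_itv/= andbT.
by apply: measurableT_comp; [apply: measurable_indic; exact: measurable_itv|exact: measurable_fst].
Qed.

Lemma measurable_kernel : measurable_fun setT
  (fun q : measurableTypeR R * plane R => supOU_kernel q.1 q.2).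
Proof.
have m1 : measurable_fun setT (fun q : measurableTypeR R * plane R => q.1 : R) by exact: measurable_fst.
have m2 : measurable_fun setT (fun q : measurableTypeR R * plane R => q.2.1 : R).
  by apply: (measurableT_comp (f := fst)); [exact: measurable_fst|exact: measurable_snd].
have m3 : measurable_fun setT (fun q : measurableTypeR R * plane R => q.2.2 : R).
  by apply: (measurableT_comp (f := snd)); [exact: measurable_snd|exact: measurable_snd].
have md : measurable_fun setT (fun q : measurableTypeR R * plane R => q.1 - q.2.2).
  exact: measurable_funB.
apply: measurable_funM.
  apply: measurableT_comp => //; apply: measurable_funM => //.
  exact: measurableT_comp m2.
have -> : (fun q : measurableTypeR R * plane R => (q.2.2 <= q.1)%R%:R : R) =
    (\1_(`[0, +oo[) : R -> R) \o (fun q => q.1 - q.2.2).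
  by apply/funext => s; rewrite /= indicE; congr (_%:R); apply/esym; rewrite mem_setE in_itv/= andbT subr_ge0.
by apply: measurableT_comp => //; apply: measurable_indic; exact: measurable_itv.
Qed.

Lemma measurable_supOU_kernel (u : R) : measurable_fun setT (supOU_kernel u).
Proof.
have := measurableT_comp measurable_kernel (measurable_pair1 (u : measurableTypeR R)).
exact.
Qed.

Lemma measurable_jump_kernel : measurable_fun setT
  (fun q : measurableTypeR R * (plane R * measurableTypeR R) => jump_kernel q.1 q.2).
Proof.
have m21 : measurable_fun setT (fun q : measurableTypeR R * (plane R * measurableTypeR R) => q.2.1).
  by apply: (measurableT_comp (f := fst)); [exact: measurable_fst|exact: measurable_snd].
apply: measurable_funM.
  by apply: (measurableT_comp (f := snd)); [exact: measurable_snd|exact: measurable_snd].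
apply: measurable_funM.
  apply: (measurableT_comp measurable_kernel (g := fun q : measurableTypeR R * (plane R * measurableTypeR R) => (q.1, q.2.1))).
  by apply: measurable_fun_pair => //; exact: measurable_fst.
exact: (measurableT_comp measurable_pos m21).
Qed.

Lemma lincomb_jump_kernel l e :
  lincomb l (fun u => jump_kernel u e) = e.2 * (lincomb l (fun u => supOU_kernel u e.1) * (0 < e.1.1)%R%:R).
Proof.
rewrite /lincomb mulr_suml mulr_sumr; apply: eq_bigr => q _; rewrite /jump_kernel; ring.
Qed.

(** Integrating the jump size first separates the exponents: each leaves a power of the envelope
    times a moment of [lam], and the scaling by r comes out as r^(-p1) and r^(-p2). *)
Lemma integral_two_power_le (al p1 p2 g1 g2 : R) : 0 <= al ->
  0 < p1 -> 0 < p2 -> 1 <= g1 -> 1 <= g2 -> p1 - al <= g1 -> p2 - al <= g2 ->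
  (origin_moment mu al < +oo)%E ->
  (small_moment lam p1 < +oo)%E -> (large_moment lam p2 < +oo)%E ->
  exists2 C, 0 <= C & forall (t : nat) (s0 r : R), (0 < t)%N -> 0 < r ->
   (\int[jump_control]_e (two_power p1 p2 (envelope t s0 e.1 / r) e.2)%:E <=
    (C * (t%:R `^ g1 * r `^ (- p1) + t%:R `^ g2 * r `^ (- p2)))%:E)%E.
Proof.
move=> al0 p10 p20 g11 g21 pg1 pg2 om sm lm.
have [C1 C10 h1] := integral_envelope_le al0 p10 g11 pg1 om.
have [C2 C20 h2] := integral_envelope_le al0 p20 g21 pg2 om.
have sE : small_moment lam p1 = (fine (small_moment lam p1))%:E.
  by rewrite fineK// ge0_fin_numE// small_moment_ge0.
have lE : large_moment lam p2 = (fine (large_moment lam p2))%:E.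
  by rewrite fineK// ge0_fin_numE// large_moment_ge0.
set S := fine _ in sE; set L := fine _ in lE.
have S0 : 0 <= S by rewrite fine_ge0// small_moment_ge0.
have L0 : 0 <= L by rewrite fine_ge0// large_moment_ge0.
exists (C1 * S + C2 * L); first by rewrite addr_ge0 ?mulr_ge0.
move=> t s0 r t0 r0.
have mf : measurable_fun setT (fun e : plane R * measurableTypeR R =>
    (two_power p1 p2 (envelope t s0 e.1 / r) e.2)%:E).
  apply/measurable_EFinP; apply: measurable_two_power; last exact: measurable_snd.
  apply: measurable_funM => //.
  by apply: (measurableT_comp (@measurable_envelope R t s0)); exact: measurable_fst.
rewrite (@fubini_tonelli1 _ _ _ _ _ plane_control lam) //; last first.
  by move=> e; rewrite lee_fin two_power_ge0.
rewrite /fubini_F/=.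
have ri0 : 0 <= r^-1 by rewrite invr_ge0 ltW.
have rE p : (r^-1) `^ p = r `^ (- p).
  by rewrite -(powR_inv1 (ltW r0)) -powRrM mulN1r.
have menv p : measurable_fun setT (fun q : plane R => (envelope t s0 q `^ p)%:E).
  apply/measurable_EFinP; apply: (measurableT_comp (measurable_powR p)).
  exact: measurable_envelope.
under eq_integral => q _.
  rewrite integral_two_power; last by rewrite divr_ge0 ?envelope_ge0// ltW.
  rewrite sE lE (powRM p1 (envelope_ge0 _ _ _) ri0) (powRM p2 (envelope_ge0 _ _ _) ri0) !rE.
  rewrite -!EFinM -!mulrA ![envelope _ _ _ `^ _ * _]mulrC !EFinM.
  over.
have c1 : 0 <= r `^ (- p1) * S by rewrite mulr_ge0 ?powR_ge0.
have c2 : 0 <= r `^ (- p2) * L by rewrite mulr_ge0 ?powR_ge0.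
rewrite ge0_integralD//; last 4 first.
- by move=> q _; rewrite -!EFinM lee_fin !mulr_ge0 ?powR_ge0.
- by apply: measurable_funeM; exact: menv.
- by move=> q _; rewrite -!EFinM lee_fin !mulr_ge0 ?powR_ge0.
- by apply: measurable_funeM; exact: menv.
have k1 := h1 t s0 t0; have k2 := h2 t s0 t0.
have key p c (I : \bar R) : 0 <= c -> (\int[plane_control]_q (envelope t s0 q `^ p)%:E <= I)%E ->
    (\int[plane_control]_q (c%:E * (envelope t s0 q `^ p)%:E) <= c%:E * I)%E.
  move=> c0 hI; rewrite ge0_integralZl//; last by move=> q _; rewrite lee_fin powR_ge0.
  exact: lee_wpmul2l.
rewrite -!EFinM; apply: le_trans (leeD (key _ _ _ c1 k1) (key _ _ _ c2 k2)) _.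
rewrite -!EFinM -EFinD lee_fin.
have := powR_ge0 r (- p1); have := powR_ge0 r (- p2).
have := powR_ge0 t%:R g1; have := powR_ge0 (t%:R : R) g2.
set a := _ `^ g2; set b := _ `^ g1; set c := r `^ _; set e := r `^ _ => a0 b0 c0 e0.
rewrite -subr_ge0 (_ : _ - _ = C1 * S * (a * c) + C2 * L * (b * e)); first by rewrite addr_ge0 ?mulr_ge0.
ring.
Qed.

(** All times of the combination lie in [-N, N]. Each is -N + k + v with k <= 2N an integer part and
    v in [0, 1], so its kernel is one term of a sum of 2N + 1 kernels bounded by [sum_kernel_le]. *)
Lemma kernel_le_envelope (l : seq (R * R)) : exists2 c : R, 0 <= c & exists t s0,
  (0 < t)%N /\ forall q : plane R, 0 < q.1 ->
  `|lincomb l (fun u => supOU_kernel u q)| <= c * envelope t s0 q.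
Proof.
pose B := \sum_(x <- l) `|x.2|.
have [N NB] : exists N : nat, B <= N%:R.
  by exists (Num.bound B); rewrite ltW// archi_boundP// sumr_ge0.
exists (\sum_(x <- l) `|x.1|); first by rewrite sumr_ge0.
exists (N + N).+1%N, (- N%:R); split => // q q0.
rewrite /lincomb mulr_suml (le_trans (ler_norm_sum _ _ _))// big_seq [leRHS]big_seq.
apply: ler_sum => x xl; rewrite normrM ler_wpM2l//.
rewrite (ger0_norm (supOU_kernel_ge0 _ _)).
have xB : `|x.2| <= N%:R.
  apply: le_trans NB; rewrite /B (big_rem x)//= lerDl sumr_ge0//.
have x0 : 0 <= x.2 + N%:R by move: xB; rewrite ler_norml => /andP[]; lra.
pose k := Num.truncn (x.2 + N%:R).
have /andP[k1 k2] := truncn_itv x0.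
have kN : (k < (N + N).+1)%N.
  rewrite ltnS -(ler_nat R) (le_trans k1)// natrD lerD2r; exact: le_trans (ler_norm _) xB.
pose v := x.2 + N%:R - k%:R.
have v01 : 0 <= v <= 1.
  rewrite /v subr_ge0 k1 lerBlDr; move: k2; rewrite -/k -natr1; lra.
apply: le_trans (sum_kernel_le (N + N).+1 (- N%:R) v01 q0).
rewrite (bigD1 (Ordinal kN))//= (_ : - N%:R + k%:R + v = x.2); last by rewrite /v; ring.
by rewrite lerDl sumr_ge0// => i _; exact: supOU_kernel_ge0.
Qed.

End levy_control.

(** * Symmetrization and tail bounds *)

Section symmetrization.
Context {R : realType} d (T : measurableType d) (P : probability T R).

Definition square_prob : probability (T * T)%type R := (P \x P)%E.

(** The squared modulus of the characteristic function of [U]: the phase, where the drift sits,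
    disappears. *)
Lemma cos_symmetrization (U : T -> R) : measurable_fun setT U ->
  \int[square_prob]_w cos (U w.1 - U w.2) =
  (\int[P]_w cos (U w)) ^+ 2 + (\int[P]_w sin (U w)) ^+ 2.
Proof.
move=> mU.
have mU1 : measurable_fun setT (fun w : T * T => U w.1) by exact: measurableT_comp.
have mU2 : measurable_fun setT (fun w : T * T => U w.2) by exact: measurableT_comp.
have mf : measurable_fun setT (fun w : T * T => cos (U w.1 - U w.2)).
  by apply: measurableT_comp; [exact: measurable_cos|exact: measurable_funB].
have mc : measurable_fun setT (cos \o U) by apply: measurableT_comp => //; exact: measurable_cos.
have ms : measurable_fun setT (sin \o U) by apply: measurableT_comp => //; exact: measurable_sin.
have intf : square_prob.-integrable setT (EFin \o (fun w : T * T => cos (U w.1 - U w.2))).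
  by apply: (@bounded_integrable _ _ _ _ _ 1) => // w; rewrite cos_sin_bound.
have ic : P.-integrable setT (EFin \o (cos \o U)).
  by apply: (@bounded_integrable _ _ _ _ _ 1) => // w; rewrite /= cos_sin_bound.
have isn : P.-integrable setT (EFin \o (sin \o U)).
  by apply: (@bounded_integrable _ _ _ _ _ 1) => // w; rewrite /= cos_sin_bound.
set C := \int[P]_w cos (U w); set S := \int[P]_w sin (U w).
have iZ (V : T -> R) c : P.-integrable setT (EFin \o V) ->
    P.-integrable setT (EFin \o (fun w => c * V w)).
  by move=> iV; have hh := integrableZl measurableT c iV; exact: hh.
have inner x : (\int[P]_y (cos (U x - U y))%:E = (cos (U x) * C + sin (U x) * S)%:E)%E.
  transitivity (\int[P]_y (cos (U x) * cos (U y) + sin (U x) * sin (U y)) : R)%:E.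
    rewrite fineK.
      by apply: eq_integral => y _; rewrite cosB.
    apply: integrable_fin_num => //.
    have hh := integrableD measurableT (iZ _ (cos (U x)) ic) (iZ _ (sin (U x)) isn); exact: hh.
  congr EFin; rewrite RintegralD//; [|exact: iZ ic|exact: iZ isn].
  by rewrite !RintegralZl.
rewrite /Rintegral -(@integral12_prod_meas1 _ _ _ _ _ P P _ intf) /fubini_F/=.
under eq_integral do rewrite inner.
transitivity (\int[P]_w (C * cos (U w) + S * sin (U w))).
  by apply: eq_Rintegral => w _; rewrite ![C * _]mulrC ![S * _]mulrC.
rewrite RintegralD//; [|exact: iZ ic|exact: iZ isn].
by rewrite !RintegralZl// !expr2.
Qed.

End symmetrization.

(** * Law of the symmetrized process *)

Section supOU_law.
Context (R : realType) (d : measure_display) (T : measurableType d).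
Variables (P : probability T R) (a : R).
Variables (mu : {finite_measure set (measurableTypeR R) -> \bar R})
  (lam : {sigma_finite_measure set (measurableTypeR R) -> \bar R}).
Variables (Lam : set (plane R) -> T -> R) (X : R -> T -> R).
Hypotheses (lam_levy : is_levy_measure lam)
  (Lam_basis : is_levy_basis P a 0 lam mu Lam) (X_supOU : is_supOU P mu Lam X).
Variables (p al : R).
Hypotheses (p0 : 0 < p) (p1 : p <= 1) (large_p : (large_moment lam p < +oo)%E)
  (al0 : 0 <= al) (origin_al : (origin_moment mu al < +oo)%E).
Local Notation m := (mu \x @lebesgue_measure R)%E.
Local Notation D := (@half_plane R).
Local Notation kernels q := (fun u => supOU_kernel u q).

Lemma integrable_envelope_powR (q : R) t s0 : 0 < q -> (0 < t)%N ->
  m.-integrable setT (fun x => (envelope t s0 x `^ q)%:E).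
Proof.
move=> q0 t0; apply/integrableP; split.
  apply/measurable_EFinP; apply: (measurableT_comp (measurable_powR q)).
  exact: measurable_envelope.
have g1 : 1 <= Num.max 1 (q - al) by rewrite le_max lexx.
have g2 : q - al <= Num.max 1 (q - al) by rewrite le_max lexx orbT.
have [C C0 hC] := integral_envelope_le al0 q0 g1 g2 origin_al.
under eq_integral do rewrite /= ger0_norm ?powR_ge0//.
exact: le_lt_trans (hC t s0 t0) (ltry _).
Qed.

Lemma measurable_lincomb_kernel l : measurable_fun setT (fun q : plane R => lincomb l (kernels q)).
Proof. by apply: measurable_lincomb => u; exact: measurable_supOU_kernel. Qed.

(** The auxiliary exponent p serves integrability: each of |y|, y^2 and |y|^p is bounded by a
    multiple of a power of the envelope, whose integral is finite. It is independent of the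
    exponents that fix the growth rate. *)
Lemma integrable_rate l (r : R -> R) : continuous r ->
  (exists2 C, 0 <= C & forall y, `|r y| <= C * (`|y| + y ^+ 2 + `|y| `^ p)) ->
  m.-integrable D (fun q => (r (lincomb l (kernels q)))%:E).
Proof.
move=> cr [C C0 hC].
have [c c0 [t [s0 [t0 hk]]]] := kernel_le_envelope l.
pose dom (q : plane R) := C * (c * envelope t s0 q `^ 1 + c ^+ 2 * envelope t s0 q `^ 2
     + c `^ p * envelope t s0 q `^ p).
have mD := @measurable_half_plane R.
have idom : m.-integrable D (EFin \o dom).
  apply: (@integrableS _ _ _ _ setT) => //.
  have iZ (V : plane R -> R) k : m.-integrable setT (EFin \o V) ->
      m.-integrable setT (EFin \o (fun w => k * V w)).
    by move=> iV; have hh := integrableZl measurableT k iV; exact: hh.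
  have iDD (V U : plane R -> R) : m.-integrable setT (EFin \o V) -> m.-integrable setT (EFin \o U) ->
      m.-integrable setT (EFin \o (fun w => V w + U w)).
    by move=> iV iU; have hh := integrableD measurableT iV iU; exact: hh.
  by apply: (iZ); apply: (iDD); [apply: (iDD)|]; apply: (iZ); apply: integrable_envelope_powR.
apply: (le_integrable mD _ _ idom).
  apply/measurable_EFinP/measurable_funTS.
  apply: measurableT_comp; first exact: continuous_measurable_fun.
  exact: measurable_lincomb_kernel.
move=> q q0; rewrite /= lee_fin; apply: (le_trans (hC _)).
apply: le_trans (ler_norm _); rewrite /dom ler_wpM2l//.
have kq := hk q q0; have e0 := envelope_ge0 t s0 q.
have ce := mulr_ge0 c0 e0; set y := lincomb _ _ in kq *; set e := envelope _ _ _ in kq e0 ce *.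
rewrite powRr1// (powR_mulrn 2 e0) -exprMn -powRM//.
apply: lerD; first apply: lerD => //.
  by rewrite -(real_normK (num_real y)) lerXn2r ?nnegrE.
by rewrite ge0_ler_powR ?nnegrE ?(ltW p0).
Qed.

Lemma supOU_measurable u : measurable_fun setT (X u).
Proof.
have [mX _] := X_supOU.
have := measurableT_comp mX (measurable_pair1 (u : measurableTypeR R)); exact.
Qed.

Lemma supOU_char l : has_char P (fun w => lincomb l (fun u => X u w))
  (\int[m]_(q in D) rate_re lam (lincomb l (kernels q)))
  (\int[m]_(q in D) rate_im a lam (lincomb l (kernels q))).
Proof.
have [_ /choice[fn hfn]] := X_supOU.
have lE (y : R -> R) : lincomb l y = \sum_(i < size l) (nth (0, 0) l i).1 * y (nth (0, 0) l i).2.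
  by rewrite /lincomb (big_nth (0, 0)) big_mkord.
have p01 : 0 <= p <= 1 by rewrite (ltW p0).
have [C C0 hC] := rate_le a lam_levy p01 large_p.
have mu_fin : (mu setT < +oo)%E by rewrite ltey_eq fin_num_measure.
have := @stochastic_integral_has_char R d T P a lam m Lam lam_levy
  (fun A => @levy_basis_measurable _ _ _ _ _ _ _ _ _ Lam_basis A)
  (fun A => bounded_borel_fin mu_fin (A := A))
  (fun I c B bB => @Lam_char_family _ _ _ P a lam mu Lam lam_levy Lam_basis mu_fin I c B bB)
  'I_(size l) (fun i => (nth (0, 0) l i).1)
  (fun i => supOU_kernel (nth (0, 0) l i).2) (fun i => X (nth (0, 0) l i).2)
  (fun i => measurable_supOU_kernel _) (fun i => supOU_measurable _)
  _ _ (fun i => fn (nth (0, 0) l i).2).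
have eqre : (fun q => rate_re lam (lincomb l (kernels q))) =
  (fun q => rate_re lam (\sum_(i < size l) (nth (0, 0) l i).1 * supOU_kernel (nth (0, 0) l i).2 q)).
  by apply/funext => q; rewrite lE.
have eqim : (fun q => rate_im a lam (lincomb l (kernels q))) =
  (fun q => rate_im a lam (\sum_(i < size l) (nth (0, 0) l i).1 * supOU_kernel (nth (0, 0) l i).2 q)).
  by apply/funext => q; rewrite lE.
have -> : (fun w => lincomb l (fun u => X u w)) =
   (fun w => \sum_(i < size l) (nth (0, 0) l i).1 * X (nth (0, 0) l i).2 w).
  by apply/funext => w; rewrite lE.
rewrite eqre eqim; apply.
- have := @integrable_rate l (rate_re lam) (continuous_rate_re lam_levy).
  rewrite (_ : (fun q => _%:E) = EFin \o (fun q => rate_re lam (lincomb l (kernels q))))// eqre; apply.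
  by exists C => // y; have [] := hC y.
- have := @integrable_rate l (rate_im a lam) (continuous_rate_im lam_levy).
  rewrite (_ : (fun q => _%:E) = EFin \o (fun q => rate_im a lam (lincomb l (kernels q))))// eqim; apply.
  by exists C => // y; have [] := hC y.
- by move=> i; have [] := hfn (nth (0, 0) l i).2.
- by move=> i A mA AD; have [_ h _] := hfn (nth (0, 0) l i).2; exact: h.
- by move=> i; have [] := hfn (nth (0, 0) l i).2.
Qed.

(** The z-integral of 1 - cos is minus the real rate, and the indicator of x > 0 in [jump_kernel]
    restricts the plane integral to the half-plane. *)
Lemma integral_jump_kernel l :
  (\int[jump_control mu lam]_e (1 - cos (lincomb l (fun u => jump_kernel u e)))%:E =
   (- \int[m]_(q in D) rate_re lam (lincomb l (kernels q)))%:E)%E.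
Proof.
have mD := @measurable_half_plane R.
have mf : measurable_fun setT (fun e : plane R * measurableTypeR R =>
    (1 - cos (lincomb l (fun u => jump_kernel u e)))%:E).
  apply/measurable_EFinP; apply: measurable_funB => //.
  apply: measurableT_comp; first exact: measurable_cos.
  apply: measurable_lincomb => u.
  by have := measurableT_comp (@measurable_jump_kernel R) (measurable_pair1 (u : measurableTypeR R)); exact.
rewrite (@fubini_tonelli1 _ _ _ _ _ (plane_control mu) lam) //.
rewrite /fubini_F/=.
have p01 : 0 <= p <= 1 by rewrite (ltW p0).
have [C C0 hC] := rate_le a lam_levy p01 large_p.
have ire : m.-integrable D (EFin \o (fun q => rate_re lam (lincomb l (kernels q)))).
  apply: (@integrable_rate l (rate_re lam) (continuous_rate_re lam_levy)).
  by exists C => // y; have [] := hC y.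
have re_le0 y : rate_re lam y <= 0.
  by rewrite oppr_le0; apply: Rintegral_ge0 => z _; rewrite onem_cos_ge0.
have -> : (- \int[m]_(q in D) rate_re lam (lincomb l (kernels q)))%:E =
   (\int[m]_(q in D) (- rate_re lam (lincomb l (kernels q)))%:E)%E.
  rewrite EFinN fineK; last exact: integrable_fin_num.
  rewrite -integralN//; last exact: integrable_add_def.
rewrite [RHS]integral_mkcond; apply: eq_integral => q _.
rewrite patchE; case: ifPn => [/set_mem q0|/negP q0].
  rewrite /rate_re opprK fineK; last first.
    by apply: integrable_fin_num => //; exact: integrable_rate_re.
  by apply: eq_integral => z _; rewrite lincomb_jump_kernel/= q0 mulr1 mulrC.
rewrite integral0_eq// => z _; rewrite lincomb_jump_kernel/=.
case: ltP => [h|_]; first by exfalso; apply: q0; exact: mem_set.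
by rewrite !mulr0 cos0 subrr.
Qed.

Definition symmetrized (u : R) (w : T * T) : R := X u w.1 - X u w.2.

Lemma measurable_symmetrized : measurable_fun setT
  (fun q : measurableTypeR R * (T * T) => symmetrized q.1 q.2).
Proof.
have [mX _] := X_supOU.
apply: measurable_funB.
- apply: (measurableT_comp mX (g := fun q : measurableTypeR R * (T * T) => (q.1, q.2.1))).
  apply: measurable_fun_pair; first exact: measurable_fst.
  by apply: (measurableT_comp (f := fst)); [exact: measurable_fst|exact: measurable_snd].
- apply: (measurableT_comp mX (g := fun q : measurableTypeR R * (T * T) => (q.1, q.2.2))).
  apply: measurable_fun_pair; first exact: measurable_fst.
  by apply: (measurableT_comp (f := snd)); [exact: measurable_snd|exact: measurable_snd].
Qed.

Lemma symmetrized_cos l :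
  \int[square_prob P]_w cos (lincomb l (fun u => symmetrized u w)) =
  expR (2 * \int[m]_(q in D) rate_re lam (lincomb l (kernels q))).
Proof.
have [hc hs] := supOU_char l.
have mU : measurable_fun setT (fun w => lincomb l (fun u => X u w)).
  by apply: measurable_lincomb => u; exact: supOU_measurable.
transitivity (\int[square_prob P]_w cos (lincomb l (fun u => X u w.1) - lincomb l (fun u => X u w.2))).
  apply: eq_Rintegral => w _; congr cos; rewrite /lincomb -sumrB; apply: eq_bigr => q _.
  by rewrite /symmetrized mulrBr.
rewrite (cos_symmetrization P mU) hc hs !exprMn -mulrDr cos2Dsin2 mulr1.
by rewrite mulrC expRM_natr.
Qed.

(** With A the integrated real rate, the left side is 1 - e^(2A) and the jump integral is -A, so the
    claim is e^(2A) >= 1 + 2A. *)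
Lemma symmetrized_dominated :
  dominated_functional (square_prob P) (jump_control mu lam) symmetrized
    (@jump_kernel R) (fun=> 1).
Proof.
move=> l.
under eq_integral do rewrite mulr1.
under [X in (_ <= _ * X)%E]eq_integral do rewrite mulr1.
rewrite integral_jump_kernel -EFinM.
have mU : measurable_fun setT (fun w => cos (lincomb l (fun u => symmetrized u w))).
  apply: measurableT_comp; first exact: measurable_cos.
  apply: measurable_lincomb => u.
  by have := measurableT_comp measurable_symmetrized (measurable_pair1 (u : measurableTypeR R)); exact.
have ic : (square_prob P).-integrable setT (EFin \o (fun w => cos (lincomb l (fun u => symmetrized u w)))).
  by apply: (@bounded_integrable _ _ _ _ _ 1) => // w; rewrite cos_sin_bound.
have i1 : (square_prob P).-integrable setT (EFin \o (fun w => 1 : R)).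
  by apply: (@bounded_integrable _ _ _ _ _ 1) => // w; rewrite normr1.
have -> : (\int[square_prob P]_w (1 - cos (lincomb l (fun u => symmetrized u w)))%:E =
   (\int[square_prob P]_w (1 - cos (lincomb l (fun u => symmetrized u w))) : R)%:E)%E.
  rewrite fineK//; apply: integrable_fin_num => //.
  have hh := integrableB measurableT i1 ic; exact: hh.
rewrite RintegralB// symmetrized_cos Rintegral_cst// mul1r lee_fin.
have -> : fine (square_prob P setT) = 1 by rewrite probability_setT.
set A := \int[_]_(_ in _) _.
have := expR_ge1Dx (2 * A); lra.
Qed.

End supOU_law.

(** * Affine changes of variable and folding onto the unit interval *)

Section affine_invariance.
Context {R : realType}.
Local Notation leb := (@lebesgue_measure R).

Lemma measurable_affine (c b : R) :
  measurable_fun setT (fun x : measurableTypeR R => c * x + b : measurableTypeR R).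
Proof. by apply: measurable_funD => //; exact: measurable_funM. Qed.

(** Lebesgue measure is determined by its values on half-open intervals, which the rescaled image
    measure shares. *)
Lemma lebesgue_measure_affine (c b : R) (A : set (measurableTypeR R)) : 0 < c ->
  measurable A -> leb A = (c%:E * leb ((fun x => c * x + b)%R @^-1` A))%E.
Proof.
move=> c0 mA.
pose phi : {mfun measurableTypeR R >-> measurableTypeR R} :=
  HB.pack (fun x : measurableTypeR R => c * x + b : measurableTypeR R)
   (isMeasurableFun.Build _ _ _ _ (fun x : measurableTypeR R => c * x + b : measurableTypeR R) (measurable_affine c b)).
pose cn : {nonneg R} := NngNum (ltW c0).
apply: (@lebesgue_measure_unique R (mscale cn (pushforward leb phi))) mA => X [[x y] /= _ <-].
rewrite /mscale/=.
have -> : pushforward leb phi `]x, y] = leb ((fun x0 => c * x0 + b)%R @^-1` `]x, y]) by [].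
have -> : (fun x0 => c * x0 + b)%R @^-1` `]x, y] = `]((x - b) / c), ((y - b) / c)]%classic.
  by apply/seteqP; split => z /=; rewrite !in_itv/= ltr_pdivrMr// ler_pdivlMr// (mulrC z) ltrBlDr lerBrDr.
have h1 := @lebesgue_measure_itv R `]x, y]; have h2 := @lebesgue_measure_itv R `]((x - b) / c), ((y - b) / c)].
rewrite /= in h1 h2; rewrite h1 h2 !lte_fin ltr_pM2r ?invr_gt0// ltrD2r.
case: ifP => _; last by rewrite mule0.
rewrite -!EFinD -EFinM; congr EFin; field; exact: lt0r_neq0.
Qed.

Lemma ge0_integral_affine (c b : R) (A : set (measurableTypeR R)) (f : measurableTypeR R -> \bar R) :
  0 < c -> measurable A -> measurable_fun setT f -> (forall x, 0 <= f x)%E ->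
  (\int[leb]_(x in A) f x = c%:E * \int[leb]_(x in (fun x => c * x + b)%R @^-1` A) f (c * x + b)%R)%E.
Proof.
move=> c0 mA mf f0.
pose phi : {mfun measurableTypeR R >-> measurableTypeR R} :=
  HB.pack (fun x : measurableTypeR R => c * x + b : measurableTypeR R)
   (isMeasurableFun.Build _ _ _ _ (fun x : measurableTypeR R => c * x + b : measurableTypeR R) (measurable_affine c b)).
pose cn : {nonneg R} := NngNum (ltW c0).
have e1 := @ge0_integral_pushforward _ _ _ _ R phi (measurable_affine c b) leb A f mA (measurable_funTS mf) (fun x _ => f0 x).
pose nu : {measure set (measurableTypeR R) -> \bar R} := mscale cn (pushforward leb phi).
transitivity (\int[nu (measurable_affine c b)]_(x in A) f x)%E.
  apply: eq_measure_integral => B mB _; have h := lebesgue_measure_affine b c0 mB.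
  by rewrite [LHS]h.
rewrite ge0_integral_mscale//; last by apply: measurable_funTS.
by rewrite e1.
Qed.

Lemma integral_shift (s : R) (A : set (measurableTypeR R)) (f : measurableTypeR R -> \bar R) :
  measurable A -> measurable_fun setT f ->
  (\int[leb]_(x in A) f x = \int[leb]_(x in (fun x => s + x)%R @^-1` A) f (s + x)%R)%E.
Proof.
move=> mA mf.
have pE : (fun x : R => s + x) = (fun x => 1 * x + s) by apply/funext => x; rewrite mul1r addrC.
have e (g : measurableTypeR R -> \bar R) : measurable_fun setT g -> (forall x, 0 <= g x)%E ->
   (\int[leb]_(x in A) g x = \int[leb]_(x in (fun x => s + x)%R @^-1` A) g (s + x)%R)%E.
  move=> mg g0; rewrite (ge0_integral_affine s ltr01 mA mg g0) mul1e pE.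
  by apply: eq_integral => x _; rewrite mul1r addrC.
rewrite integralE [RHS]integralE.
congr (_ - _)%E.
  rewrite (e f^\+%E)//; last exact: measurable_funepos.
  by apply: eq_integral => x _; rewrite !funeposE.
rewrite (e f^\-%E)//; last exact: measurable_funeneg.
by apply: eq_integral => x _; rewrite !funenegE.
Qed.

Lemma preimage_shift_itv (s x y : R) :
  (fun v => s + v) @^-1` `[s + x, s + y] = `[x, y]%classic.
Proof. by apply/seteqP; split => z /=; rewrite !in_itv/= !lerD2l. Qed.

Lemma integral_shift_unit (s : R) (f : measurableTypeR R -> \bar R) :
  measurable_fun setT f ->
  (\int[leb]_(x in `[s, (s + 1)%R]) f x = \int[leb]_(v in `[0%R, 1%R]) f (s + v)%R)%E.
Proof.
move=> mf; rewrite (integral_shift s (measurable_itv _) mf).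
by rewrite -{2}(addr0 s) preimage_shift_itv.
Qed.

Lemma ge0_integral_itv_cat (x y z : R) (f : measurableTypeR R -> \bar R) : x <= y -> y <= z ->
  measurable_fun setT f -> (forall x, 0 <= f x)%E ->
  (\int[leb]_(u in `[x, z]) f u = \int[leb]_(u in `[x, y]) f u + \int[leb]_(u in `[y, z]) f u)%E.
Proof.
move=> xy yz mf f0.
rewrite [X in (_ + X)%E](_ : _ = \int[leb]_(u in `]y, z]) f u)%E; last first.
  rewrite -integral_itv_obnd_cbnd//; exact: measurable_funTS.
have -> : `[x, z]%classic = `[x, y]%classic `|` `]y, z]%classic.
  by rewrite -itv_bndbnd_setU// bnd_simp.
rewrite ge0_integral_setU//=; first exact: measurable_funTS.
apply/disj_set2P; rewrite -subset0 => u [/=]; rewrite !in_itv/= => /andP[_ uy] /andP[yu _].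
by move: (lt_le_trans yu uy); rewrite ltxx.
Qed.

Lemma Rintegral_itv_cat (x y z : R) (f : measurableTypeR R -> R) : x <= y -> y <= z ->
  leb.-integrable `[x, z] (EFin \o f) ->
  \int[leb]_(u in `[x, z]) f u = \int[leb]_(u in `[x, y]) f u + \int[leb]_(u in `[y, z]) f u.
Proof.
move=> xy yz intf.
have h := @Rintegral_itvB R f (BLeft x) (BRight z) y intf.
rewrite !bnd_simp in h; have {}h := h xy yz.
have iyz : leb.-integrable `]y, z] (EFin \o f).
  apply: integrableS intf; [exact: measurable_itv|exact: measurable_itv|].
  by move=> u /=; rewrite !in_itv/= => /andP[yu ->]; rewrite andbT (le_trans xy)// ltW.
have e : \int[leb]_(u in `]y, z]) f u = \int[leb]_(u in `[y, z]) f u.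
  exact: Rintegral_itv_obnd_cbnd iyz.
by rewrite -e -[X in _ = _ + X]h addrC subrK.
Qed.

Lemma ge0_integral_itv_sum (s : R) (t : nat) (f : measurableTypeR R -> \bar R) :
  measurable_fun setT f -> (forall x, 0 <= f x)%E ->
  (\int[leb]_(u in `[s, (s + t%:R)%R]) f u =
   \sum_(k < t) \int[leb]_(v in `[0%R, 1%R]) f (s + k%:R + v)%R)%E.
Proof.
move=> mf f0; elim: t => [|t IH].
  rewrite big_ord0 addr0 set_itv1 integral_set1//.
rewrite big_ord_recr/= -IH (@ge0_integral_itv_cat s (s + t%:R))//; last 2 first.
- by rewrite lerDl.
- by rewrite lerD2l ler_nat.
congr (_ + _)%E; rewrite -natr1 addrA integral_shift_unit//.
Qed.

(** Folding onto [0, 1]: the integral of a path becomes an average over the shift v of a sum of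
    values one unit apart, the quantity that the domination controls. *)
Lemma Rintegral_itv_sum (s : R) (t : nat) (f : measurableTypeR R -> R) :
  measurable_fun setT f -> leb.-integrable `[s, s + t%:R] (EFin \o f) ->
  \int[leb]_(u in `[s, s + t%:R]) f u =
  \int[leb]_(v in `[0, 1]) (\sum_(k < t) f (s + k%:R + v)).
Proof.
move=> mf intf.
have mEf : measurable_fun setT (fun u => (f u)%:E) by exact/measurable_EFinP.
have mfs k : measurable_fun setT (fun v : measurableTypeR R => f (s + k%:R + v)).
  by apply: (measurableT_comp mf); exact: measurable_funD.
have ik (k : 'I_t) : leb.-integrable `[0, 1] (EFin \o (fun v => f (s + k%:R + v))).
  apply/integrableP; split; first by apply/measurable_EFinP/measurable_funTS.
  have /integrableP[_] := intf; apply: le_lt_trans.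
  rewrite [X in (_ <= X)%E]ge0_integral_itv_sum//; last by apply: measurableT_comp.
  rewrite (bigD1 k)//= leeDl// sume_ge0// => i _; exact: integral_ge0.
have pE (g : measurableTypeR R -> \bar R) : (forall x, 0 <= g x)%E -> measurable_fun setT g ->
   (\int[leb]_(u in `[s, (s + t%:R)%R]) g u =
   \sum_(k < t) \int[leb]_(v in `[0%R, 1%R]) g (s + k%:R + v)%R)%E.
  by move=> g0 mg; exact: ge0_integral_itv_sum.
rewrite /Rintegral integralE !pE//; do ?[exact: measurable_funepos|exact: measurable_funeneg].
have mI : measurable (`[0, 1]%classic : set (measurableTypeR R)) by exact: measurable_itv.
have fp (k : 'I_t) : (\int[leb]_(v in `[0%R, 1%R]) ((EFin \o f)^\+ (s + k%:R + v)%R) \is a fin_num)%E.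
  have := integrable_fin_num mI (integrable_funepos mI (ik k)); congr (_ \is a fin_num).
  by apply: eq_integral => v _; rewrite !funeposE.
have fn (k : 'I_t) : (\int[leb]_(v in `[0%R, 1%R]) ((EFin \o f)^\- (s + k%:R + v)%R) \is a fin_num)%E.
  have := integrable_fin_num mI (integrable_funeneg mI (ik k)); congr (_ \is a fin_num).
  by apply: eq_integral => v _; rewrite !funenegE.
rewrite -sumeN; last first.
  by move=> i j _ _; rewrite fin_num_adde_defl// fin_numN fn.
rewrite -big_split/=.
transitivity (fine (\sum_(k < t) \int[leb]_(v in `[0%R, 1%R]) (f (s + k%:R + v)%R)%:E)%E).
  congr fine; apply: eq_bigr => k _; rewrite [RHS]integralE; congr (_ - _)%E.
    by apply: eq_integral => v _; rewrite !funeposE.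
  by apply: eq_integral => v _; rewrite !funenegE.
congr fine; rewrite -integral_sum//.
by apply: eq_integral => v _; rewrite sumEFin.
Qed.

End affine_invariance.

(** * Tails and means of symmetrized blocks *)

Section supOU_tails.
Context (R : realType) (d : measure_display) (T : measurableType d).
Variables (P : probability T R) (a : R).
Variables (mu : {finite_measure set (measurableTypeR R) -> \bar R})
  (lam : {sigma_finite_measure set (measurableTypeR R) -> \bar R}).
Variables (Lam : set (plane R) -> T -> R) (X : R -> T -> R).
Hypotheses (lam_levy : is_levy_measure lam)
  (Lam_basis : is_levy_basis P a 0 lam mu Lam) (X_supOU : is_supOU P mu Lam X).
Variables (p al : R).
Hypotheses (p0 : 0 < p) (p1 : p <= 1) (large_p : (large_moment lam p < +oo)%E)
  (al0 : 0 <= al) (origin_al : (origin_moment mu al < +oo)%E).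
Local Notation W := (symmetrized X).
Local Notation P2 := (square_prob P).
Local Notation leb := (@lebesgue_measure R).

(* The domination argument needs bounds valid for all v, not only on [0, 1]. *)
Definition unit_clamp (v : R) : R := Num.min 1 (Num.max v 0).

Lemma unit_clamp_itv v : 0 <= unit_clamp v <= 1.
Proof. by rewrite /unit_clamp le_min ler01 le_max lexx orbT/= ge_min lexx. Qed.

Lemma unit_clamp_id v : 0 <= v <= 1 -> unit_clamp v = v.
Proof. by move=> /andP[v0 v1]; rewrite /unit_clamp max_l// min_r. Qed.

(** The scale r is put into the coefficients, so that the fixed threshold 9 of [prob_mean_norm_gt]
    becomes the threshold 9 r for the sum. *)
Definition block_comb (t : nat) (s0 r v : R) : seq (R * R) :=
  [seq (r^-1, s0 + k%:R + unit_clamp v) | k <- iota 0 t].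

Lemma lincomb_block t s0 r v (y : R -> R) :
  lincomb (block_comb t s0 r v) y = r^-1 * \sum_(k < t) y (s0 + k%:R + unit_clamp v).
Proof.
rewrite /lincomb big_map mulr_sumr -{1}(subn0 t) -/(index_iota 0 t) big_mkord.
exact: eq_bigr.
Qed.

Lemma measurable_lincomb_block d' (E : measurableType d') t s0 r (Y : R -> E -> R) :
  measurable_fun setT (fun q : measurableTypeR R * E => Y q.1 q.2) ->
  measurable_fun setT (fun q : measurableTypeR R * E =>
    lincomb (block_comb t s0 r q.1) (fun u => Y u q.2)).
Proof.
move=> mY; under eq_fun do rewrite lincomb_block.
apply: measurable_funM => //; apply: measurable_sum => k.
apply: (measurableT_comp mY (g := fun q : measurableTypeR R * E => (s0 + k%:R + unit_clamp q.1, q.2))).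
apply: measurable_fun_pair; last exact: measurable_snd.
apply: measurable_funD => //; apply: measurable_minr => //; apply: measurable_maxr => //.
Qed.

Lemma lincomb_block_kernel_le t s0 r v (e : plane R * measurableTypeR R) : 0 < r -> exists y,
  [/\ lincomb (block_comb t s0 r v) (fun u => jump_kernel u e) = e.2 * y, 0 <= y
    & y <= envelope t s0 e.1 / r].
Proof.
move=> r0; exists (r^-1 * (\sum_(k < t) supOU_kernel (s0 + k%:R + unit_clamp v) e.1 * (0 < e.1.1)%R%:R)).
have ri : 0 <= r^-1 by rewrite invr_ge0 ltW.
split.
- rewrite lincomb_block mulrCA; congr (_ * _); rewrite mulr_sumr.
  by apply: eq_bigr => k _; rewrite /jump_kernel.
- by rewrite mulr_ge0// sumr_ge0// => k _; rewrite mulr_ge0// supOU_kernel_ge0.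
rewrite mulrC ler_wpM2r// -mulr_suml; have [e0|e0] := ltP 0 e.1.1.
  by rewrite mulr1; apply: sum_kernel_le => //; exact: unit_clamp_itv.
by rewrite mulr0 envelope_ge0.
Qed.

Section power_bounds.
Variables (p1' p2' g1 g2 : R).
Hypotheses (p10 : 0 < p1') (p12 : p1' <= 2) (p20 : 0 < p2') (p22 : p2' <= 2)
  (g11 : 1 <= g1) (g21 : 1 <= g2) (pg1 : p1' - al <= g1) (pg2 : p2' - al <= g2)
  (small_p1 : (small_moment lam p1' < +oo)%E) (large_p2 : (large_moment lam p2' < +oo)%E).

Let bound (t : nat) (r : R) := t%:R `^ g1 * r `^ (- p1') + t%:R `^ g2 * r `^ (- p2').

Let mW : measurable_fun setT (fun q : measurableTypeR R * (T * T) => W q.1 q.2).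
Proof. exact: measurable_symmetrized X_supOU. Qed.

Let mWu u : measurable_fun setT (W u).
Proof. by have := measurableT_comp mW (measurable_pair1 (u : measurableTypeR R)); exact. Qed.

Let mku u : measurable_fun setT (@jump_kernel R u).
Proof.
by have := measurableT_comp (@measurable_jump_kernel R) (measurable_pair1 (u : measurableTypeR R)); exact.
Qed.

Let LK : dominated_functional P2 (jump_control mu lam) W (@jump_kernel R) (fun=> 1).
Proof. exact: (symmetrized_dominated lam_levy Lam_basis X_supOU p0 p1 large_p al0 origin_al). Qed.

Lemma measurable_two_power_envelope t s0 r : measurable_fun setT
  (fun e : plane R * measurableTypeR R => two_power p1' p2' (envelope t s0 e.1 / r) e.2).
Proof.
apply: measurable_two_power; last exact: measurable_snd.
apply: measurable_funM => //.
by apply: (measurableT_comp (@measurable_envelope R t s0)); exact: measurable_fst.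
Qed.

(** The law [Q] of the shift is left free: a Dirac mass gives tails at a single time, the uniform
    law on [0, 1] those of integrals over blocks. On the jump side the combination is z times a
    nonnegative factor below envelope / r, whence the integrand [two_power]. *)
Lemma symmetrized_tail : exists2 C, 0 <= C &
  forall (Q : probability (measurableTypeR R) R) t s0 r, (0 < t)%N -> 0 < r ->
  (P2 [set w | 9%:E < \int[Q]_v `|lincomb (block_comb t s0 r v) (fun u => W u w)|%:E] <=
    (C * bound t r)%:E)%E.
Proof.
have [C C0 hC] := integral_two_power_le al0 p10 p20 g11 g21 pg1 pg2 origin_al small_p1 large_p2.
exists (6 * C); first by rewrite mulr_ge0.
move=> Q t s0 r t0 r0.
apply: le_trans (prob_mean_norm_gt mWu mku LK Q (f := block_comb t s0 r) _ _
   (measurable_two_power_envelope t s0 r) _) _.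
- exact: measurable_lincomb_block.
- apply: measurable_lincomb_block; exact: measurable_jump_kernel.
- move=> v e; have [y [-> y0 yE]] := lincomb_block_kernel_le t s0 v e r0.
  have yE0 := le_trans y0 yE.
  apply: (@le_trans _ _ (Num.min 1 ((e.2 * (envelope t s0 e.1 / r)) ^+ 2))).
    rewrite le_min ge_min lexx/= ge_min; apply/orP; right.
    by rewrite [leLHS]exprMn [leRHS]exprMn ler_wpM2l ?sqr_ge0// lerXn2r ?nnegrE.
  by apply: two_power_min_sqr => //; rewrite ltW.
by rewrite -mulrA EFinM; apply: lee_wpmul2l; [rewrite lee_fin|exact: hC].
Qed.

(** Exponents at least 1 are required so that |w| <= |w|^p for |w| >= 1. The constant multiplies the
    16 of [mean_norm_le] by the 4 of the linear bound on the weight. *)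
Lemma symmetrized_mean : 1 <= p1' -> 1 <= p2' -> exists2 C, 0 <= C &
  forall t s0 r v, (0 < t)%N -> 0 < r ->
  (\int[P2]_w `|lincomb (block_comb t s0 r v) (fun u => W u w)|%:E <= (1 + C * bound t r)%:E)%E.
Proof.
move=> p11 p21.
have [C C0 hC] := integral_two_power_le al0 p10 p20 g11 g21 pg1 pg2 origin_al small_p1 large_p2.
exists (16 * 4 * C); first by rewrite mulr_ge0.
move=> t s0 r v t0 r0.
apply: le_trans (mean_norm_le mWu mku LK (l := block_comb t s0 r v)
   (b := fun e => 4 * two_power p1' p2' (envelope t s0 e.1 / r) e.2) _ _) _.
- apply: measurable_funM => //; exact: measurable_two_power_envelope.
- move=> e; have [y [-> y0 yE]] := lincomb_block_kernel_le t s0 v e r0.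
  have yE0 := le_trans y0 yE.
  apply: (@le_trans _ _ (Num.min ((e.2 * (envelope t s0 e.1 / r)) ^+ 2) (4 * `|e.2 * (envelope t s0 e.1 / r)|))).
    rewrite le_min; apply/andP; split; rewrite ge_min; apply/orP; [left|right].
      by rewrite [leLHS]exprMn [leRHS]exprMn ler_wpM2l ?sqr_ge0// lerXn2r ?nnegrE.
    by rewrite ler_pM2l// (normrM _ y) (normrM _ (_ / _)) (ger0_norm y0) (ger0_norm yE0) ler_wpM2l.
  by apply: two_power_min_norm => //; rewrite ?p11 ?p21.
rewrite [leRHS]EFinD; apply: leeD2l; rewrite -!mulrA [leRHS]EFinM; apply: lee_wpmul2l; first by rewrite lee_fin.
under eq_integral do rewrite EFinM.
rewrite ge0_integralZl//; last 2 first.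
- by apply/measurable_EFinP; exact: measurable_two_power_envelope.
- by move=> e _; rewrite lee_fin two_power_ge0.
by rewrite [leRHS]EFinM; apply: lee_wpmul2l; [rewrite lee_fin|exact: hC].
Qed.

End power_bounds.
End supOU_tails.

Lemma measure_gt_le d (T : measurableType d) (R : realType) (m : {measure set T -> \bar R})
    (f : T -> \bar R) (c : R) : 0 < c -> measurable_fun setT f -> (forall x, 0 <= f x)%E ->
  (c%:E * m [set x | c%:E < f x] <= \int[m]_x f x)%E.
Proof.
move=> c0 mf f0.
have mA : measurable [set x | c%:E < f x]%E.
  by rewrite -[X in measurable X]setTI; apply: emeasurable_fun_o_infty.
set A := [set x | _] in mA *.
have -> : (m A = \int[m]_x (\1_A x)%:E)%E by rewrite integral_indic// setIT.
rewrite -ge0_integralZl//; last 2 first.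
- by apply/measurable_EFinP; exact: measurable_indic.
- by rewrite lee_fin ltW.
apply: ge0_le_integral => //.
- by move=> x _; rewrite mule_ge0 ?lee_fin ?(ltW c0).
- by apply: measurable_funeM; apply/measurable_EFinP; exact: measurable_indic.
move=> x _; rewrite indicE; have [h|h] := boolP (x \in _); last by rewrite mule0.
by rewrite mule1 ltW//; have := set_mem h.
Qed.

Lemma measurable_gtr d (T : measurableType d) (R : realType) (f : T -> R) (c : R) :
  measurable_fun setT f -> measurable [set x | c < f x].
Proof.
move=> mf; have -> : [set x | c < f x] = setT `&` f @^-1` `]c, +oo[.
  by rewrite setTI; apply/seteqP; split => x /=; rewrite in_itv/= andbT.
exact: mf.
Qed.

(** Markov's inequality for the probability of the section, whose mean is the probability of [A]. *)
Lemma square_section_le d (T : measurableType d) (R : realType) (P : probability T R)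
    (A : set (T * T)) (c : R) : 0 < c -> measurable A ->
  (c%:E * P [set w1 | (c%:E < P (xsection A w1))%E] <= square_prob P A)%E.
Proof.
move=> c0 mA; rewrite [leRHS]/(square_prob P A)/=.
apply: (measure_gt_le (f := fun w => P (xsection A w)) P c0) => //.
exact: measurable_fun_xsection.
Qed.

(** * Uniform tightness without symmetrization *)

Section supOU_tightness.
Context (R : realType) (d : measure_display) (T : measurableType d).
Variables (P : probability T R) (a : R).
Variables (mu : {finite_measure set (measurableTypeR R) -> \bar R})
  (lam : {sigma_finite_measure set (measurableTypeR R) -> \bar R}).
Variables (Lam : set (plane R) -> T -> R) (X : R -> T -> R).
Hypotheses (lam_levy : is_levy_measure lam)
  (Lam_basis : is_levy_basis P a 0 lam mu Lam) (X_supOU : is_supOU P mu Lam X).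
Variables (p al : R).
Hypotheses (p0 : 0 < p) (p1 : p <= 1) (large_p : (large_moment lam p < +oo)%E)
  (al0 : 0 <= al) (origin_al : (origin_moment mu al < +oo)%E).
Local Notation W := (symmetrized X).
Local Notation P2 := (square_prob P).
Local Notation m := (mu \x @lebesgue_measure R)%E.
Local Notation D := (@half_plane R).

Let mX u : measurable_fun setT (X u).
Proof. exact: supOU_measurable X_supOU u. Qed.

(** Uniform in u, because the moments of the envelope of a single time are bounded independently of
    its position. With A and B the integrated rates, the mean is 1 - e^A cos B <= |A| + |B|; and th
    and th^2 are at most th^p since th <= 1 and p <= 1. *)
Lemma onem_cos_supOU_le : exists2 C, 0 <= C & forall th u, 0 < th <= 1 ->
  \int[P]_w (1 - cos (th * X u w)) <= C * th `^ p.
Proof.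
have p01 : 0 <= p <= 1 by rewrite (ltW p0).
have [C C0 hC] := rate_le a lam_levy p01 large_p.
have env q : 0 < q -> exists2 B, 0 <= B & forall u,
    (\int[m]_x (envelope 1 u x `^ q)%:E <= B%:E)%E.
  move=> q0; have g1 : 1 <= Num.max 1 (q - al) by rewrite le_max lexx.
  have g2 : q - al <= Num.max 1 (q - al) by rewrite le_max lexx orbT.
  have [B B0 hB] := integral_envelope_le al0 q0 g1 g2 origin_al.
  by exists B => // u; apply: le_trans (hB 1%N u isT) _; rewrite powR1 mulr1.
have [B1 B10 hB1] := env 1 ltr01.
have [B2 B20 hB2] := env 2 (ltr0Sn _ _).
have [B3 B30 hB3] := env p p0.
exists (2 * (C * (B1 + B2 + B3))); first by rewrite !mulr_ge0// !addr_ge0.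
move=> th u /andP[th0 th1].
have thp : 0 <= th `^ p := powR_ge0 _ _.
have th_le : th <= th `^ p.
  by rewrite -{1}(powRr1 (ltW th0)) ger_powR// th0.
have th2_le : th ^+ 2 <= th `^ p by rewrite expr2; nra.
have [hc _] := supOU_char lam_levy Lam_basis X_supOU p0 p1 large_p al0 origin_al [:: (th, u)].
have lE (y : R -> R) : lincomb [:: (th, u)] y = th * y u by rewrite /lincomb big_seq1.
have cE : \int[P]_w cos (th * X u w) = \int[P]_w cos (lincomb [:: (th, u)] (fun v => X v w)).
  by apply: eq_Rintegral => w _; rewrite lE.
rewrite -cE {cE} in hc.
pose k (q : plane R) := lincomb [:: (th, u)] (fun v => supOU_kernel v q).
have rate_bound (r : R -> R) : continuous r ->
   (forall y, `|r y| <= C * (`|y| + y ^+ 2 + `|y| `^ p)) ->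
   `|\int[m]_(q in D) r (k q)| <= C * (B1 + B2 + B3) * th `^ p.
  move=> cr hr.
  have ir : m.-integrable D (EFin \o (fun q => r (k q))).
    by apply: (integrable_rate p0 al0 origin_al [:: (th, u)] cr); exists C.
  apply: (le_trans (le_normr_Rintegral (@measurable_half_plane R) ir)).
  rewrite -lee_fin fineK; last first.
    by apply: integrable_fin_num; [exact: measurable_half_plane|exact: integrable_norm].
  have menv q : measurable_fun setT (fun x : plane R => (envelope 1 u x `^ q)%:E).
    apply/measurable_EFinP; apply: (measurableT_comp (measurable_powR q)).
    exact: measurable_envelope.
  apply: (@le_trans _ _ (\int[m]_x ((C * th `^ p)%:E * ((envelope 1 u x `^ 1)%:E + (envelope 1 u x `^ 2)%:E + (envelope 1 u x `^ p)%:E)))%E).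
    rewrite integral_mkcond; apply: ge0_le_integral => //.
    - by move=> x _; rewrite patchE; case: ifP => // _; rewrite lee_fin.
    - apply/measurable_restrict; rewrite ?setTI//; first exact: measurable_half_plane.
      by apply/measurable_EFinP; apply: measurableT_comp => //; case/integrableP: ir => /measurable_EFinP.
    - by apply: measurable_funeM; apply: emeasurable_funD => //; apply: emeasurable_funD.
    - move=> x _; have e0 : 0 <= C * th `^ p * (envelope 1 u x `^ 1 + envelope 1 u x `^ 2 + envelope 1 u x `^ p).
        by rewrite !mulr_ge0// !addr_ge0// powR_ge0.
      rewrite patchE -!EFinD -EFinM; case: ifPn => [/set_mem x0|_]; last by rewrite lee_fin.
      rewrite lee_fin (le_trans (hr _))// -mulrA ler_wpM2l//.
      have ken : `|k x| <= th * envelope 1 u x.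
        rewrite /k lE normrM (ger0_norm (ltW th0)) ler_pM2l// ger0_norm ?supOU_kernel_ge0//.
        have v01 : 0 <= (0:R) <= 1 by rewrite lexx ler01.
        by apply: le_trans (sum_kernel_le 1 u v01 x0); rewrite big_ord1 !addr0.
      have en0 := envelope_ge0 1 u x.
      rewrite (powRr1 en0) (powR_mulrn 2 en0) !mulrDr; apply: lerD; first apply: lerD.
      + by apply: le_trans ken _; rewrite ler_wpM2r.
      + rewrite -real_normK ?num_real//; apply: (@le_trans _ _ ((th * envelope 1 u x) ^+ 2)).
          by apply: lerXn2r; rewrite ?nnegrE//; apply: mulr_ge0 => //; exact: ltW.
        by rewrite exprMn ler_wpM2r ?sqr_ge0.
      + apply: (@le_trans _ _ ((th * envelope 1 u x) `^ p)).
          by apply: ge0_ler_powR; rewrite ?nnegrE ?(ltW p0)//; apply: mulr_ge0 => //; exact: ltW.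
        by rewrite powRM// ltW.
  have pw q x : (0 <= (envelope 1 u x `^ q)%:E)%E by rewrite lee_fin powR_ge0.
  rewrite ge0_integralZl//; last 3 first.
  - by apply: emeasurable_funD => //; apply: emeasurable_funD.
  - by move=> x _; rewrite !adde_ge0.
  - by rewrite lee_fin mulr_ge0.
  rewrite ge0_integralD//; last 2 first.
  - by move=> x _; rewrite !adde_ge0.
  - exact: emeasurable_funD.
  rewrite ge0_integralD//.
  rewrite [leRHS](_ : _ = (C * th `^ p)%:E * (B1%:E + B2%:E + B3%:E))%E; last first.
    by rewrite -!EFinD -EFinM; congr EFin; ring.
  apply: lee_wpmul2l; first by rewrite lee_fin mulr_ge0.
  by rewrite !leeD.
have h1 := rate_bound _ (continuous_rate_re lam_levy) (fun y => (hC y).1).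
have h2 := rate_bound _ (continuous_rate_im lam_levy) (fun y => (hC y).2).
have ic : P.-integrable setT (EFin \o (fun w => cos (th * X u w))).
  apply: (@bounded_integrable _ _ _ _ _ 1); last by move=> w; rewrite cos_sin_bound.
  by apply: measurableT_comp; [exact: measurable_cos|exact: measurable_funM].
have i1 : P.-integrable setT (EFin \o (fun w => 1 : R)).
  by apply: (@bounded_integrable _ _ _ _ _ 1) => // w; rewrite normr1.
rewrite RintegralB// hc Rintegral_cst// mul1r.
have -> : fine (P setT) = 1 by rewrite probability_setT.
move: h1 h2; rewrite /k; set A := \int[_]_(_ in _) _; set B := \int[_]_(_ in _) _ => h1 h2.
have A0 : A <= 0.
  rewrite -oppr_ge0 -lee_fin /A -(integral_jump_kernel a lam_levy p0 p1 large_p al0 origin_al).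
  by apply: integral_ge0 => e _; rewrite lee_fin onem_cos_ge0.
have eA := expR_ge1Dx A; have cB := onem_cos_min B.
have mB : Num.min 1 (B ^+ 2) <= `|B|.
  have := min_sqr_powR (p := 1) (w := `|B|); rewrite powRr1//.
  by rewrite real_normK ?num_real//; apply => //; rewrite ler01 ler1n.
have cB2 := onem_cos_le2 B; have cBs := onem_cos_le_sqr B.
have cB1 : 1 - cos B <= `|B|.
  rewrite -cos_normr; have := onem_cos_le_sqr `|B|; have := onem_cos_le2 `|B|.
  have := normr_ge0 B; rewrite expr2; nra.
have eA0 := expR_gt0 A; have eA1 : expR A <= 1 by rewrite expR_le1.
have cBm := cos_le1 B; have nB := normr_ge0 B.
have : `|A| = - A by rewrite ler0_norm.
nra.
Qed.

(* Some section of X - X' is small with large probability, so X u is within s of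
   a constant c; if |c| were large, 1 - cos (th X u) would not be small for th of
   order 1 / |c|, against onem_cos_supOU_le. *)
Lemma supOU_tight (s : R) : 0 < s ->
  (forall u, P2 [set w | (s < `|W u w|)%R] <= (64^-1)%:E)%E ->
  exists2 K, 0 < K & forall u, (P [set w | (K < `|X u w|)%R] <= (8^-1)%:E)%E.
Proof.
move=> s0 hs; have [C C0 hC] := onem_cos_supOU_le.
(* Up to the frequency [th0] the mean of 1 - cos is at most 1/4. *)
have [th0 th01 hth0] : exists2 th0, 0 < th0 <= 1 & C * th0 `^ p <= 4^-1.
  pose y := Num.min 1 ((4 * (C + 1))^-1).
  have y0 : 0 < y by rewrite lt_min ltr01 invr_gt0 mulr_gt0// ltr_wpDl.
  have y1 : y <= 1 by rewrite ge_min lexx.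
  exists (y `^ p^-1).
    rewrite powR_gt0//=.
    rewrite -(powRr0 y) ger_powR ?y0//= invr_ge0 ltW//.
  rewrite -powRrM mulVf ?gt_eqF// powRr1 ?(ltW y0)//.
  have : y <= (4 * (C + 1))^-1 by rewrite ge_min lexx orbT.
  rewrite invfM => yC; have c1 : C * (C + 1)^-1 <= 1.
    by rewrite ler_pdivrMr ?ltr_wpDl// mul1r lerDl.
  have : C * y <= C * (4^-1 * (C + 1)^-1) by rewrite ler_wpM2l.
  by lra.
have /andP[th0p th0le] := th01.
(* The first term makes s small against |c|; the second keeps the test frequency 3 / (2 |c|) below
   [th0]. *)
exists (Num.max (3 * s) (3 / (2 * th0))).
  by rewrite lt_max mulr_gt0.
move=> u.
set K := Num.max _ _.
pose A := [set w : T * T | s < `|W u w|].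
have mW : measurable_fun setT (fun w : T * T => W u w).
  have := measurableT_comp (measurable_symmetrized X_supOU) (measurable_pair1 (u : measurableTypeR R)); exact.
have mA : measurable A by apply: measurable_gtr; exact: measurableT_comp.
have e8 : 0 < (8:R)^-1 by rewrite invr_gt0.
have h1 := square_section_le P e8 mA.
(* 64 = 8 * 8: sections of probability above 1/8 occur with probability at most 1/8. *)
pose N := [set w1 | ((8:R)^-1%:E < P (xsection A w1))%E].
have PN : (P N <= (8^-1)%:E)%E.
  have : ((8^-1)%:E * P N <= (64^-1)%:E)%E by apply: le_trans h1 (hs u).
  rewrite -lee_pdivlMl// -EFinM => /le_trans; apply; rewrite lee_fin; lra.
have mN : measurable N.
  have mf : measurable_fun setT (P \o xsection A) by exact: measurable_fun_xsection.
  by have := emeasurable_fun_o_infty measurableT mf (8^-1)%:E; rewrite setTI; exact.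
apply: le_trans PN; apply: le_measure; rewrite ?inE//.
  by apply: measurable_gtr; exact: measurableT_comp.
move=> w /= Kc; apply: contrapT => /negP; rewrite -leNgt => PE.
set c := X u w in Kc.
have c0 : 0 < `|c| by apply: lt_trans Kc; rewrite /K lt_max mulr_gt0.
have Kc1 : 3 * s < `|c| by apply: le_lt_trans Kc; rewrite /K le_max lexx.
have Kc2 : 3 / (2 * th0) < `|c| by apply: le_lt_trans Kc; rewrite /K le_max lexx orbT.
(* Then th |c| = 3/2 and th s <= 1/2, so th |X u| lies in [1, 2] off the bad section, where 1 - cos
   >= 3/8. *)
pose th := 3 / (2 * `|c|).
have thp : 0 < th by rewrite divr_gt0// mulr_gt0.
have thth : th < th0.
  rewrite /th ltr_pdivrMr ?mulr_gt0//; move: Kc2; rewrite ltr_pdivrMr ?mulr_gt0//; nra.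
have thc : th * `|c| = 3 / 2 by rewrite /th; field; exact: lt0r_neq0.
have ths : th * s <= 2^-1 by nra.
pose E := xsection A w.
have mE : measurable E by exact: measurable_xsection.
have low w' : (3 / 8) * \1_(~` E) w' <= 1 - cos (th * X u w').
  rewrite indicE; have [h|_] := boolP (w' \in ~` E); last by rewrite mulr0 onem_cos_ge0.
  rewrite mulr1; move: (set_mem h) => {}h.
  have {}h : `|c - X u w'| <= s.
    rewrite leNgt; apply/negP => h'; apply: h; rewrite /E /xsection/=; apply/mem_set.
    exact: h'.
  have l1 : `|c| <= `|X u w'| + s.
    have := ler_normD (X u w') (c - X u w'); rewrite addrC subrK; lra.
  have l2 : `|X u w'| <= `|c| + s.
    have := ler_normD c (X u w' - c); rewrite addrC subrK distrC; lra.
  rewrite -cos_normr normrM (ger0_norm (ltW thp)); apply: onem_cos_ge; nra.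
have mc : measurable_fun setT (fun w' => 1 - cos (th * X u w')).
  apply: measurable_funB => //; apply: measurableT_comp; first exact: measurable_cos.
  exact: measurable_funM.
have i1 : P.-integrable setT (EFin \o (fun w' => 1 - cos (th * X u w'))).
  apply: (@bounded_integrable _ _ _ _ _ 2) => // w'.
  by rewrite ger0_norm ?onem_cos_ge0// onem_cos_le2.
have i2 : P.-integrable setT (EFin \o \1_(~` E)).
  apply: (@bounded_integrable _ _ _ _ _ 1); first exact/measurable_indic/measurableC.
  by move=> w'; rewrite indicE; case: (_ \in _); rewrite ?normr0 ?normr1.
have i3 : P.-integrable setT (EFin \o (fun w' => 3 / 8 * \1_(~` E) w')).
  have hh := integrableZl measurableT (3 / 8) i2; exact: hh.
have ub := hC th u; rewrite thp (le_trans (ltW thth))//= in ub.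
have {}ub := ub isT.
(* The complement of the section has probability at least 7/8, so the mean would be at least 21/64 >
   1/4. *)
have : 3 / 8 * \int[P]_w' \1_(~` E) w' <= \int[P]_w' (1 - cos (th * X u w')).
  by rewrite -RintegralZl//; apply: le_Rintegral.
have -> : \int[P]_w' \1_(~` E) w' = 1 - fine (P E).
  rewrite /Rintegral integral_indic//; last exact: measurableC.
  rewrite setIT; have := probability_setC P mE => /= ->.
  by rewrite fineB// fin_num_measure.
have PEf : fine (P E) <= 8^-1.
  by rewrite -lee_fin fineK// fin_num_measure.
have : C * th `^ p <= C * th0 `^ p.
  by rewrite ler_wpM2l// ge0_ler_powR ?nnegrE ?(ltW p0) ?(ltW thp) ?(ltW th0p) ?(ltW thth).
move: ub; lra.
Qed.

End supOU_tightness.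

Section parametric_integrals.
Context (R : realType) d (T : measurableType d).
Local Notation leb := (@lebesgue_measure R).

Lemma ge0_measurable_integral_param (A : set (measurableTypeR R))
    (f : measurableTypeR R * T -> \bar R) : measurable A ->
  measurable_fun setT f -> (forall q, 0 <= f q)%E ->
  measurable_fun setT (fun w => \int[leb]_(u in A) f (u, w))%E.
Proof.
move=> mA mf f0.
have -> : (fun w => \int[leb]_(u in A) f (u, w))%E =
   (fun w => \int[leb]_u (f (u, w) * (\1_A u)%:E))%E.
  apply/funext => w; rewrite integral_mkcond; apply: eq_integral => u _.
  by rewrite patchE indicE; case: ifP; rewrite ?mule1 ?mule0.
apply: (@measurable_fun_fubini_tonelli_G _ _ _ _ _ leb (fun q => f q * (\1_A q.1)%:E)%E) => //.
- apply: emeasurable_funM => //; apply/measurable_EFinP.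
  apply: (@measurableT_comp _ _ _ _ _ _ (\1_A : measurableTypeR R -> R)); last exact: measurable_fst.
  exact: measurable_indic.
- by move=> q; rewrite mule_ge0// lee_fin.
Qed.

Lemma ge0_integral_exchange (m : {sigma_finite_measure set T -> \bar R})
    (A : set (measurableTypeR R)) (f : measurableTypeR R * T -> \bar R) : measurable A ->
  measurable_fun setT f -> (forall q, 0 <= f q)%E ->
  (\int[leb]_(u in A) \int[m]_w f (u, w) = \int[m]_w \int[leb]_(u in A) f (u, w))%E.
Proof.
move=> mA mf f0.
have m1A : measurable_fun setT (fun q : measurableTypeR R * T => (\1_A q.1)%:E : \bar R).
  apply/measurable_EFinP.
  apply: (@measurableT_comp _ _ _ _ _ _ (\1_A : measurableTypeR R -> R)); last exact: measurable_fst.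
  exact: measurable_indic.
transitivity (\int[leb]_u \int[m]_w (f (u, w) * (\1_A u)%:E))%E.
  rewrite integral_mkcond; apply: eq_integral => u _; rewrite patchE.
  case: ifPn => uA.
    by apply: eq_integral => w _; rewrite indicE uA mule1.
  by rewrite integral0_eq// => w _; rewrite indicE (negbTE uA) mule0.
rewrite (@fubini_tonelli _ _ _ _ _ leb m (fun q => f q * (\1_A q.1)%:E)%E)//.
- apply: eq_integral => w _; rewrite [RHS]integral_mkcond; apply: eq_integral => u _.
  by rewrite patchE indicE; case: ifP; rewrite ?mule1 ?mule0.
- exact: emeasurable_funM.
- by move=> q; rewrite mule_ge0// lee_fin.
Qed.

Lemma measurable_integral_param (A : set (measurableTypeR R))
    (f : measurableTypeR R * T -> R) : measurable A -> measurable_fun setT f ->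
  measurable_fun setT (fun w => \int[leb]_(u in A) f (u, w)).
Proof.
move=> mA mf; have mEf : measurable_fun setT (EFin \o f) by exact/measurable_EFinP.
apply: (measurableT_comp (fine_measurable _)) => //.
have -> : (fun w => \int[leb]_(u in A) (f (u, w))%:E)%E =
   (fun w => \int[leb]_(u in A) (EFin \o f)^\+ (u, w) - \int[leb]_(u in A) (EFin \o f)^\- (u, w))%E.
  apply/funext => w; rewrite integralE; congr (_ - _)%E.
    by apply: eq_integral => u _; rewrite !funeposE.
  by apply: eq_integral => u _; rewrite !funenegE.
by apply: emeasurable_funB; apply: ge0_measurable_integral_param => //;
  [exact: measurable_funepos|exact: measurable_funeneg].
Qed.

End parametric_integrals.

(** * Removing the symmetrization *)

Section desymmetrization.
Context (R : realType) d (T : measurableType d) (P : probability T R).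

(** With probability at least 1/2 an independent w' has Y w' <= K, and then Y w > r + K forces Z (w,
    w') > r: up to null sets, the rectangle of {Y > r + K} and {Y <= K} lies in {Z > r}. [D] is the
    full event on which Y and Z can be compared. *)
Lemma prob_desym (D : set T) (Y : T -> \bar R) (Z : T * T -> \bar R) (r K : R) :
  measurable D -> P (~` D) = 0%E ->
  measurable_fun setT Y -> measurable_fun setT Z ->
  (forall w w', D w -> D w' -> Y w <= Z (w, w') + Y w')%E ->
  (P [set w | K%:E < Y w] <= 2^-1%:E)%E ->
  (P [set w | (r + K)%:E < Y w] <= 2%:E * square_prob P [set w | r%:E < Z w])%E.
Proof.
move=> mD PD mY mZ YZ PK.
have mgt c : measurable [set w | (c%:E < Y w)%E].
  by have := emeasurable_fun_o_infty measurableT mY c%:E; rewrite setTI; exact.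
have mZr : measurable [set w | (r%:E < Z w)%E].
  by have := emeasurable_fun_o_infty measurableT mZ r%:E; rewrite setTI; exact.
have PID A : measurable A -> P (A `&` D) = P A.
  move=> mA; apply/eqP; rewrite eq_le; apply/andP; split.
    by apply: le_measure; rewrite ?inE//; exact: measurableI.
  have mID : measurable (A `&` D) by exact: measurableI.
  have mCD : measurable (~` D) by exact: measurableC.
  have : (P A <= P ((A `&` D) `|` ~` D))%E.
    apply: le_measure; rewrite ?inE//; first exact: measurableU.
    by move=> x Ax; have [h|h] := pselect (D x); [left|right].
  move/le_trans; apply; apply: (@le_trans _ _ (P (A `&` D) + P (~` D))%E).
    exact: measureU2.
  by rewrite PD adde0.
pose A := [set w | ((r + K)%:E < Y w)%E] `&` D.
pose B := ~` [set w | (K%:E < Y w)%E] `&` D.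
have mA : measurable A by exact: measurableI.
have mB : measurable B by apply: measurableI => //; exact: measurableC.
have PB : ((2^-1)%:E <= P B)%E.
  rewrite PID; last exact: measurableC.
  have := probability_setC P (mgt K) => /= ->; move: PK.
  have : P [set w | (K%:E < Y w)%E] \is a fin_num by exact: fin_num_measure.
  move=> /fineK <-; rewrite !lee_fin; lra.
have sub : A `*` B `<=` [set w | (r%:E < Z w)%E].
  move=> [w w'] /= [[h1 Dw] [h2 Dw']]; rewrite ltNge; apply/negP => h3.
  have {}h2 : (Y w' <= K%:E)%E by rewrite leNgt; exact/negP.
  have := le_trans (YZ w w' Dw Dw') (leeD h3 h2); rewrite -EFinD leNgt h1//.
have h : (P A * P B <= square_prob P [set w | r%:E < Z w])%E.
  rewrite -product_measure1E//; apply: le_measure; rewrite ?inE//.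
  exact: measurableX.
rewrite -(PID _ (mgt _)) -/A -lee_pdivrMl// muleC; apply: le_trans h; exact: lee_wpmul2l.
Qed.

(** Above twice K = k tau one has r - K >= r / 2, which costs the factor 2^q. Below it the second
    term of the constant already makes the bound exceed 1. *)
Lemma desym_tail (D : set T) (Y : T -> \bar R) (Z : T * T -> \bar R) (C q tau k : R) :
  measurable D -> P (~` D) = 0%E ->
  measurable_fun setT Y -> measurable_fun setT Z ->
  (forall w w', D w -> D w' -> Y w <= Z (w, w') + Y w')%E ->
  0 <= C -> 0 < q -> 0 < tau -> 0 < k ->
  (forall r, 0 < r -> (square_prob P [set w | r%:E < Z w] <= (C * (tau / r) `^ q)%:E)%E) ->
  (P [set w | (k * tau)%:E < Y w] <= 2^-1%:E)%E ->
  forall r, 0 < r ->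
  (P [set w | (r%:E < Y w)%E] <= ((2 * C * 2 `^ q + (2 * k) `^ q) * (tau / r) `^ q)%:E)%E.
Proof.
move=> mD PD mY mZ YZ C0 q0 t0 k0 hZ hY r r0; set K := k * tau in hY.
have K0 : 0 < K by rewrite mulr_gt0.
have r10 : 0 <= tau / r by rewrite divr_ge0// ltW.
have [rK|rK] := leP (2 * K) r; last first.
  apply: le_trans (probability_le1 _ _) _.
    by have := emeasurable_fun_o_infty measurableT mY r%:E; rewrite setTI; exact.
  rewrite lee_fin mulrDl -powRM// ?mulr_ge0 ?(ltW k0)//.
  have : 1 <= (2 * k * (tau / r)) `^ q.
    have e1 : 1 `^ q = 1 :> R by rewrite powR1.
    have rK1 : 1 <= 2 * k * (tau / r).
      by rewrite mulrA ler_pdivlMr// mul1r -mulrA ltW.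
    by rewrite -[leLHS]e1 ge0_ler_powR ?nnegrE ?(ltW q0)// (le_trans _ rK1).
  have : 0 <= 2 * C * 2 `^ q * (tau / r) `^ q by rewrite !mulr_ge0 ?powR_ge0.
  lra.
have rK0 : 0 < r - K by lra.
have := prob_desym (r - K) mD PD mY mZ YZ hY.
rewrite subrK => /le_trans; apply.
apply: (@le_trans _ _ (2%:E * (C * (tau / (r - K)) `^ q)%:E)%E).
  by apply: lee_wpmul2l; rewrite ?lee_fin// hZ.
rewrite -EFinM lee_fin [leRHS]mulrDl; apply: (@le_trans _ _ (2 * C * 2 `^ q * (tau / r) `^ q)).
  have rKi : tau / (r - K) <= 2 * (tau / r).
    by rewrite mulrA ler_pdivrMr// mulrAC ler_pdivlMr//; nra.
  have rKi0 : 0 <= tau / (r - K) by rewrite divr_ge0// ltW.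
  rewrite -!mulrA ler_pM2l// ler_wpM2l// -powRM//.
  by rewrite ge0_ler_powR ?nnegrE ?(ltW q0)// mulr_ge0.
by rewrite lerDl mulr_ge0 ?powR_ge0.
Qed.

End desymmetrization.

(** * Masses of the process over unit intervals *)

Section unit_blocks.
Context (R : realType) d (T : measurableType d) (P : probability T R) (X : R -> T -> R).
Hypothesis mX : measurable_fun setT (fun q : measurableTypeR R * T => X q.1 q.2).
Local Notation W := (symmetrized X).
Local Notation P2 := (square_prob P).
Local Notation leb := (@lebesgue_measure R).
Variables (C q H K : R).
Hypotheses (C0 : 0 <= C) (q0 : 0 < q) (K0 : 0 < K).
Hypothesis tailW : forall (t : nat) s0 r, (0 < t)%N -> 0 < r ->
  (P2 [set w | r%:E < \int[leb]_(v in `[0%R, 1%R]) `|\sum_(k < t) W (s0 + k%:R + v) w|%:E] <=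
    (C * (t%:R `^ H / r) `^ q)%:E)%E.
Hypothesis tightX : forall u, (P [set w | (K < `|X u w|)%R] <= (8^-1)%:E)%E.

Definition unit_mass (s : R) (w : T) : \bar R :=
  (\int[leb]_(v in `[0%R, 1%R]) `|X (s + v) w|%:E)%E.

Definition unit_mass_sym (s : R) (w : T * T) : \bar R :=
  (\int[leb]_(v in `[0%R, 1%R]) `|W (s + v) w|%:E)%E.

Let mI : measurable (`[0, 1]%classic : set (measurableTypeR R)).
Proof. exact: measurable_itv. Qed.

Lemma measurable_shifted s : measurable_fun setT
  (fun x : measurableTypeR R * T => X (s + x.1) x.2).
Proof.
apply: (measurableT_comp mX (g := fun x : measurableTypeR R * T => (s + x.1, x.2))).
apply: measurable_fun_pair; last exact: measurable_snd.
by apply: measurable_funD.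
Qed.

Lemma measurable_shifted_sym s : measurable_fun setT
  (fun x : measurableTypeR R * (T * T) => W (s + x.1) x.2).
Proof.
apply: measurable_funB.
  apply: (measurableT_comp (measurable_shifted s) (g := fun x : measurableTypeR R * (T * T) => (x.1, x.2.1))).
  apply: measurable_fun_pair; first exact: measurable_fst.
  by apply: (measurableT_comp (f := fst)); [exact: measurable_fst|exact: measurable_snd].
apply: (measurableT_comp (measurable_shifted s) (g := fun x : measurableTypeR R * (T * T) => (x.1, x.2.2))).
apply: measurable_fun_pair; first exact: measurable_fst.
by apply: (measurableT_comp (f := snd)); [exact: measurable_snd|exact: measurable_snd].
Qed.

Lemma measurable_unit_mass s : measurable_fun setT (unit_mass s).
Proof.
apply: (ge0_measurable_integral_param (f := fun x => `|X (s + x.1) x.2|%:E) mI) => //.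
by apply/measurable_EFinP; apply: measurableT_comp => //; exact: measurable_shifted.
Qed.

Lemma measurable_unit_mass_sym s : measurable_fun setT (unit_mass_sym s).
Proof.
apply: (ge0_measurable_integral_param (f := fun x => `|W (s + x.1) x.2|%:E) mI) => //.
by apply/measurable_EFinP; apply: measurableT_comp => //; exact: measurable_shifted_sym.
Qed.

Lemma measurable_path s w : measurable_fun setT (fun v : measurableTypeR R => X (s + v) w).
Proof.
by have := measurableT_comp (measurable_shifted s) (measurable_pair2 w); exact.
Qed.

Lemma measurable_path_sym s w : measurable_fun setT (fun v : measurableTypeR R => W (s + v) w).
Proof.
by have := measurableT_comp (measurable_shifted_sym s) (measurable_pair2 w); exact.
Qed.

Lemma unit_mass_ge0 s w : (0 <= unit_mass s w)%E.
Proof. by apply: integral_ge0 => v _; rewrite lee_fin. Qed.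

Lemma unit_mass_desym s w w' : (unit_mass s w <= unit_mass_sym s (w, w') + unit_mass s w')%E.
Proof.
have mp := measurable_path s; have mps := measurable_path_sym s.
rewrite /unit_mass /unit_mass_sym -ge0_integralD//; last 2 first.
- by apply/measurable_EFinP/measurable_funTS; apply: measurableT_comp.
- by apply/measurable_EFinP/measurable_funTS; apply: measurableT_comp.
apply: ge0_le_integral => //.
- by apply/measurable_EFinP/measurable_funTS; apply: measurableT_comp.
- by apply: emeasurable_funD; apply/measurable_EFinP/measurable_funTS; apply: measurableT_comp.
- move=> v _; rewrite -EFinD lee_fin /symmetrized/=.
  by rewrite -[X in `|X| <= _](subrK (X (s + v) w')) ler_normD.
Qed.

Lemma unit_mass_sym_tail s r : 0 < r ->
  (P2 [set w | (r%:E < unit_mass_sym s w)%E] <= (C * (1 / r) `^ q)%:E)%E.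
Proof.
move=> r0; have := @tailW 1%N s r isT r0; rewrite powR1; apply: le_trans.
have e w : (\int[leb]_(v in `[0%R, 1%R]) `|\sum_(k < 1) W (s + k%:R + v) w|%:E = unit_mass_sym s w)%E.
  by apply: eq_integral => v _; rewrite big_ord1 addr0.
by under [X in (_ <= P2 X)%E]eq_set do rewrite e.
Qed.

(** Tightness at single times does not bound an integral over times, as the exceptional events vary
    with v. Instead a typical w is compared with many w' at once, and the integrals in v and w' are
    exchanged. *)
Lemma unit_mass_tight : exists2 K2, 0 < K2 &
  forall s, (P [set w | (K2%:E < unit_mass s w)%E] <= (2^-1)%:E)%E.
Proof.
(* 1/16 = 1/8 * 1/2: sections of probability above 1/8 then occur with probability at most 1/2, the
   level that the desymmetrization requires. *)
have [R0 R00 hR0] : exists2 r, 0 < r & C * (1 / r) `^ q <= 16^-1.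
  exists ((16 * (C + 1)) `^ q^-1); first by rewrite powR_gt0// mulr_gt0// ltr_wpDl.
  have c1 : 0 < 16 * (C + 1) by rewrite mulr_gt0// ltr_wpDl.
  rewrite div1r -powRN -powRrM mulNr mulVf ?gt_eqF// powR_inv1 ?(ltW c1)//.
  by rewrite ler_pdivrMr//; lra.
exists (2 * (R0 + K)); first by rewrite mulr_gt0// addr_gt0.
move=> s.
pose A := [set w : T * T | (R0%:E < unit_mass_sym s w)%E].
have mA : measurable A.
  by have := emeasurable_fun_o_infty measurableT (measurable_unit_mass_sym s) R0%:E; rewrite setTI; exact.
have e8 : 0 < (8:R)^-1 by rewrite invr_gt0.
have h1 := square_section_le P e8 mA.
pose N := [set w1 | ((8:R)^-1%:E < P (xsection A w1))%E].
have PN : (P N <= (2^-1)%:E)%E.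
  have : ((8^-1)%:E * P N <= (16^-1)%:E)%E.
    by apply: le_trans h1 _; apply: le_trans (unit_mass_sym_tail s R00) _; rewrite lee_fin.
  rewrite -lee_pdivlMl// -EFinM => /le_trans; apply; rewrite lee_fin; lra.
have mN : measurable N.
  have mf : measurable_fun setT (P \o xsection A) by exact: measurable_fun_xsection.
  by have := emeasurable_fun_o_infty measurableT mf (8^-1)%:E; rewrite setTI; exact.
apply: le_trans PN; apply: le_measure; rewrite ?inE//.
  by have := emeasurable_fun_o_infty measurableT (measurable_unit_mass s) (2 * (R0 + K))%:E; rewrite setTI; exact.
move=> w /= Kc; apply: contrapT => /negP; rewrite -leNgt => PE.
pose G := ~` xsection A w.
have mG : measurable G by apply: measurableC; exact: measurable_xsection.
have PG : ((7 / 8)%:E <= P G)%E.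
  have := probability_setC P (measurable_xsection w mA) => /= ->; move: PE.
  have : P (xsection A w) \is a fin_num by apply: fin_num_measure; exact: measurable_xsection.
  move=> /fineK <-; rewrite !lee_fin; lra.
have mXu u : measurable_fun setT (X u).
  by have := measurableT_comp mX (measurable_pair1 (u : measurableTypeR R)); exact.
pose F (v : R) (w' : T) : \bar R := ((\1_G w') * `|W (s + v) (w, w')|)%:E.
have mF : measurable_fun setT (fun x : measurableTypeR R * T => F x.1 x.2).
  apply/measurable_EFinP; apply: measurable_funM.
    by apply: measurableT_comp; [exact: measurable_indic|exact: measurable_snd].
  apply: measurableT_comp => //.
  apply: (measurableT_comp (measurable_shifted_sym s) (g := fun x : measurableTypeR R * T => (x.1, (w, x.2)))).
  apply: measurable_fun_pair; first exact: measurable_fst.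
  by apply: measurable_fun_pair; [exact: measurable_cst|exact: measurable_snd].
have F0 v w' : (0 <= F v w')%E by rewrite lee_fin mulr_ge0.
(* The w' in [G] with |X (s + v) w'| <= K have probability at least 7/8 - 1/8 = 3/4, and for them |X
   (s + v) w| is at most the symmetrized value plus K. Integrated over v, this gives 3/4 of the mass
   <= R0 + K, against a mass above 2 (R0 + K). *)
have pt v : ((3 / 4)%:E * `|X (s + v) w|%:E <= \int[P]_w' F v w' + K%:E)%E.
  pose B := G `&` ~` [set w' | K < `|X (s + v) w'|].
  have mgt : measurable [set w' | K < `|X (s + v) w'|] by apply: measurable_gtr; exact: measurableT_comp.
  have mB : measurable B by apply: measurableI => //; exact: measurableC.
  have PB : ((3 / 4)%:E <= P B)%E.
    set BK := [set w' | _] in B mgt mB *.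
    have : (P G <= P B + P BK)%E.
      apply: le_trans (measureU2 _ _ _) => //; apply: le_measure; rewrite ?inE//.
        exact: measurableU.
      by move=> x Gx; have [h|h] := pselect (K < `|X (s + v) x|); [right|left].
    have f1 : P G \is a fin_num by exact: fin_num_measure.
    have f2 : P B \is a fin_num by exact: fin_num_measure.
    have f3 : P BK \is a fin_num by exact: fin_num_measure.
    have := tightX (s + v); move: PG; rewrite -(fineK f1) -(fineK f2) -/BK -(fineK f3) -EFinD !lee_fin; lra.
  apply: (@le_trans _ _ (P B * `|X (s + v) w|%:E)%E).
    by apply: lee_wpmul2r; rewrite ?lee_fin.
  have -> : (P B * `|X (s + v) w|%:E = \int[P]_w' (`|X (s + v) w| * \1_B w')%:E)%E.
    under eq_integral do rewrite EFinM.
    rewrite ge0_integralZl//; last first.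
      by apply/measurable_EFinP; exact: measurable_indic.
    by rewrite integral_indic// setIT muleC.
  have -> : (\int[P]_w' F v w' + K%:E = \int[P]_w' (F v w' + K%:E))%E.
    rewrite ge0_integralD//.
    - have := integral_cst P measurableT K%:E => /= ->.
      by have := probability_setT P => /= ->; rewrite mule1.
    - by have := measurableT_comp mF (measurable_pair1 (v : measurableTypeR R)); exact.
    - by move=> w' _; rewrite lee_fin ltW.
  apply: ge0_le_integral => //.
  - by apply/measurable_EFinP; apply: measurable_funM => //; exact: measurable_indic.
  - apply: emeasurable_funD => //.
    by have := measurableT_comp mF (measurable_pair1 (v : measurableTypeR R)); exact.
  - move=> w' _; rewrite /F -EFinD lee_fin [in leLHS]indicE.
    have [/set_mem[Gw' hK]|_] := boolP (w' \in B); last by rewrite mulr0 addr_ge0// ?mulr_ge0// ltW.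
    rewrite indicE (mem_set Gw') mulr1 mul1r /symmetrized/=.
    have {}hK : `|X (s + v) w'| <= K by rewrite leNgt; exact/negP.
    by rewrite -[X in `|X| <= _](subrK (X (s + v) w')) (le_trans (ler_normD _ _))// lerD2l.
have tot : ((3 / 4)%:E * unit_mass s w <= (R0 + K)%:E)%E.
  rewrite /unit_mass -ge0_integralZl//; last first.
    by apply/measurable_EFinP/measurable_funTS; apply: measurableT_comp => //; exact: measurable_path.
  apply: (@le_trans _ _ (\int[leb]_(v in `[0%R, 1%R]) (\int[P]_w' F v w' + K%:E))%E).
    apply: ge0_le_integral => //.
    - by apply: measurable_funeM; apply/measurable_EFinP/measurable_funTS; apply: measurableT_comp => //; exact: measurable_path.
    - apply: emeasurable_funD => //; apply: measurable_funTS.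
      exact: (@measurable_fun_fubini_tonelli_F _ _ _ _ _ P (fun x => F x.1 x.2)).
  rewrite ge0_integralD//; last 3 first.
  - by move=> v _; exact: integral_ge0.
  - apply: measurable_funTS.
    exact: (@measurable_fun_fubini_tonelli_F _ _ _ _ _ P (fun x => F x.1 x.2)).
  - by move=> v _; rewrite lee_fin ltW.
  rewrite EFinD; apply: leeD; last first.
    have := integral_cst leb mI K%:E => /= ->.
    have := @lebesgue_measure_itv R `[0, 1]; rewrite /= lte_fin ltr01 => ->.
    by rewrite oppr0 adde0 mule1.
  rewrite (ge0_integral_exchange P mI (f := fun x => F x.1 x.2))//.
  apply: (@le_trans _ _ (\int[P]_w' R0%:E)%E); last first.
    have := integral_cst P measurableT R0%:E => /= ->.
    by have := probability_setT P => /= ->; rewrite mule1.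
  apply: ge0_le_integral => //.
  - by move=> w' _; exact: integral_ge0.
  - exact: (ge0_measurable_integral_param (f := fun x => F x.1 x.2)).
  - move=> w' _; have [Gw'|Gw'] := boolP (w' \in G).
      rewrite [leLHS](_ : _ = unit_mass_sym s (w, w')).
        by rewrite leNgt; apply/negP => h; have := set_mem Gw'; apply; rewrite /xsection/=; apply/mem_set.
      by apply: eq_integral => v _; rewrite /F indicE Gw' mul1r.
    rewrite integral0_eq ?lee_fin ?(ltW R00)// => v _.
    by rewrite /F indicE (negbTE Gw') mul0r.
move: tot Kc; have := unit_mass_ge0 s w; case: (unit_mass s w) => // [x|] x0.
  rewrite -EFinM !lee_fin lte_fin => h2 h3; have := addr_gt0 R00 K0; set y := R0 + K in h2 h3 *; lra.
by rewrite gt0_muley// ?leye_eq// lte_fin.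
Qed.

Lemma unit_mass_tail : exists2 C1, 0 <= C1 & forall s r, 0 < r ->
  (P [set w | (r%:E < unit_mass s w)%E] <= (C1 * (1 / r) `^ q)%:E)%E.
Proof.
have [K2 K20 hK2] := unit_mass_tight.
exists (2 * C * 2 `^ q + (2 * K2) `^ q); first by rewrite addr_ge0 ?mulr_ge0 ?powR_ge0.
move=> s; apply: (desym_tail (D := setT) (Z := unit_mass_sym s)) => //.
- by rewrite setCT measure0.
- exact: measurable_unit_mass.
- exact: measurable_unit_mass_sym.
- by move=> w w' _ _; exact: unit_mass_desym.
- exact: unit_mass_sym_tail.
- by rewrite mulr1.
Qed.

End unit_blocks.

(** * Almost sure growth of sums and integrals *)

Section dyadic_sums.
Context {R : realType}.

Lemma powR_exp (x z : R) n : 0 <= x -> (x ^+ n) `^ z = (x `^ z) ^+ n.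
Proof.
by move=> x0; rewrite -(powR_mulrn n x0) -powRrM mulrC powRrM powR_mulrn// powR_ge0.
Qed.

Lemma sum_geometric_le (rho : R) n : 0 <= rho < 1 -> \sum_(i < n) rho ^+ i <= (1 - rho)^-1.
Proof.
move=> /andP[r0 r1]; rewrite -[leRHS]mul1r ler_pdivlMr ?subr_gt0// mulrC.
have := subrX1 rho n; have := exprn_ge0 n r0; set S := \sum_(_ < _) _ => h; nra.
Qed.

Lemma nneseries_geometric_le (c rho : R) : 0 <= c -> 0 <= rho < 1 ->
  (\sum_(0 <= i <oo) (c * rho ^+ i)%:E <= (c / (1 - rho))%:E)%E.
Proof.
move=> c0 /andP[r0 r1].
apply: lime_le.
  by apply: is_cvg_nneseries => i _ _; rewrite lee_fin mulr_ge0// exprn_ge0.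
apply: nearW => n; rewrite sumEFin lee_fin big_mkord -mulr_sumr ler_wpM2l//.
by apply: sum_geometric_le; rewrite r0.
Qed.

Lemma borel_cantelli_geometric d (T : measurableType d) (P : probability T R)
    (F : (set T)^nat) (c rho : R) : 0 <= c -> 0 <= rho < 1 ->
  (forall n, measurable (F n)) -> (forall n, (P (F n) <= (c * rho ^+ n)%:E)%E) ->
  {ae P, forall w, exists n0, forall n, (n0 <= n)%N -> ~ F n w}.
Proof.
move=> c0 r01 mF hF.
have sF : (\sum_(n <oo) P (F n) < +oo)%E.
  apply: le_lt_trans (ltry (c / (1 - rho))); apply: le_trans (nneseries_geometric_le c0 r01).
  exact: lee_nneseries.
have PF := lim_sup_set_cvg0 mF sF.
exists (lim_sup_set F); split => //.
  by apply: bigcap_measurable => // n _; apply: bigcup_measurable.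
move=> w /= h n _; apply: contrapT => hn; apply: h; exists n => m nm Fm; apply: hn.
by exists m.
Qed.

(** u <= u^s for the two fractions u = x / (x + y) and u = y / (x + y), which sum to 1. *)
Lemma powR_subadd (s x y : R) : 0 < s <= 1 -> 0 <= x -> 0 <= y ->
  (x + y) `^ s <= x `^ s + y `^ s.
Proof.
move=> /andP[s0 s1] x0 y0.
have [xy0|xyn0] := eqVneq (x + y) 0.
  by rewrite xy0 powR0 ?gt_eqF// addr_ge0 ?powR_ge0.
have xy : 0 < x + y by rewrite lt_neqAle eq_sym xyn0 addr_ge0.
have key z : 0 <= z -> z <= x + y -> z / (x + y) * (x + y) `^ s <= z `^ s.
  move=> z0 zxy; have [->|zn0] := eqVneq z 0; first by rewrite !mul0r powR_ge0.
  have zgt : 0 < z by rewrite lt_neqAle eq_sym zn0.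
  have q0 : 0 < z / (x + y) by rewrite divr_gt0.
  have -> : z `^ s = (z / (x + y)) `^ s * (x + y) `^ s.
    by rewrite -powRM ?(ltW q0) ?(ltW xy)// divfK.
  rewrite ler_wpM2r ?powR_ge0// -{1}(powRr1 (ltW q0)) ger_powR// q0/=.
  by rewrite ler_pdivrMr// mul1r.
have := key x x0; have := key y y0; rewrite lerDl lerDr => /(_ x0) h1 /(_ y0) h2.
apply: le_trans (lerD h2 h1); rewrite -mulrDl -mulrDl divff// mul1r//.
Qed.

Lemma powR_sum_le (s : R) n (y : nat -> R) : 0 < s <= 1 -> (forall k, 0 <= y k) ->
  (\sum_(k < n) y k) `^ s <= \sum_(k < n) y k `^ s.
Proof.
move=> s01 y0; elim: n => [|n IH].
  by rewrite !big_ord0 powR0// gt_eqF//; case/andP: s01.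
rewrite !big_ord_recr/=; apply: le_trans (powR_subadd s01 _ (y0 n)) _.
  by rewrite sumr_ge0.
by rewrite lerD2r.
Qed.

(* A version of 1 + z^s whose mean is a series of tail probabilities. *)
Definition dyadic_moment (s : R) (z : \bar R) : \bar R :=
  (1 + \sum_(0 <= i <oo) (((2 ^+ i.+1) `^ s)%:E * (((2 ^+ i)%:E < z)%E%:R)%:E))%E.

(** The term with 2^i < y <= 2^(i+1) alone gives (2^(i+1))^s >= y^s. The argument z may be infinite
    while y ranges over its finite lower bounds. *)
Lemma dyadic_moment_ge (s y : R) (z : \bar R) : 0 < s -> 0 <= y -> (y%:E <= z)%E ->
  ((y `^ s)%:E <= dyadic_moment s z)%E.
Proof.
move=> s0 y0 yz; rewrite /dyadic_moment.
have t0 i : (0 <= ((2 ^+ i.+1) `^ s)%:E * (((2 ^+ i)%:E < z)%E%:R)%:E)%E.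
  by rewrite mule_ge0// lee_fin ?powR_ge0.
have [y1|y1] := leP y 1.
  apply: (@le_trans _ _ 1%E); last by rewrite leeDl// nneseries_ge0.
  rewrite lee_fin; have e1 : 1 `^ s = 1 :> R by rewrite powR1.
  by rewrite -[leRHS]e1 ge0_ler_powR ?nnegrE ?(ltW s0).
have ex : exists i, y <= 2 ^+ i.
  exists (Num.bound y); rewrite ltW// (lt_le_trans (archi_boundP y0))//.
  by rewrite -natrX ler_nat ltnW// ltn_expl.
case: (ex_minnP ex) => -[|i] yi mini.
  by move: yi y1; rewrite expr0 leNgt => /negP.
have iy : 2 ^+ i < y.
  by rewrite ltNge; apply/negP => /mini; rewrite ltnn.
apply: (@le_trans _ _ (((2 ^+ i.+1) `^ s)%:E * (((2 ^+ i)%:E < z)%E%:R)%:E)%E).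
  rewrite (lt_le_trans _ yz) ?lte_fin// mule1 lee_fin.
  by rewrite ge0_ler_powR ?nnegrE ?(ltW s0)// exprn_ge0.
apply: (@le_trans _ _ (\sum_(0 <= j < i.+1) (((2 ^+ j.+1) `^ s)%:E * (((2 ^+ j)%:E < z)%E%:R)%:E))%E).
  by rewrite big_nat_recr//= leeDr// sume_ge0.
apply: (@le_trans _ _ (\sum_(0 <= j <oo) (((2 ^+ j.+1) `^ s)%:E * (((2 ^+ j)%:E < z)%E%:R)%:E))%E).
  exact: nneseries_lim_ge.
by rewrite leeDr.
Qed.

Lemma dyadic_moment_ge0 s z : (0 <= dyadic_moment s z)%E.
Proof.
by rewrite adde_ge0// nneseries_ge0// => i _ _; rewrite mule_ge0// lee_fin ?powR_ge0.
Qed.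

End dyadic_sums.

(** * Sums of heavy-tailed variables *)

Section heavy_tailed_sums.
Context (R : realType) d (T : measurableType d) (P : probability T R).
Variables (M : nat -> T -> \bar R) (C q H : R).
Hypotheses (mM : forall k, measurable_fun setT (M k)) (M0 : forall k w, (0 <= M k w)%E)
  (C0 : 0 <= C) (q0 : 0 < q) (H1 : 1 <= H) (qH : 1 <= q * H).
Hypothesis tailM : forall k r, 0 < r -> (P [set w | (r%:E < M k w)%E] <= (C * (1 / r) `^ q)%:E)%E.

Let mgt k r : measurable [set w | (r%:E < M k w)%E].
Proof. by have := emeasurable_fun_o_infty measurableT (mM k) r%:E; rewrite setTI; exact. Qed.

Let indE k i : (fun w => ((((2 ^+ i)%:E < M k w)%E%:R : R)%:E)) =
  EFin \o \1_[set w | ((2 ^+ i)%:E < M k w)%E].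
Proof.
apply/funext => w; rewrite /= indicE; congr ((nat_of_bool _)%:R)%:E.
by apply/idP/idP => [h|/set_mem h]; [apply/mem_set|].
Qed.

Let mterm s k i : measurable_fun setT
  (fun w => ((((2:R) ^+ i.+1) `^ s)%:E * (((2 ^+ i)%:E < M k w)%E%:R)%:E)%E).
Proof.
by apply: measurable_funeM; rewrite indE; apply/measurable_EFinP; exact: measurable_indic.
Qed.

Lemma measurable_dyadic_moment s k : measurable_fun setT (fun w => dyadic_moment s (M k w)).
Proof.
by apply: emeasurable_funD => //; apply: ge0_emeasurable_sum.
Qed.

(** The i-th term has mean at most 2^((i+1) s) C 2^(- i q), so the series is geometric of ratio 2^(s
    - q) < 1. *)
Lemma integral_dyadic_moment (s : R) : 0 < s -> s < q -> exists2 B, 0 <= B &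
  forall k, (\int[P]_w dyadic_moment s (M k w) <= B%:E)%E.
Proof.
move=> s0 sq; pose rho : R := 2 `^ (s - q).
have rho01 : 0 <= rho < 1.
  by rewrite powR_ge0/= /rho /powR gt_eqF// expR_lt1 nmulr_rlt0 ?ln_gt0 ?ltr1n// subr_lt0.
exists (1 + 2 `^ s * C / (1 - rho)).
  by case/andP: rho01 => _ ?; rewrite addr_ge0// divr_ge0 ?mulr_ge0 ?powR_ge0// subr_ge0 ltW.
have t0 k i w : (0 <= ((2 ^+ i.+1) `^ s)%:E * (((2 ^+ i)%:E < M k w)%E%:R)%:E :> \bar R)%E.
  by rewrite mule_ge0// lee_fin ?powR_ge0.
move=> k; rewrite /dyadic_moment ge0_integralD//; last 2 first.
- by move=> w _; rewrite nneseries_ge0.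
- by apply: ge0_emeasurable_sum.
rewrite EFinD; apply: leeD.
  by have := integral_cst P measurableT 1%E => /= ->; have := probability_setT P => /= ->; rewrite mule1.
rewrite integral_nneseries//.
apply: le_trans (nneseries_geometric_le _ rho01); last by rewrite mulr_ge0 ?powR_ge0.
apply: lee_nneseries => [i _ _|i _]; first exact: integral_ge0.
rewrite ge0_integralZl//; last first.
  by rewrite indE; apply/measurable_EFinP; exact: measurable_indic.
rewrite [X in (_ * X)%E](_ : _ = P [set w | ((2 ^+ i)%:E < M k w)%E]); last first.
  by rewrite indE integral_indic// setIT.
have i0 : 0 < (2:R) ^+ i by rewrite exprn_gt0.
apply: (@le_trans _ _ (((2 ^+ i.+1) `^ s)%:E * (C * (1 / 2 ^+ i) `^ q)%:E)%E).
  by apply: lee_wpmul2l; rewrite ?lee_fin ?powR_ge0// tailM.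
rewrite -EFinM lee_fin powR_exp// div1r -exprVn powR_exp ?invr_ge0//.
have -> : rho = 2 `^ s * 2^-1 `^ q.
  rewrite /rho powRD; last by apply/implyP.
  by rewrite -(powR_inv1 (ler0n R 2)) -[in RHS]powRrM mulN1r.
rewrite exprMn exprS le_eqVlt; apply/orP; left; apply/eqP; ring.
Qed.

(** For a power s slightly below 1 / H one has s <= 1 and s < q, so the s-th power of the sum is at
    most the sum of the s-th powers, whose mean is of order 2^n. Markov's inequality at the level
    2^(n (H + e) s) leaves a geometric series, as (H + e) s > 1. No independence is used. *)
Lemma sum_heavy_tailed (e : R) : 0 < e ->
  {ae P, forall w, exists n0, forall n, (n0 <= n)%N ->
    (\sum_(k < 2 ^ n) M k w <= ((2 ^+ n) `^ (H + e))%:E)%E}.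
Proof.
move=> e0; pose s := (H + e / 2)^-1.
have hH := H1; have hq := q0; have hqH := qH.
have He : 0 < H + e / 2 by lra.
have s0 : 0 < s by rewrite invr_gt0.
have s1 : s <= 1 by rewrite invf_le1; lra.
have s01 : 0 < s <= 1 by rewrite s0.
have sHe : s * (H + e / 2) = 1 by rewrite mulVf// gt_eqF.
have sq : s < q.
  rewrite -(ltr_pM2r He) sHe (le_lt_trans qH)//; nra.
have [B B0 hB] := integral_dyadic_moment s0 sq.
pose rho : R := 2 * 2 `^ (- ((H + e) * s)).
have rho01 : 0 <= rho < 1.
  rewrite mulr_ge0 ?powR_ge0//= /rho -{1}(powRr1 (ler0n R 2)) -powRD; last by apply/implyP.
  rewrite /powR gt_eqF// expR_lt1 nmulr_rlt0 ?ln_gt0 ?ltr1n// subr_lt0.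
  nra.
pose F n := [set w | (((2 ^+ n) `^ (H + e))%:E < \sum_(k < 2 ^ n) M k w)%E].
have mS n : measurable_fun setT (fun w => \sum_(k < 2 ^ n) M k w)%E.
  by apply: emeasurable_sum.
have mF n : measurable (F n).
  by have := emeasurable_fun_o_infty measurableT (mS n) ((2 ^+ n) `^ (H + e))%:E; rewrite setTI; exact.
have B20 : 0 <= 2 * B by rewrite mulr_ge0.
have [|N [mN N0 hN]] := @borel_cantelli_geometric R _ _ P F _ _ B20 rho01 mF; last first.
  exists N; split => // w hw; apply: hN => /= h; apply: hw; have [n0 hn0] := h.
  exists n0 => n nn; rewrite leNgt; apply/negP; exact: hn0.
move=> n; set b : R := (2 ^+ n) `^ (H + e).
have b0 : 0 < b by rewrite powR_gt0// exprn_gt0.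
pose G w := (\sum_(k < 2 ^ n) dyadic_moment s (M k w))%E.
have mG : measurable_fun setT G.
  by apply: emeasurable_sum => k; exact: measurable_dyadic_moment.
(* Halving b^s turns the weak inequality obtained for s-th powers into the strict one of
   [measure_gt_le]. *)
have bs0 : 0 < b `^ s / 2 by rewrite divr_gt0// powR_gt0.
have bs_lt : b `^ s / 2 < b `^ s by have : 0 < b `^ s := powR_gt0 s b0; lra.
have FG : F n `<=` [set w | ((b `^ s / 2)%:E < G w)%E].
  move=> w; rewrite /F/= => hS.
  apply: (@lt_le_trans _ _ (b `^ s)%:E); first by rewrite lte_fin.
  have [fin|] := pselect (forall k : 'I_(2 ^ n), M k w \is a fin_num).
    have yE (k : 'I_(2 ^ n)) : M k w = (fine (M k w))%:E by rewrite fineK.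
    move: hS; rewrite (eq_bigr (fun k : 'I_(2 ^ n) => (fine (M k w))%:E)) ?sumEFin ?lte_fin//.
    move=> hS; apply: (@le_trans _ _ (\sum_(k < 2 ^ n) (fine (M k w) `^ s)%:E)%E).
      rewrite sumEFin lee_fin; apply: le_trans (powR_sum_le (y := fun k => fine (M k w)) _ s01 _).
        by rewrite ge0_ler_powR ?nnegrE ?(ltW s0) ?(ltW b0)// ?(ltW hS)// (le_trans (ltW b0))// ltW.
      by move=> k; rewrite fine_ge0.
    apply: lee_sum => k _; apply: dyadic_moment_ge => //; first by rewrite fine_ge0.
    by rewrite -yE.
  (* An infinite term is covered as well: its dyadic moment is at least b^s for every finite b. *)
  move=> /existsNP[k hk]; apply: (@le_trans _ _ (dyadic_moment s (M k w))).
    apply: dyadic_moment_ge => //; first exact: ltW.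
    by move: hk (M0 k w); case: (M k w) => // _ _; rewrite leey.
  by rewrite /G (bigD1 k)//= leeDl// sume_ge0// => j _; exact: dyadic_moment_ge0.
have mGt : measurable [set w | ((b `^ s / 2)%:E < G w)%E].
  by have := emeasurable_fun_o_infty measurableT mG (b `^ s / 2)%:E; rewrite setTI; exact.
apply: (@le_trans _ _ (P [set w | ((b `^ s / 2)%:E < G w)%E])).
  by apply: le_measure; rewrite ?inE.
have G0 w : (0 <= G w)%E by rewrite sume_ge0// => j _; exact: dyadic_moment_ge0.
have := measure_gt_le P bs0 mG G0.
have IG : (\int[P]_w G w <= ((2 ^+ n) * B)%:E)%E.
  rewrite ge0_integral_sum//; last 2 first.
  - by move=> k; exact: measurable_dyadic_moment.
  - by move=> k w _; exact: dyadic_moment_ge0.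
  apply: (@le_trans _ _ (\sum_(k < 2 ^ n) B%:E)%E); first exact: lee_sum.
  by rewrite sumEFin sumr_const card_ord lee_fin -natrX mulr_natl.
move=> /le_trans /(_ IG); rewrite -lee_pdivlMl// => /le_trans; apply.
rewrite -EFinM lee_fin.
have -> : rho ^+ n = 2 ^+ n * (b `^ s)^-1.
  rewrite /rho exprMn; congr (_ * _); rewrite /b -powRrM powR_exp// -exprVn -powRN//.
rewrite invfM invrK le_eqVlt; apply/orP; left; apply/eqP; ring.
Qed.

End heavy_tailed_sums.

(** * Chaining over dyadic blocks *)

Section dyadic_chaining.
Context {R : realType}.

(** Binary expansion of N: by induction on m the points i * 2^(n - m) are reached with at most m + 1
    increments, an odd i costing one block more than its half at the previous level. *)
Lemma dyadic_chain (G : nat -> R) (r : R) n : G 0%N = 0 -> 0 <= r ->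
  (forall j i, (j <= n)%N -> (i < 2 ^ (n - j))%N -> `|G (i * 2 ^ j + 2 ^ j)%N - G (i * 2 ^ j)%N| <= r) ->
  forall N, (N <= 2 ^ n)%N -> `|G N| <= n.+1%:R * r.
Proof.
move=> G0 r0 hG.
suff key m i : (m <= n)%N -> (i <= 2 ^ m)%N -> `|G (i * 2 ^ (n - m))%N| <= m.+1%:R * r.
  by move=> N hN; have := key n N (leqnn n) hN; rewrite subnn muln1.
elim: m i => [|m IH] i mn hi.
  rewrite mul1r; have := hG n 0%N (leqnn n); rewrite subnn mul0n add0n G0 subr0 => /(_ isT) h.
  by move: hi; rewrite subn0; case: i => [|[|//]] _; rewrite ?mul0n ?mul1n ?G0 ?normr0.
have e : (n - m = (n - m.+1).+1)%N by rewrite subnSK.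
set j := (n - m.+1)%N in e *.
have dbl a : (a.*2 * 2 ^ j = a * 2 ^ (n - m))%N by rewrite e expnS mulnA muln2.
have ha : (i./2 <= 2 ^ m)%N.
  by rewrite -(half_bit_double (2 ^ m) false)/= add0n half_leq// -muln2 mulnC -expnS.
have IHa := IH i./2 (ltnW mn) ha; rewrite -dbl in IHa.
have m1r : m.+2%:R * r = m.+1%:R * r + r by rewrite -natr1 mulrDl mul1r.
rewrite -(odd_double_half i) m1r; case: (boolP (odd i)) => oi; last first.
  by rewrite add0n (le_trans IHa)// lerDl.
rewrite addnC mulnDl mul1n.
have jn : (j <= n)%N by rewrite leq_subr.
have hi2 : (i./2.*2 < 2 ^ (n - j))%N.
  have -> : (n - j = m.+1)%N by rewrite /j subKn.
  by apply: leq_trans hi; rewrite -{2}(odd_double_half i) oi.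
have := hG j i./2.*2 jn hi2; move: IHa; set x := G _; set y := G (_ + _)%N.
by move=> hx hy; rewrite -(subrK x y) addrC (le_trans (ler_normD _ _))// lerD.
Qed.

(** Absorbs the number of levels of the chain. The constant c solves c (x - 1) = x, so each step of
    the right side grows by x^(n+1) >= 1. *)
Lemma linear_le_geometric (x : R) n : 1 < x -> n.+1%:R <= (1 + (x - 1)^-1) * x ^+ n.
Proof.
move=> x1; have x10 : 0 < x - 1 by rewrite subr_gt0.
set c := 1 + _; have cx : c * (x - 1) = x by rewrite /c mulrDl mul1r mulVf ?gt_eqF// subrK.
have c1 : 1 <= c by rewrite /c lerDl invr_ge0 ltW.
elim: n => [|n IH]; first by rewrite expr0 mulr1.
have xn : 1 <= x ^+ n by rewrite exprn_ege1// ltW.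
rewrite -natr1 exprS; nra.
Qed.

End dyadic_chaining.

(** * Growth of centered integrals at integer times *)

Section centered_growth.
Context (R : realType) d (T : measurableType d) (P : probability T R) (X : R -> T -> R).
Hypothesis mX : measurable_fun setT (fun q : measurableTypeR R * T => X q.1 q.2).
Local Notation W := (symmetrized X).
Local Notation P2 := (square_prob P).
Local Notation leb := (@lebesgue_measure R).
Variables (C q H B B' C1 : R).
Hypotheses (C0 : 0 <= C) (q0 : 0 < q) (H0 : 0 < H) (qH : 1 <= q * H)
  (B0 : 0 <= B) (B'0 : 0 <= B') (C10 : 0 <= C1).
Hypothesis tailW : forall (t : nat) s0 r, (0 < t)%N -> 0 < r ->
  (P2 [set w | r%:E < \int[leb]_(v in `[0%R, 1%R]) `|\sum_(k < t) W (s0 + k%:R + v) w|%:E] <=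
    (C * (t%:R `^ H / r) `^ q)%:E)%E.
Hypothesis meanW : forall (t : nat) s0 v, (0 < t)%N -> 0 <= v <= 1 ->
  (\int[P2]_w `|\sum_(k < t) W (s0 + k%:R + v) w|%:E <= (B * t%:R `^ H)%:E)%E.
Hypothesis meanX : forall u, (\int[P]_w `|X u w|%:E <= B'%:E)%E.
Hypothesis tailM : forall s r, 0 < r ->
  (P [set w | (r%:E < unit_mass X s w)%E] <= (C1 * (1 / r) `^ q)%:E)%E.

Let mI : measurable (`[0, 1]%classic : set (measurableTypeR R)).
Proof. exact: measurable_itv. Qed.

Definition block_integral (a t : nat) (w : T) : R :=
  \int[leb]_(u in `[a%:R, a%:R + t%:R]) X u w.

Definition block_dev (t : nat) (s0 : R) (w : T * T) : \bar R :=
  (\int[leb]_(v in `[0%R, 1%R]) `|\sum_(k < t) W (s0 + k%:R + v) w|%:E)%E.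

Let D := [set w | forall k : nat, (unit_mass X k%:R w < +oo)%E].

Let mXu u : measurable_fun setT (X u).
Proof. by have := measurableT_comp mX (measurable_pair1 (u : measurableTypeR R)); exact. Qed.

Let mpath w : measurable_fun setT (fun u : measurableTypeR R => X u w).
Proof. by have := measurableT_comp mX (measurable_pair2 w); exact. Qed.

Lemma unit_mass_mean s : (\int[P]_w unit_mass X s w <= B'%:E)%E.
Proof.
rewrite /unit_mass -(ge0_integral_exchange P mI (f := fun x => `|X (s + x.1) x.2|%:E)%E)//; last first.
  by apply/measurable_EFinP; apply: measurableT_comp => //; exact: measurable_shifted.
apply: (@le_trans _ _ (\int[leb]_(v in `[0%R, 1%R]) B'%:E)%E).
  apply: ge0_le_integral => //.
  - by move=> v _; exact: integral_ge0.
  - apply: measurable_funTS.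
    apply: (@measurable_fun_fubini_tonelli_F _ _ _ _ _ P (fun x => `|X (s + x.1) x.2|%:E)%E) => //.
    by apply/measurable_EFinP; apply: measurableT_comp => //; exact: measurable_shifted.
  - by move=> v _; have := meanX (s + v); exact.
have := integral_cst leb mI B'%:E => /= ->.
have := @lebesgue_measure_itv R `[0, 1]; rewrite /= lte_fin ltr01 => ->.
by rewrite oppr0 adde0 mule1.
Qed.

Let mD : measurable D.
Proof.
have -> : D = \bigcap_k [set w | (unit_mass X k%:R w < +oo)%E].
  by apply/seteqP; split => w h k; [move=> _; exact: h|exact: (h k I)].
apply: bigcap_measurable => // k _.
by have := emeasurable_fun_infty_o measurableT (measurable_unit_mass mX k%:R) +oo%E; rewrite setTI; exact.
Qed.

Let PD : P (~` D) = 0%E.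
Proof.
have : {ae P, forall w, forall k : nat, (unit_mass X k%:R w < +oo)%E}.
  apply: ae_foralln => k.
  have ik : P.-integrable setT (unit_mass X k%:R).
    apply/integrableP; split; first exact: measurable_unit_mass.
    under eq_integral do rewrite gee0_abs ?unit_mass_ge0//.
    exact: le_lt_trans (unit_mass_mean _) (ltry _).
  have := integrable_ae measurableT ik; apply: filterS => w /(_ I).
  by move=> h; rewrite ltey_eq h.
move=> [N [mN PN DN]]; apply/eqP; rewrite eq_le measure_ge0 andbT -PN.
by apply: le_measure; rewrite ?inE//; exact: measurableC.
Qed.

Let abs_block a t w :
  (\int[leb]_(u in `[a%:R, (a%:R + t%:R)%R]) `|X u w|%:E = \sum_(k < t) unit_mass X (a + k)%:R w)%E.
Proof.
rewrite ge0_integral_itv_sum//; last first.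
  by apply/measurable_EFinP; apply: measurableT_comp.
by apply: eq_bigr => k _; rewrite natrD.
Qed.

Lemma path_integrable a t w : D w -> leb.-integrable `[a%:R, a%:R + t%:R] (EFin \o X ^~ w).
Proof.
move=> Dw; apply/integrableP; split; first exact/measurable_EFinP/measurable_funTS.
rewrite abs_block; apply: lte_sum_pinfty => k _; exact: Dw.
Qed.

Let mZ a t : measurable_fun setT (block_integral a t).
Proof. by apply: (measurable_integral_param (f := fun q => X q.1 q.2)) => //; exact: measurable_itv. Qed.

Let Z_le a t w : D w -> (`|block_integral a t w|%:E <= \sum_(k < t) unit_mass X (a + k)%:R w)%E.
Proof.
move=> Dw; rewrite -abs_block /block_integral.
have ip := path_integrable a t Dw.
rewrite -[leRHS]fineK; last first.
  by apply: integrable_fin_num => //; exact: integrable_norm.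
by rewrite lee_fin; apply: le_normr_Rintegral => //; exact: measurable_itv.
Qed.

Let aeD : {ae P, forall w, D w}.
Proof. by exists (~` D); split => //; exact: measurableC. Qed.

Lemma block_integrable a t : P.-integrable setT (EFin \o block_integral a t).
Proof.
apply/integrableP; split; first exact/measurable_EFinP.
apply: (@le_lt_trans _ _ (\int[P]_w (\sum_(k < t) unit_mass X (a + k)%:R w))%E).
  apply: ae_ge0_le_integral => //.
  - by apply/measurable_EFinP; apply: measurableT_comp.
  - by move=> w _; apply: sume_ge0 => k _; exact: unit_mass_ge0.
  - by apply: emeasurable_sum => k; exact: measurable_unit_mass.
  - by apply: filterS aeD => w Dw _; exact: Z_le.
rewrite ge0_integral_sum//; last 2 first.
- by move=> k; exact: measurable_unit_mass.
- by move=> k w _; exact: unit_mass_ge0.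
apply: lte_sum_pinfty => k _; exact: le_lt_trans (unit_mass_mean _) (ltry _).
Qed.

Lemma block_desym a t w w' : D w -> D w' ->
  (`|block_integral a t w - block_integral a t w'|%:E <= block_dev t a%:R (w, w'))%E.
Proof.
move=> Dw Dw'; have ip := path_integrable a t Dw; have ip' := path_integrable a t Dw'.
have mA : measurable (`[a%:R, a%:R + t%:R]%classic : set (measurableTypeR R)) by exact: measurable_itv.
have mpW : measurable_fun setT (fun u : measurableTypeR R => X u w - X u w') by exact: measurable_funB.
have iW : leb.-integrable `[a%:R, a%:R + t%:R] (EFin \o (fun u => X u w - X u w')).
  by have hh := integrableB mA ip ip'; exact: hh.
rewrite /block_integral -RintegralB// Rintegral_itv_sum//.
have mS : measurable_fun setT (fun v : measurableTypeR R => \sum_(k < t) (X (a%:R + k%:R + v) w - X (a%:R + k%:R + v) w')).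
  apply: measurable_sum => k; apply: (measurableT_comp mpW); exact: measurable_funD.
rewrite /block_dev /symmetrized/=.
have [fin|] := boolP ((\int[leb]_(v in `[0%R, 1%R]) `|\sum_(k < t) (X (a%:R + k%:R + v) w - X (a%:R + k%:R + v) w')|%:E < +oo)%E).
  have iS : leb.-integrable `[0, 1] (EFin \o (fun v => \sum_(k < t) (X (a%:R + k%:R + v) w - X (a%:R + k%:R + v) w'))).
    by apply/integrableP; split => //; apply/measurable_EFinP/measurable_funTS.
  rewrite -[leRHS]fineK; last first.
    by apply: integrable_fin_num => //; exact: integrable_norm.
  by rewrite lee_fin; apply: le_normr_Rintegral.
by rewrite ltey negbK => /eqP ->; rewrite leey.
Qed.

Let mdev t s0 : measurable_fun setT (block_dev t s0).
Proof.
apply: (ge0_measurable_integral_param (f := fun x => `|\sum_(k < t) W (s0 + k%:R + x.1) x.2|%:E)%E mI) => //.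
apply/measurable_EFinP; apply: measurableT_comp => //; apply: measurable_sum => k.
exact: measurable_shifted_sym.
Qed.

Lemma block_dev_mean t s0 : (0 < t)%N -> (\int[P2]_w block_dev t s0 w <= (B * t%:R `^ H)%:E)%E.
Proof.
move=> t0; rewrite /block_dev.
have mf : measurable_fun setT (fun x : measurableTypeR R * (T * T) => `|\sum_(k < t) W (s0 + k%:R + x.1) x.2|%:E)%E.
  apply/measurable_EFinP; apply: measurableT_comp => //; apply: measurable_sum => k.
  exact: measurable_shifted_sym.
rewrite -(ge0_integral_exchange P2 mI (f := fun x => `|\sum_(k < t) W (s0 + k%:R + x.1) x.2|%:E)%E)//.
apply: (@le_trans _ _ (\int[leb]_(v in `[0%R, 1%R]) (B * t%:R `^ H)%:E)%E).
  apply: ge0_le_integral => //.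
  - by move=> v _; exact: integral_ge0.
  - apply: measurable_funTS.
    exact: (@measurable_fun_fubini_tonelli_F _ _ _ _ _ P2 (fun x => `|\sum_(k < t) W (s0 + k%:R + x.1) x.2|%:E)%E).
  - by move=> v /=; rewrite in_itv/= => v01; exact: meanW.
have := integral_cst leb mI (B * t%:R `^ H)%:E => /= ->.
have := @lebesgue_measure_itv R `[0, 1]; rewrite /= lte_fin ltr01 => ->.
by rewrite oppr0 adde0 mule1.
Qed.

Definition block_mean a t : R := \int[P]_w block_integral a t w.

Let Y a t w : \bar R := `|block_integral a t w - block_mean a t|%:E.

Let mY a t : measurable_fun setT (Y a t).
Proof. by apply/measurable_EFinP; apply: measurableT_comp => //; exact: measurable_funB. Qed.

(** The deviation from the mean is the average over w' of the difference with an independent copy,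
    so its mean absolute value is at most that of the symmetrized block. *)
Lemma centered_mean a t : (0 < t)%N -> (\int[P]_w Y a t w <= (B * t%:R `^ H)%:E)%E.
Proof.
move=> t0; apply: le_trans (block_dev_mean a%:R t0).
rewrite (@fubini_tonelli1 _ _ _ _ _ P P)//; last by move=> w; exact: integral_ge0.
apply: ae_ge0_le_integral => //.
- by move=> w _; rewrite lee_fin.
- by move=> w _; apply: integral_ge0 => w' _; exact: integral_ge0.
- by apply: measurable_fun_fubini_tonelli_F => // w; exact: integral_ge0.
apply: filterS aeD => w Dw _; rewrite /fubini_F.
have iZ := block_integrable a t.
have ic : P.-integrable setT (EFin \o (fun _ : T => block_integral a t w)).
  exact: (@bounded_integrable _ _ _ _ _ `|block_integral a t w|).
have iB : P.-integrable setT (EFin \o (fun w' => block_integral a t w - block_integral a t w')).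
  by have hh := integrableB measurableT ic iZ; exact: hh.
apply: (@le_trans _ _ (\int[P]_w' `|block_integral a t w - block_integral a t w'|%:E)%E).
  rewrite -[leRHS]fineK; last first.
    by apply: integrable_fin_num => //; exact: integrable_norm.
  rewrite lee_fin.
  have -> : block_integral a t w - block_mean a t = \int[P]_w' (block_integral a t w - block_integral a t w').
    rewrite RintegralB// Rintegral_cst//.
    have -> : fine (P setT) = 1 by rewrite probability_setT.
    by rewrite mulr1.
  exact: le_normr_Rintegral.
apply: ae_ge0_le_integral => //.
- by apply/measurable_EFinP; apply: measurableT_comp => //; exact: measurable_funB.
- by move=> w' _; exact: integral_ge0.
- by have := measurableT_comp (mdev t a%:R) (measurable_pair1 w); exact.
by apply: filterS aeD => w' Dw' _; exact: block_desym.
Qed.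

Lemma centered_tail : exists2 C4, 0 <= C4 & forall a t r, (0 < t)%N -> 0 < r ->
  (P [set w | (r%:E < Y a t w)%E] <= (C4 * (t%:R `^ H / r) `^ q)%:E)%E.
Proof.
(* By Markov's inequality the deviation exceeds k t^H with probability at most B / k <= 1/2, as
   [desym_tail] requires; B + 1 rules out a zero threshold. *)
pose k := 2 * (B + 1).
have k0 : 0 < k by rewrite mulr_gt0// ltr_wpDl.
exists (2 * C * 2 `^ q + (2 * k) `^ q); first by rewrite addr_ge0 ?mulr_ge0 ?powR_ge0.
move=> a t r t0 r0.
have tH : 0 < t%:R `^ H :> R by rewrite powR_gt0// ltr0n.
apply: (desym_tail (D := D) (Z := block_dev t a%:R)) => //.
- move=> w w' Dw Dw'; apply: (@le_trans _ _ (`|block_integral a t w - block_integral a t w'|%:E + Y a t w')%E).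
    rewrite /Y -EFinD lee_fin; apply: le_trans (ler_normD _ _).
    by rewrite addrA subrK.
  by apply: leeD => //; exact: block_desym.
- by move=> r' r'0; exact: tailW.
have kt : 0 < k * t%:R `^ H by rewrite mulr_gt0.
have := measure_gt_le P kt (mY a t); move=> /(_ _)/le_trans /(_ (centered_mean a t0)) h.
have {}h : ((k * t%:R `^ H)%:E * P [set x | ((k * t%:R `^ H)%:E < Y a t x)%E] <= (B * t%:R `^ H)%:E)%E.
  by apply: h => w; rewrite lee_fin.
move: h; rewrite -lee_pdivlMl// => /le_trans; apply.
rewrite -EFinM lee_fin ler_pdivrMl// /k; have b0 := B0; nra.
Qed.

(** Union bound over the 2^(n - j) blocks of each length 2^j in [0, 2^n]. Because q H >= 1, every
    length contributes at most a multiple of 2^(- n e q), which remains summable in n after adding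
    up the n + 1 lengths. *)
Lemma centered_growth (e : R) : 0 < e ->
  {ae P, forall w, D w /\ exists n0, forall n, (n0 <= n)%N ->
    (forall N, (N <= 2 ^ n)%N ->
       `|block_integral 0 N w - block_mean 0 N| <= n.+1%:R * (2 ^+ n) `^ (H + e)) /\
    (forall k, (k < 2 ^ n)%N -> (unit_mass X k%:R w <= ((2 ^+ n) `^ (H + e))%:E)%E)}.
Proof.
move=> e0; have [C4 C40 hC4] := centered_tail.
pose r n : R := (2 ^+ n) `^ (H + e).
have r0 n : 0 < r n by rewrite powR_gt0// exprn_gt0.
pose F n := (\bigcup_(j < n.+1) \bigcup_(i < 2 ^ (n - j)%N) [set w | ((r n)%:E < Y (i * 2 ^ j) (2 ^ j) w)%E])
   `|` \bigcup_(k < 2 ^ n) [set w | ((r n)%:E < unit_mass X k%:R w)%E].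
have mYr a t x : measurable [set w | (x%:E < Y a t w)%E].
  by have := emeasurable_fun_o_infty measurableT (mY a t) x%:E; rewrite setTI; exact.
have mMr s x : measurable [set w | (x%:E < unit_mass X s w)%E].
  by have := emeasurable_fun_o_infty measurableT (measurable_unit_mass mX s) x%:E; rewrite setTI; exact.
have mU1 n j : measurable (\bigcup_(i < 2 ^ (n - j)%N) [set w | ((r n)%:E < Y (i * 2 ^ j) (2 ^ j) w)%E]).
  by apply: bigcup_measurable.
have mU2 n : measurable (\bigcup_(j < n.+1) \bigcup_(i < 2 ^ (n - j)%N) [set w | ((r n)%:E < Y (i * 2 ^ j) (2 ^ j) w)%E]).
  by apply: bigcup_measurable => j _; exact: mU1.
have mU3 n : measurable (\bigcup_(k < 2 ^ n) [set w | ((r n)%:E < unit_mass X k%:R w)%E]).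
  by apply: bigcup_measurable.
have mF n : measurable (F n) by exact: measurableU.
(* 2^(- n e q) = sg^(- 2 n): one factor sg^(- n) absorbs the n + 1 lengths, the other makes the
   series geometric. *)
pose sg : R := 2 `^ (e * q / 2).
have sg1 : 1 < sg.
  by rewrite /sg /powR gt_eqF// expR_gt1 mulr_gt0// ?divr_gt0 ?mulr_gt0// ln_gt0// ltr1n.
have sg0 : 0 < sg := lt_trans ltr01 sg1.
have sgi : 0 <= sg^-1 < 1 by rewrite invr_ge0 (ltW sg0)/= invf_lt1.
have pw n j : (j <= n)%N -> (2 ^+ (n - j)) * ((2 ^+ j) `^ H / r n) `^ q <= (sg^-1) ^+ n * (sg^-1) ^+ n.
  move=> jn; have E m : (2:R) ^+ m = 2 `^ m%:R by rewrite powR_mulrn.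
  have -> : (sg^-1) ^+ n * (sg^-1) ^+ n = 2 `^ (- (e * q * n%:R)).
    rewrite -exprMn -invfM /sg -powRD; last by apply/implyP.
    by rewrite -powRN -powR_mulrn ?powR_ge0// -powRrM; congr (_ `^ _); field.
  rewrite /r !E -!powRrM -powRN -powRD; last by apply/implyP.
  rewrite -powRrM -powRD; last by apply/implyP.
  rewrite ler_powR ?ler1n// natrB//.
  have jnR : (j%:R : R) <= n%:R by rewrite ler_nat.
  have hq := qH; have : 0 <= (n%:R - j%:R) * (q * H - 1) by rewrite mulr_ge0 ?subr_ge0.
  lra.
have PU m (G : nat -> set T) (c : R) : (forall i, measurable (G i)) ->
    (forall i, (i < m)%N -> (P (G i) <= c%:E)%E) -> (P (\bigcup_(i < m) G i) <= (m%:R * c)%:E)%E.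
  move=> mG hG; rewrite bigcup_mkord.
  apply: (@le_trans _ _ (\sum_(i < m) P (G i))%E); first by apply: Boole_inequality.
  apply: (@le_trans _ _ (\sum_(i < m) c%:E)%E); first by apply: lee_sum => i _; exact: hG.
  by rewrite sumEFin sumr_const card_ord lee_fin mulr_natl.
have PF n : (P (F n) <= ((C4 + C1) * (1 + (sg - 1)^-1) * (sg^-1) ^+ n)%:E)%E.
  have lin := linear_le_geometric n sg1.
  have sn0 : 0 <= sg^-1 ^+ n by rewrite exprn_ge0// invr_ge0 ltW.
  have snn : sg ^+ n * sg^-1 ^+ n = 1 by rewrite -exprMn divff ?gt_eqF// expr1n.
  apply: (@le_trans _ _ ((n.+1%:R * (C4 * (sg^-1 ^+ n * sg^-1 ^+ n)))%:E + (C1 * (sg^-1 ^+ n * sg^-1 ^+ n))%:E)%E).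
    apply: le_trans (measureU2 _ _ _) _ => //; apply: leeD.
      apply: (PU) => // j; rewrite ltnS => jn.
      apply: (@le_trans _ _ ((2 ^ (n - j))%:R * (C4 * ((2 ^ j)%:R `^ H / r n) `^ q))%:E).
        by apply: (PU) => // i _; apply: hC4; rewrite ?expn_gt0.
      rewrite lee_fin mulrCA ler_wpM2l//; have := pw n j jn; rewrite !natrX; exact.
    apply: (@le_trans _ _ ((2 ^ n)%:R * (C1 * (1 / r n) `^ q))%:E).
      by apply: (PU) => // k _; exact: tailM.
    rewrite lee_fin mulrCA ler_wpM2l//; have := pw n 0%N (leq0n n).
    by rewrite subn0 expr0 powR1 natrX.
  rewrite -EFinD lee_fin; set z := sg^-1 ^+ n in sn0 snn *; set y := sg ^+ n in lin snn *.
  have c0 : 0 <= 1 + (sg - 1)^-1 by rewrite addr_ge0// invr_ge0 subr_ge0 ltW.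
  have z1 : n.+1%:R * z <= 1 + (sg - 1)^-1.
    by rewrite (le_trans (ler_wpM2r sn0 lin))// -mulrA snn mulr1.
  have z2 : z <= n.+1%:R * z by rewrite ler_peMl// ler1n.
  have a1 : n.+1%:R * (C4 * (z * z)) <= C4 * (1 + (sg - 1)^-1) * z.
    rewrite mulrCA -!mulrA ler_wpM2l// mulrA ler_wpM2r//.
  have a2 : C1 * (z * z) <= C1 * (1 + (sg - 1)^-1) * z.
    by rewrite -mulrA ler_wpM2l// ler_wpM2r// (le_trans z2).
  rewrite !mulrDl in a1 a2 *; lra.
have c0 : 0 <= (C4 + C1) * (1 + (sg - 1)^-1).
  by rewrite mulr_ge0 ?addr_ge0// invr_ge0 subr_ge0 ltW.
have bc := @borel_cantelli_geometric R _ _ P F _ _ c0 sgi mF PF.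
apply: filterS2 aeD bc => w Dw [n0 hn0]; split => //; exists n0 => n nn.
have hF := hn0 n nn; split; last first.
  move=> k k2; rewrite leNgt; apply/negP => h; apply: hF; right; exists k => //.
have Z0 v : block_integral 0 0 v = 0.
  by rewrite /block_integral addr0 set_itv1 Rintegral_set1.
have Zcat a t v : D v -> block_integral 0 (a + t) v = block_integral 0 a v + block_integral a t v.
  move=> Dv; rewrite /block_integral natrD !add0r.
  rewrite (@Rintegral_itv_cat R 0 a%:R)//; first by rewrite lerDl.
  by have := path_integrable 0 (a + t) Dv; rewrite natrD add0r.
have Zmean a t : block_mean 0 (a + t) = block_mean 0 a + block_mean a t.
  rewrite /block_mean -RintegralD//; [|exact: block_integrable|exact: block_integrable].
  congr fine; apply: ae_eq_integral => //.
  - by apply/measurable_EFinP.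
  - by apply/measurable_EFinP; exact: measurable_funD.
  - by apply: filterS aeD => v Dv _; rewrite Zcat.
apply: (@dyadic_chain _ (fun N => block_integral 0 N w - block_mean 0 N)).
- have -> : block_mean 0 0 = 0.
    by rewrite /block_mean; under eq_Rintegral do rewrite Z0; rewrite Rintegral_cst// mul0r.
  by rewrite Z0 subrr.
- exact: ltW.
move=> j i jn i2.
rewrite Zcat// Zmean leNgt; apply/negP => h; apply: hF; left; exists j => //; exists i => //=.
rewrite /Y lte_fin; move: h.
move: (block_integral 0 (i * 2 ^ j) w) (block_integral (i * 2 ^ j) (2 ^ j) w)
  (block_mean 0 (i * 2 ^ j)) (block_mean (i * 2 ^ j) (2 ^ j)) => x1 x2 x3 x4 h.
by have -> : x2 - x4 = x1 + x2 - (x3 + x4) - (x1 - x3) by ring.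
Qed.

End centered_growth.

(** No integrability is assumed: if the right side is infinite there is nothing to prove. *)
Lemma normr_Rintegral_le d (T : measurableType d) (R : realType) (m : {measure set T -> \bar R})
    (A : set T) (f : T -> R) : measurable A -> measurable_fun A f ->
  (`|\int[m]_(x in A) f x|%:E <= \int[m]_(x in A) `|f x|%:E)%E.
Proof.
move=> mA mf; have mfE : measurable_fun A (EFin \o f) by exact/measurable_EFinP.
have [fin|] := ltP (\int[m]_(x in A) `|f x|%:E)%E +oo%E; last first.
  by rewrite leye_eq => /eqP ->; rewrite leey.
have intf : m.-integrable A (EFin \o f) by apply/integrableP; split.
apply: le_trans (le_abse_integral m mA mfE); rewrite /Rintegral -abse_EFin fineK//.
exact: integrable_fin_num.
Qed.

Lemma dyadic_bracket {R : realType} (t : R) : 1 <= t -> exists n,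
  [/\ 2 ^+ n <= t, t < 2 ^+ n.+1 & (Num.truncn t < 2 ^ n.+1)%N].
Proof.
move=> t1; have t0 : 0 <= t by rewrite (le_trans ler01).
have /andP[h1 h2] := truncn_itv t0.
have N0 : (0 < Num.truncn t)%N.
  by rewrite -ltnS -(ltr_nat R) (le_lt_trans t1).
have /andP[n1 n2] := trunc_log_bounds (isT : (1 < 2)%N) N0.
exists (trunc_log 2 (Num.truncn t)); split => //.
  by apply: le_trans h1; rewrite -natrX ler_nat.
by apply: lt_le_trans h2 _; rewrite -natrX ler_nat.
Qed.

Lemma centering_le d (T : measurableType d) (R : realType) (P : probability T R) (Y : T -> R) (b : R) :
  measurable_fun setT Y -> (\int[P]_w `|Y w|%:E <= b%:E)%E -> `|centering P Y| <= b.
Proof.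
move=> mY h; have b0 : 0 <= b by rewrite -lee_fin (le_trans _ h)//; exact: integral_ge0.
rewrite /centering; case: ifP => _; last by rewrite normr0.
by rewrite -lee_fin (le_trans _ h)// unlock; exact: normr_Rintegral_le.
Qed.

(** * From dyadic times to all times *)

Section path_growth.
Context (R : realType) d (T : measurableType d) (P : probability T R) (X : R -> T -> R).
Hypothesis mX : measurable_fun setT (fun q : measurableTypeR R * T => X q.1 q.2).
Local Notation W := (symmetrized X).
Local Notation P2 := (square_prob P).
Local Notation leb := (@lebesgue_measure R).

Let mXw w : measurable_fun setT (fun u : measurableTypeR R => X u w).
Proof. by have := measurableT_comp mX (measurable_pair2 w); exact. Qed.

Let mI t : measurable_fun setT (integrated X t).
Proof.
by apply: (@measurable_integral_param _ _ _ _ (fun q => X q.1 q.2)) => //; exact: measurable_itv.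
Qed.

Lemma path_mass_le t w n : t <= n%:R ->
  (\int[leb]_(u in `[0%R, t]) `|X u w|%:E <= \sum_(k < n) unit_mass X k%:R w)%E.
Proof.
move=> tn; have mXE : measurable_fun setT (fun u : measurableTypeR R => `|X u w|%:E).
  by apply/measurable_EFinP; exact: measurableT_comp.
apply: (@le_trans _ _ (\int[leb]_(u in `[0%R, n%:R]) `|X u w|%:E)%E).
  apply: ge0_subset_integral => //; first exact: measurable_funTS.
  by move=> u /=; rewrite !in_itv/= => /andP[-> /le_trans]; apply.
have := ge0_integral_itv_sum 0 n mXE; rewrite add0r => -> //.
by apply: lee_sum => k _; rewrite add0r.
Qed.

Lemma path_integrable_masses t w : (forall k : nat, unit_mass X k%:R w < +oo)%E ->
  leb.-integrable `[0, t] (EFin \o (fun u => X u w)).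
Proof.
move=> fin; apply/integrableP; split.
  by apply/measurable_EFinP; exact: measurable_funTS.
have [n tn] : exists n : nat, t <= n%:R.
  by exists (Num.bound `|t|); rewrite (le_trans (ler_norm t))// ltW// archi_boundP.
apply: le_lt_trans (path_mass_le w tn) _.
by apply: lte_sum_pinfty.
Qed.

Lemma integrated_norm_le t w n : t <= n%:R ->
  (`|integrated X t w|%:E <= \sum_(k < n) unit_mass X k%:R w)%E.
Proof.
move=> tn; apply: le_trans (path_mass_le w tn); apply: normr_Rintegral_le; first exact: measurable_itv.
exact: measurable_funTS.
Qed.

Lemma integrated_mean_le B' t : 0 <= t ->
  (forall u, (\int[P]_w `|X u w|%:E <= B'%:E)%E) ->
  (\int[P]_w `|integrated X t w|%:E <= (B' * t)%:E)%E.
Proof.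
move=> t0 hB; have mt : measurable (`[0, t]%classic : set (measurableTypeR R)) by exact: measurable_itv.
have mq : measurable_fun setT (fun q : measurableTypeR R * T => `|X q.1 q.2|%:E).
  by apply/measurable_EFinP; exact: measurableT_comp.
apply: (@le_trans _ _ (\int[P]_w \int[leb]_(u in `[0%R, t]) `|X u w|%:E)%E).
  apply: ge0_le_integral => //.
  - by apply/measurable_EFinP; exact: measurableT_comp.
  - exact: (@ge0_measurable_integral_param _ _ _ _ (fun q => `|X q.1 q.2|%:E)).
  by move=> w _; apply: normr_Rintegral_le => //; exact: measurable_funTS.
rewrite -(@ge0_integral_exchange _ _ _ P _ (fun q => `|X q.1 q.2|%:E))//.
apply: (@le_trans _ _ (\int[leb]_(u in `[0%R, t]) B'%:E)%E).
  apply: ge0_le_integral => //.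
  - by move=> u _; apply: integral_ge0.
  - apply: measurable_funTS; exact: (@measurable_fun_fubini_tonelli_F _ _ _ _ _ P (fun q => `|X q.1 q.2|%:E)).
  by move=> u _; exact: hB.
have := integral_cst leb mt B'%:E => /= ->; rewrite EFinM.
have := @lebesgue_measure_itv R `[0, t]; rewrite /= lte_fin => ->.
have B'0 : (0 <= B'%:E)%E by apply: le_trans (hB 0); exact: integral_ge0.
by case: ltP => _; rewrite ?mule0 ?mule_ge0// -EFinB subr0.
Qed.

Variables (q H C1 : R).
Hypotheses (q0 : 0 < q) (H0 : 0 < H) (qH : 1 <= q * H) (C10 : 0 <= C1).
Hypothesis tailM : forall s r, 0 < r ->
  (P [set w | (r%:E < unit_mass X s w)%E] <= (C1 * (1 / r) `^ q)%:E)%E.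

Lemma dyadic_powR_le (t z : R) n : 0 <= z -> 2 ^+ n <= t -> (2 ^+ n.+1) `^ z <= 2 `^ z * t `^ z.
Proof.
move=> z0 nt; have t0 : 0 <= t by apply: le_trans nt; rewrite exprn_ge0.
rewrite -powRM//; apply: ge0_ler_powR; rewrite ?nnegrE ?exprn_ge0 ?mulr_ge0//.
by rewrite exprS ler_pM2l.
Qed.

Lemma heavy_path_growth (e : R) : 1 <= H -> 0 < e ->
  (exists2 B', 0 <= B' & forall u, (\int[P]_w `|X u w|%:E <= B'%:E)%E) \/
  (forall t, 0 < t -> {ae P, forall w, leb.-integrable `[0, t] (EFin \o (fun u => X u w))} ->
    (\int[P]_w `|integrated X t w|%:E = +oo)%E) ->
  {ae P, forall w, exists c t0, forall t, t0 <= t ->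
    `|integrated X t w - centering P (integrated X t)| <= c * t `^ (H + e)}.
Proof.
move=> H1 e0 dich.
have He : 0 <= H + e by rewrite addr_ge0// ltW.
have grow := sum_heavy_tailed (fun k => measurable_unit_mass mX k%:R)
  (fun k w => unit_mass_ge0 X k%:R w) C10 q0 H1 qH (fun k => @tailM k%:R) e0.
have fin : {ae P, forall w, forall k : nat, (unit_mass X k%:R w < +oo)%E}.
  apply: filterS grow => w [n0 hn] k; have nk : (n0 <= maxn n0 k)%N by exact: leq_maxl.
  apply: le_lt_trans (ltry _); apply: le_trans (hn _ nk).
  have kn : (k < 2 ^ maxn n0 k)%N by rewrite (leq_ltn_trans (leq_maxr n0 k))// ltn_expl.
  by rewrite (bigD1 (Ordinal kn))//= leeDl// sume_ge0// => i _; exact: unit_mass_ge0.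
(* A linear bound suffices because H >= 1. In the second alternative the integrability of the paths,
   needed for the infinite mean, follows from the masses being almost surely finite, itself a
   consequence of their growth bound. *)
have [B' B'0 hB] : exists2 B', 0 <= B' & forall t, 1 <= t -> `|centering P (integrated X t)| <= B' * t.
  case: dich => [[B' B'0 hB]|inf].
    exists B' => // t t1; apply: centering_le => //; apply: integrated_mean_le => //.
    by rewrite (le_trans ler01).
  exists 0 => // t t1; rewrite /centering unlock inf ?ltxx ?normr0 ?mul0r//.
    by rewrite (lt_le_trans ltr01).
  by apply: filterS fin => w; exact: path_integrable_masses.
apply: filterS grow => w [n0 hn]; exists (2 `^ (H + e) + B'), (2 ^+ n0) => t tn0.
have t1 : 1 <= t by apply: le_trans tn0; rewrite exprn_ege1// ler1n.
have [n [n1 n2 _]] := dyadic_bracket t1.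
have nn : (n0 <= n.+1)%N.
  by rewrite ltnW// -(ltr_eXn2l (x := 2 : R)) ?ltr1n// (le_lt_trans tn0).
have tn : t <= (2 ^ n.+1)%:R by rewrite natrX ltW.
have := le_trans (integrated_norm_le w tn) (hn _ nn); rewrite lee_fin => h.
rewrite (le_trans (ler_normB _ _))// mulrDl lerD//.
  exact: le_trans h (dyadic_powR_le He n1).
rewrite (le_trans (hB t t1))// ler_wpM2l//.
by apply: le1r_powR => //; rewrite (le_trans H1)// lerDl ltW.
Qed.

Variables (C B B' : R).
Hypotheses (C0 : 0 <= C) (B0 : 0 <= B) (B'0 : 0 <= B').
Hypothesis tailW : forall (t : nat) s0 r, (0 < t)%N -> 0 < r ->
  (P2 [set w | r%:E < \int[leb]_(v in `[0%R, 1%R]) `|\sum_(k < t) W (s0 + k%:R + v) w|%:E] <=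
    (C * (t%:R `^ H / r) `^ q)%:E)%E.
Hypothesis meanW : forall (t : nat) s0 v, (0 < t)%N -> 0 <= v <= 1 ->
  (\int[P2]_w `|\sum_(k < t) W (s0 + k%:R + v) w|%:E <= (B * t%:R `^ H)%:E)%E.
Hypothesis meanX : forall u, (\int[P]_w `|X u w|%:E <= B'%:E)%E.

(** Passing from t to its integer part N costs one unit mass for the path and at most B' for the
    mean. The chaining is run with e / 2, and the other half of e absorbs the factor n + 1 that
    counts the levels. *)
Lemma centered_path_growth (e : R) : 0 < e ->
  {ae P, forall w, exists c t0, forall t, t0 <= t ->
    `|integrated X t w - centering P (integrated X t)| <= c * t `^ (H + e)}.
Proof.
move=> e0; have e2 : 0 < e / 2 by rewrite divr_gt0.
have e2e : e / 2 <= e by lra.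
have split4 (x y z u : R) : x - u = (y - z) + (x - y) - (u - z) by ring.
have He : 0 <= H + e by rewrite addr_ge0// ltW.
have x1 : 1 < 2 `^ (e / 2) :> R.
  have one_pow : 1 `^ (e / 2) = 1 :> R by rewrite powR1.
  by rewrite -[ltLHS]one_pow; apply: gt0_ltr_powR; rewrite ?nnegrE ?ltr1n.
have [k0 k00 hk] : exists2 k0 : R, 0 <= k0 & forall n, n.+1%:R <= k0 * (2 `^ (e / 2)) ^+ n.
  exists (1 + (2 `^ (e / 2) - 1)^-1); first by rewrite addr_ge0// invr_ge0 subr_ge0 ltW.
  by move=> n; exact: linear_le_geometric.
have gr := centered_growth mX C0 q0 qH B0 C10 tailW meanW meanX tailM e2.
have intI t : 0 <= t -> P.-integrable setT (EFin \o integrated X t).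
  move=> t0; apply/integrableP; split; first exact/measurable_EFinP.
  by apply: le_lt_trans (integrated_mean_le t0 meanX) _; rewrite ltry.
have cE t : 0 <= t -> centering P (integrated X t) = \int[P]_w integrated X t w.
  move=> t0; rewrite /centering unlock ifT//.
  exact: le_lt_trans (integrated_mean_le t0 meanX) (ltry _).
have bE N w : block_integral X 0 N w = integrated X N%:R w.
  by rewrite /block_integral /integrated add0r.
apply: filterS (gr) => w [fin [n0 hn]].
exists (k0 * 2 `^ (H + e) + 2 `^ (H + e) + B'), (2 ^+ n0) => t tn0.
have t1 : 1 <= t by apply: le_trans tn0; rewrite exprn_ege1// ler1n.
have t0 : 0 <= t by rewrite (le_trans ler01).
have [n [n1 n2 n3]] := dyadic_bracket t1.
have nn : (n0 <= n.+1)%N.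
  by rewrite ltnW// -(ltr_eXn2l (x := 2 : R)) ?ltr1n// (le_lt_trans tn0).
have [hN hM] := hn _ nn; move: (Num.truncn t) n3 (truncn_itv t0) => N n3 /andP[t2 t3].
have {}hN := hN N (ltnW n3); have {}hM := hM N n3.
have Nr : 0 <= N%:R :> R by [].
have Nt w' : (forall k : nat, unit_mass X k%:R w' < +oo)%E ->
    (`|integrated X t w' - integrated X N%:R w'|%:E <= unit_mass X N%:R w')%E.
  move=> fin'; have it := path_integrable_masses t fin'.
  rewrite /integrated (Rintegral_itv_cat Nr t2 it) addrAC subrr add0r.
  apply: le_trans (normr_Rintegral_le _ _ _) _; first exact: measurable_itv.
    exact: measurable_funTS.
  have mXE : measurable_fun setT (fun u : measurableTypeR R => `|X u w'|%:E).
    by apply/measurable_EFinP; exact: measurableT_comp.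
  rewrite /unit_mass -(integral_shift_unit N%:R mXE).
  apply: ge0_subset_integral => //; first exact: measurable_funTS.
  move=> u /=; rewrite !in_itv/= => /andP[-> /le_trans]; apply.
  by rewrite natr1 ltW.
have mean : `|\int[P]_w' integrated X t w' - \int[P]_w' integrated X N%:R w'| <= B'.
  rewrite -RintegralB//; [|exact: intI|exact: intI].
  rewrite -lee_fin; apply: le_trans (normr_Rintegral_le _ _ _) _ => //.
    exact: measurable_funB.
  apply: le_trans (unit_mass_mean mX meanX N%:R).
  apply: ae_ge0_le_integral => //.
  - by apply/measurable_EFinP; apply: measurableT_comp => //; exact: measurable_funB.
  - by move=> w' _; exact: unit_mass_ge0.
  - exact: measurable_unit_mass.
  by apply: filterS gr => w' [fin' _] _; exact: Nt.
have d1 : `|integrated X t w - integrated X N%:R w| <= 2 `^ (H + e) * t `^ (H + e).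
  rewrite -lee_fin; apply: le_trans (Nt w fin) (le_trans hM _); rewrite lee_fin.
  apply: le_trans (dyadic_powR_le He n1); apply: ler_powR; first by rewrite exprn_ege1// ler1n.
  by rewrite lerD2l.
have d2 : `|integrated X N%:R w - \int[P]_w' integrated X N%:R w'| <= k0 * 2 `^ (H + e) * t `^ (H + e).
  have -> : \int[P]_w' integrated X N%:R w' = block_mean P X 0 N.
    by rewrite /block_mean; apply: eq_Rintegral => w' _; rewrite bE.
  rewrite -bE; apply: le_trans hN _; rewrite -mulrA.
  apply: (@le_trans _ _ (k0 * (2 ^+ n.+1) `^ (H + e))); last first.
    by rewrite ler_wpM2l//; exact: dyadic_powR_le.
  have -> : (2 ^+ n.+1) `^ (H + e) = (2 `^ (e / 2)) ^+ n.+1 * (2 ^+ n.+1) `^ (H + e / 2) :> R.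
    rewrite -powR_exp// -powRD; last by rewrite expf_neq0 ?implybT.
    by congr (_ `^ _); field.
  rewrite mulrA ler_wpM2r ?powR_ge0//; exact: hk.
have tp : 1 <= t `^ (H + e) by rewrite -(powRr0 t) ler_powR.
rewrite (cE t t0) mulrDl mulrDl.
rewrite (split4 _ (integrated X N%:R w) (\int[P]_w' integrated X N%:R w')).
apply: le_trans (ler_normB _ _) _; apply: lerD; last first.
  by apply: le_trans mean _; rewrite -[leLHS]mulr1 ler_wpM2l.
by apply: le_trans (ler_normD _ _) _; exact: lerD.
Qed.

End path_growth.

(** * Infinite mean of the integrated process *)

Section riemann_sums.
Context {R : realType}.
Local Notation leb := (@lebesgue_measure R).

Let mI : measurable (`[0, 1]%classic : set (measurableTypeR R)).
Proof. exact: measurable_itv. Qed.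

Let leb01 : leb (`[0, 1]%classic : set (measurableTypeR R)) = 1%E.
Proof.
have := @lebesgue_measure_itv R `[0, 1]; rewrite /= lte_fin ltr01 => ->.
by rewrite oppr0 adde0.
Qed.

Lemma preimage_scale_itv (h x y : R) : 0 < h ->
  (fun v => h * v + 0) @^-1` `[h * x, h * y] = `[x, y]%classic.
Proof. by move=> h0; apply/seteqP; split => z /=; rewrite addr0 !in_itv/= !ler_pM2l. Qed.

Lemma ge0_integral_scale (h t : R) (f : measurableTypeR R -> \bar R) : 0 < h ->
  measurable_fun setT f -> (forall x, 0 <= f x)%E ->
  (\int[leb]_(u in `[0%R, (h * t)%R]) f u = h%:E * \int[leb]_(u in `[0%R, t]) f (h * u)%R)%E.
Proof.
move=> h0 mf f0; rewrite (ge0_integral_affine 0 h0 (measurable_itv _) mf f0).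
have := preimage_scale_itv 0 t h0; rewrite mulr0 => ->; congr (_ * _)%E.
by apply: eq_integral => u _; rewrite addr0.
Qed.

Lemma Rintegral_scale (h t : R) (f : measurableTypeR R -> R) : 0 < h ->
  measurable_fun setT f -> leb.-integrable `[0, h * t] (EFin \o f) ->
  leb.-integrable `[0, t] (EFin \o (fun u => h * f (h * u))) /\
  \int[leb]_(u in `[0, h * t]) f u = \int[leb]_(u in `[0, t]) (h * f (h * u)).
Proof.
move=> h0 mf intf.
have mEf : measurable_fun setT (EFin \o f) by exact/measurable_EFinP.
have mfh : measurable_fun setT (fun u : measurableTypeR R => f (h * u)).
  by apply: (measurableT_comp mf); exact: measurable_funM.
have mh : measurable_fun setT (fun u : measurableTypeR R => h * f (h * u)).
  exact: measurable_funM.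
have ih : leb.-integrable `[0, t] (EFin \o (fun u => h * f (h * u))).
  apply/integrableP; split; first exact/measurable_EFinP/measurable_funTS.
  have /integrableP[_] := intf; apply: le_lt_trans.
  rewrite (ge0_integral_scale t h0 (f := fun u => `|(f u)%:E|%E))//; last by apply: measurableT_comp.
  rewrite -ge0_integralZl//; last 2 first.
  - by apply: measurable_funTS; apply: measurableT_comp => //; exact/measurable_EFinP.
  - by rewrite lee_fin ltW.
  rewrite le_eqVlt; apply/orP; left; apply/eqP; apply: eq_integral => u _.
  by rewrite /= normrM (gtr0_norm h0).
split => //; rewrite /Rintegral integralE [in RHS]integralE.
rewrite (ge0_integral_scale t h0 (f := (EFin \o f)^\+%E))//; last exact: measurable_funepos.
rewrite (ge0_integral_scale t h0 (f := (EFin \o f)^\-%E))//; last exact: measurable_funeneg.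
rewrite -!ge0_integralZl//; do ?[exact: measurable_itv|exact: ltW|by rewrite lee_fin ltW].
- have pm (x : \bar R) : (h%:E * maxe x 0 = maxe (h%:E * x) 0)%E by rewrite maxe_pMr ?mule0// ltW.
  congr fine; congr (_ - _)%E; apply: eq_integral => u _.
    by rewrite [in LHS]funeposE [in RHS]funeposE pm.
  by rewrite [in LHS]funenegE [in RHS]funenegE pm muleN.
- apply: measurable_funTS; apply: (@measurableT_comp _ _ _ _ _ _ (EFin \o f)^\-%E); last exact: measurable_funM.
  exact: measurable_funeneg.
- apply: measurable_funTS; apply: (@measurableT_comp _ _ _ _ _ _ (EFin \o f)^\+%E); last exact: measurable_funM.
  exact: measurable_funepos.
Qed.

(** F minus its mean splits through G into three parts: the first and last cost the L1 distance of F
    and G each, the middle one the oscillation of G. *)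
Lemma mean_dev_le (F G : measurableTypeR R -> R) (eta : R) :
  leb.-integrable `[0, 1] (EFin \o F) -> leb.-integrable `[0, 1] (EFin \o G) ->
  (forall v v', 0 <= v <= 1 -> 0 <= v' <= 1 -> `|G v - G v'| <= eta) ->
  \int[leb]_(v in `[0, 1]) `|F v - \int[leb]_(v' in `[0, 1]) F v'| <=
  2 * \int[leb]_(v in `[0, 1]) `|F v - G v| + eta.
Proof.
move=> iF iG oscG.
set mF := \int[leb]_(_ in _) F _; set mG := \int[leb]_(v in `[0, 1]) G v.
have ic c : leb.-integrable `[0, 1] (EFin \o (fun _ : measurableTypeR R => c : R)).
  apply/integrableP; split; first exact: measurable_cst.
  have := integral_cst leb mI `|c|%:E => /= ->; rewrite leb01 mule1; exact: ltry.
have iB (U V : measurableTypeR R -> R) : leb.-integrable `[0, 1] (EFin \o U) -> leb.-integrable `[0, 1] (EFin \o V) ->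
    leb.-integrable `[0, 1] (EFin \o (fun v => U v - V v)).
  by move=> iU iV; have hh := integrableB mI iU iV; exact: hh.
have iN (U : measurableTypeR R -> R) : leb.-integrable `[0, 1] (EFin \o U) ->
    leb.-integrable `[0, 1] (EFin \o (fun v => `|U v|)).
  by move=> iU; have hh := integrable_norm iU; exact: hh.
have iD (U V : measurableTypeR R -> R) : leb.-integrable `[0, 1] (EFin \o U) -> leb.-integrable `[0, 1] (EFin \o V) ->
    leb.-integrable `[0, 1] (EFin \o (fun v => U v + V v)).
  by move=> iU iV; have hh := integrableD mI iU iV; exact: hh.
have cst01 c : \int[leb]_(v in `[0, 1]) (c : R) = c.
  by rewrite Rintegral_cst//; have := leb01 => /= ->; rewrite mulr1.
set d := \int[leb]_(v in `[0, 1]) `|F v - G v|.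
have mFG : `|mG - mF| <= d.
  rewrite distrC /mF /mG -RintegralB//; apply: le_normr_Rintegral => //; exact: iB.
have Gm v : 0 <= v <= 1 -> `|G v - mG| <= eta.
  move=> v01; rewrite -{1}(cst01 (G v)) /mG -RintegralB//.
  have iGv := iB _ _ (ic (G v)) iG.
  apply: (le_trans (le_normr_Rintegral mI iGv)).
  rewrite -[leRHS](cst01 eta); apply: le_Rintegral => //; first exact: iN.
  by move=> v'; rewrite /= in_itv/= => v'01; exact: oscG.
apply: (@le_trans _ _ (\int[leb]_(v in `[0, 1]) (`|F v - G v| + (eta + d)))).
  apply: le_Rintegral => //; [exact/iN/iB|apply: iD; [exact/iN/iB|exact: ic]|].
  move=> v; rewrite /= in_itv/= => v01.
  rewrite (_ : F v - mF = (F v - G v) + ((G v - mG) + (mG - mF))); last by ring.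
  rewrite (le_trans (ler_normD _ _))// lerD2l (le_trans (ler_normD _ _))// lerD// Gm//.
by rewrite RintegralD//; [rewrite cst01 -/d; lra|exact/iN/iB].
Qed.

Lemma uniform_continuity (t eps : R) (g : R -> R) : 0 < t -> 0 < eps -> continuous g ->
  exists N0 : nat, forall N, (N0 <= N)%N -> (0 < N)%N -> forall x y, 0 <= x <= t -> 0 <= y <= t ->
    `|x - y| <= t / N%:R -> `|g x - g y| <= eps.
Proof.
move=> t0 eps0 cg.
have /compact_near_coveringP : compact [set` `[0, t]] by exact: segment_compact.
move=> /(_ nat \oo (fun N x => (0 < N)%N -> forall y, `|x - y| <= t / N%:R -> `|g x - g y| <= eps)).
case.
  move=> x _; have /cvgrPdist_le/(_ (eps / 2)) := cg x.
  have -> : 0 < eps / 2 by rewrite divr_gt0.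
  move=> /(_ isT)/nbhs_ballP[de /= de0 hde].
  have [N1 hN1] : exists N1 : nat, 2 * t / de < N1%:R.
    by exists (Num.bound (2 * t / de)); apply: archi_boundP; rewrite divr_ge0 ?mulr_ge0 ?ltW.
  exists (ball x (de / 2), [set N | (N1 <= N)%N]) => /=.
    split; last by exists N1.
    by apply/nbhs_ballP; exists (de / 2) => //=; rewrite divr_gt0.
  move=> [z N] /= [xz N1N] N0 y zy.
  have Nr : 0 < N%:R :> R by rewrite ltr0n.
  have tN : t / N%:R < de / 2.
    rewrite ltr_pdivrMr//; have : N1%:R <= N%:R :> R by rewrite ler_nat.
    move: hN1; rewrite ltr_pdivrMr//; nra.
  have h1 : `|g x - g z| <= eps / 2.
    by apply: hde; rewrite /ball/=; move: xz; rewrite /ball/=; lra.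
  have h2 : `|g x - g y| <= eps / 2.
    apply: hde; rewrite /ball/=; move: xz; rewrite /ball/= => xz.
    rewrite (_ : x - y = (x - z) + (z - y)); last by ring.
    rewrite (le_lt_trans (ler_normD _ _))//; lra.
  rewrite (_ : g z - g y = - (g x - g z) + (g x - g y)); last by ring.
  rewrite (le_trans (ler_normD _ _))// normrN; lra.
by move=> N0 _ hN0; exists N0 => N NN N1 x y x01 _; apply: (hN0 N NN).
Qed.

(* Averaging over the shift v makes the Riemann sums of a function that is only
   integrable converge in mean. *)
Definition riemann_sum (t : R) (N : nat) (c : R -> R) (v : R) : R :=
  \sum_(k < N) t / N%:R * c (t / N%:R * (k%:R + v)).

(** By folding, the mean over v of the Riemann sum is exactly the integral, so only its fluctuation
    in v matters. For a continuous g this is uniform continuity; replacing c by such a g costs the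
    L1 distance of c and g, again by folding. The final bound is 2 * eps / 4 + eps / 4. *)
Lemma riemann_sum_cvg (t eps : R) (c : measurableTypeR R -> R) : 0 < t -> 0 < eps ->
  measurable_fun setT c -> leb.-integrable `[0, t] (EFin \o c) ->
  exists N0, forall N, (N0 <= N)%N -> (0 < N)%N ->
    leb.-integrable `[0, 1] (EFin \o riemann_sum t N c) /\
    \int[leb]_(v in `[0, 1]) `|riemann_sum t N c v - \int[leb]_(u in `[0, t]) c u| <= eps.
Proof.
move=> t0 eps0 mc intc.
have arith (x y : R) : x <= y -> y <= eps / 4 -> 2 * x + eps / 4 <= eps by lra.
have mt : measurable (`[0, t]%classic : set (measurableTypeR R)) by exact: measurable_itv.
have [g [cg ig dg]] : exists g : R -> R, [/\ continuous g, leb.-integrable `[0, t] (EFin \o g) &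
    \int[leb]_(u in `[0, t]) `|c u - g u| <= eps / 4].
  have lt : (leb (`[0%R, t]%classic : set (measurableTypeR R)) < +oo)%E.
    by have := @lebesgue_measure_itv R `[0, t]; rewrite /= lte_fin t0 => ->; rewrite -EFinB ltry.
  have [g_ [cg ig]] := approximation_continuous_integrable mt lt intc.
  move=> /fine_cvgP[_ /cvgrPdist_le/(_ (eps / 4))].
  have -> : 0 < eps / 4 by rewrite divr_gt0.
  move=> /(_ isT)[n _ /(_ n (leqnn n))] /=.
  rewrite sub0r normrN => h; exists (g_ n); split => //.
  exact: le_trans (ler_norm _) h.
have [N0 hN0] : exists N0 : nat, forall N, (N0 <= N)%N -> (0 < N)%N -> forall x y, 0 <= x <= t -> 0 <= y <= t ->
    `|x - y| <= t / N%:R -> `|g x - g y| <= eps / (4 * t).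
  by apply: uniform_continuity => //; rewrite divr_gt0// mulr_gt0.
exists N0 => N NN N1.
have Nr : 0 < N%:R :> R by rewrite ltr0n.
pose h := t / N%:R; have h0 : 0 < h by rewrite divr_gt0.
have hN : h * N%:R = t by rewrite divfK// gt_eqF.
have rs (f : measurableTypeR R -> R) : measurable_fun setT f -> leb.-integrable `[0, t] (EFin \o f) ->
   leb.-integrable `[0, 1] (EFin \o riemann_sum t N f) /\
   \int[leb]_(u in `[0, t]) f u = \int[leb]_(v in `[0, 1]) riemann_sum t N f v.
  move=> mf intf.
  have mh : measurable_fun setT (fun u : measurableTypeR R => h * f (h * u)).
    by apply: measurable_funM => //; apply: (measurableT_comp mf); exact: measurable_funM.
  have [|ih eh] := @Rintegral_scale h N%:R f h0 mf; first by rewrite hN.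
  rewrite hN in eh; have rE : (fun v => \sum_(k < N) h * f (h * (0 + k%:R + v))) = riemann_sum t N f.
    by apply/funext => v; apply: eq_bigr => k _; rewrite add0r.
  split; last first.
    rewrite eh -{1}(add0r N%:R) Rintegral_itv_sum//; last by rewrite add0r.
    by rewrite -rE.
  rewrite -rE; apply/integrableP; split.
    apply/measurable_EFinP/measurable_funTS; apply: measurable_sum => k.
    by apply: (measurableT_comp mh); exact: measurable_funD.
  have /integrableP[_] := ih; apply: le_lt_trans.
  have key := @ge0_integral_itv_sum R 0 N (fun u => `|(h * f (h * u))%:E|%E) _ (fun x => abse_ge0 _).
  rewrite add0r in key; rewrite [leRHS]key; last by apply: measurableT_comp => //; exact/measurable_EFinP.
  have mk (k : 'I_N) : measurable_fun setT (fun v : measurableTypeR R => `|(h * f (h * (0 + k%:R + v)))%:E|%E).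
    by apply: measurableT_comp => //; apply/measurable_EFinP; apply: (measurableT_comp mh); exact: measurable_funD.
  rewrite -ge0_integral_sum//; last by move=> k; exact: measurable_funTS.
  apply: ge0_le_integral => //.
  - apply: measurable_funTS; apply: measurableT_comp => //; apply/measurable_EFinP; apply: measurable_sum => k.
    by apply: (measurableT_comp mh); exact: measurable_funD.
  - by apply: measurable_funTS; apply: emeasurable_sum.
  - by move=> v _; rewrite /= sumEFin lee_fin ler_norm_sum.
have mg : measurable_fun setT (g : measurableTypeR R -> R) by exact: continuous_measurable_fun.
have [iF eF] := rs c mc intc; split => //.
have [iG eG] := rs g mg ig.
rewrite eF; apply: le_trans (@mean_dev_le _ (riemann_sum t N g) (eps / 4) iF iG _) _.
  move=> v v' /andP[v0 v1] /andP[v'0 v'1]; rewrite /riemann_sum -sumrB.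
  apply: (le_trans (ler_norm_sum _ _ _)).
  apply: (@le_trans _ _ (\sum_(k < N) h * (eps / (4 * t)))); last first.
    rewrite sumr_const card_ord -[_ *+ N]mulr_natl mulrA [N%:R * h]mulrC hN.
    by rewrite le_eqVlt; apply/orP; left; apply/eqP; field; rewrite gt_eqF.
  apply: ler_sum => k _; rewrite -mulrBr normrM (gtr0_norm h0) ler_pM2l//.
  have kN : k%:R + 1 <= N%:R :> R by rewrite natr1 ler_nat ltn_ord.
  have k0 : 0 <= k%:R :> R := ler0n _ _.
  have tN u : 0 <= u -> u <= 1 -> 0 <= h * (k%:R + u) <= t.
    move=> u0 u1; rewrite mulr_ge0 ?(ltW h0) ?addr_ge0//= -[leRHS]hN ler_pM2l//; lra.
  apply: (hN0 N) => //.
  - exact: tN.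
  - exact: tN.
  - rewrite -/h -mulrBr normrM (gtr0_norm h0) ger_pMr// ler_norml; apply/andP; split; lra.
have mfg : measurable_fun setT (fun u : measurableTypeR R => c u - g u) by exact: measurable_funB.
have ifg : leb.-integrable `[0, t] (EFin \o (fun u => c u - g u)).
  by have hh := integrableB mt intc ig; exact: hh.
have ifgn : leb.-integrable `[0, t] (EFin \o (fun u => `|c u - g u|)).
  by have hh := integrable_norm ifg; exact: hh.
have mfgn : measurable_fun setT (fun u : measurableTypeR R => `|c u - g u|) by apply: measurableT_comp.
have [iA eA] := rs _ mfgn ifgn.
suff : \int[leb]_(v in `[0, 1]) `|riemann_sum t N c v - riemann_sum t N g v| <=
       \int[leb]_(v in `[0, 1]) riemann_sum t N (fun u => `|c u - g u|) v.
  by rewrite -eA => hle; exact: arith hle dg.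
apply: le_Rintegral => //.
  have hh := integrable_norm (integrableB mI iF iG); exact: hh.
move=> v _; rewrite /riemann_sum -sumrB (le_trans (ler_norm_sum _ _ _))//.
by apply: ler_sum => k _; rewrite -mulrBr normrM (gtr0_norm h0).
Qed.

End riemann_sums.

Lemma square_ae d (T : measurableType d) (R : realType) (P : probability T R) (D : T -> Prop) :
  {ae P, forall w, D w} -> {ae square_prob P, forall w, D w.1 /\ D w.2}.
Proof.
move=> [N [mN PN sub]].
have P0 (A B : set T) : measurable A -> measurable B -> square_prob P (A `*` B) = (P A * P B)%E.
  by move=> mA mB; exact: product_measure1E.
exists ((N `*` setT) `|` (setT `*` N)); split.
- by apply: measurableU; apply: measurableX.
- have m1 : measurable (N `*` [set: T]) by exact: measurableX.
  have m2 : measurable ([set: T] `*` N) by exact: measurableX.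
  have e1 : (square_prob P (N `*` [set: T]) <= 0)%E by rewrite P0// PN mul0e.
  have e2 : (square_prob P ([set: T] `*` N) <= 0)%E by rewrite P0// PN mule0.
  apply/eqP; rewrite eq_le measure_ge0 andbT; apply: le_trans (measureU2 _ m1 m2) _.
  by have := leeD e1 e2; rewrite adde0; exact.
- move=> w /= nD; apply: contrapT => /not_orP[h1 h2]; apply: nD; split; apply: contrapT => h.
    by apply: h1; split => //; exact: sub.
  by apply: h2; split => //; exact: sub.
Qed.

Lemma integral_square_fst d (T : measurableType d) (R : realType) (P : probability T R)
    (f : T -> \bar R) : measurable_fun setT f -> (forall w, 0 <= f w)%E ->
  (\int[square_prob P]_w f w.1 = \int[P]_w f w)%E.
Proof.
move=> mf f0; rewrite (@fubini_tonelli1 _ _ _ _ _ P P)//; last first.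
  by apply: measurableT_comp => //; exact: measurable_fst.
rewrite /fubini_F/=; apply: eq_integral => w _.
by have := integral_cst P measurableT (f w) => /= ->; have := probability_setT P => /= ->; rewrite mule1.
Qed.

Lemma integral_square_snd d (T : measurableType d) (R : realType) (P : probability T R)
    (f : T -> \bar R) : measurable_fun setT f -> (forall w, 0 <= f w)%E ->
  (\int[square_prob P]_w f w.2 = \int[P]_w f w)%E.
Proof.
move=> mf f0; rewrite (@fubini_tonelli1 _ _ _ _ _ P P)//; last first.
  by apply: measurableT_comp => //; exact: measurable_snd.
rewrite /fubini_F/=; have := integral_cst P measurableT (\int[P]_w f w)%E => /= ->.
by have := probability_setT P => /= ->; rewrite mule1.
Qed.

(** Converse of 1 - exp (- 2 x) <= 2 x up to a factor 2, valid before the exponential saturates. *)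
Lemma onem_expR_ge {R : realType} (x : R) : 0 <= x <= 2^-1 -> x <= 1 - expR (- (2 * x)).
Proof.
move=> /andP[x0 x1]; have e := expR_ge1Dx (2 * x).
have e0 : 0 < expR (2 * x) by exact: expR_gt0.
have : (expR (2 * x))^-1 <= 1 - x by rewrite -[leLHS]mul1r ler_pdivrMr//; nra.
by rewrite expRN; lra.
Qed.

Lemma dyadic_weight_lipschitz {R : realType} I (x y : R) :
  `|dyadic_weight I x - dyadic_weight I y| <= I.+1%:R * `|x - y|.
Proof.
rewrite /dyadic_weight -sumrB (le_trans (ler_norm_sum _ _ _))//.
apply: (@le_trans _ _ (\sum_(i < I.+1) `|x - y|)); last first.
  by rewrite sumr_const card_ord mulr_natl.
apply: ler_sum => i _; rewrite -mulrBr normrM ger0_norm ?exprn_ge0//.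
rewrite (_ : 1 - _ - _ = cos (2 ^- i * y) - cos (2 ^- i * x)); last by ring.
rewrite -ler_pdivlMl ?exprn_gt0// (le_trans (cos_lipschitz _ _))//.
rewrite -mulrBr normrM distrC ger0_norm// invr_ge0 exprn_ge0//.
Qed.

Lemma dyadic_weight_le {R : realType} I (y : R) : dyadic_weight I y <= 2 * I.+1%:R * 2 ^+ I.
Proof.
apply: (@le_trans _ _ (\sum_(i < I.+1) 2 ^+ I * 2)).
  apply: ler_sum => i _; apply: ler_pM; rewrite ?exprn_ge0 ?onem_cos_ge0 ?onem_cos_le2//.
  by rewrite ler_eXn2l ?ltr1n// -ltnS ltn_ord.
rewrite sumr_const card_ord -[_ *+ I.+1]mulr_natl le_eqVlt; apply/orP; left; apply/eqP; ring.
Qed.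

Lemma supOU_kernel_le_envelope (R : realType) (t : nat) (s0 u : R) (q : plane R) :
  s0 <= u -> u < s0 + t%:R -> 0 < q.1 -> supOU_kernel u q <= envelope t s0 q.
Proof.
move=> u0 ut q0; have x0 : 0 <= u - s0 by rewrite subr_ge0.
pose k := Num.truncn (u - s0).
have /andP[k1 k2] := truncn_itv x0.
have kt : (k < t)%N.
  by rewrite -(ltr_nat R) (le_lt_trans k1)//; lra.
have v01 : 0 <= u - s0 - k%:R <= 1.
  rewrite subr_ge0 k1/=; move: k2; rewrite -/k -natr1; lra.
apply: le_trans (sum_kernel_le t s0 v01 q0).
rewrite (bigD1 (Ordinal kt))//= (_ : s0 + k%:R + _ = u); last by ring.
by rewrite lerDl sumr_ge0// => i _; exact: supOU_kernel_ge0.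
Qed.

(** * Lower bounds from heavy large jumps *)

Section infinite_mean.
Context (R : realType) (d : measure_display) (T : measurableType d).
Variables (P : probability T R) (a : R).
Variables (mu : {finite_measure set (measurableTypeR R) -> \bar R})
  (lam : {sigma_finite_measure set (measurableTypeR R) -> \bar R}).
Variables (Lam : set (plane R) -> T -> R) (X : R -> T -> R).
Hypotheses (lam_levy : is_levy_measure lam)
  (Lam_basis : is_levy_basis P a 0 lam mu Lam) (X_supOU : is_supOU P mu Lam X).
Variables (p al : R).
Hypotheses (p0 : 0 < p) (p1 : p <= 1) (large_p : (large_moment lam p < +oo)%E)
  (al0 : 0 <= al) (origin_al : (origin_moment mu al < +oo)%E).
Local Notation W := (symmetrized X).
Local Notation P2 := (square_prob P).
Local Notation leb := (@lebesgue_measure R).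
Local Notation nu := (jump_control mu lam).

(** A converse domination, available only while the jump integral is at most 1/2; this dictates the
    scaling factor [de] below. *)
Lemma symmetrized_onem_cos_ge l :
  (\int[nu]_e (1 - cos (lincomb l (fun u => jump_kernel u e)))%:E <= 2^-1%:E)%E ->
  (\int[nu]_e (1 - cos (lincomb l (fun u => jump_kernel u e)))%:E <=
   \int[P2]_w (1 - cos (lincomb l (fun u => W u w)))%:E)%E.
Proof.
have phi0 : (0 <= \int[nu]_e (1 - cos (lincomb l (fun u => jump_kernel u e)))%:E)%E.
  by apply: integral_ge0 => e _; rewrite lee_fin onem_cos_ge0.
move: phi0; rewrite (integral_jump_kernel a lam_levy p0 p1 large_p al0 origin_al) !lee_fin.
have sc := symmetrized_cos lam_levy Lam_basis X_supOU p0 p1 large_p al0 origin_al l.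
pose A := \int[(mu \x leb)%E]_(q in @half_plane R) rate_re lam (lincomb l (fun u => supOU_kernel u q)).
rewrite -/A in sc *; move=> A0 A1.
have mU : measurable_fun setT (fun w => cos (lincomb l (fun u => W u w))).
  apply: measurableT_comp; first exact: measurable_cos.
  apply: measurable_lincomb => u.
  by have := measurableT_comp (measurable_symmetrized X_supOU) (measurable_pair1 (u : measurableTypeR R)); exact.
have ic : P2.-integrable setT (EFin \o (fun w => cos (lincomb l (fun u => W u w)))).
  by apply: (@bounded_integrable _ _ _ _ _ 1) => // w; rewrite cos_sin_bound.
have i1 : P2.-integrable setT (EFin \o (fun w => 1 : R)).
  by apply: (@bounded_integrable _ _ _ _ _ 1) => // w; rewrite normr1.
have -> : (\int[P2]_w (1 - cos (lincomb l (fun u => W u w)))%:E =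
   (\int[P2]_w (1 - cos (lincomb l (fun u => W u w))) : R)%:E)%E.
  rewrite fineK//; apply: integrable_fin_num => //.
  have hh := integrableB measurableT i1 ic; exact: hh.
rewrite RintegralB// sc Rintegral_cst// mul1r lee_fin.
have -> : fine (P2 setT) = 1 by rewrite probability_setT.
have := @onem_expR_ge R (- A); rewrite mulrN opprK A0 A1; exact.
Qed.

Definition riemann_comb (t : R) (N : nat) (v : R) : seq (R * R) :=
  [seq (t / N%:R, t / N%:R * (k%:R + v)) | k <- iota 0 N].

Lemma lincomb_riemann t N v (y : R -> R) :
  lincomb (riemann_comb t N v) y = riemann_sum t N y v.
Proof.
rewrite /lincomb big_map -{1}(subn0 N) -/(index_iota 0 N) big_mkord.
exact: eq_bigr.
Qed.

Lemma riemann_kernel_le (t : R) (n N : nat) v (q : plane R) : 0 < t -> t < n%:R -> (0 < N)%N ->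
  0 <= v <= 1 -> 0 < q.1 ->
  0 <= riemann_sum t N (fun u => supOU_kernel u q) v <= t * envelope n 0 q.
Proof.
move=> t0 tn N0 /andP[v0 v1] q0; have Nr : 0 < N%:R :> R by rewrite ltr0n.
have h0 : 0 < t / N%:R by rewrite divr_gt0.
apply/andP; split.
  by apply: sumr_ge0 => k _; rewrite mulr_ge0 ?supOU_kernel_ge0// ltW.
apply: (@le_trans _ _ (\sum_(k < N) t / N%:R * envelope n 0 q)); last first.
  by rewrite sumr_const card_ord -[_ *+ N]mulr_natl mulrA [N%:R * _]mulrC divfK// gt_eqF.
apply: ler_sum => k _; rewrite ler_wpM2l ?(ltW h0)//.
have kN : k%:R + 1 <= N%:R :> R by rewrite natr1 ler_nat ltn_ord.
apply: supOU_kernel_le_envelope => //; first by rewrite mulr_ge0 ?(ltW h0) ?addr_ge0.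
rewrite add0r; apply: le_lt_trans tn; rewrite -[leRHS](divfK (lt0r_neq0 Nr)) ler_pM2l//; lra.
Qed.

(** A jump at a time in [-1, 0] is felt during all of [0, t], at an age of at most t + 1 and with a
    decay rate of at most K, so each kernel value lies between exp (- K (t + 1)) and 1. *)
Lemma riemann_kernel_ge (t K : R) (N : nat) v (q : plane R) : 0 < t -> (0 < N)%N ->
  0 <= v <= 1 -> 0 < q.1 <= K -> -1 <= q.2 <= 0 ->
  t * expR (- K * (t + 1)) <= riemann_sum t N (fun u => supOU_kernel u q) v <= t.
Proof.
move=> t0 N0 /andP[v0 v1] /andP[q0 qK] /andP[s1 s0]; have Nr : 0 < N%:R :> R by rewrite ltr0n.
have h0 : 0 < t / N%:R by rewrite divr_gt0.
have tE c : t * c = \sum_(k < N) t / N%:R * c.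
  by rewrite sumr_const card_ord -[_ *+ N]mulr_natl mulrA [N%:R * _]mulrC divfK// gt_eqF.
have ku (k : 'I_N) : 0 <= t / N%:R * (k%:R + v) <= t.
  have kN : k%:R + 1 <= N%:R :> R by rewrite natr1 ler_nat ltn_ord.
  rewrite mulr_ge0 ?(ltW h0) ?addr_ge0//= -[leRHS](divfK (lt0r_neq0 Nr)) ler_pM2l//; lra.
have kb (k : 'I_N) : expR (- K * (t + 1)) <= supOU_kernel (t / N%:R * (k%:R + v)) q <= 1.
  move: (ku k); set u := _ * _ => /andP[u0 ut].
  rewrite /supOU_kernel (le_trans s0 u0) mulr1 ler_expR expR_le1 !mulNr oppr_le0 lerN2.
  apply/andP; split; last by rewrite mulr_ge0 ?(ltW q0)//; lra.
  apply: ler_pM => //; [exact: ltW|lra|lra].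
apply/andP; split.
  by rewrite tE; apply: ler_sum => k _; apply: ler_wpM2l; [exact: ltW|case/andP: (kb k)].
rewrite -[leRHS]mulr1 tE; apply: ler_sum => k _.
by apply: ler_wpM2l; [exact: ltW|case/andP: (kb k)].
Qed.

(** Requiring |z| >= a0 removes only a finite part of the first moment, since the jumps above 1 have
    finite total mass; the truncations exhaust the rest as I grows. *)
Lemma large_integral_unbounded (a0 c B : R) : large_moment lam 1 = +oo%E -> 1 <= a0 -> 0 < c ->
  exists I : nat, (B%:E <= \int[lam]_(z in [set z | (a0 <= `|z| <= c * 2 ^+ I)%R]) `|z|%:E)%E.
Proof.
move=> linf a1 c0.
pose A (I : nat) : set (measurableTypeR R) := [set z | a0 <= `|z| <= c * 2 ^+ I].
have mabs : measurable_fun setT (fun z : measurableTypeR R => `|z| : R) by exact: normr_measurable.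
have mE : measurable_fun setT (fun z : measurableTypeR R => `|z|%:E) by exact/measurable_EFinP.
have mA I : measurable (A I).
  have -> : A I = setT `&` (fun z : measurableTypeR R => `|z|) @^-1` `[a0, c * 2 ^+ I].
    by rewrite setTI; apply/seteqP; split => z /=; rewrite in_itv.
  by apply: mabs => //; exact: measurable_itv.
have ndA : nondecreasing_seq A.
  move=> n m nm; apply/subsetPset => z; rewrite /A/= => /andP[h1 h2]; rewrite h1/=.
  by rewrite (le_trans h2)// ler_pM2l// ler_eXn2l ?ltr1n.
apply: contrapT => /forallNP hI.
have cv := @ge0_nondecreasing_set_cvg_integral _ _ R A (fun z => `|z|%:E) lam ndA mA
  (fun i => measurable_funTS mE) (fun i z _ => ltac:(by rewrite lee_fin)).
have le : (\int[lam]_(z in \bigcup_i A i) `|z|%:E <= B%:E)%E.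
  rewrite -(cvg_lim _ cv)//; apply: lime_le; first by apply/cvg_ex; eexists; exact: cv.
  by apply: nearW => i; have /negP := hI i; rewrite -ltNge => /ltW.
have UA : \bigcup_i A i = [set z : measurableTypeR R | a0 <= `|z|].
  apply/seteqP; split => z /=; first by move=> [i _ /andP[]].
  move=> za; exists (Num.bound (`|z| / c)) => //=; rewrite /A/= za/=.
  rewrite mulrC -ler_pdivrMr// ltW// (lt_le_trans (archi_boundP _))//.
    by rewrite divr_ge0// ltW.
  by rewrite -natrX ler_nat ltnW// ltn_expl.
have mUA : measurable (\bigcup_i A i) by exact: bigcup_measurable.
pose S := [set z : measurableTypeR R | 1 < `|z|] `&` [set z | `|z| < a0].
have mL : measurable [set z : measurableTypeR R | 1 < `|z|] by exact: measurable_large.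
have mS : measurable S.
  apply: measurableI => //; have -> : [set z : measurableTypeR R | `|z| < a0] = ~` (\bigcup_i A i).
    by rewrite UA; apply/seteqP; split => z /=; rewrite ltNge => /negP.
  exact: measurableC.
have lfin : (lam [set z : measurableTypeR R | (1 < `|z|)%R] < +oo)%E.
  have := large_moment_mono (ltW p0) large_p; rewrite /large_moment.
  under eq_integral do rewrite powRr0.
  have := integral_cst lam mL 1%E => /= ->; by rewrite mul1e.
have sub : [set z : measurableTypeR R | 1 < `|z|] `<=` S `|` \bigcup_i A i.
  move=> z /= z1; rewrite UA/=; have [h|h] := leP a0 `|z|; first by right.
  by left; split.
have : (large_moment lam 1 <= a0%:E * lam [set z : measurableTypeR R | (1 < `|z|)%R] + B%:E)%E.
  rewrite /large_moment; under eq_integral do rewrite powRr1//.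
  apply: (@le_trans _ _ (\int[lam]_(z in S `|` \bigcup_i A i) `|z|%:E)%E).
    apply: ge0_subset_integral => //; first exact: measurableU.
    exact: measurable_funTS.
  rewrite ge0_integral_setU//; last 2 first.
  - exact: measurable_funTS.
  - apply/disj_setPS => z [[_ /=]]; rewrite UA/= => h1 h2.
    by move: (lt_le_trans h1 h2); rewrite ltxx.
  apply: leeD => //.
  apply: (@le_trans _ _ (\int[lam]_(z in S) a0%:E)%E).
    apply: ge0_le_integral => //.
    - exact: measurable_funTS.
    - by move=> z [_ /=] h; rewrite lee_fin ltW.
  have := integral_cst lam mS a0%:E => /= ->.
  apply: lee_wpmul2l; first by rewrite lee_fin (le_trans ler01).
  by apply: le_measure; rewrite ?inE// => z [].
rewrite linf leye_eq => /eqP h.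
have : (a0%:E * lam [set z : measurableTypeR R | (1 < `|z|)%R] + B%:E < +oo)%E.
  by rewrite lte_add_pinfty// ?ltry// lte_mul_pinfty// ?lee_fin ?(le_trans ler01).
by rewrite h ltxx.
Qed.

(** On jumps with rate in (0, K] and time in [-1, 0] the Riemann sum of kernels lies between two
    positive constants, so the weight of level I dominates a multiple of |z| for sizes up to order
    2^I. Its jump integral is thus unbounded in I, and the converse domination carries this over to
    the process, uniformly in N and v. *)
Lemma riemann_dyadic_unbounded (t K : R) : 0 < t -> 0 < K ->
  (0 < mu (`]0%R, K]%classic : set (measurableTypeR R)))%E -> large_moment lam 1 = +oo%E ->
  exists2 de, 0 < de & forall B, exists I : nat, forall N v, (0 < N)%N -> 0 <= v <= 1 ->
   (B%:E <= \int[P2]_w (dyadic_weight I (de * riemann_sum t N (fun u => W u w) v))%:E)%E.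
Proof.
move=> t0 K0 muK linf.
have [n tn] : exists n : nat, t < n%:R.
  by exists (Num.bound t); apply: archi_boundP; exact: ltW.
have n0 : (0 < n)%N by rewrite -(ltr_nat R) (lt_trans t0).
pose g q := Num.max 1 (q - al).
have g1 q : 1 <= g q by rewrite le_max lexx.
have g2 q : q - al <= g q by rewrite le_max lexx orbT.
have [C C0 hC] := integral_two_power_le al0 (ltr0Sn R 1) p0 (g1 2) (g1 p) (g2 2) (g2 p)
  origin_al (levy_small_moment2 lam_levy) large_p.
pose C' := C * (n%:R `^ g 2 + n%:R `^ g p).
have C'0 : 0 <= C' by rewrite mulr_ge0// addr_ge0 ?powR_ge0.
have y0 : 0 < 4 * C' + 1 by rewrite ltr_wpDl ?mulr_ge0.
have y1 : 1 <= 4 * C' + 1 by rewrite lerDr mulr_ge0.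
(* C' r^(-p) <= 1/4 bounds the jump integral of [two_power] by 1/4, hence that of 1 - cos by 1/2, as
   the converse domination demands. *)
pose r := (4 * C' + 1) `^ p^-1.
have r0 : 0 < r by rewrite powR_gt0.
have r1 : 1 <= r by rewrite -(powRr0 (4 * C' + 1)) ler_powR// invr_ge0 ltW.
have rp : r `^ (- p) = (4 * C' + 1)^-1.
  by rewrite powRN -powRrM mulVf ?gt_eqF// powRr1// ltW.
have bnd : (\int[nu]_e (two_power 2 p (envelope n 0 e.1 / r) e.2)%:E <= 4^-1%:E)%E.
  apply: le_trans (hC n 0 r n0 r0) _; rewrite lee_fin.
  have r2 : r `^ (- 2) <= r `^ (- p) by rewrite ler_powR// lerN2 (le_trans p1)// ler1n.
  apply: (@le_trans _ _ (C' * r `^ (- p))).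
    rewrite /C' -mulrA ler_wpM2l// mulrDl lerD// ler_wpM2l// powR_ge0.
  by rewrite rp ler_pdivrMr//; lra.
(* With this factor the scaled Riemann sum of kernels is at most envelope / r, and a further factor
   2^-i only decreases it. *)
pose de := (r * t)^-1; have de0 : 0 < de by rewrite invr_gt0 mulr_gt0.
have det : de * t = r^-1 by rewrite /de invfM -mulrA mulVf ?mulr1// gt_eqF.
exists de => // B.
pose c1 := t * expR (- K * (t + 1)); have c10 : 0 < c1 by rewrite mulr_gt0// expR_gt0.
(* For sizes from a0 to 2 r 2^I the scaled argument has modulus between 1 and 2^(I+1), the range
   where the weight is comparable with it. *)
pose a0 := Num.max 1 ((de * c1)^-1).
have a01 : 1 <= a0 by rewrite le_max lexx.
have dc0 : 0 < de * c1 by rewrite mulr_gt0.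
pose D : set (measurableTypeR R) := `]0%R, K]%classic.
have mD : measurable D by exact: measurable_itv.
have mQf : mu D \is a fin_num by rewrite fin_num_measure.
pose mQ := fine (mu D).
have mQE : mu D = mQ%:E by rewrite fineK.
have mQ0 : 0 < mQ by rewrite -lte_fin -mQE; exact: muK.
have c2 : 0 < 2 * r by rewrite mulr_gt0.
have [I hI] := large_integral_unbounded (B / (mQ * (de * c1 / 8))) linf a01 c2.
pose A : set (measurableTypeR R) := [set z | a0 <= `|z| <= 2 * r * 2 ^+ I].
exists I => N v N0 v01.
have mA : measurable A.
  have -> : A = setT `&` (fun z : measurableTypeR R => `|z|) @^-1` `[a0, 2 * r * 2 ^+ I].
    by rewrite setTI; apply/seteqP; split => z /=; rewrite in_itv.
  by apply: normr_measurable => //; exact: measurable_itv.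
pose Q : set (plane R) := D `*` `[(-1)%R, 0%R]%classic.
have mQs : measurable Q by apply: measurableX; exact: measurable_itv.
pose l := riemann_comb t N v.
have mku u : measurable_fun setT (@jump_kernel R u).
  by have := measurableT_comp (@measurable_jump_kernel R) (measurable_pair1 (u : measurableTypeR R)); exact.
have mWu u : measurable_fun setT (W u).
  by have := measurableT_comp (measurable_symmetrized X_supOU) (measurable_pair1 (u : measurableTypeR R)); exact.
have mcos (d' : measure_display) (E : measurableType d') (Z : R -> E -> R) i : (forall u, measurable_fun setT (Z u)) ->
    measurable_fun setT (fun w => 1 - cos (2 ^- i * (de * lincomb l (fun u => Z u w)))).
  move=> mZ; apply: measurable_funB => //; apply: measurableT_comp; first exact: measurable_cos.
  by apply: measurable_funM => //; apply: measurable_funM => //; exact: measurable_lincomb.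
have dyE (d' : measure_display) (E : measurableType d') (m' : {measure set E -> \bar R}) (Z : R -> E -> R) :
   (forall u, measurable_fun setT (Z u)) ->
   (\int[m']_w (dyadic_weight I (de * lincomb l (fun u => Z u w)))%:E =
    \sum_(i < I.+1) (2 ^+ i)%:E * \int[m']_w (1 - cos (2 ^- i * (de * lincomb l (fun u => Z u w))))%:E)%E.
  move=> mZ; rewrite /dyadic_weight.
  under eq_integral do rewrite -sumEFin.
  rewrite ge0_integral_sum//; last first.
    by move=> i; apply/measurable_EFinP; apply: measurable_funM => //; exact: mcos.
  apply: eq_bigr => i _; under eq_integral do rewrite EFinM.
  by rewrite ge0_integralZl//; apply/measurable_EFinP; exact: mcos.
under eq_integral do rewrite -lincomb_riemann -/l.
rewrite (dyE _ _ P2 (fun u w => W u w) mWu).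
apply: (@le_trans _ _ (\int[nu]_e (dyadic_weight I (de * lincomb l (fun u => jump_kernel u e)))%:E)%E); last first.
  rewrite (dyE _ _ nu (fun u e => jump_kernel u e) mku); apply: lee_sum => i _.
  apply: lee_wpmul2l; first by rewrite lee_fin exprn_ge0.
  have lE (y : R -> R) : 2 ^- i * (de * lincomb l y) = lincomb (scale_comb (2 ^- i * de) l) y.
    by rewrite lincomb_scale mulrA.
  under eq_integral do rewrite lE.
  under [X in (_ <= X)%E]eq_integral do rewrite lE.
  apply: symmetrized_onem_cos_ge.
  apply: (@le_trans _ _ (\int[nu]_e (2 * two_power 2 p (envelope n 0 e.1 / r) e.2)%:E)%E).
    apply: ge0_le_integral => //.
    - apply/measurable_EFinP; apply: measurable_funB => //; apply: measurableT_comp; first exact: measurable_cos.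
      exact: measurable_lincomb.
    - apply/measurable_EFinP; apply: measurable_funM => //; exact: measurable_two_power_envelope.
    move=> e _; rewrite lee_fin (le_trans (onem_cos_min _))// ler_pM2l//.
    have h22 : 0 <= (2:R) <= 2 by rewrite lexx ler0n.
    have h2p : 0 <= p <= 2 by rewrite (ltW p0) (le_trans p1)// ler1n.
    have er0 : 0 <= envelope n 0 e.1 / r by rewrite divr_ge0 ?envelope_ge0// ltW.
    apply: le_trans (two_power_min_sqr e.2 h22 h2p er0).
    rewrite lincomb_scale lincomb_jump_kernel /l lincomb_riemann.
    rewrite le_min ge_min lexx/= ge_min; apply/orP; right.
    rewrite mulrCA [leLHS]exprMn [leRHS]exprMn ler_wpM2l ?sqr_ge0//.
    have [e0|e0] := ltP 0 e.1.1; last by rewrite !mulr0 expr0n/= sqr_ge0.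
    have /andP[k0 k1] := riemann_kernel_le t0 tn N0 v01 e0.
    have i0 : 0 <= 2 ^- i :> R by rewrite invr_ge0 exprn_ge0.
    have i1 : 2 ^- i <= 1 :> R by rewrite invf_le1 ?exprn_gt0// exprn_ege1// ler1n.
    have a0' : 0 <= 2 ^- i * de * riemann_sum t N (fun u => supOU_kernel u e.1) v.
      by rewrite mulr_ge0// mulr_ge0// ltW.
    rewrite mulr1 lerXn2r// ?nnegrE//.
    apply: (@le_trans _ _ (de * (t * envelope n 0 e.1))).
      rewrite -mulrA; apply: (@le_trans _ _ (1 * (de * riemann_sum t N (fun u => supOU_kernel u e.1) v))).
        by rewrite ler_wpM2r// mulr_ge0// ltW.
      by rewrite mul1r ler_wpM2l// ltW.
    by rewrite mulrA det mulrC.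
  under eq_integral do rewrite EFinM.
  rewrite ge0_integralZl//; last 2 first.
  - by apply/measurable_EFinP; exact: measurable_two_power_envelope.
  - by move=> e _; rewrite lee_fin two_power_ge0.
  apply: (@le_trans _ _ (2%:E * 4^-1%:E)%E); first exact: lee_wpmul2l.
  by rewrite -EFinM lee_fin; lra.
have mq : measurable_fun setT (fun e : plane R * measurableTypeR R =>
    (\1_Q e.1 * (de * c1 / 8 * (`|e.2| * \1_A e.2)))%:E).
  have m1 : measurable_fun setT (fun e : plane R * measurableTypeR R => \1_Q e.1 : R).
    have h := @measurable_indic _ (plane R) R setT Q mQs.
    exact: (measurableT_comp h (@measurable_fst _ _ (plane R) (measurableTypeR R))).
  have m2 : measurable_fun setT (fun e : plane R * measurableTypeR R => \1_A e.2 : R).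
    have h := @measurable_indic _ (measurableTypeR R) R setT A mA.
    exact: (measurableT_comp h (@measurable_snd _ _ (plane R) (measurableTypeR R))).
  apply/measurable_EFinP; apply: measurable_funM => //; apply: measurable_funM => //.
  apply: measurable_funM => //; apply: measurableT_comp => //; exact: measurable_snd.
apply: (@le_trans _ _ (\int[nu]_e (\1_Q e.1 * (de * c1 / 8 * (`|e.2| * \1_A e.2)))%:E)%E); last first.
  apply: ge0_le_integral => //.
  - by move=> e _; rewrite lee_fin !mulr_ge0// ltW.
  - apply/measurable_EFinP; rewrite /dyadic_weight; apply: measurable_sum => i.
    by apply: measurable_funM => //; exact: mcos.
  move=> e _; rewrite lee_fin !indicE.
  have [eQ|_] := boolP (e.1 \in Q); last by rewrite mul0r dyadic_weight_ge0.
  have [eA|_] := boolP (e.2 \in A); last by rewrite !mulr0 dyadic_weight_ge0.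
  rewrite mul1r mulr1 lincomb_jump_kernel /l lincomb_riemann.
  have [] := set_mem eQ; rewrite /= !in_itv/= => q1 q2.
  have /andP[l1 l2] := riemann_kernel_ge t0 N0 v01 q1 q2.
  have q10 : 0 < e.1.1 by case/andP: q1.
  rewrite q10 mulr1; move: l1 l2; rewrite -/c1; set S := riemann_sum _ _ _ _ => l1 l2.
  have S0 : 0 <= S by rewrite (le_trans _ l1)// ltW.
  have /andP[z1 z2] := set_mem eA.
  have nE : `|de * (e.2 * S)| = de * (`|e.2| * S) by rewrite normrM normrM (gtr0_norm de0) (ger0_norm S0).
  apply: le_trans (dyadic_weight_geS (I := I) _); rewrite nE.
    rewrite mulrAC ler_pM2r ?invr_gt0// -mulrA ler_pM2l// mulrC ler_wpM2l//.
  apply/andP; split.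
    apply: (@le_trans _ _ (de * (`|e.2| * c1))); last by rewrite ler_pM2l// ler_wpM2l.
    rewrite mulrC -mulrA mulrC [c1 * de]mulrC -ler_pdivrMl// mulr1.
    by apply: le_trans z1; rewrite le_max lexx orbT.
  apply: (@le_trans _ _ (de * (`|e.2| * t))); first by rewrite ler_pM2l// ler_wpM2l.
  rewrite mulrCA det exprS ler_pdivrMr// (le_trans z2)// mulrAC//.
have mrhs : measurable_fun setT (fun z : measurableTypeR R => (`|z| * \1_A z)%:E).
  by apply/measurable_EFinP; apply: measurable_funM.
rewrite (@fubini_tonelli1 _ _ _ _ _ (plane_control mu) lam)//; last first.
  by move=> e; rewrite lee_fin !mulr_ge0// ltW.
rewrite /fubini_F/=.
have inner q : (\int[lam]_z (\1_Q q * (de * c1 / 8 * (`|z| * \1_A z)))%:E =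
    (\1_Q q)%:E * ((de * c1 / 8)%:E * \int[lam]_(z in A) `|z|%:E))%E.
  under eq_integral do rewrite EFinM EFinM.
  rewrite ge0_integralZl//; last 2 first.
  - by apply: measurable_funeM.
  - by move=> z _; rewrite mule_ge0// lee_fin ?mulr_ge0// ltW// divr_gt0.
  rewrite ge0_integralZl//; last first.
    by rewrite lee_fin ltW// divr_gt0.
  congr (_ * (_ * _))%E; rewrite [RHS]integral_mkcond; apply: eq_integral => z _.
  by rewrite patchE indicE; case: ifP => zA; rewrite ?mulr1// mulr0.
under eq_integral do rewrite inner.
rewrite ge0_integralZr//; last 2 first.
- by apply/measurable_EFinP; exact: measurable_indic.
- by rewrite mule_ge0// ?integral_ge0// lee_fin ltW// divr_gt0.
rewrite integral_indic// setIT.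
set m0 := (X in (_ <= X * _)%E); have -> : m0 = mQ%:E.
  transitivity (mu D * leb `[(-1)%R, 0%R])%E.
    by apply: product_measure1E => //; exact: measurable_itv.
  rewrite mQE; have := @lebesgue_measure_itv R `[(-1)%R, 0%R]; rewrite /= lte_fin ltrN10 => ->.
  by rewrite -EFinD -EFinM opprK add0r mulr1.
have h8 : 0 < de * c1 / 8 by rewrite divr_gt0.
rewrite muleA -EFinM.
apply: (@le_trans _ _ ((mQ * (de * c1 / 8))%:E * (B / (mQ * (de * c1 / 8)))%:E)%E).
  by rewrite -EFinM lee_fin mulrC divfK// gt_eqF// mulr_gt0.
by apply: lee_wpmul2l; [rewrite lee_fin ltW// mulr_gt0|exact: hI].
Qed.

Let unit_itv_fin : (leb (`[0%R, 1%R]%classic) < +oo)%E.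
Proof. by have := @lebesgue_measure_itv R `[0, 1]; rewrite /= lte_fin ltr01 => ->; rewrite -EFinB ltry. Qed.

Lemma measurable_integrated t : measurable_fun setT (integrated X t).
Proof.
have [mX _] := X_supOU.
by apply: (@measurable_integral_param _ _ _ _ (fun q => X q.1 q.2)) => //; exact: measurable_itv.
Qed.

(** At a fixed level the weight is Lipschitz with constant I + 1, so the mean convergence of the
    Riemann sums is enough. *)
Lemma riemann_functional_cvg (t de : R) I w : 0 < t -> 0 < de ->
  leb.-integrable `[0, t] (EFin \o (fun u => W u w)) ->
  (\int[leb]_(v in `[0, 1]) dyadic_weight I (de * riemann_sum t N.+1 (fun u => W u w) v))
    @[N --> \oo] --> dyadic_weight I (de * \int[leb]_(u in `[0, t]) W u w).
Proof.
move=> t0 de0 iW.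
have mc : measurable_fun setT (fun u : measurableTypeR R => W u w).
  have := measurableT_comp (measurable_symmetrized X_supOU) (measurable_pair2 (w : T * T)); exact.
have m01 : measurable (`[0, 1]%classic : set (measurableTypeR R)) by exact: measurable_itv.
have l01 : leb (`[0, 1]%classic : set (measurableTypeR R)) = 1%E.
  by have := @lebesgue_measure_itv R `[0, 1]; rewrite /= lte_fin ltr01 => ->; rewrite -EFinB subr0.
set z := \int[leb]_(u in `[0, t]) W u w.
have mdw N : measurable_fun setT (fun v : measurableTypeR R => dyadic_weight I (de * riemann_sum t N (fun u => W u w) v)).
  apply: measurableT_comp; [exact: measurable_dyadic_weight|apply: measurable_funM => //].
  rewrite /riemann_sum; apply: measurable_sum => k; apply: measurable_funM => //.
  apply: (measurableT_comp mc); have := @measurable_affine R (t / N%:R) (t / N%:R * k%:R).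
  by apply: eq_measurable_fun => x _ /=; rewrite mulrDr addrC.
have idw N : leb.-integrable `[0, 1] (EFin \o (fun v => dyadic_weight I (de * riemann_sum t N (fun u => W u w) v))).
  apply: (@measurable_bounded_integrable _ _ R leb) => //.
    exact: measurable_funTS.
  exists (2 * I.+1%:R * 2 ^+ I); split; first exact: num_real.
  move=> x hx v _ /=; rewrite ger0_norm ?dyadic_weight_ge0//.
  by rewrite (le_trans (dyadic_weight_le _ _))// ltW.
apply/cvgrPdist_le => /= eps eps0.
have c0 : 0 < I.+1%:R * de by rewrite mulr_gt0.
have [N0 hN0] := riemann_sum_cvg t0 (divr_gt0 eps0 c0) mc iW.
near=> N; have NN : (N0 <= N.+1)%N by rewrite ltnW//; near: N; exact: nbhs_infty_ge.
have [iR hR] := hN0 N.+1 NN (ltn0Sn N).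
have icst (x : R) : leb.-integrable `[0, 1] (EFin \o (fun=> x)).
  apply: (@measurable_bounded_integrable _ _ R leb) => //.
  by exists `|x|; split; [exact: num_real|move=> y /= /ltW].
have zE : dyadic_weight I (de * z) = \int[leb]_(v in `[0, 1]) dyadic_weight I (de * z).
  rewrite Rintegral_cst// (_ : fine _ = 1) ?mulr1//.
  exact: (congr1 fine l01).
rewrite zE distrC -RintegralB//.
apply: le_trans (le_normr_Rintegral _ _) _ => //.
  have h := integrableB m01 (idw N.+1) (icst (dyadic_weight I (de * z))); exact: h.
have iD : leb.-integrable `[0, 1] (EFin \o (fun v => `|riemann_sum t N.+1 (fun u => W u w) v - z|)).
  have h := integrable_norm (integrableB m01 iR (icst z)); exact: h.
apply: (@le_trans _ _ (\int[leb]_(v in `[0, 1]) (I.+1%:R * de * `|riemann_sum t N.+1 (fun u => W u w) v - z|))).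
  apply: le_Rintegral => //.
  - have h := integrable_norm (integrableB m01 (idw N.+1) (icst (dyadic_weight I (de * z)))); exact: h.
  - have h := integrableZl m01 (I.+1%:R * de) iD; exact: h.
  move=> v _; rewrite (le_trans (dyadic_weight_lipschitz _ _ _))// -mulrBr normrM (gtr0_norm de0) mulrA//.
rewrite RintegralZl//.
by rewrite -ler_pdivlMl// mulrC.
Unshelve. all: by end_near.
Qed.

(** If the mean E were finite, the weight of the symmetrized integral would have mean at most 4 de
    (E + E). The level I is chosen so that this is exceeded by 1 for all Riemann sums at once; as
    the weight is bounded at fixed I, the excess survives in the limit. *)
Lemma integrated_mean_infinite (t K : R) : 0 < t -> 0 < K ->
  (0 < mu (`]0%R, K]%classic : set (measurableTypeR R)))%E -> large_moment lam 1 = +oo%E ->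
  {ae P, forall w, leb.-integrable `[0, t] (EFin \o (fun u => X u w))} ->
  (\int[P]_w `|integrated X t w|%:E = +oo)%E.
Proof.
move=> t0 K0 muK linf aeI.
have mY := measurable_integrated t.
have mYE : measurable_fun setT (fun w => `|integrated X t w|%:E).
  by apply/measurable_EFinP; exact: measurableT_comp.
have m01 : measurable (`[0, 1]%classic : set (measurableTypeR R)) by exact: measurable_itv.
have l01 : leb (`[0, 1]%classic : set (measurableTypeR R)) = 1%E.
  by have := @lebesgue_measure_itv R `[0, 1]; rewrite /= lte_fin ltr01 => ->; rewrite -EFinB subr0.
have [de de0 hde] := riemann_dyadic_unbounded t0 K0 muK linf.
apply: contrapT => /eqP; rewrite -ltey => Efin.
have E0 : (0 <= \int[P]_w `|integrated X t w|%:E)%E by apply: integral_ge0.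
pose E := fine (\int[P]_w `|integrated X t w|%:E)%E.
have EE : (\int[P]_w `|integrated X t w|%:E = E%:E)%E by rewrite fineK// ge0_fin_numE.
have {hde}[I hI] := hde (4 * de * (E + E) + 1).
pose M := 2 * I.+1%:R * 2 ^+ I : R.
pose F N (q : measurableTypeR R * (T * T)) := dyadic_weight I (de * riemann_sum t N (fun u => W u q.2) q.1).
have mF N : measurable_fun setT (F N).
  apply: measurableT_comp; [exact: measurable_dyadic_weight|apply: measurable_funM => //].
  rewrite /riemann_sum; apply: measurable_sum => k; apply: measurable_funM => //.
  have h1 : measurable_fun setT (fun q : measurableTypeR R * (T * T) =>
      (t / N%:R * (k%:R + q.1) : measurableTypeR R, q.2)).
    apply/measurable_fun_pairP; split => /=; last exact: measurable_snd.
    apply: measurable_funM => //; apply: measurable_funD => //; exact: measurable_fst.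
  exact: (measurableT_comp (measurable_symmetrized X_supOU) h1).
pose A N w := \int[leb]_(v in `[0, 1]) F N (v, w).
have mA N : measurable_fun setT (A N).
  exact: measurable_integral_param.
have FA N w : (\int[leb]_(v in `[0%R, 1%R]) (F N (v, w))%:E = (A N w)%:E)%E.
  rewrite /A /Rintegral fineK//; apply: integrable_fin_num => //.
  apply: (@measurable_bounded_integrable _ _ R leb) => //.
    by apply: measurable_funTS; have := measurableT_comp (mF N) (measurable_pair2 (w : T * T)); exact.
  exists M; split; first exact: num_real.
  move=> x hx v _ /=; rewrite ger0_norm ?dyadic_weight_ge0//.
  by rewrite (le_trans (dyadic_weight_le _ _))// ltW.
have F0 N q : (0 <= (F N q)%:E)%E by rewrite lee_fin dyadic_weight_ge0.
have cst01 (x : R) : (\int[leb]_(v in `[0%R, 1%R]) x%:E = x%:E)%E.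
  by rewrite integral_cst// [X in (_ * X)%E]l01 mule1.
have A0 N w : 0 <= A N w by rewrite -lee_fin -FA; exact: integral_ge0.
have AM N w : A N w <= M.
  rewrite -lee_fin -FA -[leRHS]cst01; apply: ge0_le_integral => //.
  - by apply/measurable_EFinP; apply: measurable_funTS; have := measurableT_comp (mF N) (measurable_pair2 (w : T * T)); exact.
  - by move=> v _; rewrite lee_fin dyadic_weight_le.
have lb N : ((4 * de * (E + E) + 1)%:E <= \int[P2]_w (A N.+1 w)%:E)%E.
  under eq_integral do rewrite -FA.
  rewrite -(@ge0_integral_exchange _ _ _ P2 _ (fun q => (F N.+1 q)%:E))//; last by apply/measurable_EFinP.
  rewrite -[leLHS]cst01; apply: ge0_le_integral => //.
  - by move=> v _; rewrite lee_fin addr_ge0// mulr_ge0 ?addr_ge0 ?mulr_ge0 ?(ltW de0)// -lee_fin -EE.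
  - apply: measurable_funTS; apply: (@measurable_fun_fubini_tonelli_F _ _ _ _ _ P2 (fun q => (F N.+1 q)%:E)) => //.
    exact/measurable_EFinP.
  by move=> v; rewrite /= in_itv/= => v01; exact: hI.
pose Ws (w : T * T) := integrated X t w.1 - integrated X t w.2.
have mWs : measurable_fun setT Ws by apply: measurable_funB; exact: measurableT_comp.
have mdW : measurable_fun setT (fun w => (dyadic_weight I (de * Ws w))%:E).
  apply/measurable_EFinP; apply: measurableT_comp; first exact: measurable_dyadic_weight.
  exact: measurable_funM.
have cvA : {ae P2, forall w, setT w -> (A N.+1 w)%:E @[N --> \oo] --> (dyadic_weight I (de * Ws w))%:E}.
  apply: filterS (square_ae aeI) => w [i1 i2] _; apply/fine_cvgP; split; first exact: nearW.
  have mt : measurable (`[0, t]%classic : set (measurableTypeR R)) by exact: measurable_itv.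
  have -> : Ws w = \int[leb]_(u in `[0, t]) W u w by rewrite /symmetrized RintegralB.
  apply: riemann_functional_cvg => //.
  have h := integrableB mt i1 i2; exact: h.
have iM : P2.-integrable setT (fun=> M%:E) by exact: finite_measure_integrable_cst.
have domA : {ae P2, forall w N, setT w -> (`|(A N.+1 w)%:E| <= M%:E)%E}.
  by apply: nearW => w N _; rewrite lee_fin ger0_norm//; exact: AM.
have mAE N : measurable_fun setT (fun w => (A N.+1 w)%:E) by exact/measurable_EFinP.
have [_ _ cv] := dominated_convergence measurableT mAE mdW cvA iM domA.
have : ((4 * de * (E + E) + 1)%:E <= \int[P2]_w (dyadic_weight I (de * Ws w))%:E)%E.
  rewrite -(cvg_lim _ cv)//; apply: lime_ge; first by apply/cvg_ex; eexists; exact: cv.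
  exact: nearW.
apply/negP; rewrite -ltNge.
apply: (@le_lt_trans _ _ (\int[P2]_w ((4 * de)%:E * (`|integrated X t w.1|%:E + `|integrated X t w.2|%:E)))%E).
  apply: ge0_le_integral => //.
  - by move=> w _; rewrite lee_fin dyadic_weight_ge0.
  - apply: measurable_funeM; apply: emeasurable_funD; apply: (measurableT_comp mYE); [exact: measurable_fst|exact: measurable_snd].
  move=> w _; rewrite -EFinD -EFinM lee_fin (le_trans (dyadic_weight_le_norm _ _))//.
  by rewrite normrM (gtr0_norm de0) mulrA ler_wpM2l ?mulr_ge0 ?(ltW de0)// ler_normB.
rewrite ge0_integralZl//; last 3 first.
- apply: emeasurable_funD; apply: (measurableT_comp mYE); [exact: measurable_fst|exact: measurable_snd].
- by move=> w _; rewrite adde_ge0.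
- by rewrite lee_fin mulr_ge0// ltW.
rewrite ge0_integralD//; last 2 first.
- by apply: (measurableT_comp mYE); exact: measurable_fst.
- by apply: (measurableT_comp mYE); exact: measurable_snd.
rewrite (integral_square_fst P mYE)// (integral_square_snd P mYE)// EE -EFinD -EFinM lte_fin.
by rewrite ltrDl.
Qed.
End infinite_mean.

(** * Growth of integrated supOU processes *)

(** The constant disappears because ln c / ln t tends to 0: half of e pays for it, the other half
    for 1 / (k + 1). Where Z vanishes, the logarithm is -oo and the bound holds trivially. *)
Lemma limsup_growth_ratio {R : realType} (Z : R -> R) (L : R) :
  (forall k : nat, exists c t0, forall t, t0 <= t -> `|Z t| <= c * t `^ (L + k.+1%:R^-1)) ->
  (limf_esup (fun t => lne (`|Z t|%R)%:E / (ln t)%:E) (pinfty_nbhs R) <= L%:E)%E.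
Proof.
move=> hZ; apply/lee_addgt0Pr => e e0; have e20 : 0 < e / 2 by rewrite divr_gt0.
have [k ke] : exists k : nat, k.+1%:R^-1 <= e / 2.
  exists (Num.bound (e / 2)^-1); rewrite invf_ple ?posrE//.
  by rewrite ltW// (lt_trans (archi_boundP _))// ?ltr_nat// invr_ge0 ltW.
have [c [t0 ht]] := hZ k.
pose c1 := Num.max 1 c; have c11 : 1 <= c1 by rewrite le_max lexx.
have c10 : 0 < c1 by exact: lt_le_trans c11.
pose M := Num.max t0 (Num.max 1 (expR (ln c1 / (e / 2)))).
rewrite limf_esupE; apply: ge_ereal_inf.
pose V : set R := [set t | M < t].
exists (ereal_sup [set (lne (`|Z t|%R)%:E / (ln t)%:E)%E | t in V]) => /=.
  exists V => //; exists M; split; [exact: num_real|by []].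
apply: ub_ereal_sup => _ [t Mt <-].
have : M < t by exact: Mt.
rewrite !gt_max => /and3P[t0t t1 tc].
have tpos : 0 < t by exact: lt_trans t1.
have lt0 : 0 < ln t by rewrite ln_gt0.
have lc : ln c1 <= e / 2 * ln t.
  rewrite mulrC -ler_pdivrMr// -(expRK (ln c1 / _)).
  by apply/ltW; rewrite ltr_ln ?posrE ?expR_gt0.
rewrite inver gt_eqF// lee_pdivrMr// -EFinD -EFinM.
case: ifPn => [_|]; first by rewrite leNye.
rewrite -ltNge => Zpos; rewrite lee_fin.
have hb : `|Z t| <= c1 * t `^ (L + k.+1%:R^-1).
  by apply: le_trans (ht t (ltW t0t)) _; rewrite ler_wpM2r ?powR_ge0// le_max lexx orbT.
apply: (@le_trans _ _ (ln (c1 * t `^ (L + k.+1%:R^-1)))).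
  by rewrite ler_ln// posrE mulr_gt0 ?powR_gt0.
rewrite lnM ?posrE ?powR_gt0// ln_powR.
apply: (@le_trans _ _ (e / 2 * ln t + (L + e / 2) * ln t)).
  by apply: lerD => //; rewrite ler_wpM2r ?(ltW lt0)// lerD2l.
by rewrite -mulrDl (_ : e / 2 + (L + e / 2) = L + e)//; field.
Qed.

(** * Bundled measures and the index parameters *)

Lemma finite_measure_of d (T : measurableType d) (R : realType) (m : {measure set T -> \bar R}) :
  (m setT < +oo)%E -> exists m' : {finite_measure set T -> \bar R}, (m' : {measure set T -> \bar R}) = m.
Proof.
case: m => m cm fin.
pose f := @Measure_isFinite.Build _ _ _ (Measure.Pack cm : set T -> \bar R) (lty_fin_num_fun fin).
pose m' : {finite_measure set T -> \bar R} :=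
  HB.pack (m : set T -> \bar R) (Measure.Pack cm : {measure set T -> \bar R}) f.
by exists m'; destruct cm.
Qed.

Lemma sigma_finite_measure_of d (T : measurableType d) (R : realType) (m : {measure set T -> \bar R}) :
  sigma_finite setT m ->
  exists m' : {sigma_finite_measure set T -> \bar R}, (m' : {measure set T -> \bar R}) = m.
Proof.
case: m => m cm fin.
pose f := @Measure_isSigmaFinite.Build _ _ _ (Measure.Pack cm : set T -> \bar R) fin.
pose m' : {sigma_finite_measure set T -> \bar R} :=
  HB.pack (m : set T -> \bar R) (Measure.Pack cm : {measure set T -> \bar R}) f.
by exists m'; destruct cm.
Qed.

Lemma origin_moment_mono {R : realType} (mu : {measure set (measurableTypeR R) -> \bar R}) (p q : R) :
  p <= q -> (origin_moment mu q < +oo -> origin_moment mu p < +oo)%E.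
Proof.
move=> pq; apply: le_lt_trans; rewrite /origin_moment.
have m01 : measurable (`]0, 1]%classic : set (measurableTypeR R)) by exact: measurable_itv.
have mp z : measurable_fun (`]0, 1]%classic : set (measurableTypeR R)) (fun x : measurableTypeR R => (x `^ z)%:E).
  by apply/measurable_EFinP; apply: measurable_funTS; exact: measurable_powR.
apply: ge0_le_integral => //.
  by move=> x _; rewrite lee_fin powR_ge0.
move=> x; rewrite /= in_itv/= => /andP[x0 x1]; rewrite lee_fin; apply: ger_powR; rewrite ?x0//.
by rewrite lerD2r lerN2.
Qed.

(** If the supremum is attained it is a real number, so some nonnegative order is admissible and the
    supremum is nonnegative. Otherwise an admissible order exceeds [al], and finiteness passes to
    smaller orders. *)
Lemma alpha_paramP {R : realType} (mu : {measure set (measurableTypeR R) -> \bar R}) (al : R) :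
  alpha_param mu al -> 0 <= al /\ (origin_moment mu al < +oo)%E.
Proof.
rewrite /alpha_param; case: ifP => [/andP[_ h] ale|_ [al0 /ereal_sup_gt[_ [b [b0 hb] <-]]]].
  split; last by rewrite -[al]/(fine al%:E) ale.
  have : (-oo < alpha0 mu)%E by rewrite -ale ltNyr.
  by move=> /ereal_sup_gt[_ [b [b0 hb] <-] _]; rewrite -lee_fin ale;
    apply: (@le_trans _ _ b%:E); [rewrite lee_fin|apply: ereal_sup_ubound; exists b].
by rewrite lte_fin => /ltW ab; split => //; exact: origin_moment_mono hb.
Qed.

Lemma eta_paramP {R : realType} (lam : {measure set (measurableTypeR R) -> \bar R}) (eta : R) :
  eta_param lam eta -> 0 <= eta /\ (large_moment lam eta < +oo)%E.
Proof.
rewrite /eta_param; case: ifP => [/andP[_ h] ale|_ [al0 /ereal_sup_gt[_ [b [b0 hb] <-]]]].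
  split; last by rewrite -[eta]/(fine eta%:E) ale.
  have : (-oo < eta_infty lam)%E by rewrite -ale ltNyr.
  by move=> /ereal_sup_gt[_ [b [b0 hb] <-] _]; rewrite -lee_fin ale;
    apply: (@le_trans _ _ b%:E); [rewrite lee_fin|apply: ereal_sup_ubound; exists b].
by rewrite lte_fin => /ltW ab; split => //; exact: large_moment_mono hb.
Qed.

(** Order 2 is always admissible for a Levy measure, whence beta0 <= 2. In the unattained case an
    admissible order lies below beta, and finiteness passes to larger orders. *)
Lemma beta_paramP {R : realType} (lam : {measure set (measurableTypeR R) -> \bar R}) (beta : R) :
  is_levy_measure lam -> beta_param lam beta ->
  [/\ 0 <= beta, beta <= 2 & (small_moment lam beta < +oo)%E].
Proof.
move=> lam_levy; set S := [set b | 0 <= b /\ (small_moment lam b < +oo)%E].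
have S2 : S 2 by split => //; exact: levy_small_moment2.
have lbS : lbound S 0 by move=> b [].
have b00 : 0 <= beta0 lam by apply: lb_le_inf => //; exists 2.
rewrite /beta_param; case: ifP => [h ->|_ [b1 b2 _]].
  by split => //; apply: ge_inf => //; exists 0.
split => //; first by rewrite (le_trans b00)// ltW.
have hS : has_inf S by split; [exists 2|exists 0].
have [b [hb0 hb] bb] := inf_adherent (eps := beta - beta0 lam) (ltac:(by rewrite subr_gt0)) hS.
move: bb; rewrite -/(beta0 lam) addrC subrK => /ltW bb.
exact: small_moment_mono bb hb.
Qed.

(** By Markov's inequality the sets where min (1, z^2) > 1 / (n + 1) have finite measure; they cover
    everything but 0, which is a null set. *)
Lemma levy_sigma_finite {R : realType} (lam : {measure set (measurableTypeR R) -> \bar R}) :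
  is_levy_measure lam -> sigma_finite setT lam.
Proof.
move=> [lam0 lam2]; pose f (z : measurableTypeR R) : R := Num.min 1 (z ^+ 2).
have mf : measurable_fun setT f.
  by apply: measurable_minr => //; exact: measurable_funX.
pose F n : set (measurableTypeR R) := [set 0] `|` [set z | n.+1%:R^-1 < f z].
have mF n : measurable (F n).
  by apply: measurableU; [exact: measurable_set1|exact: measurable_gtr].
exists F.
  apply/esym/seteqP; split => // z _; have [->|z0] := eqVneq z 0; first by exists 0%N => //; left.
  have fz : 0 < f z by rewrite /f lt_min ltr01 exprn_even_gt0.
  exists (Num.bound (f z)^-1) => //; right => /=; rewrite invf_plt ?posrE//.
  by rewrite (lt_trans (archi_boundP _))// ?ltr_nat// invr_ge0 ltW.
move=> n; split => //.
apply: le_lt_trans (measureU2 _ _ _) _; [exact: measurable_set1|exact: measurable_gtr|].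
rewrite [X in (X + _)%E]lam0 add0e.
have c0 : 0 < n.+1%:R^-1 :> R by rewrite invr_gt0.
have := measure_gt_le lam c0 (_ : measurable_fun setT (EFin \o f)) _.
move=> /(_ (ltac:(exact/measurable_EFinP)) (ltac:(by move=> z; rewrite lee_fin le_min ler01 sqr_ge0))).
under [X in lam X]eq_set do rewrite lte_fin.
move=> h; have := le_lt_trans h lam2.
by rewrite -lte_pdivlMl// => /lt_le_trans; apply; rewrite leey.
Qed.

(** * Growth rate for general exponents *)

Section supOU_estimates.
Context (R : realType) (d : measure_display) (T : measurableType d).
Variables (P : probability T R) (a : R).
Variables (mu : {finite_measure set (measurableTypeR R) -> \bar R})
  (lam : {sigma_finite_measure set (measurableTypeR R) -> \bar R}).
Variables (Lam : set (plane R) -> T -> R) (X : R -> T -> R).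
Hypotheses (lam_levy : is_levy_measure lam)
  (Lam_basis : is_levy_basis P a 0 lam mu Lam) (X_supOU : is_supOU P mu Lam X).
Variables (p al : R).
Hypotheses (p0 : 0 < p) (p1 : p <= 1) (large_p : (large_moment lam p < +oo)%E)
  (al0 : 0 <= al) (origin_al : (origin_moment mu al < +oo)%E).
Local Notation W := (symmetrized X).
Local Notation P2 := (square_prob P).
Local Notation leb := (@lebesgue_measure R).

Let mX : measurable_fun setT (fun q : measurableTypeR R * T => X q.1 q.2).
Proof. by case: X_supOU. Qed.

Let mXu u : measurable_fun setT (X u).
Proof. by have := measurableT_comp mX (measurable_pair1 (u : measurableTypeR R)); exact. Qed.

Let mWu u : measurable_fun setT (W u).
Proof.
by have := measurableT_comp (measurable_symmetrized X_supOU) (measurable_pair1 (u : measurableTypeR R)); exact.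
Qed.

(** A block of one time with a Dirac mass for [Q]: the choice of r gives 2 C r^(-p) = 2 C / (128 C +
    1) <= 1/64, the level asked by [supOU_tight], and s = 9 r comes from the threshold 9. *)
Lemma supOU_tight_uniform :
  exists2 K, 0 < K & forall u, (P [set w | (K < `|X u w|)%R] <= (8^-1)%:E)%E.
Proof.
have g1 q : 1 <= Num.max 1 (q - al) by rewrite le_max lexx.
have g2 q : q - al <= Num.max 1 (q - al) by rewrite le_max lexx orbT.
have p2 : p <= 2 by rewrite (le_trans p1)// ler1n.
have [C C0 hC] := symmetrized_tail lam_levy Lam_basis X_supOU p0 p1 large_p al0 origin_al
  (ltr0Sn R 1) (lexx _) p0 p2 (g1 2) (g1 p) (g2 2) (g2 p) (levy_small_moment2 lam_levy) large_p.
have y0 : 0 < 128 * C + 1 by rewrite ltr_wpDl ?mulr_ge0.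
pose r := (128 * C + 1) `^ p^-1.
have r0 : 0 < r by rewrite powR_gt0.
have r1 : 1 <= r by rewrite -(powRr0 (128 * C + 1)) ler_powR ?invr_ge0 ?(ltW p0)// lerDr mulr_ge0.
have rp : r `^ (- p) = (128 * C + 1)^-1.
  by rewrite powRN -powRrM mulVf ?gt_eqF// powRr1// ltW.
have r2 : r `^ (- 2) <= r `^ (- p) by rewrite ler_powR// lerN2.
apply: (supOU_tight lam_levy Lam_basis X_supOU p0 p1 large_p al0 origin_al (s := 9 * r)).
  by rewrite mulr_gt0.
pose Q0 : probability (measurableTypeR R) R := \d_(0%R : measurableTypeR R).
move=> u; have := hC Q0 1%N u r isT r0.
have inner w : (\int[Q0]_v `|lincomb (block_comb 1 u r v) (fun u0 => W u0 w)|%:E = (r^-1 * `|W u w|)%:E)%E.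
  rewrite /Q0 integral_dirac//; last first.
    apply/measurable_EFinP; apply: measurableT_comp => //.
    have h := measurable_lincomb_block 1 u r (measurable_symmetrized X_supOU).
    by have := measurableT_comp h (measurable_pair2 (w : T * T)); exact.
  rewrite diracT mul1e lincomb_block big_ord1 unit_clamp_id ?lexx ?ler01// !addr0 normrM gtr0_norm ?invr_gt0//.
have -> : [set w | (9%:E < \int[Q0]_v `|lincomb (block_comb 1 u r v) (fun u0 => W u0 w)|%:E)%E] =
    [set w | 9 * r < `|W u w|].
  by apply/seteqP; split => w /=; rewrite inner lte_fin [r^-1 * _]mulrC ltr_pdivlMr.
have one_pow (x : R) : 1%:R `^ x = 1 :> R by rewrite powR1.
rewrite !one_pow => /le_trans; apply; rewrite lee_fin.
rewrite !mul1r; apply: (@le_trans _ _ (C * (2 * r `^ (- p)))).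
  by rewrite ler_wpM2l// mulr2n mulrDl mul1r lerD2r.
by rewrite rp mulrA ler_pdivrMr//; lra.
Qed.

(** Restricting the independent copy to |X u| <= K, an event of probability at least 1/2, shows that
    half the mean of |X u| is at most B + K. *)
Lemma supOU_mean (B : R) : 0 <= B -> (forall u, (\int[P2]_w `|W u w|%:E <= B%:E)%E) ->
  exists2 B', 0 <= B' & forall u, (\int[P]_w `|X u w|%:E <= B'%:E)%E.
Proof.
move=> B0 hB; have [K K0 tightX] := supOU_tight_uniform.
exists (2 * (B + K)); first by rewrite mulr_ge0// addr_ge0// ltW.
move=> u; have mXE : measurable_fun setT (fun w => `|X u w|%:E).
  by apply/measurable_EFinP; exact: measurableT_comp.
pose A := [set w | `|X u w| <= K].
have mA : measurable A.
  rewrite (_ : A = ~` [set w | K < `|X u w|]).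
    by apply: measurableC; apply: measurable_gtr; exact: measurableT_comp.
  by apply/seteqP; split => w; rewrite /A/= leNgt => /negP.
have PA : (2^-1%:E <= P A)%E.
  have := tightX u; rewrite (_ : [set w | _] = ~` A); last first.
    by apply/seteqP; split => w /=; rewrite /A/= ltNge => /negP.
  rewrite probability_setC// -(fineK (fin_num_measure P _ mA)) -EFinB !lee_fin; lra.
have E0 : (0 <= \int[P]_w `|X u w|%:E)%E by apply: integral_ge0.
have m1 : measurable_fun setT (fun w : T * T => `|X u w.1|%:E).
  by apply: (measurableT_comp mXE); exact: measurable_fst.
have mA2 : measurable_fun setT (fun w : T * T => (\1_A w.2 : R)%:E).
  apply/measurable_EFinP.
  have h := @measurable_indic _ T R setT A mA.
  exact: (measurableT_comp h (@measurable_snd _ _ T T)).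
have : (\int[P2]_w (`|X u w.1|%:E * (\1_A w.2)%:E) <= (B + K)%:E)%E.
  apply: (@le_trans _ _ (\int[P2]_w (`|W u w|%:E + K%:E))%E).
    apply: ge0_le_integral => //.
    - exact: emeasurable_funM.
    - apply: emeasurable_funD => //; apply/measurable_EFinP; exact: measurableT_comp.
    move=> w _; rewrite -EFinM -EFinD lee_fin indicE.
    have [/set_mem wA|_] := boolP (w.2 \in A); last by rewrite mulr0 addr_ge0// ltW.
    rewrite mulr1 (_ : X u w.1 = W u w + X u w.2); last by rewrite /symmetrized subrK.
    by rewrite (le_trans (ler_normD _ _))// lerD2l.
  rewrite ge0_integralD//; last 2 first.
  - by apply/measurable_EFinP; exact: measurableT_comp.
  - by move=> w _; rewrite lee_fin ltW.
  rewrite EFinD; apply: leeD => //.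
  have := integral_cst P2 measurableT K%:E => /= ->; have := probability_setT P2 => /= ->.
  by rewrite mule1.
rewrite (@fubini_tonelli1 _ _ _ _ _ P P)//; last exact: emeasurable_funM.
rewrite /fubini_F/=.
under eq_integral do [rewrite ge0_integralZl//; last by apply/measurable_EFinP; exact: measurable_indic].
rewrite ge0_integralZr//; last by apply: integral_ge0.
rewrite integral_indic// setIT => h.
have : (2^-1%:E * \int[P]_w `|X u w|%:E <= (B + K)%:E)%E.
  by apply: le_trans h; rewrite muleC; apply: lee_wpmul2l.
rewrite -lee_pdivlMl// => /le_trans; apply.
by rewrite -EFinM invrK.
Qed.

Section exponents.
Variables (p1' p2' H : R).
Hypotheses (p10 : 0 < p1') (p12 : p1' <= 2) (p20 : 0 < p2') (p22 : p2' <= 2)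
  (small_p1 : (small_moment lam p1' < +oo)%E) (large_p2 : (large_moment lam p2' < +oo)%E)
  (pH1 : 1 <= p1' * H) (pH2 : 1 <= p2' * H) (pg1 : p1' - al <= p1' * H) (pg2 : p2' - al <= p2' * H).

Let bound_le (t : nat) (r p' : R) : (0 < t)%N -> 0 < r -> 0 < p' ->
  t%:R `^ (p' * H) * r `^ (- p') = (t%:R `^ H / r) `^ p'.
Proof.
move=> t0 r0 p'0; rewrite powRM ?powR_ge0 ?invr_ge0 ?(ltW r0)// -powRrM mulrC [H * _]mulrC.
by rewrite -(powR_inv1 (ltW r0)) -powRrM mulN1r mulrC.
Qed.

(** With x = t^H / r, the case x >= 1 is trivial thanks to the +1 in the constant. For x < 1 both
    powers are at most that of the smaller exponent, and the scale r / 9 costs 9^p <= 81 in each of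
    the two terms, hence 162. *)
Lemma supOU_tail : exists2 C, 0 <= C & forall (t : nat) s0 r, (0 < t)%N -> 0 < r ->
  (P2 [set w | r%:E < \int[leb]_(v in `[0%R, 1%R]) `|\sum_(k < t) W (s0 + k%:R + v) w|%:E] <=
    (C * (t%:R `^ H / r) `^ Num.min p1' p2')%:E)%E.
Proof.
have [C C0 hC] := symmetrized_tail lam_levy Lam_basis X_supOU p0 p1 large_p al0 origin_al
  p10 p12 p20 p22 pH1 pH2 pg1 pg2 small_p1 large_p2.
exists (162 * C + 1); first by rewrite addr_ge0// mulr_ge0.
move=> t s0 r t0 r0; set x := t%:R `^ H / r.
have x0 : 0 <= x by rewrite divr_ge0 ?powR_ge0// ltW.
have q0 : 0 < Num.min p1' p2' by rewrite lt_min p10 p20.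
have [x1|x1] := leP 1 x.
  apply: le_trans (probability_le1 P2 _) _; last rewrite lee_fin.
    rewrite -[X in measurable X]setTI; apply: emeasurable_fun_o_infty => //.
    apply: (@ge0_measurable_integral_param _ _ _ _ (fun q => `|\sum_(k < t) W (s0 + k%:R + q.1) q.2|%:E)%E) => //.
    apply/measurable_EFinP; apply: measurableT_comp => //; apply: measurable_sum => k.
    exact: (@measurable_shifted_sym _ _ _ _ mX (s0 + k%:R)).
  have : 1 <= x `^ Num.min p1' p2' by rewrite -(powRr0 x) ler_powR// ltW.
  move: (x `^ _) => y y1; have : 0 <= 162 * C * y by rewrite !mulr_ge0// (le_trans ler01).
  by rewrite mulrDl mul1r; lra.
have r9 : 0 < r / 9 by rewrite divr_gt0.
have := hC (uniform_prob (@ltr01 R)) t s0 (r / 9) t0 r9.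
have -> : [set w | (9%:E < \int[uniform_prob (@ltr01 R)]_v
      `|lincomb (block_comb t s0 (r / 9) v) (fun u => W u w)|%:E)%E] =
    [set w | (r%:E < \int[leb]_(v in `[0%R, 1%R]) `|\sum_(k < t) W (s0 + k%:R + v) w|%:E)%E].
  have i9 : 0 < (r / 9)^-1 by rewrite invr_gt0.
  have inner w : (\int[uniform_prob (@ltr01 R)]_v
      `|lincomb (block_comb t s0 (r / 9) v) (fun u => W u w)|%:E =
      ((r / 9)^-1)%:E * \int[leb]_(v in `[0%R, 1%R]) `|\sum_(k < t) W (s0 + k%:R + v) w|%:E)%E.
    rewrite integral_uniform//; last first.
      apply/measurable_EFinP; apply: measurableT_comp => //.
      have h := measurable_lincomb_block t s0 (r / 9) (measurable_symmetrized X_supOU).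
      by have := measurableT_comp h (measurable_pair2 (w : T * T)); exact.
    rewrite subr0 invr1 mul1e -ge0_integralZl//; last 2 first.
    - apply/measurable_EFinP; apply: measurableT_comp => //; apply: measurable_sum => k.
      exact: measurable_funTS (measurable_path_sym mX (s0 + k%:R) w).
    - by rewrite lee_fin ltW.
    apply: eq_integral => v; rewrite inE/= in_itv/= => v01.
    by rewrite lincomb_block unit_clamp_id// normrM gtr0_norm.
  apply/seteqP; split => w /=; rewrite inner lte_pdivlMl// -EFinM divfK//.
move=> /le_trans; apply; rewrite lee_fin (bound_le t0 r9 p10) (bound_le t0 r9 p20).
have xE : t%:R `^ H / (r / 9) = 9 * x by rewrite /x invf_div mulrCA.
have part p' : 0 < p' <= 2 -> Num.min p1' p2' <= p' -> (9 * x) `^ p' <= 81 * x `^ Num.min p1' p2'.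
  move=> /andP[p'0 p'2] mp; rewrite powRM//; apply: ler_pM; rewrite ?powR_ge0//.
    have -> : 81 = 9 `^ 2 :> R by rewrite powR_mulrn//; ring.
    by rewrite ler_powR// ler1n.
  have [->|xn0] := eqVneq x 0.
    by rewrite !powR0 ?gt_eqF.
  by apply: ger_powR => //; rewrite lt0r xn0 x0/= ltW.
rewrite xE; have h1 := part p1' _ _; have h2 := part p2' _ _.
have {}h1 : (9 * x) `^ p1' <= 81 * x `^ Num.min p1' p2' by apply: part; rewrite ?p10// ge_min lexx.
have {}h2 : (9 * x) `^ p2' <= 81 * x `^ Num.min p1' p2' by apply: part; rewrite ?p20// ge_min lexx orbT.
have y0 : 0 <= x `^ Num.min p1' p2' by exact: powR_ge0.
move: h1 h2 y0; move: (x `^ _) (_ `^ p1') (_ `^ p2') => y y1 y2 h1 h2 y0.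
rewrite mulrDl mul1r (le_trans (ler_wpM2l C0 (lerD h1 h2)))//.
rewrite (_ : C * _ = 162 * C * y); last by ring.
by rewrite lerDl.
Qed.

(** The scale r = t^H makes both terms of the bound equal to 1. *)
Lemma supOU_sum_mean : 1 <= p1' -> 1 <= p2' -> exists2 B, 0 <= B &
  forall (t : nat) s0 v, (0 < t)%N -> 0 <= v <= 1 ->
  (\int[P2]_w `|\sum_(k < t) W (s0 + k%:R + v) w|%:E <= (B * t%:R `^ H)%:E)%E.
Proof.
move=> p11 p21.
have [C C0 hC] := symmetrized_mean lam_levy Lam_basis X_supOU p0 p1 large_p al0 origin_al
  p10 p12 p20 p22 pH1 pH2 pg1 pg2 small_p1 large_p2 p11 p21.
exists (1 + C * 2); first by rewrite addr_ge0// mulr_ge0.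
move=> t s0 v t0 v01; have r0 : 0 < t%:R `^ H :> R by rewrite powR_gt0// ltr0n.
have one_pow (x : R) : 1 `^ x = 1 :> R by rewrite powR1.
have := hC t s0 (t%:R `^ H) v t0 r0; rewrite (bound_le t0 r0 p10) (bound_le t0 r0 p20) divff ?gt_eqF// !one_pow.
have mS : measurable_fun setT (fun w => `|\sum_(k < t) W (s0 + k%:R + v) w|%:E).
  by apply/measurable_EFinP; apply: measurableT_comp => //; exact: measurable_sum.
under eq_integral do rewrite lincomb_block unit_clamp_id// normrM gtr0_norm ?invr_gt0// EFinM.
rewrite ge0_integralZl//.
rewrite muleC lee_pdivrMr// => /le_trans; apply.
Qed.

End exponents.

Lemma supOU_mean_bounded : (large_moment lam 1 < +oo)%E ->
  exists2 B', 0 <= B' & forall u, (\int[P]_w `|X u w|%:E <= B'%:E)%E.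
Proof.
move=> l1.
(* Only t = 1 is used, so the rate is immaterial: H = 2 meets every constraint for the exponents 2
   and 1. *)
have h1 : (1:R) <= 2 * 2 by lra.
have h2 : (1:R) <= 1 * 2 by lra.
have h3 : (2:R) - al <= 2 * 2 by have := al0; lra.
have h4 : (1:R) - al <= 1 * 2 by have := al0; lra.
have h5 : (1:R) <= 2 by lra.
have [B B0 hB] := supOU_sum_mean (ltr0Sn R 1) (lexx _) ltr01 h5 (levy_small_moment2 lam_levy) l1
  h1 h2 h3 h4 h5 (lexx _).
apply: (supOU_mean B0) => u.
have v01 : 0 <= (0:R) <= 1 by rewrite lexx ler01.
have := hB 1%N u 0 isT v01; rewrite powR1 mulr1.
by under eq_integral do rewrite big_ord1 !addr0.
Qed.

(** The jump measure vanishes with [mu], so [mean_norm_le] leaves only the constant 1. *)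
Lemma supOU_mean_null : mu setT = 0%E ->
  exists2 B', 0 <= B' & forall u, (\int[P]_w `|X u w|%:E <= B'%:E)%E.
Proof.
move=> mu0.
apply: (supOU_mean ler01) => u.
have nu0 : jump_control mu lam setT = 0%E.
  rewrite -setXTT; transitivity (plane_control mu setT * lam setT)%E.
    exact: product_measure1E.
  suff -> : plane_control mu setT = 0%E by rewrite mul0e.
  rewrite -setXTT; transitivity (mu setT * leb setT)%E.
    exact: product_measure1E.
  by rewrite mu0 mul0e.
have LK := symmetrized_dominated lam_levy Lam_basis X_supOU p0 p1 large_p al0 origin_al.
have mku v : measurable_fun setT (@jump_kernel R v).
  by have := measurableT_comp (@measurable_jump_kernel R) (measurable_pair1 (v : measurableTypeR R)); exact.
pose l := [:: (1 : R, u)].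
pose b (e : plane R * measurableTypeR R) := 4 * `|lincomb l (fun u => jump_kernel u e)|.
have mb : measurable_fun setT b.
  by apply: measurable_funM => //; apply: measurableT_comp => //; exact: measurable_lincomb.
have := mean_norm_le mWu mku LK (l := l) mb.
have lE (y : R -> R) : lincomb l y = y u by rewrite /lincomb big_seq1 mul1r.
under eq_integral do rewrite lE.
move=> h; apply: le_trans (h _) _; first by move=> e; rewrite ge_min lexx orbT.
rewrite (@null_set_integral _ _ _ _ setT)// ?mule0 ?adde0//.
exact/measurable_EFinP.
Qed.

(** The infinite mean needs mass of [mu] on some interval (0, K]. If there is none, [mu] vanishes
    altogether, and the means are bounded. *)
Lemma supOU_mean_dichotomy : mu [set x | x <= 0] = 0%E ->
  (exists2 B', 0 <= B' & forall u, (\int[P]_w `|X u w|%:E <= B'%:E)%E) \/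
  (forall t, 0 < t -> {ae P, forall w, leb.-integrable `[0, t] (EFin \o (fun u => X u w))} ->
    (\int[P]_w `|integrated X t w|%:E = +oo)%E).
Proof.
move=> mu_neg.
have [l1|l1] := ltP (large_moment lam 1) +oo%E; first by left; exact: supOU_mean_bounded.
have {}l1 : large_moment lam 1 = +oo%E by apply/eqP; rewrite -leye_eq.
have [m0|m0] := eqVneq (mu setT) 0%E; first by left; exact: supOU_mean_null.
right=> t t0 aeI.
pose D n : set (measurableTypeR R) := `]0%R, n%:R]%classic.
have mD n : measurable (D n) by exact: measurable_itv.
have [K K0] : exists2 K, 0 < K & (0 < mu (`]0%R, K]%classic : set (measurableTypeR R)))%E.
  apply: contrapT => nK; move/eqP: m0; apply.
  have D0 n : mu.-negligible (D n).
    exists (D n); split => //; apply/eqP; rewrite eq_le measure_ge0 andbT leNgt.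
    apply/negP => h; apply: nK; exists n.+1%:R => //; apply: lt_le_trans h _.
    apply: le_measure; rewrite ?inE//.
    by move=> x; rewrite /D/= !in_itv/= => /andP[-> /le_trans]; apply; rewrite ler_nat.
  have neg : mu.-negligible ([set x : measurableTypeR R | x <= 0] `|` \bigcup_n D n).
    apply: negligibleU; last exact: negligible_bigcup.
    exists [set x | x <= 0]; split => //.
    have -> : [set x : measurableTypeR R | x <= 0] = `]-oo, 0%R]%classic by apply/seteqP; split => x; rewrite /= in_itv.
    exact: measurable_itv.
  apply: measure_negligible => //; apply: negligibleS neg => x _.
  have [x0|x0] := leP x 0; first by left.
  right; exists (Num.bound x) => //; rewrite /D/= in_itv/= x0/= ltW//.
  by apply: archi_boundP; exact: ltW.
move=> muK; exact: (integrated_mean_infinite lam_levy Lam_basis X_supOU p0 p1 large_p al0 origin_al t0 K0 muK).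
Qed.

(* The exponents p1' and p2' are used for small and large jumps. *)
Lemma supOU_limsup (p1' p2' H : R) : mu [set x | x <= 0] = 0%E ->
  0 < p1' -> p1' <= 2 -> 0 < p2' -> p2' <= 2 -> 0 < H ->
  (small_moment lam p1' < +oo)%E -> (large_moment lam p2' < +oo)%E ->
  1 <= p1' * H -> 1 <= p2' * H -> p1' - al <= p1' * H -> p2' - al <= p2' * H ->
  {ae P, forall w,
    (limf_esup (fun t => growth_ratio P (integrated X) t w) (pinfty_nbhs R) <= H%:E)%E}.
Proof.
move=> mu_neg p10 p12 p20 p22 H0 small_p1 large_p2 pH1 pH2 pg1 pg2.
have [C C0 tailW] := supOU_tail
  p10 p12 p20 p22 small_p1 large_p2 pH1 pH2 pg1 pg2.
have [K K0 tightX] := supOU_tight_uniform.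
have q0 : 0 < Num.min p1' p2' by rewrite lt_min p10 p20.
have qH : 1 <= Num.min p1' p2' * H by rewrite minr_pMl ?(ltW H0)// le_min pH1 pH2.
have [C1 C10 tailM] := unit_mass_tail mX C0 q0 K0 tailW tightX.
suff gr : forall k : nat, {ae P, forall w, exists c t0, forall t, t0 <= t ->
    `|integrated X t w - centering P (integrated X t)| <= c * t `^ (H + k.+1%:R^-1)}.
  apply: filterS (ae_foralln gr) => w hw.
  exact: (limsup_growth_ratio (Z := fun t => integrated X t w - centering P (integrated X t))).
move=> k; have e0 : 0 < k.+1%:R^-1 :> R by rewrite invr_gt0.
have [H1|H1] := leP 1 H.
  have dich := supOU_mean_dichotomy mu_neg.
  exact: (heavy_path_growth mX q0 H0 qH C10 tailM H1 e0 dich).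
(* For H < 1 the conditions p H >= 1 force both exponents to be at least 1, so first moments exist
   and the mean estimates apply. *)
have gt1 p' : 0 < p' -> 1 <= p' * H -> 1 <= p'.
  by move=> p'0 /le_trans; apply; rewrite ler_piMr ?(ltW p'0) ?(ltW H1).
have [B B0 meanW] := supOU_sum_mean
  p10 p12 p20 p22 small_p1 large_p2 pH1 pH2 pg1 pg2 (gt1 _ p10 pH1) (gt1 _ p20 pH2).
have [B' B'0 meanX] := supOU_mean_bounded
  (large_moment_mono (gt1 _ p20 pH2) large_p2).
exact: (centered_path_growth mX q0 H0 qH C10 tailM C0 B0 B'0 tailW meanW meanX).
Qed.

End supOU_estimates.

Theorem corollary1 (R : realType) (d : measure_display) (T : measurableType d)
  (P : probability T R) (a b : R)
  (lam mu : {measure set (measurableTypeR R) -> \bar R})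
  (Lam : set (plane R) -> T -> R) (X : R -> T -> R)
  (alpha beta eta : R)
  (mu_pos : mu [set x | x <= 0] = 0%E)
  (mu_inv : (\int[mu]_(x in `]0%R, +oo[) (x^-1)%:E < +oo)%E)
  (b_ge0 : 0 <= b) (lam_levy : is_levy_measure lam)
  (lam_log : (\int[lam]_(z in [set z | (1 < `|z|)%R]) (ln `|z|)%:E < +oo)%E)
  (Lam_basis : is_levy_basis P a b lam mu Lam)
  (X_supOU : is_supOU P mu Lam X)
  (alphaP : alpha_param mu alpha) (betaP : beta_param lam beta)
  (etaP : eta_param lam eta)
  (mu_fin : (mu setT < +oo)%E)
  (b_eq0 : b = 0)
  (a_fin : (\int[lam]_(z in [set z | (`|z| <= 1)%R]) `|z|%:E < +oo)%E ->
    a = \int[lam]_(z in [set z | `|z| <= 1]) z)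
  (a_inf : (\int[lam]_(z in [set z | (`|z| <= 1)%R]) `|z|%:E = +oo)%E ->
    a = 0) :
  {ae P, forall w,
    let L := limf_esup (fun t => growth_ratio P (integrated X) t w)
               (pinfty_nbhs R) in
    [/\ 1 <= alpha /\ 2 <= eta -> (L <= (1 / 2)%:E)%E,
        (1 <= alpha /\ eta < 2) \/
          [/\ alpha < 1, eta <= 1 + alpha & beta <= 1 + alpha] ->
          (L <= (eta%:E)^-1)%E,
        [/\ alpha < 1, 1 + alpha < eta & beta <= 1 + alpha] ->
          (L <= (1 / (1 + alpha))%:E)%E
      & [/\ alpha < 1, 1 + alpha < eta & 1 + alpha < beta] ->
          (L <= (1 - alpha / beta)%:E)%E]}.
Proof.
have [al0 origin_al] := alpha_paramP alphaP.
have [eta0 large_eta] := eta_paramP etaP.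
have [beta_ge0 beta2 small_beta] := beta_paramP lam_levy betaP.
move: Lam_basis X_supOU; rewrite b_eq0.
have [mu' muE] := finite_measure_of mu_fin.
have [lam' lamE] := sigma_finite_measure_of (levy_sigma_finite lam_levy).
rewrite -muE -lamE in mu_pos lam_levy origin_al large_eta small_beta *.
move=> basis ou.
have small2 := levy_small_moment2 lam_levy.
(* [Num.min 1 eta] is the auxiliary exponent that makes the rates integrable. It must be positive,
   hence the separate treatment of eta = 0 below. *)
have rate (p1 p2 H : R) : 0 < eta -> 0 < p1 -> p1 <= 2 -> 0 < p2 -> p2 <= 2 -> 0 < H ->
    (small_moment lam' p1 < +oo)%E -> (large_moment lam' p2 < +oo)%E ->
    1 <= p1 * H -> 1 <= p2 * H -> p1 - alpha <= p1 * H -> p2 - alpha <= p2 * H ->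
    {ae P, forall w,
      (limf_esup (fun t => growth_ratio P (integrated X) t w) (pinfty_nbhs R) <= H%:E)%E}.
  move=> e0; have m0 : 0 < Num.min 1 eta by rewrite lt_min ltr01.
  have m1 : Num.min 1 eta <= 1 by rewrite ge_min lexx.
  have lm : (large_moment lam' (Num.min 1%R eta) < +oo)%E.
    by apply: large_moment_mono large_eta; rewrite ge_min lexx orbT.
  exact: (supOU_limsup lam_levy basis ou m0 m1 lm al0 origin_al mu_pos).
(* p1 = p2 = 2 and H = 1/2; alpha >= 1 is what gives 2 - alpha <= 2 H. *)
have ae1 : 1 <= alpha /\ 2 <= eta -> {ae P, forall w,
    (limf_esup (fun t => growth_ratio P (integrated X) t w) (pinfty_nbhs R) <= (1 / 2)%:E)%E}.
  move=> [a1 e2]; have e0 : 0 < eta by exact: lt_le_trans e2.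
  have h1 : (1:R) <= 2 * (1 / 2) by clear; lra.
  have h2 : 2 - alpha <= 2 * (1 / 2) by clear -a1; lra.
  have h3 : 0 < 1 / 2 :> R by rewrite divr_gt0.
  have l2 := large_moment_mono e2 large_eta.
  exact: (rate 2 2).
have ae2 : (1 <= alpha /\ eta < 2) \/ [/\ alpha < 1, eta <= 1 + alpha & beta <= 1 + alpha] ->
    {ae P, forall w,
    (limf_esup (fun t => growth_ratio P (integrated X) t w) (pinfty_nbhs R) <= (eta%:E)^-1)%E}.
  (* (0%:E)^-1 = +oo *)
  move=> hyp; have [->|en0] := eqVneq eta 0.
    by apply: nearW => w; rewrite inver eqxx leey.
  have e0 : 0 < eta by rewrite lt0r en0.
  have ie0 : 0 < eta^-1 by rewrite invr_gt0.
  have ee : eta * eta^-1 = 1 by rewrite divff.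
  rewrite inver (negbTE en0).
  (* H = 1 / eta and p2 = eta in both alternatives. Small jumps use p1 = 2 if alpha >= 1; otherwise
     p1 = 1 + alpha, whose moment is finite because beta <= 1 + alpha and which satisfies p1 H >= 1
     because eta <= 1 + alpha. *)
  case: hyp => [[a1 e2]|[a1 e1 b1]].
    have h : 1 <= 2 * eta^-1 by rewrite ler_pdivlMr//; clear -e2; lra.
    have h3 : 2 - alpha <= 2 * eta^-1 by clear -a1 h; lra.
    have h4 : eta - alpha <= eta * eta^-1 by rewrite ee; clear -a1 e2; lra.
    by apply: (rate 2 eta) => //; rewrite ?ee// ltW.
  have h : 1 <= (1 + alpha) * eta^-1 by rewrite ler_pdivlMr// mul1r.
  have h3 : 1 + alpha - alpha <= (1 + alpha) * eta^-1 by rewrite addrK.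
  have h4 : eta - alpha <= eta * eta^-1 by rewrite ee lerBlDr.
  have h5 : 0 < 1 + alpha by rewrite ltr_wpDr.
  have h6 : 1 + alpha <= 2 by clear -a1; lra.
  have h7 : eta <= 2 by exact: le_trans e1 h6.
  have s1 := small_moment_mono beta_ge0 b1 small_beta.
  by apply: (rate (1 + alpha) eta) => //; rewrite ee.
(* p1 = p2 = 1 + alpha: the conditions p H >= 1 and p H >= p - alpha are both equalities. *)
have ae3 : [/\ alpha < 1, 1 + alpha < eta & beta <= 1 + alpha] -> {ae P, forall w,
    (limf_esup (fun t => growth_ratio P (integrated X) t w) (pinfty_nbhs R) <= (1 / (1 + alpha))%:E)%E}.
  move=> [a1 e1 b1]; have a0 : 0 < 1 + alpha by clear -al0; lra.
  have h : (1 + alpha) * (1 / (1 + alpha)) = 1 by rewrite mul1r divff ?gt_eqF.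
  have h6 : 1 + alpha <= 2 by clear -a1; lra.
  have h3 : 1 + alpha - alpha <= 1 by rewrite addrK.
  have e0 : 0 < eta by exact: lt_trans e1.
  have h4 : 0 < 1 / (1 + alpha) by rewrite divr_gt0.
  have s1 := small_moment_mono beta_ge0 b1 small_beta.
  have l1 := large_moment_mono (ltW e1) large_eta.
  by apply: (rate (1 + alpha) (1 + alpha)) => //; rewrite h.
(* Small jumps force p1 = beta, and H solves beta H = beta - alpha. For large jumps p2 = 1 + alpha
   is enough, because (1 + alpha) * alpha / beta <= alpha. *)
have ae4 : [/\ alpha < 1, 1 + alpha < eta & 1 + alpha < beta] -> {ae P, forall w,
    (limf_esup (fun t => growth_ratio P (integrated X) t w) (pinfty_nbhs R) <= (1 - alpha / beta)%:E)%E}.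
  move=> [a1 e1 b1]; have b0 : 0 < beta by clear -b1 al0; lra.
  have h1 : beta * (1 - alpha / beta) = beta - alpha by rewrite mulrBr mulr1 mulrCA divff ?gt_eqF// mulr1.
  have h2 : (1 + alpha) * (alpha / beta) <= alpha by rewrite mulrCA ler_piMr// ler_pdivrMr// mul1r ltW.
  have h3 : 0 < 1 - alpha / beta by rewrite subr_gt0 ltr_pdivrMr//; clear -b1; lra.
  have h4 : 1 <= (1 + alpha) * (1 - alpha / beta) by rewrite mulrBr mulr1; clear -h2; lra.
  have h5 : 1 + alpha <= 2 by clear -a1; lra.
  have h6 : 1 + alpha - alpha <= (1 + alpha) * (1 - alpha / beta) by rewrite addrK.
  have a0 : 0 < 1 + alpha by rewrite ltr_wpDr.
  have e0 : 0 < eta by exact: lt_trans e1.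
  have h7 : 1 <= beta - alpha by clear -b1; lra.
  have l1 := large_moment_mono (ltW e1) large_eta.
  by apply: (rate beta (1 + alpha)) => //; rewrite h1.
(* The case conditions do not depend on w, so each is decided outside the almost sure statement. *)
have guard (Q : Prop) (E : T -> Prop) : (Q -> {ae P, forall w, E w}) -> {ae P, forall w, Q -> E w}.
  by move=> h; have [q|nq] := pselect Q; [apply: filterS (h q) => w ? _|apply: nearW => w /nq].
move/guard: ae1; move/guard: ae2; move/guard: ae3; move/guard: ae4.
move=> h4 h3 h2 h1.
by apply: filterS (filterI (filterI h1 h2) (filterI h3 h4)) => w [[r1 r2] [r3 r4]]; split.
Qed.
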